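(* Let $A$ be a $\sigma$-unital $C^*$-algebra, let $G$ be a second-countable compact group, and let $\alpha\colon G\to\mathrm{Aut}(A)$ be an action with the Rokhlin property. Then $$\dim_{\mathrm{nuc}}(A^\alpha)=\dim_{\mathrm{nuc}}(A\rtimes_\alpha G)\leq\dim_{\mathrm{nuc}}(A)\quad\text{and}\quad \mathrm{dr}(A^\alpha)=\mathrm{dr}(A\rtimes_\alpha G)\leq\mathrm{dr}(A).$$
   Context: $\dim_{\mathrm{nuc}}$ denotes nuclear dimension (Winter-Zacharias) and $\mathrm{dr}$ denotes decomposition rank (Kirchberg-Winter). Conventions: homomorphisms between $C^*$-algebras are $*$-homomorphisms, subalgebras are $C^*$-subalgebras; actions on $C^*$-algebras are point-norm continuous; $A^\alpha$ is the fixed point algebra and $A\rtimes_\alpha G$ the crossed product. Sequence algebras: for a $C^*$-algebra $A$, let $\ell^\infty(\mathbb{N},A)$ be the $C^*$-algebra of bounded sequences in $A$, $c_0(\mathbb{N},A)$ the ideal of norm-null sequences, $A_\infty=\ell^\infty(\mathbb{N},A)/c_0(\mathbb{N},A)$ with quotient map $\eta_A$; $A$ sits in $A_\infty$ as constant sequences. For a subalgebra $D\subseteq A$, let $\mathrm{Ann}(D,A_\infty)$ be the annihilator of $D$ in $A_\infty$, an ideal of $A_\infty\cap D'$, let $F(D,A)=(A_\infty\cap D')/\mathrm{Ann}(D,A_\infty)$ and let $\kappa_{D,A}$ be the quotient map. If $\alpha\colon G\to\mathrm{Aut}(A)$ is an action and $D$ is $\alpha$-invariant, entrywise application of $\alpha$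 gives actions (not necessarily continuous) $\alpha^\infty$ on $\ell^\infty(\mathbb{N},A)$, $\alpha_\infty$ on $A_\infty$ and on $A_\infty\cap D'$, and $F(\alpha)$ on $F(D,A)$. Let $\ell^\infty_\alpha(\mathbb{N},A)$ be the set of $a\in\ell^\infty(\mathbb{N},A)$ with $g\mapsto\alpha^\infty_g(a)$ norm continuous, $A_{\infty,\alpha}=\eta_A(\ell^\infty_\alpha(\mathbb{N},A))$ and $F_\alpha(D,A)=\kappa_{D,A}(A_{\infty,\alpha}\cap D')$. Rokhlin property: an action $\alpha\colon G\to\mathrm{Aut}(A)$ of a second-countable compact group $G$ on a $\sigma$-unital $C^*$-algebra $A$ has the Rokhlin property if for every separable $\alpha$-invariant subalgebra $D\subseteq A$ there is an equivariant unital homomorphism $\varphi\colon(C(G),\mathtt{Lt})\to(F_\alpha(D,A),F(\alpha))$, where $\mathtt{Lt}$ is the action of $G$ on $C(G)$ induced by left translation. *)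

(* Defs.v *)
From HB Require Import structures.
From mathcomp Require Import all_boot all_order all_algebra.
From mathcomp Require Import generic_quotient ring_quotient sesquilinear.
From mathcomp Require Import all_classical all_reals all_analysis.
From mathcomp Require Import complex.

Set Implicit Arguments.
Unset Strict Implicit.
Unset Printing Implicit Defensive.

Import Order.TTheory GRing.Theory Num.Theory.
Import numFieldNormedType.Exports.

Local Open Scope classical_set_scope.
Local Open Scope ring_scope.
Local Open Scope complex_scope.

HB.mixin Record Lmodule_isStarAlg (R : realType) V of GRing.Lmodule R[i] V := {
  amul : V -> V -> V;
  star : V -> V;
  amulA : associative amul;
  amulDl : left_distributive amul +%R;
  amulDr : right_distributive amul +%R;
  amulZl : forall (c : R[i]) (x y : V), amul (c *: x) y = c *: amul x y;
  amulZr : forall (c : R[i]) (x y : V), amul x (c *: y) = c *: amul x y;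
  starK : involutive star;
  starD : {morph star : x y / x + y};
  starZ : forall (c : R[i]) (x : V), star (c *: x) = c^* *: star x;
  starM : forall x y : V, star (amul x y) = amul (star y) (star x)
}.

(* Complex *-algebras, not necessarily unital. *)
#[short(type="starAlgType")]
HB.structure Definition StarAlg (R : realType) :=
  {V of GRing.Lmodule R[i] V & Lmodule_isStarAlg R V}.

Notation "x ** y" := (amul x y) (at level 40, left associativity) : ring_scope.

HB.mixin Record StarAlg_isPreCStar (R : realType) V
    of NormedModule R[i] V & StarAlg R V := {
  normr_amul : forall x y : V, `|x ** y| <= `|x| * `|y|;
  normr_starM : forall x : V, `|star x ** x| = `|x| ^+ 2
}.

#[short(type="preCStarAlgType")]
HB.structure Definition PreCStarAlg (R : realType) :=
  {V of NormedModule R[i] V & StarAlg R V & StarAlg_isPreCStar R V}.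

#[short(type="cstarAlgType")]
HB.structure Definition CStarAlg (R : realType) :=
  {V of PreCStarAlg R V & CompleteNormedModule R[i] V}.

Section StarAlgTheory.
Context {R : realType} {V : starAlgType R}.
Implicit Types x y : V.

Lemma star0 : star (0 : V) = 0.
Proof. by rewrite -(scale0r (0 : V)) starZ rmorph0 !scale0r. Qed.
Lemma starN x : star (- x) = - star x.
Proof. by rewrite -scaleN1r starZ rmorphN1 scaleN1r. Qed.
Lemma starB x y : star (x - y) = star x - star y.
Proof. by rewrite starD starN. Qed.
Lemma amul0r x : 0 ** x = 0.
Proof. by rewrite -(scale0r (0 : V)) amulZl !scale0r. Qed.
Lemma amulr0 x : x ** 0 = 0.
Proof. by rewrite -(scale0r (0 : V)) amulZr !scale0r. Qed.
Lemma amulNr x y : x ** (- y) = - (x ** y).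
Proof. by rewrite -scaleN1r amulZr scaleN1r. Qed.
Lemma amulNl x y : (- x) ** y = - (x ** y).
Proof. by rewrite -scaleN1r amulZl scaleN1r. Qed.
Lemma amulBr x y z : x ** (y - z) = x ** y - x ** z.
Proof. by rewrite amulDr amulNr. Qed.
Lemma amulBl x y z : (x - y) ** z = x ** z - y ** z.
Proof. by rewrite amulDl amulNl. Qed.

End StarAlgTheory.

Section PreCStarTheory.
Context {R : realType} {A : preCStarAlgType R}.

Lemma normr_star (x : A) : `|star x| = `|x|.
Proof.
suff le y : `|y : A| <= `|star y|.
  by apply/eqP; rewrite eq_le le andbT; have := le (star x); rewrite starK.
have [->|y0] := eqVneq y 0; first by rewrite normr0.
have := normr_amul (star y) y; rewrite normr_starM expr2.
by rewrite ler_pM2r// normr_gt0.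
Qed.

Lemma star_continuous : continuous (star : A -> A).
Proof.
move=> x; apply/cvgrPdist_lt => e e0; near=> y.
rewrite -starB normr_star; near: y.
exact: cvgr_dist_lt e0.
Unshelve. all: by end_near. Qed.

End PreCStarTheory.

Section AmulContinuous.
Context {R : realType} {A : preCStarAlgType R}.

Lemma cvg_amul (T : Type) (F : set_system T) (FF : Filter F) (f g : T -> A)
    (a b : A) :
  f @ F --> a -> g @ F --> b -> (fun t => f t ** g t) @ F --> a ** b.
Proof.
move=> fa gb; apply/cvgrPdist_lt => e e0.
pose M := `|a| + 1 + `|b|.
have M0 : 0 < M.
  by rewrite /M ltr_wpDr// ltr_wpDl.
have d0 : 0 < Num.min 1 (e / (M + M)) :> R[i].
  rewrite comparable_lt_min; last first.
    by apply: real_comparable; rewrite ger0_real// ltW// divr_gt0// addr_gt0.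
  by rewrite ltr01 divr_gt0// addr_gt0.
have cmp : (1 : R[i]) >=< e / (M + M).
  by apply: real_comparable; rewrite ger0_real// ltW// divr_gt0// addr_gt0.
near=> t.
have Hf : `|a - f t| < Num.min 1 (e / (M + M)).
  by near: t; exact: cvgr_dist_lt d0.
have Hg : `|b - g t| < Num.min 1 (e / (M + M)).
  by near: t; exact: cvgr_dist_lt d0.
move: Hf; rewrite comparable_lt_min// => /andP[f1 fe].
move: Hg; rewrite comparable_lt_min// => /andP[_ ge].
have -> : a ** b - f t ** g t = (a - f t) ** b + f t ** (b - g t).
  by rewrite amulBl amulBr addrA subrK.
have ft : `|f t| <= M.
  rewrite /M ler_wpDr// -[f t](subKr a).
  apply: le_trans (ler_normB _ _) _.
  by rewrite lerD2l ltW.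
have bM : `|b| <= M by rewrite /M ler_wpDl// addr_ge0.
apply: le_lt_trans (ler_normD _ _) _.
have -> : e = M * (e / (M + M)) + M * (e / (M + M)).
  rewrite -mulrDl mulrCA divff ?mulr1// gt_eqF// addr_gt0//.
apply: ler_ltD.
  apply: le_trans (normr_amul _ _) _; rewrite mulrC ler_pM// ltW//.
apply: le_lt_trans (normr_amul _ _) _.
apply: le_lt_trans (ler_wpM2r (normr_ge0 _) ft) _.
by rewrite ltr_pM2l.
Unshelve. all: by end_near. Qed.

End AmulContinuous.

Section Scalars.
Context {R : realType}.
Let C := (R[i]^o)%type.

HB.instance Definition _ := @Lmodule_isStarAlg.Build R R[i]^o
  *%R conjc (@mulrA R[i]) (@mulrDl R[i]) (@mulrDr R[i])
  (fun c x y => esym (mulrA c x y)) (fun c x y => mulrCA x c y)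
  (@conjcK R) (rmorphD conjc) (fun c x => rmorphM conjc c x)
  (fun x y => etrans (rmorphM conjc x y) (mulrC _ _)).

Let normr_mulC (x y : C) : `|x ** y| <= `|x| * `|y|.
Proof. by rewrite normrM. Qed.

Let normr_starMC (x : C) : `|star x ** x| = `|x| ^+ 2.
Proof. by 
rewrite normrM expr2; congr (_ * _); case: x => a b; rewrite !normc_def /= sqrrN. Qed.

HB.instance Definition _ := @StarAlg_isPreCStar.Build R R[i]^o
  normr_mulC normr_starMC.

End Scalars.

Section FunctionAlgebra.
Context {R : realType} (T : Type) (V : starAlgType R).

Program Definition fct_starAlgMixin := @Lmodule_isStarAlg.Build R (T -> V)
  (fun f g t => f t ** g t) (fun f t => star (f t)) _ _ _ _ _ _ _ _ _.
Next Obligation. by move=> f g h; apply/funext => t; rewrite amulA. Qed.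
Next Obligation. by move=> f g h; apply/funext => t; rewrite amulDl. Qed.
Next Obligation. by move=> f g h; apply/funext => t; rewrite amulDr. Qed.
Next Obligation. by move=> c f g; apply/funext => t; rewrite amulZl. Qed.
Next Obligation. by move=> c f g; apply/funext => t; rewrite amulZr. Qed.
Next Obligation. by move=> f; apply/funext => t; rewrite starK. Qed.
Next Obligation. by move=> f g; apply/funext => t; rewrite starD. Qed.
Next Obligation. by move=> c f; apply/funext => t; rewrite starZ. Qed.
Next Obligation. by move=> f g; apply/funext => t; rewrite starM. Qed.
HB.instance Definition _ := fct_starAlgMixin.

End FunctionAlgebra.

Record starSubalg (R : realType) (V : starAlgType R) := StarSubalg {
  ssa_set : set V;
  ssa0 : ssa_set 0;
  ssaD : forall x y, ssa_set x -> ssa_set y -> ssa_set (x + y);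
  ssaZ : forall (c : R[i]) x, ssa_set x -> ssa_set (c *: x);
  ssaM : forall x y, ssa_set x -> ssa_set y -> ssa_set (x ** y);
  ssaS : forall x, ssa_set x -> ssa_set (star x)
}.

Section SubStarAlgebra.
Context {R : realType} {V : starAlgType R} (S : starSubalg V).

Definition ssa_pred : {pred V} := fun x => `[< ssa_set S x >].

Lemma ssa_predP x : reflect (ssa_set S x) (x \in ssa_pred).
Proof. exact: asboolP. Qed.

Let ssa_submod : GRing.submod_closed ssa_pred.
Proof.
split; first by apply/ssa_predP; exact: ssa0.
move=> c x y /ssa_predP Sx /ssa_predP Sy; apply/ssa_predP.
by apply: ssaD => //; exact: ssaZ.
Qed.
HB.instance Definition _ := GRing.isSubmodClosed.Build R[i] V ssa_pred ssa_submod.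

Definition substar := {x : V | x \in ssa_pred}.
HB.instance Definition _ := SubChoice.on substar.
HB.instance Definition _ := [SubChoice_isSubLmodule of substar by <:].

Definition mksub (x : V) (Sx : ssa_set S x) : substar :=
  exist _ x (introT (ssa_predP x) Sx).

Lemma val_substar (x : substar) : ssa_set S (val x).
Proof. by apply/ssa_predP; exact: valP. Qed.

Definition substar_amul (x y : substar) : substar :=
  mksub (ssaM (val_substar x) (val_substar y)).
Definition substar_star (x : substar) : substar := mksub (ssaS (val_substar x)).

Program Definition substar_starAlgMixin := @Lmodule_isStarAlg.Build R substar
  substar_amul substar_star _ _ _ _ _ _ _ _ _.
Next Obligation. by move=> x y z; apply: val_inj; rewrite /= amulA. Qed.
Next Obligation. by move=> x y z; apply: val_inj; rewrite /= amulDl. Qed.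
Next Obligation. by move=> x y z; apply: val_inj; rewrite /= amulDr. Qed.
Next Obligation. by move=> c x y; apply: val_inj; rewrite /= amulZl. Qed.
Next Obligation. by move=> c x y; apply: val_inj; rewrite /= amulZr. Qed.
Next Obligation. by move=> x; apply: val_inj; rewrite /= starK. Qed.
Next Obligation. by move=> x y; apply: val_inj; rewrite /= starD. Qed.
Next Obligation. by move=> c x; apply: val_inj; rewrite /= starZ. Qed.
Next Obligation. by move=> x y; apply: val_inj; rewrite /= starM. Qed.
HB.instance Definition _ := substar_starAlgMixin.

End SubStarAlgebra.
Coercion substar : starSubalg >-> Sortclass.

Record starIdeal (R : realType) (V : starAlgType R) := StarIdeal {
  si_set : set V;
  si0 : si_set 0;
  siD : forall x y, si_set x -> si_set y -> si_set (x + y);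
  siZ : forall (c : R[i]) x, si_set x -> si_set (c *: x);
  siMl : forall x y, si_set y -> si_set (x ** y);
  siMr : forall x y, si_set x -> si_set (x ** y);
  siS : forall x, si_set x -> si_set (star x)
}.

Section StarQuotient.
Context {R : realType} {V : starAlgType R} (I : starIdeal V).
Local Open Scope quotient_scope.

Definition si_pred : {pred V} := fun x => `[< si_set I x >].

Lemma si_predP x : reflect (si_set I x) (x \in si_pred).
Proof. exact: asboolP. Qed.

Let si_submod : GRing.submod_closed si_pred.
Proof.
split; first by apply/si_predP; exact: si0.
move=> c x y /si_predP Sx /si_predP Sy; apply/si_predP.
by apply: siD => //; exact: siZ.
Qed.
HB.instance Definition _ := GRing.isSubmodClosed.Build R[i] V si_pred si_submod.

Definition quotstar := Quotient.quot si_pred.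
HB.instance Definition _ := GRing.Zmodule.on quotstar.

Definition quot_pi (x : V) : quotstar := \pi_(Quotient.quot si_pred) x.
Definition quot_repr (q : quotstar) : V := repr (q : Quotient.quot si_pred).

Lemma quot_reprK : cancel quot_repr quot_pi.
Proof. exact: reprK. Qed.

Lemma quot_piP x y : quot_pi x = quot_pi y <-> si_set I (x - y).
Proof.
split=> [/eqP|/si_predP]; first by rewrite -Quotient.idealrBE => /si_predP.
by rewrite Quotient.idealrBE => /eqP.
Qed.

Lemma quot_piD x y : quot_pi (x + y) = quot_pi x + quot_pi y.
Proof. by rewrite /quot_pi !piE. Qed.

Lemma quot_repr_pi x : si_set I (quot_repr (quot_pi x) - x).
Proof. by apply/quot_piP; rewrite quot_reprK. Qed.

Definition quot_scale (c : R[i]) (p : quotstar) : quotstar :=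
  quot_pi (c *: quot_repr p).
Definition quot_amul (p q : quotstar) : quotstar :=
  quot_pi (quot_repr p ** quot_repr q).
Definition quot_star (p : quotstar) : quotstar := quot_pi (star (quot_repr p)).

Lemma quot_piZ c x : quot_pi (c *: x) = quot_scale c (quot_pi x).
Proof.
apply/esym/quot_piP; rewrite -scalerBr; apply: siZ; exact: quot_repr_pi.
Qed.

Lemma quot_piM x y : quot_pi (x ** y) = quot_amul (quot_pi x) (quot_pi y).
Proof.
apply/esym/quot_piP; set a := quot_repr _; set b := quot_repr _.
have -> : a ** b - x ** y = (a - x) ** b + x ** (b - y).
  by rewrite amulBl amulBr addrA subrK.
by apply: siD; [apply: siMr|apply: siMl]; exact: quot_repr_pi.
Qed.

Lemma quot_piS x : quot_pi (star x) = quot_star (quot_pi x).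
Proof. by apply/esym/quot_piP; rewrite -starB; apply: siS; exact: quot_repr_pi. Qed.

Lemma quot_ind (P : quotstar -> Prop) : (forall x, P (quot_pi x)) -> forall q, P q.
Proof. by move=> Px q; rewrite -(quot_reprK q). Qed.

Let quot_scalerA a b p : quot_scale a (quot_scale b p) = quot_scale (a * b) p.
Proof. by elim/quot_ind: p => x; rewrite -!quot_piZ scalerA. Qed.
Let quot_scale1r : left_id 1 quot_scale.
Proof. by elim/quot_ind => x; rewrite -quot_piZ scale1r. Qed.
Let quot_scalerDr : right_distributive quot_scale +%R.
Proof.
move=> c; elim/quot_ind => x; elim/quot_ind => y.
by rewrite -quot_piD -!quot_piZ -quot_piD scalerDr.
Qed.
Let quot_scalerDl p : {morph quot_scale^~ p : a b / a + b}.
Proof.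
by move=> a b; elim/quot_ind: p => x; rewrite -!quot_piZ -quot_piD scalerDl.
Qed.
HB.instance Definition _ := GRing.Zmodule_isLmodule.Build R[i] quotstar
  quot_scalerA quot_scale1r quot_scalerDr quot_scalerDl.

Let quot_amulA : associative quot_amul.
Proof.
elim/quot_ind => x; elim/quot_ind => y; elim/quot_ind => z.
by rewrite -!quot_piM amulA.
Qed.
Let quot_amulDl : left_distributive quot_amul +%R.
Proof.
elim/quot_ind => x; elim/quot_ind => y; elim/quot_ind => z.
by rewrite -quot_piD -!quot_piM -quot_piD amulDl.
Qed.
Let quot_amulDr : right_distributive quot_amul +%R.
Proof.
elim/quot_ind => x; elim/quot_ind => y; elim/quot_ind => z.
by rewrite -quot_piD -!quot_piM -quot_piD amulDr.
Qed.
Let quot_amulZl c p q : quot_amul (c *: p) q = c *: quot_amul p q.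
Proof.
elim/quot_ind: p => x; elim/quot_ind: q => y.
by rewrite -[c *: quot_pi x]quot_piZ -!quot_piM -[RHS]quot_piZ amulZl.
Qed.
Let quot_amulZr c p q : quot_amul p (c *: q) = c *: quot_amul p q.
Proof.
elim/quot_ind: p => x; elim/quot_ind: q => y.
by rewrite -[c *: quot_pi y]quot_piZ -!quot_piM -[RHS]quot_piZ amulZr.
Qed.
Let quot_starK : involutive quot_star.
Proof. by elim/quot_ind => x; rewrite -!quot_piS starK. Qed.
Let quot_starD : {morph quot_star : p q / p + q}.
Proof.
elim/quot_ind => x; elim/quot_ind => y.
by rewrite -quot_piD -!quot_piS -quot_piD starD.
Qed.
Let quot_starZ (c : R[i]) p : quot_star (c *: p) = c^* *: quot_star p.
Proof.
elim/quot_ind: p => x.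
by rewrite -[c *: quot_pi x]quot_piZ -!quot_piS -[RHS]quot_piZ starZ.
Qed.
Let quot_starM p q :
  quot_star (quot_amul p q) = quot_amul (quot_star q) (quot_star p).
Proof.
elim/quot_ind: p => x; elim/quot_ind: q => y.
by rewrite -quot_piM -!quot_piS -quot_piM starM.
Qed.
HB.instance Definition _ := Lmodule_isStarAlg.Build R quotstar
  quot_amulA quot_amulDl quot_amulDr quot_amulZl quot_amulZr
  quot_starK quot_starD quot_starZ quot_starM.

End StarQuotient.

Section SubNormed.
Context {R : realType} {A : preCStarAlgType R} (S : starSubalg A).

Definition substar_norm (x : S) : R[i] := `|val x|.

Let substar_normD x y : substar_norm (x + y) <= substar_norm x + substar_norm y.
Proof. exact: ler_normD. Qed.
Let substar_normZ (c : R[i]) x : substar_norm (c *: x) = `|c| * substar_norm x.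
Proof. exact: normrZ. Qed.
Let substar_norm_eq0 x : substar_norm x = 0 -> x = 0.
Proof. by move/normr0_eq0 => x0; exact: val_inj. Qed.
HB.instance Definition _ := Lmodule_isNormed.Build R[i] (substar S)
  substar_normD substar_normZ substar_norm_eq0.

Let substar_normM (x y : S) : `|x ** y| <= `|x| * `|y|.
Proof. exact: normr_amul. Qed.
Let substar_normS (x : S) : `|star x ** x| = `|x| ^+ 2.
Proof. exact: normr_starM. Qed.
HB.instance Definition _ := StarAlg_isPreCStar.Build R (substar S)
  substar_normM substar_normS.

End SubNormed.

Record cstarSubalg (R : realType) (A : cstarAlgType R) := CStarSubalg {
  csa_alg :> starSubalg A;
  csa_closed : closed (ssa_set csa_alg)
}.

Section CStarSubalgebra.
Context {R : realType} {A : cstarAlgType R} (D : cstarSubalg A).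

Definition csubstar := substar D.
HB.instance Definition _ := PreCStarAlg.on csubstar.

Let csubstar_complete (F : set_system csubstar) :
  ProperFilter F -> cauchy F -> cvg F.
Proof.
move=> FF Fc.
have Gc : cauchy (val @ F : set_system A).
  apply/(cauchyP (val @ F : set_system A)) => e e0.
  move/cauchyP : Fc => /(_ e e0)[x Fx].
  exists (val x); rewrite -ball_normE in Fx; rewrite -ball_normE.
  exact: Fx.
have /cvg_ex[l Gl] : cvg (val @ F : set_system A) by exact: cauchy_cvg.
have Dl : ssa_set D l.
  apply: (@csa_closed _ _ D) => B Bl.
  have /filter_ex[x Bx] : F (val @^-1` B) by exact: (Gl _ Bl).
  by exists (val x); split => //; exact: val_substar.
apply/cvg_ex; exists (mksub Dl : csubstar).
apply/cvgrPdist_lt => e e0.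
move/cvgrPdist_lt : Gl => /(_ e e0). exact.
Qed.
HB.instance Definition _ := Uniform_isComplete.Build csubstar csubstar_complete.

End CStarSubalgebra.

Section Morphisms.
Context {R : realType}.

Definition star_hom (V W : starAlgType R) (f : V -> W) : Prop :=
  [/\ linear f, {morph f : x y / x ** y} & {morph f : x / star x}].

Lemma quot_pi_hom (V : starAlgType R) (I : starIdeal V) : star_hom (quot_pi I).
Proof.
split; [|exact: quot_piM|exact: quot_piS].
by move=> c x y; rewrite quot_piD quot_piZ.
Qed.

(* Only meaningful when [f] maps cosets of [I] into cosets of [J]. *)
Definition quot_map (V W : starAlgType R) (I : starIdeal V) (J : starIdeal W)
  (f : V -> W) (q : quotstar I) : quotstar J := quot_pi J (f (quot_repr q)).

Lemma quot_mapE (V W : starAlgType R) (I : starIdeal V) (J : starIdeal W)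
    (f : V -> W) : linear f -> (forall x, si_set I x -> si_set J (f x)) ->
  forall x, quot_map J f (quot_pi I x) = quot_pi J (f x).
Proof.
move=> flin fIJ x; apply/quot_piP.
have -> : f (quot_repr (quot_pi I x)) - f x = f (quot_repr (quot_pi I x) - x).
  by rewrite -[_ - x]addrC -[- x]scaleN1r flin scaleN1r addrC.
exact/fIJ/quot_repr_pi.
Qed.

Definition sub_map (V : starAlgType R) (S : starSubalg V) (f : V -> V)
    (fS : forall x, ssa_set S x -> ssa_set S (f x)) (x : S) : S :=
  mksub (fS _ (val_substar x)).

End Morphisms.

HB.mixin Record isTopologicalGroup G of Group G & Topological G := {
  mulg_continuous2 : continuous (fun p : G * G => (p.1 * p.2)%g);
  invg_continuous : continuous (fun g : G => g^-1%g)
}.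

#[short(type="topGroupType")]
HB.structure Definition TopologicalGroup :=
  {G of Group G & Topological G & isTopologicalGroup G}.

(* Isometry is automatic for *-automorphisms of a C*-algebra; having it as a
   field makes the fixed point algebra visibly closed and the entrywise action
   on bounded sequences visibly well defined. *)
Record cstarAction (R : realType) (G : topGroupType) (A : cstarAlgType R) :=
  CStarAction {
    act :> G -> A -> A;
    act_hom : forall g, star_hom (act g);
    act_norm : forall g x, `|act g x| = `|x|;
    act1 : forall x, act 1%g x = x;
    actM : forall g h x, act (g * h)%g x = act g (act h x);
    act_continuous : forall x, continuous (act ^~ x)
  }.

Section ActionTheory.
Context {R : realType} {G : topGroupType} {A : cstarAlgType R}.
Variable alpha : cstarAction G A.

Lemma act_linear g : linear (alpha g).
Proof. by case: (act_hom alpha g). Qed.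
Lemma act_amul g : {morph alpha g : x y / x ** y}.
Proof. by case: (act_hom alpha g). Qed.
Lemma act_star g : {morph alpha g : x / star x}.
Proof. by case: (act_hom alpha g). Qed.
Lemma actD g : {morph alpha g : x y / x + y}.
Proof. by move=> x y; rewrite -[x in LHS]scale1r act_linear scale1r. Qed.
Lemma act0 g : alpha g 0 = 0.
Proof. by apply: (@addrI _ (alpha g 0)); rewrite -actD !addr0. Qed.
Lemma actZ g c x : alpha g (c *: x) = c *: alpha g x.
Proof. by rewrite -[c *: x]addr0 act_linear act0 addr0. Qed.
Lemma actB g x y : alpha g (x - y) = alpha g x - alpha g y.
Proof. by rewrite actD -scaleN1r actZ scaleN1r. Qed.
Lemma actVK g : cancel (alpha g^-1%g) (alpha g).
Proof. by move=> x; rewrite -actM mulgV act1. Qed.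

Definition fixed_set : set A := [set x | forall g, alpha g x = x].

Program Definition fixed_starSubalg : starSubalg A :=
  @StarSubalg R A fixed_set _ _ _ _ _.
Next Obligation. by move=> g; rewrite act0. Qed.
Next Obligation. by move=> x y fx fy g; rewrite actD fx fy. Qed.
Next Obligation. by move=> c x fx g; rewrite actZ fx. Qed.
Next Obligation. by move=> x y fx fy g; rewrite act_amul fx fy. Qed.
Next Obligation. by move=> x fx g; rewrite act_star fx. Qed.

Lemma fixed_closed : closed fixed_set.
Proof.
move=> x xcl g; apply/eqP; rewrite -subr_eq0 -normr_le0.
rewrite real_leNgt ?normr_real ?real0//; apply/negP => n0.
have /xcl[y [fy]] : nbhs x (ball x (`|alpha g x - x| / 2)).
  by apply: nbhsx_ballx; rewrite divr_gt0.
rewrite -ball_normE /= => xy.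
have : `|alpha g x - x| < `|alpha g x - x|.
  rewrite [ltRHS]splitr -[X in `|X| < _](subrKA y).
  apply: le_lt_trans (ler_normD _ _) _; apply: ltrD; last by rewrite distrC.
  by rewrite -{1}(fy g) -actB act_norm.
by rewrite ltxx.
Qed.

Definition fixed_alg : cstarSubalg A := @CStarSubalg R A fixed_starSubalg fixed_closed.

End ActionTheory.

Section SequenceAlgebra.
Context {R : realType} (A : cstarAlgType R).

Definition linf_set : set (nat -> A) :=
  [set a | exists M : R[i], forall n, `|a n| <= M].

Program Definition linf : starSubalg (nat -> A) :=
  @StarSubalg R (nat -> A)%type linf_set _ _ _ _ _.
Next Obligation. by exists 0 => n; rewrite normr0. Qed.
Next Obligation.
move=> a b [M aM] [N bN]; exists (M + N) => n.
by apply: le_trans (ler_normD _ _) _; exact: lerD.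
Qed.
Next Obligation.
move=> c a [M aM]; exists (`|c| * M) => n.
by rewrite normrZ ler_wpM2l.
Qed.
Next Obligation.
move=> a b [M aM] [N bN]; exists (M * N) => n.
by apply: le_trans (normr_amul _ _) _; exact: ler_pM.
Qed.
Next Obligation. by move=> a [M aM]; exists M => n; rewrite normr_star. Qed.

Definition c0_set : set linf := [set a | val a n @[n --> \oo] --> (0 : A)].

Lemma c0_dominated (a b : linf) (M : R[i]) :
  (forall n, `|val b n| <= M * `|val a n|) -> c0_set a -> c0_set b.
Proof.
move=> ba a0; apply/cvgr0Pnorm_lt => e e0.
have d0 : 0 < e / (`|M| + 1) by rewrite divr_gt0// ltr_wpDl.
near=> n; apply: le_lt_trans (ba n) _.
have [M0|/negP M0] := boolP (0 <= M).
  apply: (@le_lt_trans _ _ ((`|M| + 1) * `|val a n|)).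
    by rewrite ger0_norm// ler_wpM2r// lerDl.
  rewrite mulrC -ltr_pdivlMr ?ltr_wpDl//.
  by near: n; move/cvgr0Pnorm_lt : a0; exact.
have := le_trans (normr_ge0 _) (ba n).
have [->|an] := eqVneq (val a n) 0; first by rewrite normr0 mulr0.
by rewrite pmulr_lge0 ?normr_gt0//.
Unshelve. all: by end_near. Qed.

Program Definition c0 : starIdeal linf := @StarIdeal R linf c0_set _ _ _ _ _ _.
Next Obligation. exact: cvg_cst. Qed.
Next Obligation.
by move=> a b a0 b0; rewrite /c0_set /= -[0 in X in _ --> X]addr0; exact: cvgD.
Qed.
Next Obligation.
by move=> c a; apply: (@c0_dominated _ _ `|c|) => // n; rewrite -normrZ.
Qed.
Next Obligation.
move=> x y; have [M xM] := val_substar x.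
apply: (@c0_dominated _ _ M) => // n.
by apply: le_trans (normr_amul _ _) _; rewrite ler_wpM2r.
Qed.
Next Obligation.
move=> x y; have [M yM] := val_substar y.
apply: (@c0_dominated _ _ M) => // n.
by apply: le_trans (normr_amul _ _) _; rewrite mulrC ler_wpM2r.
Qed.
Next Obligation.
by move=> x; apply: (@c0_dominated _ _ 1) => // n; rewrite mul1r normr_star.
Qed.

Definition seq_alg := quotstar c0.
HB.instance Definition _ := StarAlg.on seq_alg.

Definition seq_eta : linf -> seq_alg := quot_pi c0.

Lemma seq_eta_hom : star_hom seq_eta.
Proof. exact: quot_pi_hom. Qed.

Lemma seq_eta_surj (x : seq_alg) : exists a, x = seq_eta a.
Proof. by exists (quot_repr x); rewrite /seq_eta quot_reprK. Qed.

Lemma cst_linf (x : A) : linf_set (fun=> x).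
Proof. by exists `|x|. Qed.

Definition seq_const (x : A) : seq_alg := seq_eta (mksub (S := linf) (cst_linf x)).

Lemma seq_const_star x : seq_const (star x) = star (seq_const x).
Proof.
by rewrite /seq_const /seq_eta -[RHS]quot_piS; congr quot_pi; exact: val_inj.
Qed.

End SequenceAlgebra.

Section CentralSequences.
Context {R : realType} {A : cstarAlgType R} (D : cstarSubalg A).

Definition commutant_set : set (seq_alg A) :=
  [set x | forall d, ssa_set D d -> x ** seq_const d = seq_const d ** x].

Program Definition commutant : starSubalg (seq_alg A) :=
  @StarSubalg R (seq_alg A) commutant_set _ _ _ _ _.
Next Obligation. by move=> d _; rewrite amul0r amulr0. Qed.
Next Obligation. by move=> x y xD yD d Dd; rewrite amulDl amulDr xD// yD. Qed.
Next Obligation. by move=> c x xD d Dd; rewrite amulZl amulZr xD. Qed.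
Next Obligation.
by move=> x y xD yD d Dd; rewrite -amulA yD// amulA xD// amulA.
Qed.
Next Obligation.
move=> x xD d Dd; rewrite -[d]starK seq_const_star -!starM xD//; exact: ssaS.
Qed.

Definition annihilator_set : set commutant :=
  [set x | forall d, ssa_set D d ->
     val x ** seq_const d = 0 /\ seq_const d ** val x = 0].

Program Definition annihilator : starIdeal commutant :=
  @StarIdeal R commutant annihilator_set _ _ _ _ _ _.
Next Obligation. by move=> d _; rewrite amul0r amulr0. Qed.
Next Obligation.
move=> x y xA yA d Dd; have [x1 x2] := xA d Dd; have [y1 y2] := yA d Dd.
by rewrite amulDl amulDr x1 x2 y1 y2 !addr0.
Qed.
Next Obligation.
move=> c x xA d Dd; have [x1 x2] := xA d Dd.
by rewrite amulZl amulZr x1 x2 !scaler0.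
Qed.
Next Obligation.
move=> x y yA d Dd; have [y1 y2] := yA d Dd; split.
  by rewrite /= -amulA y1 amulr0.
by rewrite /= amulA -(val_substar x d Dd) -amulA y2 amulr0.
Qed.
Next Obligation.
move=> x y xA d Dd; have [x1 x2] := xA d Dd; split.
  by rewrite /= -amulA (val_substar y d Dd) amulA x1 amul0r.
by rewrite /= amulA x2 amul0r.
Qed.
Next Obligation.
move=> x xA d Dd; have [x1 x2] := xA _ (ssaS Dd).
rewrite /= -[d]starK seq_const_star -!starM.
by rewrite x1 x2 star0.
Qed.

(* F(D, A) *)
Definition central_quot := quotstar annihilator.
HB.instance Definition _ := StarAlg.on central_quot.

Definition central_kappa : commutant -> central_quot := quot_pi annihilator.

End CentralSequences.
Section ContinuousFunctions.
Context {R : realType} (T : topologicalType) (B : preCStarAlgType R).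

Definition cont_set : set (T -> B) := [set f | continuous f].

Program Definition cont_alg : starSubalg (T -> B) :=
  @StarSubalg R (T -> B)%type cont_set _ _ _ _ _.
Next Obligation. by move=> t; exact: cvg_cst. Qed.
Next Obligation. by move=> f g fc gc t; apply: cvgD; [exact: fc|exact: gc]. Qed.
Next Obligation. by move=> c f fc t; apply: cvgZl_tmp; exact: fc. Qed.
Next Obligation. by move=> f g fc gc t; apply: cvg_amul; [exact: fc|exact: gc]. Qed.
Next Obligation.
by move=> f fc t; apply: continuous_comp; [exact: fc|exact: star_continuous].
Qed.

End ContinuousFunctions.

Section ScalarFunctions.
Context {R : realType} (G : topGroupType).

(* C(G) *)
Definition scalar_cont := cont_alg G (R[i]^o : preCStarAlgType R).

Lemma cst_cont : cont_set (fun _ : G => 1 : R[i]^o).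
Proof. by move=> t; exact: cvg_cst. Qed.

Definition scalar_cont1 : scalar_cont := mksub (S := scalar_cont) cst_cont.

Lemma left_translation_cont (g : G) (f : G -> R[i]^o) :
  cont_set f -> cont_set (fun h => f (g^-1 * h)%g).
Proof.
move=> fc h; apply: (continuous_comp _ (fc _)).
apply: (@continuous_comp _ _ _ (fun h => (g^-1%g, h)) (fun p => (p.1 * p.2)%g)).
  by apply: cvg_pair; [exact: cvg_cst|exact: cvg_id].
exact: mulg_continuous2.
Qed.

Definition left_translation (g : G) : scalar_cont -> scalar_cont :=
  sub_map (S := scalar_cont) (f := fun f h => f (g^-1 * h)%g)
    (@left_translation_cont g).

End ScalarFunctions.

Record invSubalg (R : realType) (G : topGroupType) (A : cstarAlgType R)
    (alpha : cstarAction G A) := InvSubalg {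
  inv_alg :> cstarSubalg A;
  inv_act : forall g x, ssa_set inv_alg x -> ssa_set inv_alg (alpha g x)
}.

Section InducedActions.
Context {R : realType} {G : topGroupType} {A : cstarAlgType R}.
Variable alpha : cstarAction G A.

Lemma linf_act_subproof g (a : nat -> A) :
  linf_set a -> linf_set (fun n => alpha g (a n)).
Proof. by move=> [M aM]; exists M => n; rewrite act_norm. Qed.

Definition linf_act g : linf A -> linf A :=
  sub_map (S := linf A) (f := fun a n => alpha g (a n)) (@linf_act_subproof g).

Definition seq_act g : seq_alg A -> seq_alg A := quot_map (c0 A) (linf_act g).

Lemma linf_act_linear g : linear (linf_act g).
Proof.
by move=> c a b; apply: val_inj; apply/funext => n /=; rewrite act_linear.
Qed.

Lemma seq_actE g a : seq_act g (seq_eta a) = seq_eta (linf_act g a).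
Proof.
apply: quot_mapE; first exact: linf_act_linear.
by move=> x; apply: (@c0_dominated _ _ _ _ 1) => n; rewrite mul1r /= act_norm.
Qed.

Lemma seq_act_hom g : star_hom (seq_act g).
Proof.
have [etaL etaM etaS] := seq_eta_hom A.
split.
- move=> c x y; have [a ->] := seq_eta_surj x; have [b ->] := seq_eta_surj y.
  by rewrite -etaL !seq_actE linf_act_linear etaL.
- move=> x y; have [a ->] := seq_eta_surj x; have [b ->] := seq_eta_surj y.
  rewrite -etaM !seq_actE -etaM; congr seq_eta.
  by apply: val_inj; apply/funext => n /=; rewrite act_amul.
- move=> x; have [a ->] := seq_eta_surj x.
  rewrite -etaS !seq_actE -etaS; congr seq_eta.
  by apply: val_inj; apply/funext => n /=; rewrite act_star.
Qed.

Lemma seq_act_const g x : seq_act g (seq_const x) = seq_const (alpha g x).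
Proof. by rewrite /seq_const seq_actE; congr seq_eta; exact: val_inj. Qed.

Variable D : invSubalg alpha.

Lemma commutant_act_subproof g (x : seq_alg A) :
  commutant_set D x -> commutant_set D (seq_act g x).
Proof.
move=> xD d Dd; have [_ actM _] := seq_act_hom g.
rewrite -[d](actVK alpha g) -seq_act_const -!actM xD//; exact: inv_act.
Qed.

Definition commutant_act g : commutant D -> commutant D :=
  sub_map (S := commutant D) (@commutant_act_subproof g).

Definition central_act g : central_quot D -> central_quot D :=
  quot_map (annihilator D) (commutant_act g).

Lemma central_actE g x :
  central_act g (central_kappa x) = central_kappa (commutant_act g x).
Proof.
have [actL actM _] := seq_act_hom g.
apply: quot_mapE.
  by move=> c y z; apply: val_inj; rewrite /= actL.
have act00 : seq_act g 0 = 0.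
  by have := actL (-1) 0 0; rewrite scaler0 addr0 scaleN1r addNr.
move=> y yA d Dd; have /(yA _)[y1 y2] := inv_act g^-1%g Dd.
by rewrite /= -[d](actVK alpha g) -seq_act_const -!actM y1 y2 act00.
Qed.

(* For bounded sequences, the uniform topology is that of the sup norm. *)
Definition linf_cont : set (linf A) :=
  [set a | continuous (fun g => val (linf_act g a) : {uniform nat -> A})].

Definition seq_cont : set (seq_alg A) := @seq_eta R A @` linf_cont.

(* F_alpha(D, A) *)
Definition central_cont : set (central_quot D) :=
  @central_kappa R A D @` [set x | seq_cont (val x)].

End InducedActions.

Section Rokhlin.
Context {R : realType}.

Definition separable_set (T : topologicalType) (X : set T) : Prop :=
  exists Y : set T, [/\ countable Y, Y `<=` X & X `<=` closure Y].

Definition rokhlin (G : topGroupType) (A : cstarAlgType R)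
    (alpha : cstarAction G A) : Prop :=
  forall D : invSubalg alpha, separable_set (ssa_set D) ->
  exists phi : scalar_cont G -> central_quot D,
    [/\ star_hom phi,
        forall f, central_cont (phi f),
        forall y, central_cont y ->
          phi (scalar_cont1 G) ** y = y /\ y ** phi (scalar_cont1 G) = y
      & forall g f, phi (left_translation g f) = central_act g (phi f)].

End Rokhlin.

Section Positivity.
Context {R : realType}.

Definition positive (V : starAlgType R) (x : V) : Prop :=
  exists y, x = star y ** y.

Definition mx_amul (V : starAlgType R) n (X Y : 'M[V]_n) : 'M[V]_n :=
  \matrix_(i, j) \sum_k X i k ** Y k j.

Definition mx_star (V : starAlgType R) n (X : 'M[V]_n) : 'M[V]_n :=
  \matrix_(i, j) star (X j i).

Definition mx_positive (V : starAlgType R) n (X : 'M[V]_n) : Prop :=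
  exists Y, X = mx_amul (mx_star Y) Y.

(* Positivity at all matrix levels, a matrix being positive in M_n(V) when it is
   of the form Y^* Y. *)
Definition completely_positive (V W : starAlgType R) (f : V -> W) : Prop :=
  linear f /\
  forall n (X : 'M[V]_n), mx_positive X -> mx_positive (map_mx f X).

Definition contractive (A B : cstarAlgType R) (f : A -> B) : Prop :=
  forall x, `|f x| <= `|x|.

Definition order_zero (V W : starAlgType R) (f : V -> W) : Prop :=
  forall x y, positive x -> positive y -> x ** y = 0 -> f x ** f y = 0.

Definition sigma_unital (A : cstarAlgType R) : Prop :=
  exists u : nat -> A,
    [/\ forall n, positive (u n), forall n, `|u n| <= 1,
        forall x, u n ** x @[n --> \oo] --> x
      & forall x, x ** u n @[n --> \oo] --> x].

End Positivity.

Section NuclearDimension.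
Context {R : realType}.

Definition finite_dimensional (V : lmodType R[i]) : Prop :=
  exists n (e : 'I_n -> V), forall x, exists c : 'I_n -> R[i],
    x = \sum_i c i *: e i.

Definition is_ideal (F : cstarAlgType R) (I : cstarSubalg F) : Prop :=
  forall x y, ssa_set I y -> ssa_set I (x ** y) /\ ssa_set I (y ** x).

Definition is_direct_sum (F : cstarAlgType R) n (I : 'I_n -> cstarSubalg F) :
    Prop :=
  forall x : F, exists! y : {ffun 'I_n -> F},
    (forall i, ssa_set (I i) (y i)) /\ x = \sum_i y i.

(* [F] is the direct sum of [n + 1] ideals, on each of which [phi] restricts to
   a completely positive contractive order zero map. *)
Definition decomposable n (F A : cstarAlgType R) (phi : F -> A) : Prop :=
  exists I : 'I_n.+1 -> cstarSubalg F,
    [/\ forall i, is_ideal (I i), is_direct_sum I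
      & forall i (phi_i := fun x : csubstar (I i) => phi (val x)),
          [/\ completely_positive phi_i, contractive phi_i & order_zero phi_i]].

Definition nuc_approx n (A F : cstarAlgType R) (psi : A -> F) (phi : F -> A) :
    Prop :=
  [/\ finite_dimensional F, completely_positive psi, contractive psi,
      completely_positive phi & decomposable n phi].

Definition nuc_dim_le (A : cstarAlgType R) (n : nat) : Prop :=
  forall (s : seq A) (e : R), 0 < e ->
  exists (F : cstarAlgType R) (psi : A -> F) (phi : F -> A),
    nuc_approx n psi phi /\ forall a, a \in s -> `|phi (psi a) - a| < e%:C.

Definition dec_rank_le (A : cstarAlgType R) (n : nat) : Prop :=
  forall (s : seq A) (e : R), 0 < e ->
  exists (F : cstarAlgType R) (psi : A -> F) (phi : F -> A),
    [/\ nuc_approx n psi phi, contractive phi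
      & forall a, a \in s -> `|phi (psi a) - a| < e%:C].

(* The least [n] with the given property, [+oo] if there is none. *)
Definition least_dim (P : nat -> Prop) : \bar R :=
  ereal_inf [set n%:R%:E | n in [set n | P n]].

Definition nuc_dim (A : cstarAlgType R) : \bar R := least_dim (nuc_dim_le A).
Definition dec_rank (A : cstarAlgType R) : \bar R := least_dim (dec_rank_le A).

End NuclearDimension.

Section Haar.
Variable G : topGroupType.

(* [measurableType] requires a pointed carrier. *)
Definition pointed_group : Type := G.
HB.instance Definition _ := Topological.on pointed_group.
HB.instance Definition _ := isPointed.Build pointed_group (1%g : G).

Definition borel_group := g_sigma_algebraType (@open pointed_group).

Definition left_invariant (R : realType) (mu : set borel_group -> \bar R) : Prop :=
  forall (g : G) (X : set borel_group), measurable X ->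
    mu [set (g * x)%g | x in (X : set G)] = mu X.

End Haar.

Section Integration.
Context {R : realType} {G : topGroupType}.
Variable mu : probability (borel_group G) R.

Definition cintegral (f : G -> R[i]) : R[i] :=
  (\int[mu]_(s in [set: borel_group G]) complex.Re (f s))%R +i*
  (\int[mu]_(s in [set: borel_group G]) complex.Im (f s))%R.

(* The weak (Pettis) integral: for continuous integrands on a compact group and
   values in a Banach space it exists, is unique, and agrees with the Bochner
   integral. *)
Definition is_vintegral (V : normedModType R[i]) (f : G -> V) (v : V) : Prop :=
  forall ell : V -> R[i]^o, linear ell -> continuous ell ->
    ell v = cintegral (fun s => ell (f s)).

Definition vintegral (V : normedModType R[i]) (f : G -> V) : V :=
  xget 0 [set v | is_vintegral f v].

End Integration.

Record hilbertSpace (R : realType) := HilbertSpace {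
  hs_carrier :> completeNormedModType R[i];
  hs_inner : {dot hs_carrier for conjc};
  hs_norm : forall x, `|x| ^+ 2 = hs_inner x x
}.

Section CrossedProduct.
Context {R : realType} {G : topGroupType} {A : cstarAlgType R}.
Variable alpha : cstarAction G A.

Record covariant_rep (H : hilbertSpace R) (p : A -> H -> H) (u : G -> H -> H) :
    Prop := CovariantRep {
  cr_bounded : forall a, exists M : R[i], forall xi, `|p a xi| <= M * `|xi|;
  cr_linear : forall a, linear (p a);
  cr_linear2 : forall c a b xi, p (c *: a + b) xi = c *: p a xi + p b xi;
  cr_amul : forall a b xi, p (a ** b) xi = p a (p b xi);
  cr_star : forall a xi eta,
    hs_inner H (p a xi) eta = hs_inner H xi (p (star a) eta);
  cr_unitary_linear : forall g, linear (u g);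
  cr_unitary_inner : forall g xi eta,
    hs_inner H (u g xi) (u g eta) = hs_inner H xi eta;
  cr_unitary1 : forall xi, u 1%g xi = xi;
  cr_unitaryM : forall g h xi, u (g * h)%g xi = u g (u h xi);
  cr_unitary_cont : forall xi, continuous (u ^~ xi);
  cr_covariant : forall g a xi, p (alpha g a) xi = u g (p a (u g^-1%g xi))
}.

Definition rnorm (V : normedModType R[i]) (x : V) : \bar R :=
  (complex.Re `|x|)%:E.

Definition opnorm (H : hilbertSpace R) (T : H -> H) : \bar R :=
  ereal_sup [set rnorm (T xi) | xi in [set xi : H | `|xi| <= 1]].

Definition integrated_form (mu : probability (borel_group G) R)
    (H : hilbertSpace R) (p : A -> H -> H) (u : G -> H -> H) (f : G -> A) :
    H -> H :=
  fun xi => vintegral mu (fun s => p (f s) (u s xi)).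

Definition universal_norm (mu : probability (borel_group G) R) (f : G -> A) :
    \bar R :=
  ereal_sup [set r | exists (H : hilbertSpace R) (p : A -> H -> H)
    (u : G -> H -> H), covariant_rep p u /\ r = opnorm (integrated_form mu p u f)].

(* For compact (hence unimodular) [G]: the completion of the *-algebra C(G, A),
   with the convolution product and involution twisted by [alpha], in the
   universal norm. *)
Record crossedProduct := CrossedProduct {
  cp_alg :> cstarAlgType R;
  cp_haar : probability (borel_group G) R;
  cp_haar_inv : left_invariant cp_haar;
  cp_emb : cont_alg G A -> cp_alg;
  cp_linear : linear cp_emb;
  cp_convolution : forall f g h : cont_alg G A,
    (forall s, val h s =
       vintegral cp_haar (fun t => val f t ** alpha t (val g (t^-1 * s)%g))) ->
    cp_emb h = cp_emb f ** cp_emb g;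
  cp_star : forall f h : cont_alg G A,
    (forall s, val h s = alpha s (star (val f s^-1%g))) ->
    cp_emb h = star (cp_emb f);
  cp_norm : forall f : cont_alg G A,
    rnorm (cp_emb f) = universal_norm cp_haar (val f);
  cp_dense : dense (range cp_emb)
}.

End CrossedProduct.

(* Main.v *)
(* Rokhlin towers x_i in the central sequence algebra yield positive, approximately multiplicative
maps w |-> E (sum_i x_i k alpha_(g_i) w k x_i) from A to A^alpha that almost fix A^alpha, so that
decomposable approximations of A descend to A^alpha. Dimension passes between A^alpha and the crossed
product because j(a)^* c j(b) lies in A^alpha, while c is close to sums of j(a) j(b)^*. Both steps
replace an approximation by its matricial data (images of matrix units under order zero maps),
which are stable under perturbation. *)

Require Import Defs.
From HB Require Import structures.
From mathcomp Require Import all_boot all_order all_algebra.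
From mathcomp Require Import all_classical all_reals all_analysis.
From mathcomp Require Import complex ring lra sesquilinear.

Set Implicit Arguments.
Unset Strict Implicit.
Unset Printing Implicit Defensive.

Import Order.TTheory GRing.Theory Num.Theory.
Import numFieldNormedType.Exports.

Local Open Scope classical_set_scope.
Local Open Scope ring_scope.
Local Open Scope complex_scope.

Implicit Types (R : realType) (G : topGroupType).

Local Notation Re := complex.Re.
Local Notation Im := complex.Im.
Local Notation cstar := cstarAlgType.
Local Notation "\ev n , P" := (exists N : nat, forall n : nat, (N <= n)%N -> P) (at level 200, n name, right associativity).

(** The obstacle is that matricial data in the target satisfy the order zero relations only up to an
    error. They are therefore encoded as one vector [rho] of the Hilbert module [B^J]: an
    approximation is [T |-> <rho, T rho>] on an algebra of block matrices, and it is order zero on a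
    colour as soon as the rank-one operator [theta rho rho] of that colour commutes with the blocks.
    This operator is close to some [D] that does commute with them. A cut-off of [rho], followed by
    an approximate polar decomposition, replaces [theta rho rho] by an element of the double
    commutant of [D]; the price is a square root of the error, hence tolerances of the form
    [t ^+ 2]. The new vector is a limit of operators applied to [rho], so its inner products stay in
    the closed subalgebra at hand. As the algebras need not be unital, spectral arguments take place
    among adjointable operators, where each algebra sits as a left ideal and positivity is a norm
    condition. That [A^alpha] embeds isometrically in the crossed product is seen in the covariant
    representation induced by a state composed with averaging. *)

Lemma complex_eq R (x y : R[i]) : Re x = Re y -> Im x = Im y -> x = y.
Proof. by case: x; case: y => a b c d /= -> ->. Qed.

Tactic Notation "bnd" uconstr(H) :=
 first [refine (le_trans H _) | refine (le_trans (H _) _) | refine (le_trans (H _ _) _)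
 | refine (le_trans (H _ _ _) _) | refine (le_lt_trans H _) | refine (le_lt_trans (H _) _)
 | refine (le_lt_trans (H _ _) _) | refine (le_lt_trans (H _ _ _) _)].
Tactic Notation "each" ident(i) := first [apply: ler_sum | apply: eq_bigr]; let h := fresh in intros i h; clear h.
Tactic Notation "via" uconstr(y) := first [refine (@le_trans _ _ y _ _ _ _) | refine (@le_lt_trans _ _ y _ _ _ _)].

(** * Real-valued norms and convergence of sequences *)

Section RealNorm.
Context {R}.
Implicit Types V : normedModType R[i].

(** Norms take values in [R[i]]; the real part is a number to which [lra] and [nra] apply. *)
Definition nm V (x : V) : R := Re `|x|.

Lemma normE V (x : V) : `|x| = (nm x)%:C.
have := normr_ge0 x; rewrite /nm; case: `|x| => a b.
by rewrite /= => /andP[/eqP -> _].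
Qed.
Lemma nm_ge0 V (x : V) : 0 <= nm x.
by rewrite -ler0c -normE. Qed.
Lemma nm_eqE V (x : V) (t : R) : `|x| = t%:C -> nm x = t.
by rewrite normE => -[]. Qed.
Lemma nm0 V : nm (0 : V) = 0.
by apply: nm_eqE; rewrite normr0. Qed.
Lemma nm_eq0 V (x : V) : nm x = 0 -> x = 0.
by move=> x0; apply: normr0_eq0; rewrite normE x0. Qed.
Lemma nm_le0 V (x : V) : nm x <= 0 -> x = 0.
by move=> x0; apply: nm_eq0; apply/eqP; rewrite eq_le x0 nm_ge0. Qed.
Lemma nmD V (x y : V) : nm (x + y) <= nm x + nm y.
by have := ler_normD x y; rewrite !normE -rmorphD lecR. Qed.
Lemma nmN V (x : V) : nm (- x) = nm x.
by apply: nm_eqE; rewrite normrN normE. Qed.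
Lemma nmB V (x y : V) : nm (x - y) <= nm x + nm y.
by rewrite -(nmN y) nmD. Qed.
Lemma nmBC V (x y : V) : nm (x - y) = nm (y - x).
by rewrite -nmN opprB. Qed.
Lemma nm_tri V (x y z : V) : nm (x - z) <= nm (x - y) + nm (y - z).
by rewrite -[x - z](subrKA y) nmD. Qed.
Lemma nm_ler V (x y : V) : nm x <= nm (x - y) + nm y.
by rewrite -{1}(subrK y x) nmD. Qed.

Lemma nm_sum V (I : Type) (r : seq I) (P : pred I) (F : I -> V) :
 nm (\sum_(i <- r | P i) F i) <= \sum_(i <- r | P i) nm (F i).
elim/big_rec2: _ => [|i y x _ le]; first by rewrite nm0.
by rewrite (le_trans (nmD _ _))// lerD2l.
Qed.

Lemma nmCZ V (c : R[i]) (x : V) : nm (c *: x) = Re `|c| * nm x.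
by apply: nm_eqE; rewrite normrZ normE rmorphM.
Qed.
Lemma nmZ V (t : R) (x : V) : nm (t%:C *: x) = `|t| * nm x.
by rewrite nmCZ /= expr0n addr0 sqrtr_sqr. Qed.
Lemma nmZ0 V (t : R) (x : V) : 0 <= t -> nm (t%:C *: x) = t * nm x.
by move=> t0; rewrite nmZ ger0_norm. Qed.
Lemma nmZV V (t : R) (x : V) : 0 < t -> nm (t^-1%:C *: x) = nm x / t.
by move=> t0; rewrite nmZ0; [rewrite mulrC|rewrite invr_ge0 ltW]. Qed.
Lemma nm_small V (x : V) : (forall e : R, 0 < e -> nm x <= e) -> x = 0.
by move=> xe; apply: nm_le0; apply/ler_addgt0Pl => e e0; rewrite addr0 xe. Qed.

Definition cvs V (u : nat -> V) (l : V) : Prop := forall e : R, 0 < e -> \ev n, nm (u n - l) < e.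

Definition caus V (u : nat -> V) : Prop := forall e : R, 0 < e -> exists N, forall m n, (N <= m)%N -> (N <= n)%N ->
 nm (u m - u n) < e.

Lemma inv_nat_lt (e : R) : 0 < e -> \ev n, n.+1%:R^-1 < e.
move=> e0; exists (Num.bound e^-1) => n Nn.
rewrite invf_plt ?posrE//.
apply: lt_le_trans (archi_boundP _) _; first by rewrite ltW ?invr_gt0.
by rewrite ler_nat ltnW.
Qed.

Lemma real_gt0 (e : R[i]) : 0 < e -> exists2 t : R, 0 < t & e = t%:C.
case: e => a b; rewrite /= => /andP[/eqP -> a0]; by exists a.
Qed.
Lemma gt0C (e : R) : 0 < e -> 0 < e%:C :> R[i].
by rewrite ltcR. Qed.

Lemma cvsP V (u : nat -> V) l : cvs u l <-> u n @[n --> \oo] --> l.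
split=> [ul|]. apply/cvgrPdist_lt => e /real_gt0[t t0 ->]. have [N uN] := ul t t0; exists N => // n Nn /=.
 by rewrite distrC normE ltcR uN.
move/cvgrPdist_lt => ul e e0; have [N _ uN] := ul e%:C (gt0C e0).
by exists N => n Nn; have := uN n Nn; rewrite distrC normE ltcR.
Qed.

Lemma cvs_unique V (u : nat -> V) l l' : cvs u l -> cvs u l' -> l = l'.
move=> ul ul'; apply: subr0_eq; apply: nm_small => e e0.
have [N uN] := ul (e / 2) ltac:(lra); have [N' uN'] := ul' (e / 2) ltac:(lra).
have := uN (maxn N N') (leq_maxl _ _); have := uN' (maxn N N') (leq_maxr _ _).
by have := nm_tri l (u (maxn N N')) l'; rewrite (nmBC l (u _)); lra.
Qed.

Lemma caus_cvs (V : completeNormedModType R[i]) (u : nat -> V) : caus u -> exists l, cvs u l.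
move=> uc; suff /cvg_ex[l ul] : cvgn u by exists l; apply/cvsP.
apply: cauchy_cvg; apply: cauchy_exP => e /real_gt0[t t0 ->].
have [N uN] := uc t t0; exists (u N); exists N => // n Nn /=.
by rewrite -ball_normE /= normE ltcR uN.
Qed.

(** From a Cauchy filter choose, for each [n], the centre [u n] of a ball of radius [1 / (n + 1)]
    that belongs to the filter. Two such balls meet, so [u] is Cauchy, and its limit is a limit of
    the filter. *)
Lemma mk_complete V : (forall u : nat -> V, caus u -> exists l, cvs u l) ->
 forall F : set_system V, ProperFilter F -> cauchy F -> cvg F.
move=> Vc F FF /cauchyP Fc.
pose e n : R := n.+1%:R^-1.
have e0 n : 0 < e n by rewrite invr_gt0.
have c n : {x | F (ball x (e n)%:C)}. by apply: cid; apply: Fc; exact: gt0C.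
pose u n := sval (c n).
have uF n : F (ball (u n) (e n)%:C) by exact: (svalP (c n)).
have uu m n : nm (u m - u n) < e m + e n. have /filter_ex[y []] : F (ball (u m) (e m)%:C `&` ball (u n) (e n)%:C).
 exact: filterI. rewrite -!ball_normE /= !normE !ltcR => h1 h2.
 by have := nm_tri (u m) y (u n); rewrite (nmBC y); lra.
have [|l ul] := Vc u. move=> d d0; have [N eN] := @inv_nat_lt (d / 2) ltac:(lra).
 exists N => m n /eN em /eN en; have := uu m n; move: em en; rewrite -/(e m) -/(e n); lra.
apply/cvg_ex; exists l; apply/cvgrPdist_lt => d /real_gt0[t t0 ->].
have [N uN] := ul (t / 2) ltac:(lra).
have [N' eN] := @inv_nat_lt (t / 2) ltac:(lra).
pose n := maxn N N'.
apply: filterS (uF n) => y; rewrite -!ball_normE /= !normE !ltcR => h.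
have := uN n (leq_maxl _ _); have := eN n (leq_maxr _ _).
by have := nm_tri l (u n) y; rewrite (nmBC l (u n)) -/(e n); lra.
Qed.

Lemma closed_nmP V (S : set V) : closed S <-> forall x, (forall e : R, 0 < e -> exists2 y, S y & nm (x - y) < e) -> S x.
split=> [cS x xS|h x xS]. apply: cS => B /nbhs_ballP[e /real_gt0[t t0 ->] eB].
 have [y Sy xy] := xS t t0; exists y; split => //; apply: eB. by rewrite -ball_normE /= normE ltcR.
apply: h => e e0; have [|y [Sy]] := xS (ball x e%:C). by apply: nbhsx_ballx; exact: gt0C.
by rewrite -ball_normE /= normE ltcR => xy; exists y.
Qed.

Lemma cvs_bnd V (u : nat -> V) l M : cvs u l -> (forall n, nm (u n) <= M) -> nm l <= M.
move=> ul uM; apply/ler_addgt0Pl => e e0; have [N uN] := ul e e0.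
by have := uN N (leqnn _); have := uM N; have := nm_ler l (u N); rewrite (nmBC l); lra.
Qed.
Lemma cvs_ext V (u v : nat -> V) l : (forall n, u n = v n) -> cvs u l -> cvs v l.
by move=> uv ul e /ul[N h]; exists N => n; rewrite -uv; exact: h. Qed.
Lemma cvs_cst V (l : V) : cvs (fun=> l) l.
by move=> e e0; exists 0 => n _; rewrite subrr nm0. Qed.
Lemma cvsD V (u v : nat -> V) l m : cvs u l -> cvs v m -> cvs (fun n => u n + v n) (l + m).
by rewrite !cvsP => ul; exact: cvgD. Qed.

Lemma cvs_dom V (W : normedModType R[i]) (u : nat -> V) l (v : nat -> W) m (M : R) :
 (forall n, nm (v n - m) <= M * nm (u n - l)) -> cvs u l -> cvs v m.
move=> vu ul e e0; have M1 : 0 < `|M| + 1 by rewrite ltr_wpDl.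
have [N uN] := ul (e / (`|M| + 1)) (divr_gt0 e0 M1); exists N => n /uN.
rewrite ltr_pdivlMr// mulrC => h; apply: le_lt_trans (vu n) (le_lt_trans _ h).
by apply: ler_wpM2r; rewrite ?nm_ge0// (le_trans (ler_norm _))// lerDl.
Qed.

Lemma cvs_closed V (S : set V) u l : closed S -> (forall n, S (u n)) -> cvs u l -> S l.
move=> /closed_nmP cS Su ul; apply: cS => e e0; have [N uN] := ul e e0.
by exists (u N) => //; rewrite nmBC uN.
Qed.

Section PreC.
Context {A : preCStarAlgType R}.
Implicit Types x y : A.

Lemma nmM x y : nm (x ** y) <= nm x * nm y.
by have := normr_amul x y; rewrite !normE -rmorphM lecR. Qed.
Lemma nmSS x : nm (star x ** x) = nm x ^+ 2.
by apply: nm_eqE; rewrite normr_starM normE rmorphXn. Qed.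
Lemma nmS x : nm (star x) = nm x.
by apply: nm_eqE; rewrite normr_star normE. Qed.
Lemma nmSSr x : nm (x ** star x) = nm x ^+ 2.
by rewrite -{1}[x]starK nmSS nmS. Qed.

Lemma nmMl x y (M : R) : nm x <= M -> nm (x ** y) <= M * nm y.
by move=> xM; bnd nmM; apply: ler_wpM2r => //; exact: nm_ge0.
Qed.

Lemma nmMr x y (M : R) : nm y <= M -> nm (x ** y) <= nm x * M.
by move=> xM; bnd nmM; apply: ler_wpM2l => //; exact: nm_ge0.
Qed.
Lemma cvsM (u v : nat -> A) l m : cvs u l -> cvs v m -> cvs (fun n => u n ** v n) (l ** m).
by rewrite !cvsP => ul; exact: cvg_amul. Qed.
Lemma cvsS (u : nat -> A) l : cvs u l -> cvs (fun n => star (u n)) (star l).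
by apply: (@cvs_dom _ _ _ _ _ _ 1) => n; rewrite mul1r -starB nmS. Qed.

End PreC.
End RealNorm.

Ltac bnd_sum := apply: le_trans (nm_sum _ _ _) _.


(** * Normal forms for noncommutative polynomial identities *)

Section StarScale.
Context {R} (V : starAlgType R).

Lemma conjCE (c : R[i]) : Num.conj c = conjc c.
by []. Qed.
Lemma starZc (c : R[i]) (x : V) : star (c *: x) = (conjc c) *: star x.
by rewrite starZ. Qed.
Lemma starZr (t : R) (x : V) : star (t%:C *: x) = t%:C *: star x.
by rewrite starZc conjc_real. Qed.

End StarScale.

(* A normalizer for noncommutative polynomial identities in *-algebras; the
 letter 0 of a word stands for a unit when there is one. *)
Section Normalizer.
Context {R} (V : starAlgType R).

Inductive nexp := | NZero | NAt of nat | NAdd of nexp & nexp | NOpp of nexp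
 | NMul of nexp & nexp | NScale of R[i] & nexp.

Fixpoint nev (env : nat -> V) (x : nexp) : V := match x with | NZero => 0 | NAt n => env n
 | NAdd x y => nev env x + nev env y | NOpp x => - nev env x | NMul x y => nev env x ** nev env y
 | NScale c x => c *: nev env x end.

Fixpoint wcat (s t : seq nat) := if s is a :: s' then a :: wcat s' t else t.
Fixpoint ncat (s t : seq (nat * seq nat * R[i])) := if s is a :: s' then a :: ncat s' t else t.
Fixpoint nscale (c : R[i]) (s : seq (nat * seq nat * R[i])) :=
 if s is a :: s' then (a.1, c * a.2) :: nscale c s' else [::].
Fixpoint nmul1 (a : nat * seq nat * R[i]) (s : seq (nat * seq nat * R[i])) :=
 if s is b :: s' then (a.1.1, wcat a.1.2 (b.1.1 :: b.1.2), a.2 * b.2) :: nmul1 a s' else [::].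
Fixpoint nmul (s t : seq (nat * seq nat * R[i])) := if s is a :: s' then ncat (nmul1 a t) (nmul s' t) else [::].

Fixpoint nnf (x : nexp) : seq (nat * seq nat * R[i]) := match x with | NZero => [::] | NAt n => [:: (n, [::], 1)]
 | NAdd x y => ncat (nnf x) (nnf y) | NOpp x => nscale (-1) (nnf x) | NMul x y => nmul (nnf x) (nnf y)
 | NScale c x => nscale c (nnf x) end.

Fixpoint wev (env : nat -> V) (n : nat) (w : seq nat) : V := if w is m :: w' then env n ** wev env m w' else env n.
Fixpoint nfev env (s : seq (nat * seq nat * R[i])) : V :=
 if s is a :: s' then a.2 *: wev env a.1.1 a.1.2 + nfev env s' else 0.

Lemma nfev_cat env s t : nfev env (ncat s t) = nfev env s + nfev env t.
by elim: s => [|a s IH] /=; rewrite ?add0r// IH addrA. Qed.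
Lemma nfev_scale env c s : nfev env (nscale c s) = c *: nfev env s.
by elim: s => [|a s IH] /=; rewrite ?scaler0// IH scalerDr scalerA. Qed.
Lemma wev_cat env n w m w' : wev env n (wcat w (m :: w')) = wev env n w ** wev env m w'.
by elim: w n => [//|k w IH] n /=; rewrite IH amulA. Qed.

Lemma nfev_mul env s t : nfev env (nmul s t) = nfev env s ** nfev env t.
elim: s => [|a s IH] /=; first by rewrite amul0r.
rewrite nfev_cat IH amulDl; congr (_ + _).
elim: t {IH} => [|b t IH] /=; first by rewrite amulr0.
by rewrite IH wev_cat amulDr !(amulZl, amulZr) scalerA.
Qed.

Lemma nnfE env x : nev env x = nfev env (nnf x).
elim: x => /= [|n|x -> y ->|x ->|x -> y ->|c x ->] //.
- by rewrite scale1r addr0.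
- by rewrite nfev_cat.
- by rewrite nfev_scale scaleN1r.
- by rewrite nfev_mul.
- by rewrite nfev_scale.
Qed.

(** These tests are plain fixpoints rather than [==], so that the restricted [cbv] of the tactics
    can evaluate them without unfolding the scalars. *)
Fixpoint neq (m n : nat) := match m, n with | 0, 0 => true | m'.+1, n'.+1 => neq m' n' | _, _ => false end.
Fixpoint weq (s t : seq nat) := match s, t with | [::], [::] => true
 | a :: s', b :: t' => if neq a b then weq s' t' else false | _, _ => false end.

Lemma neqP m n : neq m n -> m = n.
by elim: m n => [|m IH] [|n] //= /IH ->. Qed.
Lemma weqP s t : weq s t -> s = t.
elim: s t => [|a s IH] [|b t] //=.
by case: (boolP (neq a b)) => // /neqP -> /IH ->.
Qed.

Fixpoint ninsert n w c (s : seq (nat * seq nat * R[i])) := if s is a :: s' then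
 if weq (n :: w) (a.1.1 :: a.1.2) then (a.1, c + a.2) :: s' else a :: ninsert n w c s' else [:: (n, w, c)].
Fixpoint nmerge f (s : seq (nat * seq nat * R[i])) :=
 if s is a :: s' then let w := f a.1.1 a.1.2 in ninsert w.1 w.2 a.2 (nmerge f s') else [::].
Fixpoint nzero (s : seq (nat * seq nat * R[i])) : Prop := if s is a :: s' then a.2 = 0 /\ nzero s' else True.

Lemma nfev_insert env n w c s : nfev env (ninsert n w c s) = c *: wev env n w + nfev env s.
elim: s => [//|a s IH]; rewrite [ninsert _ _ _ _]/=.
case: ifP => [h|_]. by have [-> ->] := @weqP (n :: w) (a.1.1 :: a.1.2) h; rewrite /= scalerDl addrA.
rewrite /=.
by rewrite IH addrCA.
Qed.

Lemma nfev_merge env f s : (forall n w, wev env (f n w).1 (f n w).2 = wev env n w) ->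
 nfev env (nmerge f s) = nfev env s.
by move=> fE; elim: s => [//|a s IH] /=; rewrite nfev_insert IH fE. Qed.
Lemma nzeroP env s : nzero s -> nfev env s = 0.
by elim: s => [//|a s IH] /= [-> /IH ->]; rewrite scale0r addr0. Qed.

(** Merging equal words leaves one equation per word, between coefficients in [R[i]]. These are
    handed to [ring] or [field], so the scalars may be symbolic and may involve inverses. *)
Lemma nc_eq_gen f env x y : (forall n w, wev env (f n w).1 (f n w).2 = wev env n w) ->
 nzero (nmerge f (nnf (NAdd x (NOpp y)))) -> nev env x = nev env y.
move=> fE h; apply: subr0_eq.
by rewrite -[LHS]/(nev env (NAdd x (NOpp y))) nnfE -(nfev_merge _ fE) nzeroP.
Qed.

Definition fid (n : nat) (w : seq nat) := (n, w).

Lemma nc_eq env x y : nzero (nmerge fid (nnf (NAdd x (NOpp y)))) -> nev env x = nev env y.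
exact: nc_eq_gen. Qed.

Fixpoint funit n w : nat * seq nat := if w is m :: w' then let r := funit m w' in
 if neq n 0 then r else if neq r.1 0 then (n, [::]) else (n, r.1 :: r.2) else (n, [::]).

Lemma funitE (env : nat -> V) : (forall x, env 0%N ** x = x) -> (forall x, x ** env 0%N = x) ->
 forall n w, wev env (funit n w).1 (funit n w).2 = wev env n w.
move=> e1 e2 n w.
suff [] : wev env (funit n w).1 (funit n w).2 = wev env n w /\ ((funit n w).1 = 0%N -> (funit n w).2 = [::]) by [].
elim: w n => [//|m w IH] n /=; have [IH1 IH2] := IH m.
case: (boolP (neq n 0)) => [/neqP ->|n0]; first by rewrite e1.
case: (boolP (neq (funit m w).1 0)) => [/neqP r0|r0] /=. split=> //; rewrite -IH1 r0 IH2//=.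
by split; [rewrite IH1|move=> n1; rewrite n1 in n0].
Qed.

Lemma ncu_eq env x y : (forall x, env 0%N ** x = x) -> (forall x, x ** env 0%N = x) ->
 nzero (nmerge funit (nnf (NAdd x (NOpp y)))) -> nev env x = nev env y.
by move=> e1 e2; apply: nc_eq_gen; exact: funitE. Qed.

Fixpoint nle (m n : nat) := match m, n with | 0, _ => true | m'.+1, n'.+1 => nle m' n' | _, _ => false end.
Fixpoint wins n (w : seq nat) : seq nat := if w is m :: w' then if nle n m then n :: w else m :: wins n w' else [:: n].
Fixpoint wsort (w : seq nat) : seq nat := if w is m :: w' then wins m (wsort w') else [::].
Definition whd (w : seq nat) := if w is m :: w' then (m, w') else (0, [::])%N.
(** Sorting the letters respects values only if the atoms commute. [lenv_comm] supplies this by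
    placing all atoms in the double commutant of one element. *)
Definition fcomm n w := let r := whd (wsort (n :: w)) in funit r.1 r.2.

Lemma fcommE (env : nat -> V) : (forall x, env 0%N ** x = x) -> (forall x, x ** env 0%N = x) ->
 (forall m n, env m ** env n = env n ** env m) -> forall n w, wev env (fcomm n w).1 (fcomm n w).2 = wev env n w.
move=> e1 e2 ec n w; rewrite funitE//.
pose wv w := wev env (whd w).1 (whd w).2.
have wcons m v : v <> [::] -> wv (m :: v) = env m ** wv v by case: v.
have wi m v : wins m v <> [::] by case: v => //= k v; case: ifP.
have winsE m v : wv (wins m v) = wv (m :: v). elim: v => [//|k v IH]; rewrite [wins _ _]/=; case: ifP => // _.
 rewrite wcons// IH; case: v {IH} => [|l v] /=; first exact: ec. by rewrite /wv /= !amulA (ec k).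
rewrite -/(wv _) -[RHS]/(wv (n :: w)).
elim: w n => [//|m w IH] n.
rewrite winsE [RHS]wcons// -IH wcons//=.
Qed.

Lemma ncc_eq env x y : (forall x, env 0%N ** x = x) -> (forall x, x ** env 0%N = x) ->
 (forall m n, env m ** env n = env n ** env m) ->
 nzero (nmerge fcomm (nnf (NAdd x (NOpp y)))) -> nev env x = nev env y.
by move=> e1 e2 ec; apply: nc_eq_gen; exact: fcommE. Qed.

Fixpoint lenv (d : V) (l : seq V) (n : nat) : V := match l, n with
 | [::], _ => d | a :: _, 0%N => a | _ :: l', n'.+1 => lenv d l' n' end.

End Normalizer.

Ltac nc_find a l := lazymatch l with | a :: _ => constr:(0%N) | _ :: ?l' => let n := nc_find a l' in constr:(S n) end.
Ltac nc_add a l := let rec go l := lazymatch l with | [::] => false | a :: _ => true | _ :: ?l' => go l' end in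
 match go l with | true => l | false => let rec app l := lazymatch l with
 | [::] => constr:([:: a]) | ?b :: ?l' => let r := app l' in constr:(b :: r) end in app l end.
Ltac nc_atoms t l := lazymatch t with | 0%R => l | (?a + ?b)%R => let l := nc_atoms a l in nc_atoms b l
 | (- ?a)%R => nc_atoms a l | (?a ** ?b) => let l := nc_atoms a l in nc_atoms b l | (_ *: ?a)%R => nc_atoms a l
 | _ => nc_add t l end.
Ltac nc_reify R t l := lazymatch t with | 0%R => constr:(@NZero R)
 | (?a + ?b)%R => let x := nc_reify R a l in let y := nc_reify R b l in constr:(@NAdd R x y)
 | (- ?a)%R => let x := nc_reify R a l in constr:(@NOpp R x)
 | (?a ** ?b) => let x := nc_reify R a l in let y := nc_reify R b l in constr:(@NMul R x y)
 | (?c *: ?a)%R => let x := nc_reify R a l in constr:(@NScale R c x) | _ => let n := nc_find t l in constr:(@NAt R n)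
 end.
Ltac nc_cbv := cbv [nzero nmerge ninsert nnf nmul nmul1 nscale ncat wcat fid funit fcomm whd
 wsort wins nle neq weq fst snd].
Ltac nc_done := nc_cbv; repeat (split; [by [ring | field]|]); exact I.
Ltac nc_star := rewrite ?(starD, starN, starM, starK, starZr, star0).
Ltac nc_pre e k := let Vt := lazymatch goal with |- @eq ?T _ _ => T end in lazymatch goal with |- @eq _ ?x ?y =>
 let l0 := constr:(@cons Vt e nil) in let l := nc_atoms x l0 in let l := nc_atoms y l in
 lazymatch type of (fun z : Vt => z ** z) with _ =>
 let R := lazymatch constr:(fun z : Vt => z ** z) with fun _ => @amul ?R _ _ _ => R end in
 let rx := nc_reify R x l in let ry := nc_reify R y l in k l rx ry end end.
Ltac nc := let Vt := lazymatch goal with |- @eq ?T _ _ => T end in nc_pre (0%R : Vt) ltac:(fun l x y =>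
 refine (@nc_eq _ _ (lenv 0 l) x y _); nc_done).
Ltac ncu e He1 He2 := nc_pre e ltac:(fun l x y => refine (@ncu_eq _ _ (lenv e l) x y He1 He2 _); nc_done).

(** * Functions of an element: double commutants and invariant subspaces *)

Section Bicommutant.
Context {R} (V : starAlgType R).

(** Membership in the double commutant of [a], which stands for being a function of [a]: any two
    members commute with each other and with everything that commutes with [a]. *)
Definition bic (a z : V) : Prop := forall b, b ** a = a ** b -> b ** z = z ** b.

Lemma bic_refl a : bic a a. by []. Qed.
Lemma bic_trans a b c : bic a b -> bic b c -> bic a c.
by move=> ab bc d /ab /bc. Qed.
Lemma bic_comm a z w : bic a z -> bic a w -> z ** w = w ** z.
by move=> az aw; apply: aw; apply/esym/az. Qed.
Lemma bicD a z w : bic a z -> bic a w -> bic a (z + w).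
by move=> az aw b ba; rewrite amulDl amulDr az// aw. Qed.
Lemma bicZ a c z : bic a z -> bic a (c *: z).
by move=> az b ba; rewrite amulZl amulZr az. Qed.
Lemma bicN a z : bic a z -> bic a (- z).
by move=> az b ba; rewrite amulNl amulNr az. Qed.
Lemma bicB a z w : bic a z -> bic a w -> bic a (z - w).
by move=> az aw; apply: bicD => //; exact: bicN. Qed.
Lemma bicM a z w : bic a z -> bic a w -> bic a (z ** w).
by move=> az aw b ba; rewrite amulA az// -amulA aw// amulA. Qed.
Lemma bic_unit a (e : V) : (forall x, e ** x = x) -> (forall x, x ** e = x) -> bic a e.
by move=> e1 e2 b _; rewrite e1. Qed.

Fixpoint lall (P : V -> Prop) (l : seq V) : Prop := if l is a :: l' then P a /\ lall P l' else True.
Lemma lenv_comm a e l : bic a e -> lall (bic a) l -> forall m n, lenv e l m ** lenv e l n = lenv e l n ** lenv e l m.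
move=> ae al m n; suff bl k : bic a (lenv e l k) by exact: bic_comm (bl m) (bl n).
by elim: l al k => [|b l IH] //= [ab al] [|k]//; exact: IH.
Qed.
End Bicommutant.

Ltac ncc e He1 He2 a := nc_pre e ltac:(fun l x y => refine (@ncc_eq _ _ (lenv e l) x y He1 He2 _ _);
 [refine (@lenv_comm _ _ a e l _ _); [exact: (bic_unit He1 He2)|
 rewrite /=; repeat split; solve [assumption | exact: bic_refl | exact: (bic_unit He1 He2)]] | nc_done]).

Section Lattice.
Context {R} {A : cstar R}.
Implicit Types x y z : A.

(* [z] leaves invariant every closed subspace that [x] leaves invariant; this
 holds for limits of polynomials in [x]. *)
Definition lat x z : Prop := forall S : set A, closed S ->
 (forall u v, S u -> S v -> S (u + v)) -> (forall (c : R[i]) u, S u -> S (c *: u)) ->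
 (forall u, S u -> S (x ** u)) -> forall u, S u -> S (z ** u).

Lemma lat_refl x : lat x x. by move=> S _ _ _ Sx. Qed.
Lemma lat_trans x y z : lat x y -> lat y z -> lat x z.
by move=> xy yz S cS SD SZ Sx; exact: (yz S cS SD SZ (xy S cS SD SZ Sx)). Qed.
Lemma latD x y z : lat x y -> lat x z -> lat x (y + z).
move=> xy xz S cS SD SZ Sx u Su; rewrite amulDl; apply: (SD); [exact: (xy S cS SD SZ Sx)|exact: (xz S cS SD SZ Sx)].
Qed.
Lemma latZ x c y : lat x y -> lat x (c *: y).
by move=> xy S cS SD SZ Sx u Su; rewrite amulZl; apply: (SZ); exact: (xy S cS SD SZ Sx). Qed.
Lemma latN x y : lat x y -> lat x (- y).
by rewrite -scaleN1r; exact: latZ. Qed.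
Lemma latB x y z : lat x y -> lat x z -> lat x (y - z).
by move=> xy xz; apply: latD => //; exact: latN. Qed.
Lemma latM x y z : lat x y -> lat x z -> lat x (y ** z).
move=> xy xz S cS SD SZ Sx u Su; rewrite -amulA.
exact: (xy S cS SD SZ Sx _ (xz S cS SD SZ Sx _ Su)).
Qed.
Lemma lat0 x : lat x 0.
by move=> S cS SD SZ Sx u /(SZ 0); rewrite scale0r amul0r. Qed.
Lemma lat_unit x e : (forall x, e ** x = x) -> lat x e.
by move=> e1 S cS SD SZ Sx u; rewrite e1. Qed.
Lemma lat_cvs x u z : (forall n, lat x (u n)) -> cvs u z -> lat x z.
move=> xu uz S cS SD SZ Sx v Sv.
apply: (@cvs_closed _ _ S (fun n => u n ** v)) => //; first by move=> n; exact: xu.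
by apply: cvsM => //; exact: cvs_cst.
Qed.

Lemma closed_commute b : closed [set u : A | b ** u = u ** b].
apply/closed_nmP => x h; apply: subr0_eq; apply: nm_small => e e0.
have M0 : 0 < nm b + nm b + 1 by have := nm_ge0 b; lra.
have [y /= yb xy] := h _ (divr_gt0 e0 M0).
have -> : b ** x - x ** b = b ** (x - y) - (x - y) ** b. by rewrite amulBr yb; nc.
bnd nmB.
move: xy; rewrite ltr_pdivlMr// => xy.
have := nmM b (x - y); have := nmM (x - y) b; have := nm_ge0 (x - y); lra.
Qed.

(** If [b] commutes with [x], the elements commuting with [b] form a closed subspace invariant under
    multiplication by [x]. It contains the unit, hence also [z]. *)
Lemma lat_bic x e z : (forall x, e ** x = x) -> (forall x, x ** e = x) -> lat x z -> bic x z.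
move=> e1 e2 xz b bx; rewrite -[z in LHS]e2 -[z in RHS]e2.
apply: (xz [set u : A | b ** u = u ** b]) => /=.
- exact: closed_commute.
- by move=> u v bu bv; rewrite amulDl amulDr bu bv.
- by move=> c u bu; rewrite amulZl amulZr bu.
- by move=> u bu; rewrite amulA bx -amulA bu amulA.
- by rewrite e1.
Qed.

End Lattice.

(** * Square roots by iteration *)

Section SelfAdjoint.
Context {R} {A : cstar R}.
Implicit Types x y z : A.

Definition sa x : Prop := star x = x.

Lemma sa0 : sa 0. exact: star0. Qed.
Lemma saD x y : sa x -> sa y -> sa (x + y).
by rewrite /sa starD => -> ->. Qed.
Lemma saN x : sa x -> sa (- x).
by rewrite /sa starN => ->. Qed.
Lemma saB x y : sa x -> sa y -> sa (x - y).
by move=> sx sy; apply: saD => //; exact: saN. Qed.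
Lemma saZ (t : R) x : sa x -> sa (t%:C *: x).
by rewrite /sa starZr => ->. Qed.
Lemma sa_comm x y : sa x -> sa y -> x ** y = y ** x -> sa (x ** y).
by rewrite /sa starM => -> ->. Qed.
Lemma sa_sq x : sa x -> sa (x ** x).
by rewrite /sa starM => ->. Qed.
Lemma sa_cvs u x : (forall n, sa (u n)) -> cvs u x -> sa x.
move=> su ux; apply: cvs_unique (ux); apply: (cvs_ext su); exact: cvsS.
Qed.
Lemma nm_sq x : sa x -> nm (x ** x) = nm x ^+ 2.
by move=> sx; rewrite -{1}sx nmSS. Qed.

Lemma sq_eq0 x : sa x -> x ** x = 0 -> x = 0.
move=> sx xx; apply: nm_eq0; apply/eqP; rewrite -sqrf_eq0 -nm_sq// xx.
by rewrite nm0.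
Qed.

Lemma star_eq0 x : star x ** x = 0 -> x = 0.
by move=> xx; apply: nm_eq0; apply/eqP; rewrite -sqrf_eq0 -nmSS xx nm0.
Qed.

(** With [z = x + i y], commutation gives [star z ** z = x^2 + y^2], and [2 x = z + star z] bounds
    the norm of [x] by that of [z]. This is the substitute for comparing spectra of commuting
    elements. *)
Lemma nm_sum_sq x y : sa x -> sa y -> x ** y = y ** x -> nm x ^+ 2 <= nm (x ** x + y ** y).
move=> sx sy xy; pose g := (0 +i* 1) *: y; pose z := x + g.
have sg : star g = - g. rewrite /g starZ sy -scaleNr; congr (_ *: _). by apply/eqP; rewrite eq_complex /= oppr0 !eqxx.
have gg : g ** g = - (y ** y). rewrite /g amulZl amulZr scalerA -scaleN1r; congr (_ *: _).
 by apply: complex_eq => /=; ring.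
have xg : x ** g = g ** x by rewrite /g amulZl amulZr xy.
have zz : star z ** z = x ** x + y ** y. rewrite /z starD sx sg -[y ** y]opprK -gg.
 have -> : (x + - g) ** (x + g) = x ** x - g ** g + (x ** g - g ** x) by nc. by rewrite xg subrr addr0.
rewrite -zz nmSS; apply: lerXn2r; rewrite ?nnegrE ?nm_ge0//.
have : nm (2%:C *: x) <= nm z + nm (star z). have -> : 2%:C *: x = z + star z. by rewrite /z starD sx sg; nc.
 exact: nmD.
rewrite nmS nmZ0//; lra.
Qed.

(* The iteration y <- (x + y^2) / 2 converges to 1 - sqrt (1 - x), dominated by
 the corresponding scalar iteration at x = 1. *)
Let tseq := fix tseq (n : nat) : R := if n is m.+1 then 2^-1 * (1 + tseq m ^+ 2) else 0.

Let tseq_bnd n : 0 <= tseq n <= 1.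
by elim: n => [|n IH] /=; [lra|nra]. Qed.

Let tseq_incr n : tseq n <= tseq n.+1.
by rewrite /=; have := tseq_bnd n; nra. Qed.

Let tseq_mono m n : (m <= n)%N -> tseq m <= tseq n.
move=> /subnK <-; elim: (n - m)%N => [//|k IH]; rewrite addSn.
exact: le_trans IH (tseq_incr _).
Qed.

Let yseq x := fix yseq (n : nat) : A := if n is m.+1 then (2^-1)%:C *: (x + yseq m ** yseq m) else 0.

(** The equation says [(1 - y)^2 = 1 - x]; written as [2 y - y^2 = x] it makes sense without a
    unit. *)
Lemma sqrt_iter x : sa x -> nm x <= 1 -> exists y, [/\ sa y, 2%:C *: y - y ** y = x, nm y <= 1 & lat x y].
move=> sx x1; pose y := yseq x.
have ylat n : lat x (y n). elim: n => [|n IH] /=; first exact: lat0.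
 by apply: latZ; apply: latD; [exact: lat_refl|exact: latM].
have ysa n : sa (y n). elim: n => [|n IH] /=; first exact: sa0. by apply/saZ/saD => //; exact: sa_sq.
have yy m n : y m ** y n = y n ** y m. have ypow k : y k ** x = x ** y k.
 elim: k => [|k IH] /=; first by rewrite amul0r amulr0.
 by rewrite amulZl amulZr amulDl amulDr -amulA IH amulA IH amulA.
 elim: n => [|n IH] /=; first by rewrite amul0r amulr0.
 by rewrite amulZl amulZr amulDl amulDr ypow amulA IH -amulA IH amulA.
have yt n : nm (y n) <= tseq n. elim: n => [|n IH] /=; first by rewrite nm0.
 rewrite nmZ0 ?invr_ge0//; apply: ler_wpM2l; rewrite ?invr_ge0//. bnd nmD; apply: lerD => //.
 by bnd nmM; rewrite ler_pM ?nm_ge0.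
(* Since the iterates commute, [y_{n+2} - y_{n+1} = (y_{n+1} - y_n) (y_{n+1} + y_n) / 2]. The scalar
   sequence obeys the same recursion, so its increments dominate. *)
have dyt n : nm (y n.+1 - y n) <= tseq n.+1 - tseq n. elim: n => [|n IH].
 rewrite /= amulr0 addr0 !subr0 nmZ0 ?invr_ge0// expr0n addr0. lra.
 have -> : y n.+2 - y n.+1 = (2^-1)%:C *: ((y n.+1 - y n) ** (y n.+1 + y n)).
 rewrite [y n.+2]/= -/(y _) [X in _ - X]/= -/(y _). rewrite -scalerBr; congr (_ *: _).
 have -> : (y n.+1 - y n) ** (y n.+1 + y n) = y n.+1 ** y n.+1 - y n ** y n + (y n.+1 ** y n - y n ** y n.+1) by nc.
 by rewrite (yy n.+1 n) subrr addr0 opprD addrACA subrr add0r. rewrite nmZ0 ?invr_ge0//.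
 have -> : tseq n.+2 - tseq n.+1 = 2^-1 * ((tseq n.+1 - tseq n) * (tseq n.+1 + tseq n)).
 have t2 : tseq n.+2 = 2^-1 * (1 + tseq n.+1 ^+ 2) by []. have t1 : tseq n.+1 = 2^-1 * (1 + tseq n ^+ 2) by [].
 by rewrite t2 [X in _ - X = _]t1; field. apply: ler_wpM2l; rewrite ?invr_ge0//; bnd nmM.
 apply: ler_pM; rewrite ?nm_ge0//. by bnd nmD; exact: lerD.
have dy m n : (m <= n)%N -> nm (y n - y m) <= tseq n - tseq m.
 move=> /subnK <-; elim: (n - m)%N => [|k IH]; first by rewrite !subrr nm0.
 rewrite addSn; bnd (nm_tri _ (y (k + m)%N) _). by have := dyt (k + m)%N; lra.
have tcvg : cvgn tseq. apply: nondecreasing_is_cvgn; first exact: tseq_mono.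
 by exists 1 => _ [n _ <-]; case/andP: (tseq_bnd n).
have yc : caus y. move=> e e0; have e2 : 0 < e / 2 by lra.
 move/cvgrPdist_lt : tcvg => /(_ (e / 2) e2)[N _ tN]; exists N => m n Nm Nn.
 have := tN m Nm; have := tN n Nn; rewrite /= !ltr_norml => /andP[h1 h2] /andP[h3 h4].
 have [mn|/ltnW nm] := leqP m n; last by have := dy _ _ nm; lra. by rewrite nmBC; have := dy _ _ mn; lra.
have [l yl] := caus_cvs yc; exists l; split.
- exact: sa_cvs yl.
- have yl1 : cvs (fun n => y n.+1) l. by move=> e /yl[N h]; exists N => n Nn; apply: h; exact: leqW.
 have yl2 : cvs (fun n => y n.+1) ((2^-1)%:C *: (x + l ** l)). have : cvs (fun n => x + y n ** y n) (x + l ** l).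
 by apply: cvsD; [exact: cvs_cst|exact: cvsM]. by apply: cvs_dom => n; rewrite -scalerBr nmZ0.
 have -> : 2%:C *: l - l ** l = 2%:C *: ((2^-1)%:C *: (x + l ** l)) - l ** l. by rewrite -(cvs_unique yl1 yl2). by nc.
- by apply: cvs_bnd yl _ => n; bnd (yt n); case/andP: (tseq_bnd n).
- exact: lat_cvs yl.
Qed.

End SelfAdjoint.

(** * Positivity as a norm condition in a unital algebra *)

Section Unital.
Context {R} {A : cstar R} (e : A).
Hypotheses (ex : forall x, e ** x = x) (xe : forall x, x ** e = x).
Implicit Types (x y z : A) (s t : R).
Local Notation "t %:U" := (t%:C *: e) (at level 2, format "t %:U").

Lemma sa_unit : sa e.
have h : star e = e ** star e by rewrite ex.
by rewrite /sa -[RHS]starK [in RHS]h starM starK.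
Qed.

Lemma saU t : sa t%:U. by apply: saZ; exact: sa_unit. Qed.
Lemma nm_unit : nm e <= 1.
have := nmSS e; rewrite sa_unit ex; nra. Qed.
Lemma nmU t : 0 <= t -> nm t%:U <= t.
by move=> t0; rewrite nmZ0// ler_piMr// nm_unit. Qed.
Lemma Ux t x : t%:U ** x = t%:C *: x. by rewrite amulZl ex. Qed.
Lemma xU t x : x ** t%:U = t%:C *: x. by rewrite amulZr xe. Qed.
Lemma latU x t : lat x t%:U. by apply: latZ; exact: lat_unit. Qed.
Lemma lat_bicU x z : lat x z -> bic x z. exact: lat_bic. Qed.
Lemma bicU a t : bic a t%:U. by apply: bicZ; exact: bic_unit. Qed.

(** For self-adjoint [x] the inequality places the spectrum in [[0, 2 t]]. Sums and limits are easy
    in this form; agreement with the form [star y ** y] rests on [np_sqrt] and [np_star]. *)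
Definition np x : Prop := sa x /\ exists t, nm (t%:U - x) <= t.

Lemma npD x y : np x -> np y -> np (x + y).
move=> [sx [t xt]] [sy [s ys]]; split; first exact: saD.
exists (t + s).
have -> : (t + s)%:U - (x + y) = (t%:U - x) + (s%:U - y) by nc.
by bnd nmD; exact: lerD.
Qed.

Lemma npZ t x : 0 <= t -> np x -> np (t%:C *: x).
move=> t0 [sx [s xs]]; split; first exact: saZ.
exists (t * s); have -> : (t * s)%:U - t%:C *: x = t%:C *: (s%:U - x) by nc.
by rewrite nmZ0//; exact: ler_wpM2l.
Qed.
Lemma np0 : np 0.
by split; [exact: sa0|exists 0; rewrite scale0r subrr nm0]. Qed.

Lemma np_le_U t x : sa x -> nm x <= t -> np (t%:U - x).
move=> sx xt; split; first by apply: saB => //; exact: saU.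
by exists t; rewrite opprB addrC subrK.
Qed.
Lemma npU t : 0 <= t -> np t%:U.
by move=> t0; rewrite -[t%:U]subr0; apply: np_le_U; [exact: sa0|rewrite nm0]. Qed.
Lemma np_ge_U t x : sa x -> nm x <= t -> np (t%:U + x).
by move=> sx xt; rewrite -[x]opprK; apply: np_le_U; [exact: saN|rewrite nmN]. Qed.

(** [u = 1 - x / t] is a contraction, and a solution of [2 y - y^2 = u] gives
    [(1 - y)^2 = x / t]. *)
Lemma np_sqrt x : np x -> exists r, [/\ np r, r ** r = x & lat x r].
move=> [sx [t xt]]; have t0 : 0 <= t by exact: le_trans (nm_ge0 _) xt.
have [t00|tn0] := eqVneq t 0. exists 0; split; [exact: np0| |exact: lat0].
 move: xt; rewrite t00 scale0r sub0r nmN => /nm_le0; by rewrite amul0r.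
have tp : 0 < t by rewrite lt_neqAle eq_sym tn0.
pose u := e - t^-1%:C *: x.
have su : sa u by apply: saB; [exact: sa_unit|exact: saZ].
have u1 : nm u <= 1. have -> : u = t^-1%:C *: (t%:U - x). rewrite scalerBr scalerA -rmorphM mulVf//; by rewrite scale1r.
 by rewrite nmZ0 ?invr_ge0// -ler_pdivlMl ?invr_gt0// invrK mulr1.
have [y [sy yu y1 uy]] := sqrt_iter su u1.
have uylat : lat x u by apply: latB; [exact: lat_unit|apply: latZ; exact: lat_refl].
exists ((Num.sqrt t)%:C *: (e - y)); split.
- apply: npZ => //; have := np_le_U sy y1; by rewrite scale1r.
- have -> : (Num.sqrt t)%:C *: (e - y) ** ((Num.sqrt t)%:C *: (e - y)) =
 (Num.sqrt t * Num.sqrt t)%:C *: (e - (2%:C *: y - y ** y)) by ncu e ex xe.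
 rewrite -expr2 sqr_sqrtr// yu /u opprB addrC subrK scalerA -rmorphM /=. by rewrite divff// scale1r.
- apply: latZ; apply: latB; [exact: lat_unit|exact: lat_trans uy].
Qed.

(** The iteration applied to [h^2] yields [c] with [c^2 = 1 - h^2]. Now [c^2 + h^2 = 1] with [c] and
    [h] commuting, so [c] is a contraction, and so is [1 - h^2]. *)
Lemma sq_np_small h : sa h -> nm h <= 1 -> np (h ** h) /\ nm (e - h ** h) <= 1.
move=> sh h1; have shh := sa_sq sh.
have hh1 : nm (h ** h) <= 1 by rewrite nm_sq// expr_le1 ?nm_ge0.
have [y [sy yu y1 uy]] := sqrt_iter shh hh1.
pose c := e - y; have sc : sa c by apply: saB => //; exact: sa_unit.
have cc : c ** c = e - h ** h by rewrite -yu /c; ncu e ex xe.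
have hy : h ** y = y ** h. by have := lat_bicU uy; apply; rewrite amulA.
have ch : c ** h = h ** c by rewrite /c amulBl amulBr hy ex xe.
have c1 : nm c ^+ 2 <= 1. apply: le_trans (nm_sum_sq sc sh ch) _. by rewrite cc subrK; exact: nm_unit.
have h2 : nm (e - h ** h) <= 1 by rewrite -cc nm_sq.
by split => //; split=> //; exists 1; rewrite scale1r.
Qed.

Lemma sq_np h : sa h -> np (h ** h).
move=> sh; pose t := nm h + 1; have t0 : 0 < t by have := nm_ge0 h; rewrite /t; lra.
have sh' : sa (t^-1%:C *: h) by exact: saZ.
have h1 : nm (t^-1%:C *: h) <= 1. by rewrite nmZV// ler_pdivrMr// /t; lra.
have [h2 _] := sq_np_small sh' h1.
have -> : h ** h = (t * t)%:C *: (t^-1%:C *: h ** (t^-1%:C *: h)). have tn0 : t != 0 by rewrite gt_eqF.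
 rewrite amulZl amulZr !scalerA -!rmorphM /=. have -> : t * t * (t^-1 * t^-1) = 1 by field. by rewrite scale1r.
by apply: npZ => //; apply: mulr_ge0; exact: ltW.
Qed.

Lemma np_antisq d : star d = - d -> np (- (d ** d)).
move=> sd; pose g := (0 +i* 1) *: d.
have sg : sa g. rewrite /sa /g starZc sd scalerN -scaleNr; congr (_ *: _).
 by apply/eqP; rewrite eq_complex /= oppr0 opprK !eqxx.
have -> : - (d ** d) = g ** g. rewrite /g amulZl amulZr scalerA -scaleN1r; congr (_ *: _).
 by apply: complex_eq => /=; ring.
exact: sq_np.
Qed.

(** Any bound of the norm can serve as the constant in [np]: apply [sq_np_small] to the square root
    of [x / t]. This uniform choice is what makes [np] closed. *)
Lemma np_nm t x : np x -> nm x <= t -> nm (t%:U - x) <= t.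
move=> px xt; have [r [pr rx _]] := np_sqrt px; have [sr _] := pr.
have t0 : 0 <= t by exact: le_trans (nm_ge0 _) xt.
have [t00|tn0] := eqVneq t 0. move: xt; rewrite t00 => /nm_le0 ->; by rewrite scale0r subrr nm0.
have tp : 0 < t by rewrite lt_neqAle eq_sym tn0.
pose w := (Num.sqrt t)^-1; have w0 : 0 <= w by rewrite invr_ge0 sqrtr_ge0.
have ww : w * w = t^-1 by rewrite /w -invfM -expr2 sqr_sqrtr.
have sr' : sa (w%:C *: r) by exact: saZ.
have r1 : nm (w%:C *: r) <= 1. rewrite nmZ0// -(@expr_le1 _ 2) ?mulr_ge0 ?nm_ge0// exprMn -nm_sq// rx expr2 ww.
 by rewrite -ler_pdivlMl ?invr_gt0// invrK mulr1.
have [_] := sq_np_small sr' r1.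
rewrite amulZl amulZr scalerA -rmorphM /= ww rx => h.
have -> : t%:U - x = t%:C *: (e - t^-1%:C *: x). by rewrite scalerBr scalerA -rmorphM divff// scale1r.
by rewrite nmZ0// ler_piMr.
Qed.

Lemma np_closed : closed np.
apply/closed_nmP => x h; have sx : sa x. apply: subr0_eq; apply: nm_small => d d0.
 have [y [sy _] xy] := h (d / 2) ltac:(lra). have -> : star x - x = star (x - y) - (x - y) by rewrite starB sy; nc.
 by have := nmB (star (x - y)) (x - y); rewrite nmS; lra.
split => //; exists (nm x + 1); apply/ler_addgt0Pl => d d0.
have m0 : 0 < Num.min d 1 by rewrite lt_min d0 ltr01.
have [y py] := h _ m0; rewrite lt_min => /andP[xyd xy1].
have yx : nm y <= nm x + 1 by have := nm_ler y x; rewrite nmBC; lra.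
have := np_nm py yx; have := nmD ((nm x + 1)%:U - y) (y - x).
have -> : (nm x + 1)%:U - y + (y - x) = (nm x + 1)%:U - x by nc.
by rewrite (nmBC y); lra.
Qed.

Lemma np_comm x y : np x -> np y -> x ** y = y ** x -> np (x ** y).
move=> px py xy; have [r [[sr _] rx br]] := np_sqrt px; have [s [[ss _] sy bs]] := np_sqrt py.
have rs : r ** s = s ** r. apply: (lat_bicU bs); apply/esym/(lat_bicU br); exact/esym.
have -> : x ** y = (r ** s) ** (r ** s). by rewrite -rx -sy -!amulA; congr (_ ** _); rewrite !amulA rs.
by apply: sq_np; apply: sa_comm.
Qed.

Lemma np_anti x : np x -> np (- x) -> x = 0.
move=> px px'; have [r [[sr _] rx br]] := np_sqrt px; have [s [[ss _] sy bs]] := np_sqrt px'.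
have rs : r ** s = s ** r. apply: (lat_bicU bs); rewrite amulNl amulNr; congr (- _). by apply/esym/(lat_bicU br).
have := nm_sum_sq sr ss rs; rewrite rx sy subrr nm0 => h.
have r0 : nm r = 0 by have := nm_ge0 r; nra.
by rewrite -rx (nm_eq0 r0) amul0r.
Qed.

(** Commuting square roots of [x] and [t - x] have squares adding up to [t], to which [nm_sum_sq]
    applies. *)
Lemma np_bnd t x : 0 <= t -> np x -> np (t%:U - x) -> nm x <= t.
move=> t0 px ptx; have [r [[sr _] rx br]] := np_sqrt px; have [s [[ss _] sy bs]] := np_sqrt ptx.
have rs : r ** s = s ** r. apply: (lat_bicU bs); rewrite amulBl amulBr Ux xU; congr (_ - _).
 by apply/esym/(lat_bicU br).
have := nm_sum_sq sr ss rs; rewrite -nm_sq// rx sy addrC subrK => h.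
by apply: le_trans h (nmU t0).
Qed.

Lemma np_mono x y : np x -> np (y - x) -> nm x <= nm y.
move=> px pyx; apply: np_bnd => //; first exact: nm_ge0.
have sy : sa y by rewrite -[y](subrK x); apply: saD; [case: pyx|case: px].
have -> : (nm y)%:U - x = ((nm y)%:U - y) + (y - x) by nc.
by apply: npD => //; exact: np_le_U.
Qed.

Lemma sa_bnd t x : 0 <= t -> sa x -> np (t%:U - x) -> np (t%:U + x) -> nm x <= t.
move=> t0 sx p1 p2.
have : np ((t ^+ 2)%:U - x ** x). have -> : (t ^+ 2)%:U - x ** x = (t%:U - x) ** (t%:U + x) by ncu e ex xe.
 by apply: np_comm => //; ncu e ex xe.
move=> /(np_bnd _ (sq_np sx)); rewrite sqr_ge0 => /(_ isT).
by rewrite nm_sq// ler_pXn2r ?nnegrE ?nm_ge0.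
Qed.

(** Neumann series: with [T = nm x + t] one has [x + t = T (1 - z)] for [z = (nm x - x) / T], whose
    norm is at most [nm x / T < 1]. The bound on [c] follows from [1 / t - c = x c / t], a product
    of commuting positive elements. *)
Lemma np_inv t x : np x -> 0 < t -> exists c, [/\ np c, (x + t%:U) ** c = e, lat x c & nm c <= t^-1].
move=> px t0; have [sx _] := px; pose T := nm x + t.
have T0 : 0 < T by have := nm_ge0 x; rewrite /T; lra.
pose z := T^-1%:C *: ((nm x)%:U - x); pose q := nm x / T.
have q0 : 0 <= q by rewrite /q divr_ge0 ?nm_ge0 ?ltW.
have q1 : q < 1 by rewrite /q ltr_pdivrMr// mul1r /T; lra.
have zq : nm z <= q. rewrite nmZV// /q; apply: ler_wpM2r; first by rewrite invr_ge0 ltW. exact: np_nm.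
pose y := fix y n := if n is m.+1 then e + z ** y m else (0 : A).
have zl : lat x z by apply: latZ; apply: latB; [exact: latU|exact: lat_refl].
have yl n : lat x (y n). elim: n => [|n IH] /=; first exact: lat0. by apply: latD; [exact: lat_unit|exact: latM].
have dy n : nm (y n.+1 - y n) <= q ^+ n. elim: n => [|n IH]; first by rewrite /= amulr0 addr0 subr0 nm_unit.
 have -> : y n.+2 - y n.+1 = z ** (y n.+1 - y n). have t1 : y n.+1 = e + z ** y n by [].
 rewrite -[y n.+2]/(e + z ** y n.+1); rewrite [X in _ - X = _]t1; nc. rewrite exprS; bnd nmM.
 by apply: ler_pM => //; exact: nm_ge0.
have dy2 m n : (m <= n)%N -> (1 - q) * nm (y n - y m) <= q ^+ m - q ^+ n.
 move=> /subnK <-; elim: (n - m)%N => [|k IH]; first by rewrite !subrr nm0 mulr0.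
 rewrite addSn exprS; have := dy (k + m)%N; have := nm_tri (y (k + m).+1) (y (k + m)%N) (y m). move: IH; nra.
have yc : caus y. move=> d d0; have d1 : 0 < d * (1 - q) by nra.
 have qn : q ^+ n @[n --> \oo] --> (0 : R) by apply: cvg_expr; rewrite ger0_norm.
 move/cvgrPdist_lt : qn => /(_ _ d1)[N _ h]; exists N => m n Nm Nn. have qp k : 0 <= q ^+ k by exact: exprn_ge0.
 have := h m Nm; have := h n Nn; rewrite /= !sub0r !normrN !ger0_norm//. have [mn|/ltnW nm'] := leqP m n.
 rewrite nmBC; have := dy2 _ _ mn; have := qp n; nra. have := dy2 _ _ nm'; have := qp m; nra.
have [l ly] := caus_cvs yc.
have le : l = e + z ** l. apply: (@cvs_unique _ _ (fun n => y n.+1)).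
 by move=> d /ly[N h]; exists N => n Nn; apply: h; exact: leqW.
 by apply: cvsD; [exact: cvs_cst|apply: cvsM => //; exact: cvs_cst].
have ll : lat x l := lat_cvs yl ly.
pose c := T^-1%:C *: l.
have cl : lat x c by exact: latZ.
have xc : (x + t%:U) ** c = e. have Tn0 : T != 0 by rewrite gt_eqF. have -> : (x + t%:U) ** c = l - z ** l.
 have -> : (x + t%:U) = T%:C *: (e - z). rewrite /z scalerBr scalerA -rmorphM /= divff// scale1r /T.
 rewrite opprB; nc. rewrite amulZl amulZr scalerA -rmorphM /= divff// scale1r. by rewrite amulBl ex.
 by rewrite {1}le addrK.
have cx : c ** x = x ** c by apply/esym/(lat_bicU cl).
have sc : sa c. have cxt : c ** (x + t%:U) = e by rewrite amulDr cx xU -xc amulDl Ux.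
 have scx : star c ** (x + t%:U) = e. have : star ((x + t%:U) ** c) = e by rewrite xc sa_unit.
 by rewrite starM starD (saU t) sx. by rewrite /sa -[star c]xe -xc amulA scx.
have pxt : np (x + t%:U) by apply: npD => //; apply: npU; exact: ltW.
have cxt : c ** (x + t%:U) = (x + t%:U) ** c by rewrite amulDr amulDl cx Ux xU.
have ccx : c ** c ** (x + t%:U) = (x + t%:U) ** (c ** c). by rewrite -amulA cxt !amulA cxt.
have pc : np c. have -> : c = c ** c ** (x + t%:U) by rewrite -amulA cxt xc xe. by apply: np_comm => //; exact: sq_np.
exists c; split => //; apply: np_bnd => //; first by rewrite invr_ge0 ltW.
have -> : t^-1%:U - c = t^-1%:C *: (x ** c). rewrite -xc amulDl Ux scalerDr scalerA -rmorphM /= mulVf ?gt_eqF// scale1r.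
 by rewrite addrK.
by apply: npZ; [rewrite invr_ge0 ltW|exact: np_comm].
Qed.

(** Put [y = a + x] and [c = (a + t)^-1]. Then [y^2 = 2 a y], so the positive element
    [c y^2 / 2 = c a y] differs from [y] by [t c y]. Both [c a] and [c x] are contractions, whence
    an error of at most [2 t]. *)
Let abs_np x a : sa x -> np a -> a ** a = x ** x -> lat x a -> np (a + x).
move=> sx pa aa xa; apply: (closed_nmP _).1 np_closed _ _ => d d0.
pose t := d / 4; have t0 : 0 < t by rewrite /t; lra.
have [c [pc ac alc _]] := np_inv pa t0.
have ba : bic x a := lat_bicU xa.
have bc : bic x c by apply: bic_trans ba _; exact: lat_bicU.
have [sa' _] := pa; have [sc _] := pc.
pose y := a + x; have sy : sa y by exact: saD.
have yy : y ** y = 2%:C *: (a ** y). have -> : y ** y = x ** x + a ** a + 2%:C *: (a ** x) by rewrite /y; ncc e ex xe x.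
 by rewrite -aa /y; ncc e ex xe x.
exists ((2^-1)%:C *: (c ** (y ** y))). apply: npZ; first by []. apply: np_comm => //; first exact: sq_np.
 by rewrite /y; ncc e ex xe x.
have ca : c ** a = e - t%:C *: c. by rewrite -ac; ncc e ex xe x.
have ca1 : nm (c ** a) <= 1. apply: np_bnd => //. by apply: np_comm => //; ncc e ex xe x.
 by rewrite ca scale1r opprB addrC subrK; apply: npZ => //; exact: ltW.
have cx1 : nm (c ** x) <= 1. rewrite -(@expr_le1 _ 2) ?nm_ge0// -nm_sq; last by apply: sa_comm => //; ncc e ex xe x.
 have -> : c ** x ** (c ** x) = c ** a ** (c ** a). have -> : c ** a ** (c ** a) = c ** c ** (a ** a) by ncc e ex xe x.
 by rewrite aa; ncc e ex xe x. rewrite nm_sq; last by apply: sa_comm => //; ncc e ex xe x.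
 by rewrite expr_le1 ?nm_ge0.
have -> : y - (2^-1)%:C *: (c ** (y ** y)) = t%:C *: (c ** a) + t%:C *: (c ** x).
 rewrite yy; have -> : y - (2^-1)%:C *: (c ** (2%:C *: (a ** y))) = (e - c ** a) ** y. by ncu e ex xe.
 have -> : e - c ** a = t%:C *: c by rewrite ca opprB addrC subrK. by rewrite /y; nc.
bnd nmD; rewrite !nmZ0; rewrite /t in t0 *; nra.
Qed.

Lemma np_parts x : sa x -> exists P Q, [/\ np P, np Q, x = P - Q, P ** Q = 0 & lat x P /\ lat x Q].
move=> sx; have [a [pa aa xxa]] := np_sqrt (sq_np sx).
have xa : lat x a by apply: lat_trans xxa; apply: latM; exact: lat_refl.
have ba : bic x a := lat_bicU xa.
exists ((2^-1)%:C *: (a + x)), ((2^-1)%:C *: (a - x)); split.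
- by apply: npZ; [rewrite invr_ge0|exact: abs_np].
- apply: npZ; first by []. apply: abs_np => //; first exact: saN. by rewrite amulNl amulNr opprK.
 by apply: lat_trans xa; rewrite -[x in lat _ x]opprK; apply: latN; exact: lat_refl.
- by nc.
- have -> : (2^-1)%:C *: (a + x) ** ((2^-1)%:C *: (a - x)) = (2^-2)%:C *: (a ** a - x ** x) by ncc e ex xe x.
 by rewrite aa subrr scaler0.
- by split; apply: latZ; [apply: latD|apply: latB] => //; exact: lat_refl.
Qed.

(** Kaplansky's argument: let [Q] be the negative part of [star x ** x] and [y = x Q], so that
    [star y ** y = - Q^3]. Inserting the root [s] of [m = Q^3] makes [star a ** a] and [a ** star a]
    equal to [- m^2] and [- k^2]. Their sum is also a positive combination of squares, hence zero,
    and [Q^3 = 0] follows. *)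
Lemma np_star x : np (star x ** x).
have sh : sa (star x ** x) by rewrite /sa starM starK.
have [P [Q [pP pQ hPQ PQ [hP hQ]]]] := np_parts sh.
have bP := lat_bicU hP; have bQ := lat_bicU hQ.
have [sQ _] := pQ.
suff Q0 : Q = 0 by rewrite hPQ Q0 subr0.
pose m := Q ** (Q ** Q); pose y := x ** Q; pose k := y ** star y.
have pm : np m by apply: np_comm => //; [exact: sq_np|rewrite amulA].
have yy : star y ** y = - m. rewrite /y starM sQ -amulA (amulA (star x)) hPQ.
 have -> : Q ** ((P - Q) ** Q) = P ** Q ** Q - m by rewrite /m; ncc e ex xe (star x ** x). by rewrite PQ amul0r sub0r.
have [s [[ss _] sm ms]] := np_sqrt pm.
pose a := y ** s.
have a1 : star a ** a = - (m ** m). rewrite starM ss -amulA (amulA (star y)) yy -sm; nc.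
have a2 : a ** star a = - (k ** k). rewrite starM ss -amulA (amulA s) sm -[m]opprK -yy /k; nc.
have sk : sa k by rewrite /sa /k starM starK.
have n1 : np (- (m ** m + k ** k)). have -> : - (m ** m + k ** k) = (2^-1)%:C *: ((a + star a) ** (a + star a)) +
 (2^-1)%:C *: (- ((a - star a) ** (a - star a))). by rewrite opprD -a1 -a2; nc.
 apply: npD; apply: npZ; rewrite ?invr_ge0//. by apply: sq_np; rewrite /sa starD starK addrC.
 by apply: np_antisq; rewrite starB starK opprB.
have [sm' _] := pm.
have n2 : np (m ** m + k ** k) by apply: npD; exact: sq_np.
have /eqP := np_anti n2 n1; rewrite addrC addr_eq0 => /eqP km.
have mm : m ** m = 0. by apply: np_anti; [exact: sq_np|rewrite -km; exact: sq_np].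
have m0 := sq_eq0 sm' mm.
apply: sq_eq0 => //; apply: sq_eq0; first exact: sa_sq.
by rewrite -amulA -/m m0 amulr0.
Qed.

Lemma np_conj x y : np x -> np (star y ** x ** y).
move=> /np_sqrt[r [[sr _] <- _]].
by have -> : star y ** (r ** r) ** y = star (r ** y) ** (r ** y); [rewrite starM sr; nc|exact: np_star].
Qed.

(** Used as a spectral radius estimate: bounded powers along the exponents [2 ^ k], for which the
    norm of a self-adjoint element is multiplicative, force the norm to be at most one. *)
Lemma pow_bnd (a K : R) : (forall k, a ^+ (2 ^ k) <= K) -> a <= 1.
move=> aK; rewrite leNgt; apply/negP => a1; pose d := a - 1.
have d0 : 0 < d by rewrite /d; lra.
have h k : 1 + k.+1%:R * d <= a ^+ (2 ^ k). elim: k => [|k IH]; first by rewrite /d; lra.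
 rewrite expnS mulnC exprM; have k0 : 0 <= k%:R :> R by exact: ler0n.
 have := mulr_ge0 k0 (ltW d0); move: IH; rewrite -!natr1; set b := a ^+ _ => IH kd.
 have : (1 + (k%:R + 1) * d) ^+ 2 <= b ^+ 2 by apply: lerXn2r; rewrite ?nnegrE//; lra.
 have := sqr_ge0 ((k%:R + 1) * d); lra.
have K0 : 0 <= K by apply: le_trans (aK 0%N); rewrite expn0 expr1; lra.
have Kd0 : 0 <= K / d by rewrite divr_ge0// ltW.
have := archi_boundP Kd0; set n := Num.bound _; rewrite ltr_pdivrMr// => Kn.
have := h n; have := aK n; nra.
Qed.

(** Operator monotonicity of the square root. For [r = (q + t)^-1] the hypothesis makes [p r] a
    contraction. With [s] the root of [r], the powers of [x = s p s] are [s (p r)^j p s], hence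
    bounded, so [x] is a contraction. Conjugating [1 - x] by [w], the inverse of [s], gives
    [q + t - p]. *)
Lemma sqrt_mono p q : np p -> np q -> np (q ** q - p ** p) -> np (q - p).
move=> pp pq pqp; apply: (closed_nmP _).1 np_closed _ _ => d d0.
pose t := d / 2; have t0 : 0 < t by rewrite /t; lra.
have [r [pr qr qlr _]] := np_inv pq t0.
have [s [ps ss rs]] := np_sqrt pr.
have [[sp _] [sq _] [sr _] [s_s _]] := And4 pp pq pr ps.
have br : bic q r := lat_bicU qlr.
have bs : bic q s by apply: bic_trans br _; exact: lat_bicU.
have rq : r ** (q + t%:U) = e by rewrite -[RHS]qr; ncc e ex xe q.
have pr1 : nm (p ** r) <= 1. rewrite -(@expr_le1 _ 2) ?nm_ge0// -nmSS; apply: np_bnd => //; first exact: np_star.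
 have -> : 1%:U - star (p ** r) ** (p ** r) = star r ** ((q ** q - p ** p) + ((2 * t)%:C *: q + (t ^+ 2)%:U)) ** r.
 rewrite starM sr sp scale1r. have {1}-> : e = r ** (q + t%:U) ** ((q + t%:U) ** r) by rewrite rq qr xe.
 by ncu e ex xe. apply: np_conj; apply: npD => //; apply: npD. by apply: npZ => //; lra.
 by apply: npU; exact: sqr_ge0.
pose x := s ** p ** s.
have sx : sa x by rewrite /sa /x !starM s_s sp amulA.
have x1 : nm x <= 1. pose xs := fix xs k := if k is k'.+1 then xs k' ** xs k' else x.
 have xs_sa k : sa (xs k) by elim: k => [//|k IH]; exact: sa_sq. have nxs k : nm (xs k) = nm x ^+ (2 ^ k).
 elim: k => [|k IH]; first by []. by rewrite nm_sq// IH -exprM expnS mulnC.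
 have xsz k : exists2 z, nm z <= 1 & xs k = s ** z ** p ** s.
 elim: k => [|k [z z1 IH]] /=; first by exists e; [exact: nm_unit|rewrite xe].
 exists (z ** (p ** r) ** z); last by rewrite IH -ss; nc. have h1 : nm (z ** (p ** r)) <= 1.
 by bnd (nmMl _ z1); rewrite mul1r. by bnd (nmMl _ h1); rewrite mul1r.
 apply: (@pow_bnd _ (nm s * 1 * nm p * nm s)) => k; rewrite -nxs. have [z z1 ->] := xsz k.
 do 2 (bnd nmM; apply: ler_wpM2r; first exact: nm_ge0). exact: nmMr.
pose w := (q + t%:U) ** s.
have sw : sa w. by apply: sa_comm => //; [apply: saD => //; exact: saU|ncc e ex xe q].
have ws : w ** s = e by rewrite /w -amulA ss qr.
have sw1 : s ** w = e by rewrite /w -[RHS]qr -ss; ncc e ex xe q.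
have ww : w ** w = q + t%:U. have -> : w ** w = (q + t%:U) ** ((q + t%:U) ** (s ** s)) by rewrite /w; ncc e ex xe q.
 by rewrite ss qr.
exists (q + t%:U - p). have -> : q + t%:U - p = star w ** (1%:U - x) ** w. rewrite sw -ww scale1r /x.
 have {1}-> : p = w ** s ** p ** (s ** w) by rewrite ws sw1 ex xe. by ncu e ex xe. by apply: np_conj; apply: np_le_U.
have -> : q - p - (q + t%:U - p) = - t%:U by nc.
rewrite nmN; bnd (nmU (ltW t0)); rewrite /t; lra.
Qed.

(** Monotonicity is used twice: [p^2 <= q^2], and [q^2 <= p^2 + d^2 <= (p + d)^2]. *)
Lemma sqrt_close (d : R) p q : 0 <= d -> np p -> np q -> np (q ** q - p ** p) ->
 np ((d ^+ 2)%:U + p ** p - q ** q) -> nm (q - p) <= d.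
move=> d0 pp pq pqp dpq; apply: np_bnd => //; first exact: sqrt_mono.
have -> : d%:U - (q - p) = (p + d%:U) - q by nc.
apply: sqrt_mono => //; first by apply: npD => //; exact: npU.
have -> : (p + d%:U) ** (p + d%:U) - q ** q = ((d ^+ 2)%:U + p ** p - q ** q) + (2 * d)%:C *: p by ncu e ex xe.
by apply: npD => //; apply: npZ => //; lra.
Qed.

End Unital.

(** * Hilbert modules and their adjointable operators *)

Record hmod R (A : cstar R) := HMod { hm_car :> completeNormedModType R[i]; ip : hm_car -> hm_car -> A;
 ipDr : forall x y z, ip x (y + z) = ip x y + ip x z; ipZr : forall (c : R[i]) x y, ip x (c *: y) = c *: ip x y;
 ipS : forall x y, star (ip x y) = ip y x; ip_nm : forall x, nm (ip x x) = nm x ^+ 2;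
 ip_CS : forall x y, nm (ip x y) <= nm x * nm y
}.
Arguments ip {R A h}.

Section HmodTheory.
Context {R} {A : cstar R} {E : hmod A}.
Implicit Types x y z : E.

Lemma ipDl x y z : ip (x + y) z = ip x z + ip y z.
by rewrite -ipS ipDr starD !ipS. Qed.
Lemma ipZl (c : R[i]) x y : ip (c *: x) y = conjc c *: ip x y.
by rewrite -ipS ipZr starZc ipS. Qed.
Lemma ip0r x : ip x 0 = 0.
by rewrite -(scale0r 0) ipZr scale0r. Qed.
Lemma ip0l x : ip 0 x = 0.
by rewrite -ipS ip0r star0. Qed.
Lemma ipNr x y : ip x (- y) = - ip x y.
by rewrite -scaleN1r ipZr scaleN1r. Qed.
Lemma ipNl x y : ip (- x) y = - ip x y.
by rewrite -ipS ipNr starN ipS. Qed.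
Lemma ipBr x y z : ip x (y - z) = ip x y - ip x z.
by rewrite ipDr ipNr. Qed.
Lemma ipBl x y z : ip (x - y) z = ip x z - ip y z.
by rewrite ipDl ipNl. Qed.
Lemma ip_inj x y : (forall z, ip x z = ip y z) -> x = y.
move=> xy; apply/subr0_eq/nm_eq0/eqP.
by rewrite -sqrf_eq0 -ip_nm ipBl xy subrr nm0.
Qed.

Lemma cvs_ip (u v : nat -> E) x y : cvs u x -> cvs v y -> cvs (fun n => ip (u n) (v n)) (ip x y).
move=> ux vy d d0.
have [N1 h1] := ux 1 ltr01.
pose M := nm x + nm y + 1.
have M0 : 0 < M by have := nm_ge0 x; have := nm_ge0 y; rewrite /M; lra.
have dM : 0 < d / (2 * M) by rewrite divr_gt0//; lra.
have [N2 h2] := ux _ dM; have [N3 h3] := vy _ dM.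
exists (maxn N1 (maxn N2 N3)) => n; rewrite !geq_max => /and3P[n1 n2 n3].
have -> : ip (u n) (v n) - ip x y = ip (u n - x) y + ip (u n) (v n - y). by rewrite ipBl ipBr; nc.
bnd nmD.
have un : nm (u n) <= M by have := nm_ler (u n) x; have := h1 n n1; have := nm_ge0 y; rewrite /M; lra.
have := ip_CS (u n - x) y; have := ip_CS (u n) (v n - y).
have yM : nm y <= M by have := nm_ge0 x; rewrite /M; lra.
have := ler_wpM2r (nm_ge0 (v n - y)) un; have := ler_wpM2l (nm_ge0 (u n - x)) yM.
move: (h2 n n2) (h3 n n3); rewrite !ltr_pdivlMr; [|lra..].
set a := nm (ip _ _); set b := nm (ip _ _); set a' := nm (u n - x); set b' := nm (v n - y).
clearbody M; lra.
Qed.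

End HmodTheory.

Section Adjointable.
Context {R} {A : cstar R} (E : hmod A).
Implicit Types (x y z : E) (S T : E -> E).

Definition bounded_op T := exists M : R, forall x, nm (T x) <= M * nm x.
Definition adj_set : set (E -> E) := [set T | bounded_op T /\ exists T' : E -> E, forall x y, ip (T x) y = ip x (T' y)].

Lemma bounded_opP T : bounded_op T -> exists2 M : R, 0 <= M & forall x, nm (T x) <= M * nm x.
move=> [M TM]; exists `|M| => // x; bnd (TM x).
by apply: ler_wpM2r; [exact: nm_ge0|exact: ler_norm].
Qed.

Lemma adj_set0 : adj_set (fun=> 0).
split; first by exists 0 => x; rewrite nm0 mul0r.
by exists (fun=> 0) => x y; rewrite ip0l ip0r.
Qed.

Lemma adj_set_lin (c : R[i]) T S : adj_set T -> adj_set S -> adj_set (c *: T + S).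
move=> [[M TM] [T' TT']] [[N SN] [S' SS']]; split. exists (Re `|c| * M + N) => x; rewrite -[(_ + _) x]/(c *: T x + S x).
 bnd nmD; rewrite nmCZ mulrDl -mulrA; apply: lerD => //. by apply: ler_wpM2l => //; exact: (@nm_ge0 _ (R[i]^o) c).
exists (fun y => conjc c *: T' y + S' y) => x y.
by rewrite ipDl ipZl TT' SS' ipDr ipZr.
Qed.

Definition adj_pred : {pred E -> E} := fun T => `[< adj_set T >].
Lemma adj_predP T : reflect (adj_set T) (T \in adj_pred).
exact: asboolP. Qed.
Let adj_submod : GRing.submod_closed adj_pred.
split; first by apply/adj_predP; exact: adj_set0.
move=> c T S /adj_predP hT /adj_predP hS; apply/adj_predP; exact: adj_set_lin.
Qed.
HB.instance Definition _ := GRing.isSubmodClosed.Build R[i] (E -> E) adj_pred adj_submod.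

(** This algebra always contains the unit [aid]. A nonunital [A] embeds in it by left multiplication
    ([lmul]), which is how the lemmas on unital algebras reach [A]. *)
Definition adjop := {T : E -> E | T \in adj_pred}.
HB.instance Definition _ := SubChoice.on adjop.
HB.instance Definition _ := [SubChoice_isSubLmodule of adjop by <:].

Definition aop (T : adjop) : E -> E := val T.
Definition mkop (T : E -> E) (h : adj_set T) : adjop := exist _ T (introT (adj_predP T) h).

Lemma adjopP (T : adjop) : adj_set (aop T).
exact/adj_predP/valP. Qed.
Lemma adjop_eq (S T : adjop) : (forall x, aop S x = aop T x) -> S = T.
by move=> ST; apply: val_inj; apply/funext. Qed.

Definition adj_fun (T : adjop) : E -> E := sval (cid (adjopP T).2).
Lemma adj_funE (T : adjop) x y : ip (aop T x) y = ip x (adj_fun T y).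
exact: (svalP (cid (adjopP T).2)). Qed.

Lemma adj_fun_set (T : adjop) : adj_set (adj_fun T).
have [Tb _] := adjopP T; have [M M0 TM] := bounded_opP Tb; split.
 exists M => y; have [->|] := eqVneq (nm (adj_fun T y)) 0. by rewrite mulr_ge0 ?nm_ge0.
 move=> n0; have np : 0 < nm (adj_fun T y) by rewrite lt_neqAle eq_sym n0 nm_ge0.
 rewrite -(ler_pM2r np) -expr2 -ip_nm -adj_funE. apply: le_trans (ip_CS _ _) _.
 have := ler_wpM2r (nm_ge0 y) (TM (adj_fun T y)); lra.
by exists (aop T) => x y; rewrite -ipS -adj_funE ipS.
Qed.
Lemma aopDx (S T : adjop) x : aop (S + T) x = aop S x + aop T x. by []. Qed.
Lemma aopZx (c : R[i]) (T : adjop) x : aop (c *: T) x = c *: aop T x. by []. Qed.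
Lemma aopNx (T : adjop) x : aop (- T) x = - aop T x. by []. Qed.
Lemma aop0x x : aop 0 x = 0. by []. Qed.
(** Linearity comes from the adjoint, [ip] being nondegenerate; the same argument gives
    compatibility with the action of [A] where there is one. *)
Lemma aopD (T : adjop) x y : aop T (x + y) = aop T x + aop T y.
by apply: ip_inj => z; rewrite adj_funE !ipDl !adj_funE. Qed.
Lemma aopZ (T : adjop) (c : R[i]) x : aop T (c *: x) = c *: aop T x.
by apply: ip_inj => z; rewrite adj_funE !ipZl !adj_funE. Qed.
Lemma aopB (T : adjop) x y : aop T (x - y) = aop T x - aop T y.
by rewrite aopD -scaleN1r aopZ scaleN1r. Qed.
Lemma aop0 (T : adjop) : aop T 0 = 0.
by rewrite -(scale0r 0) aopZ !scale0r. Qed.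
Lemma aop_sum (T : adjop) (I : Type) (r : seq I) (P : pred I) (F : I -> E) :
 aop T (\sum_(i <- r | P i) F i) = \sum_(i <- r | P i) aop T (F i).
by elim/big_rec2: _ => [|i u v _ <-]; rewrite ?aop0// aopD. Qed.

Lemma comp_set (S T : adjop) : adj_set (aop S \o aop T).
have [M M0 SM] := bounded_opP (adjopP S).1; have [N N0 TN] := bounded_opP (adjopP T).1.
split. exists (M * N) => x /=; bnd SM; rewrite -mulrA; exact: ler_wpM2l.
by exists (adj_fun T \o adj_fun S) => x y /=; rewrite !adj_funE.
Qed.

Definition op_mul (S T : adjop) : adjop := mkop (comp_set S T).
Definition op_star (T : adjop) : adjop := mkop (adj_fun_set T).

Lemma op_starE (T : adjop) x y : ip (aop T x) y = ip x (aop (op_star T) y).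
exact: adj_funE. Qed.
Lemma op_starE' (T : adjop) x y : ip x (aop T y) = ip (aop (op_star T) x) y.
by rewrite -ipS op_starE ipS. Qed.

Program Definition adjop_starAlgMixin := @Lmodule_isStarAlg.Build R adjop op_mul op_star _ _ _ _ _ _ _ _ _.
Next Obligation. by move=> S T U; apply: adjop_eq. Qed.
Next Obligation. by move=> S T U; apply: adjop_eq. Qed.
Next Obligation. by move=> S T U; apply: adjop_eq => x; exact: aopD. Qed.
Next Obligation. by move=> c S T; apply: adjop_eq. Qed.
Next Obligation. by move=> c S T; apply: adjop_eq => x; rewrite -[LHS]/(aop S (c *: aop T x)) aopZ. Qed.
Next Obligation.
by move=> T; apply: adjop_eq => x; apply: ip_inj => z; rewrite -op_starE' -op_starE.
Qed.
Next Obligation.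
move=> S T; apply: adjop_eq => x; apply: ip_inj => z.
by rewrite -op_starE' !aopDx ipDl ipDr -!op_starE'.
Qed.
Next Obligation.
move=> c S; apply: adjop_eq => x; apply: ip_inj => z.
by rewrite -op_starE' !aopZx ipZl ipZr conjCE conjcK -!op_starE'.
Qed.
Next Obligation.
move=> S T; apply: adjop_eq => x; apply: ip_inj => z.
by rewrite -op_starE' -[LHS]/(ip x (aop S (aop T z))) !op_starE'.
Qed.
HB.instance Definition _ := adjop_starAlgMixin.

Lemma aopM (S T : adjop) x : aop (S ** T) x = aop S (aop T x). by []. Qed.
Lemma ip_adj (T : adjop) x y : ip (aop T x) y = ip x (aop (star T) y).
exact: op_starE. Qed.
Lemma ip_adj' (T : adjop) x y : ip x (aop T y) = ip (aop (star T) x) y.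
exact: op_starE'. Qed.

Definition onm (T : adjop) : R := sup [set nm (aop T x) | x in [set x | nm x <= 1]].

Let onm_has_sup (T : adjop) : has_sup [set nm (aop T x) | x in [set x | nm x <= 1]].
split; first by exists (nm (aop T 0)), 0 => //=; rewrite nm0.
have [M M0 TM] := bounded_opP (adjopP T).1; exists M => _ [x /= x1 <-].
by bnd (TM x); rewrite ler_piMr.
Qed.

Lemma onm_ge0 (T : adjop) : 0 <= onm T.
bnd (nm_ge0 (aop T 0)); apply: ub_le_sup; first by case: (onm_has_sup T).
by exists 0 => //=; rewrite nm0.
Qed.

Lemma nm_aop (T : adjop) x : nm (aop T x) <= onm T * nm x.
have [x0|x0] := eqVneq (nm x) 0. by rewrite (nm_eq0 x0) aop0 nm0 mulr0.
have xp : 0 < nm x by rewrite lt_neqAle eq_sym x0 nm_ge0.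
rewrite -ler_pdivrMr// -nmZV// -aopZ; apply: ub_le_sup; first by case: (onm_has_sup T).
by exists ((nm x)^-1%:C *: x) => //=; rewrite nmZV// divff.
Qed.

Lemma onm_le (T : adjop) M : 0 <= M -> (forall x, nm (aop T x) <= M * nm x) -> onm T <= M.
move=> M0 TM; apply: ge_sup; first by case: (onm_has_sup T).
by move=> _ [x /= x1 <-]; bnd (TM x); rewrite ler_piMr.
Qed.

Definition op_norm (T : adjop) : R[i] := (onm T)%:C.

Let op_normD (S T : adjop) : op_norm (S + T) <= op_norm S + op_norm T.
rewrite /op_norm -rmorphD lecR; apply: onm_le; first by rewrite addr_ge0 ?onm_ge0.
move=> x; rewrite aopDx mulrDl; bnd nmD.
by apply: lerD; exact: nm_aop.
Qed.

Let op_normZ (c : R[i]) (T : adjop) : op_norm (c *: T) = `|c| * op_norm T.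
have cE : `|c| = (Re `|c|)%:C by exact: (@normE _ (R[i]^o) c).
have c0 : 0 <= Re `|c| by exact: (@nm_ge0 _ (R[i]^o) c).
rewrite cE /op_norm -rmorphM; congr (_%:C); apply/le_anti/andP; split.
 apply: onm_le => [|x]; first by rewrite mulr_ge0 ?onm_ge0.
 by rewrite nmCZ -mulrA; apply: ler_wpM2l => //; exact: nm_aop.
have [c00|cn0] := eqVneq (Re `|c|) 0; first by rewrite c00 mul0r onm_ge0.
have cp : 0 < Re `|c| by rewrite lt_neqAle eq_sym cn0.
rewrite mulrC -ler_pdivlMr//; apply: onm_le => [|x]. by rewrite divr_ge0 ?onm_ge0.
rewrite mulrAC ler_pdivlMr// mulrC -nmCZ -aopZx; exact: nm_aop.
Qed.

Let op_norm_eq0 (T : adjop) : op_norm T = 0 -> T = 0.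
move=> [T0]; apply: adjop_eq => x; apply: nm_le0; bnd (nm_aop T x).
by rewrite T0 mul0r.
Qed.

HB.instance Definition _ := Lmodule_isNormed.Build R[i] adjop op_normD op_normZ op_norm_eq0.

Lemma nm_op (T : adjop) : nm T = onm T. by []. Qed.

Lemma onm_star_le (T : adjop) : onm (star T) <= onm T.
apply: onm_le => [|x]; first exact: onm_ge0.
have [->|n0] := eqVneq (nm (aop (star T) x)) 0; first by rewrite mulr_ge0 ?onm_ge0 ?nm_ge0.
have np : 0 < nm (aop (star T) x) by rewrite lt_neqAle eq_sym n0 nm_ge0.
rewrite -(ler_pM2r np) -expr2 -ip_nm -ip_adj.
apply: le_trans (ip_CS _ _) _; have := ler_wpM2r (nm_ge0 x) (nm_aop T (aop (star T) x)).
lra.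
Qed.

Let op_normM (S T : adjop) : `|S ** T| <= `|S| * `|T|.
rewrite !normE -rmorphM lecR !nm_op; apply: onm_le => [|x]. by rewrite mulr_ge0 ?onm_ge0.
rewrite aopM; bnd (nm_aop S _); rewrite -mulrA; apply: ler_wpM2l. exact: onm_ge0.
exact: nm_aop.
Qed.

Let op_normS (T : adjop) : `|star T ** T| = `|T| ^+ 2.
apply/le_anti/andP; split. bnd op_normM; rewrite expr2; apply: ler_wpM2r => //. by rewrite lecR; exact: onm_star_le.
rewrite !normE -rmorphXn lecR !nm_op.
rewrite -[leRHS]sqr_sqrtr ?onm_ge0// lerXn2r ?nnegrE ?onm_ge0 ?sqrtr_ge0//.
apply: onm_le => [|x]; first exact: sqrtr_ge0.
rewrite -(@ler_pXn2r _ 2) ?nnegrE ?mulr_ge0 ?nm_ge0//.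
rewrite exprMn sqr_sqrtr ?onm_ge0// -ip_nm ip_adj -aopM.
apply: le_trans (ip_CS _ _) _.
by have := ler_wpM2l (nm_ge0 x) (nm_aop (star T ** T) x); lra.
Qed.

HB.instance Definition _ := StarAlg_isPreCStar.Build R adjop op_normM op_normS.

(** A Cauchy sequence converges pointwise along with its adjoints, so the pointwise limit is
    adjointable; the Cauchy estimate makes the convergence uniform on the unit ball. *)
Let adjop_cvs (u : nat -> adjop) : caus u -> exists l, cvs u l.
move=> uc.
have lim (v : nat -> adjop) : caus v -> exists T : E -> E, (forall x, cvs (fun n => aop (v n) x) (T x)).
 move=> vc; suff h x : {l | cvs (fun n => aop (v n) x) l}. by exists (fun x => sval (h x)) => x; exact: (svalP (h x)).
 apply: cid; apply: caus_cvs => d d0. have x1 : 0 < nm x + 1 by have := nm_ge0 x; lra.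
 have [N h] := vc (d / (nm x + 1)) (divr_gt0 d0 x1); exists N => m n Nm Nn.
 have := h m n Nm Nn; rewrite ltr_pdivlMr// => {}h. have := nm_aop (v m - v n) x; rewrite aopDx aopNx -nm_op.
 by have := nm_ge0 (v m - v n); lra.
have [T uT] := lim u uc.
have [T' uT'] : exists T : E -> E, (forall x, cvs (fun n => aop (star (u n)) x) (T x)).
 apply: (lim (fun n => star (u n))) => d /uc[N h]; exists N => m n Nm Nn. by rewrite -starB nmS; exact: h.
have TE x y : ip (T x) y = ip x (T' y). apply: (@cvs_unique _ _ (fun n => ip (aop (u n) x) y)).
 by apply: cvs_ip => //; exact: cvs_cst. apply: (cvs_ext (u := fun n => ip x (aop (star (u n)) y))).
 by move=> n; rewrite ip_adj. by apply: cvs_ip => //; exact: cvs_cst.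
have close (d : R) : 0 < d -> \ev n, forall x, nm (aop (u n) x - T x) <= d * nm x.
 move=> d0; have [N h] := uc d d0; exists N => n Nn x.
 rewrite nmBC; apply: (@cvs_bnd _ _ (fun k => aop (u (k + N)%N) x - aop (u n) x)). apply: cvsD; last exact: cvs_cst.
 by move=> c /(uT x)[M k]; exists M => j Mj; apply: k; exact: leq_trans Mj (leq_addr _ _).
 move=> k; have := nm_aop (u (k + N)%N - u n) x; rewrite aopDx aopNx -nm_op.
 move=> /le_trans; apply; apply: ler_wpM2r; first exact: nm_ge0. by apply/ltW/h => //; exact: leq_addl.
have hT : adj_set T. split; last by exists T'. have [N k] := close 1 ltr01; exists (1 + onm (u N)) => x.
 have := k N (leqnn N) x; have := nm_aop (u N) x; have := nm_ler (T x) (aop (u N) x). by rewrite nmBC; lra.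
exists (mkop hT) => d d0; have d2 : 0 < d / 2 by lra.
have [N k] := close _ d2; exists N => n Nn; rewrite nm_op.
via (d / 2); last lra.
by apply: onm_le => [|x]; [exact: ltW|exact: k].
Qed.

HB.instance Definition _ := Uniform_isComplete.Build adjop (mk_complete adjop_cvs).

Lemma id_set : adj_set id.
by split; [exists 1 => x; rewrite mul1r|exists id]. Qed.
Definition aid : adjop := mkop id_set.
Lemma aidE x : aop aid x = x. by []. Qed.
Lemma aid_l (T : adjop) : aid ** T = T. by apply: adjop_eq. Qed.
Lemma aid_r (T : adjop) : T ** aid = T. by apply: adjop_eq. Qed.

End Adjointable.
Arguments aid {R A E}.
Arguments aid_l {R A E}.
Arguments aid_r {R A E}.

Section LinearMaps.
Context {R} {V W : lmodType R[i]} (f : V -> W).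
Hypothesis fl : linear f.

Lemma linD x y : f (x + y) = f x + f y.
by rewrite -{1}[x]scale1r fl scale1r. Qed.
Lemma lin0 : f 0 = 0.
by apply: (@addrI _ (f 0)); rewrite -linD !addr0. Qed.
Lemma linZ c x : f (c *: x) = c *: f x.
by rewrite -[c *: x]addr0 fl lin0 addr0. Qed.
Lemma linN x : f (- x) = - f x.
by rewrite -scaleN1r linZ scaleN1r. Qed.
Lemma linB x y : f (x - y) = f x - f y.
by rewrite linD linN. Qed.
Lemma lin_sum (I : Type) (r : seq I) (P : pred I) (F : I -> V) :
 f (\sum_(i <- r | P i) F i) = \sum_(i <- r | P i) f (F i).
by elim/big_rec2: _ => [|i u v _ <-]; rewrite ?lin0// linD. Qed.
End LinearMaps.

Section SumAmul.
Context {R} {V : starAlgType R}.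
Variables (I : Type) (r : seq I) (P : pred I).
Lemma amulsl (F : I -> V) y : (\sum_(i <- r | P i) F i) ** y = \sum_(i <- r | P i) F i ** y.
by elim/big_rec2: _ => [|i u v _ <-]; rewrite ?amul0r// amulDl. Qed.
Lemma amulsr (F : I -> V) y : y ** (\sum_(i <- r | P i) F i) = \sum_(i <- r | P i) y ** F i.
by elim/big_rec2: _ => [|i u v _ <-]; rewrite ?amulr0// amulDr. Qed.
Lemma star_sum (F : I -> V) : star (\sum_(i <- r | P i) F i) = \sum_(i <- r | P i) star (F i).
by elim/big_rec2: _ => [|i u v _ <-]; rewrite ?star0// starD. Qed.
End SumAmul.

(** * Homomorphisms, and positivity in subalgebras *)

Section Homs.
Context {R}.

Definition isohom (P U : cstar R) (f : P -> U) : Prop := star_hom f /\ forall x, nm (f x) = nm x.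

Lemma isohom_id (P : cstar R) : isohom (@id P).
by []. Qed.

Lemma isohom_inj (P U : cstar R) (f : P -> U) : isohom f -> injective f.
move=> [[fl _ _] fn] x y fxy; apply/subr0_eq/nm_eq0.
by rewrite -fn (linB fl) fxy subrr nm0.
Qed.

Lemma isohom_comp (P U W : cstar R) (f : P -> U) (g : U -> W) : isohom f -> isohom g -> isohom (g \o f).
move=> [[fl fM fS] fn] [[gl gM gS] gn]; split; last by move=> x /=; rewrite gn.
split; first by move=> c x y /=; rewrite fl gl. by move=> x y /=; rewrite fM.
by move=> x /=; rewrite fS.
Qed.

Lemma range_closed (P U : cstar R) (f : P -> U) : isohom f -> closed (range f).
move=> [[fl _ _] fn]; apply/closed_nmP => x h.
pose d n : R := n.+1%:R^-1.
have d0 n : 0 < d n by rewrite invr_gt0.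
have ex n : {a | nm (x - f a) < d n}. by apply: cid; have [_ [a _ <-] xa] := h _ (d0 n); exists a.
pose u n := sval (ex n); have hu n : nm (x - f (u n)) < d n by exact: (svalP (ex n)).
have fu : cvs (fun n => f (u n)) x. move=> t t0; have [N dN] := inv_nat_lt t0; exists N => n /dN dn.
 by rewrite nmBC; exact: lt_trans (hu n) dn.
have uc : caus u. move=> t t0; have t2 : 0 < t / 2 by lra.
 have [N k] := fu _ t2; exists N => m n /k km /k kn; rewrite -fn (linB fl).
 by have := nm_tri (f (u m)) x (f (u n)); rewrite (nmBC x); lra.
have [l ul] := caus_cvs uc; exists l => //; apply: cvs_unique fu.
by apply: cvs_dom ul => n; rewrite -(linB fl) fn -[leLHS]mul1r.
Qed.

(** For a contraction [a] write [star a ** a = 2 y - y^2] inside [P]. Applying [f], the element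
    [e - star (f a) ** f a] becomes the square of [e - f y], hence positive. *)
Lemma hom_contr (P U : cstar R) (e : U) (f : P -> U) : (forall x, e ** x = x) -> (forall x, x ** e = x) -> star_hom f ->
 forall a, nm (f a) <= nm a.
move=> ex xe [fl fM fS].
suff h a : nm a <= 1 -> nm (f a) <= 1. move=> a; have [a0|a0] := eqVneq (nm a) 0. by rewrite (nm_eq0 a0) (lin0 fl) !nm0.
 have ap : 0 < nm a by rewrite lt_neqAle eq_sym a0 nm_ge0.
 have := h ((nm a)^-1%:C *: a); rewrite (linZ fl) !nmZV// divff// => /(_ (lexx _)). by rewrite ler_pdivrMr// mul1r.
move=> a1; have sx : sa (star a ** a) by rewrite /sa starM starK.
have x1 : nm (star a ** a) <= 1 by rewrite nmSS expr_le1 ?nm_ge0.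
have [y [sy yx _ _]] := sqrt_iter sx x1.
have sfy : sa (f y) by rewrite /sa -fS sy.
have fE : star (f a) ** f a = 2%:C *: f y - f y ** f y. by rewrite -fS -fM -yx (linB fl) (linZ fl) fM.
rewrite -(@expr_le1 _ 2) ?nm_ge0// -nmSS; apply: (np_bnd ex xe) => //. exact: np_star.
rewrite fE scale1r; have -> : e - (2%:C *: f y - f y ** f y) = (e - f y) ** (e - f y). by ncu e ex xe.
by apply: sq_np => //; apply: saB => //; exact: sa_unit.
Qed.

Section Sqrt.
Context {U : cstar R} (e : U).
Hypotheses (ex : forall x, e ** x = x) (xe : forall x, x ** e = x).

Lemma inv_est (a c : U) t : np e a -> 0 < t -> np e c -> (a + t%:C *: e) ** c = e -> lat a c -> nm (a ** c) <= 1.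
move=> pa t0 pc ac lc; have bc := lat_bicU ex xe lc.
have E : a ** c = e - t%:C *: c. rewrite -[X in X - _]ac; ncu e ex xe.
apply: (np_bnd ex xe) => //. by apply: np_comm => //; ncc e ex xe a.
rewrite E scale1r opprB addrC subrK; apply: npZ => //; exact: ltW.
Qed.

(** With [c = (a + t)^-1], the element [r c a] lies in [S] because [r c] preserves [S]. It differs
    from [r] by [t r c], whose squared norm is at most [t]. *)
Lemma sqrt_in (S : set U) (a r : U) : closed S ->
 (forall u v, S u -> S v -> S (u + v)) -> (forall (c : R[i]) u, S u -> S (c *: u)) ->
 (forall u, S u -> S (a ** u)) -> S a -> np e r -> r ** r = a -> lat a r -> S r.
move=> cS SD SZ Sm Sa pr rr ar.
have pa : np e a by rewrite -rr; apply: sq_np => //; case: pr.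
have [sr _] := pr; have br := lat_bicU ex xe ar.
apply: (closed_nmP _).1 (cS) _ _ => d d0.
pose t := d ^+ 2 / 4; have t0 : 0 < t by rewrite /t; nra.
have [c [pc ac lc c1]] := np_inv ex xe pa t0.
have [sc _] := pc; have bc := lat_bicU ex xe lc.
exists (r ** c ** a). exact ((latM ar lc) S cS SD SZ Sm a Sa).
have E : r - r ** c ** a = t%:C *: (r ** c). by rewrite -{1}[r]xe -[X in r ** X - _]ac; ncc e ex xe a.
rewrite E nmZ0 ?ltW//; have : (nm (t%:C *: (r ** c))) ^+ 2 <= t.
 have st : sa (t%:C *: (r ** c)) by apply: saZ; apply: sa_comm => //; ncc e ex xe a. rewrite -nm_sq//.
 have -> : t%:C *: (r ** c) ** (t%:C *: (r ** c)) = (t * t)%:C *: (c ** ((r ** r) ** c)). ncc e ex xe a.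
 rewrite rr nmZ0; last by rewrite mulr_ge0// ltW. have h1 := inv_est pa t0 pc ac lc.
 have h2 : nm (c ** (a ** c)) <= t^-1. bnd (nmMr _ h1); by rewrite mulr1.
 rewrite [leRHS](_ : t = t * t * t^-1); last by field; rewrite gt_eqF.
 by apply: ler_wpM2l => //; rewrite mulr_ge0// ltW.
rewrite (nmZ0 _ (ltW t0)) => h.
have k0 : 0 <= t * nm (r ** c) by rewrite mulr_ge0 ?nm_ge0// ltW.
move: h; rewrite {2}/t; nra.
Qed.

(** The square root taken in [U] stays in the closed range by [sqrt_in]. Hence positivity in a
    subalgebra is the norm condition in any unital algebra that contains it. *)
Lemma positive_hom (P : cstar R) (f : P -> U) : isohom f -> forall x, positive x <-> np e (f x).
move=> fi x; have [[fl fM fS] fn] := fi; split=> [[y ->]|px]. by rewrite fM fS; exact: np_star.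
have [r [pr rr lr]] := np_sqrt ex xe px.
have [b _ fb] : range f r. apply: (sqrt_in (range_closed fi) _ _ _ _ pr rr lr).
 - by move=> _ _ [u _ <-] [v _ <-]; exists (u + v) => //; rewrite (linD fl).
 - by move=> c _ [u _ <-]; exists (c *: u) => //; rewrite (linZ fl).
 - by move=> _ [u _ <-]; exists (x ** u) => //.
 - by [].
exists b; apply: (isohom_inj fi); rewrite fM fS fb; case: pr => sr _.
by rewrite sr.
Qed.

End Sqrt.
End Homs.

Section SelfModule.
Context {R} (A : cstar R).

Program Definition hself : hmod A := @HMod R A A (fun x y => star x ** y) _ _ _ _ _.
Next Obligation. by move=> x y z; rewrite /= amulDr. Qed.
Next Obligation. by move=> c x y; rewrite /= amulZr. Qed.
Next Obligation. by move=> x y; rewrite starM starK. Qed.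
Next Obligation. by move=> x; exact: nmSS. Qed.
Next Obligation. by move=> x y; bnd nmM; rewrite nmS. Qed.

Lemma lmul_set (a : A) : adj_set (E := hself) (fun x => a ** x).
split; first by exists (nm a) => x; exact: nmM.
by exists (fun x => star a ** x) => x y; rewrite /= starM amulA.
Qed.
Definition lmul (a : A) : adjop hself := mkop (lmul_set a).

Lemma lmulE a x : aop (lmul a) x = a ** x. by []. Qed.

Lemma lmul_iso : isohom lmul.
split; last first. move=> a; apply/le_anti/andP; split. rewrite nm_op; apply: onm_le => [|x]; first exact: nm_ge0.
 exact: nmM. have [->|n0] := eqVneq (nm a) 0; first exact: nm_ge0.
 have np : 0 < nm a by rewrite lt_neqAle eq_sym n0 nm_ge0.
 rewrite -(ler_pM2r np) -expr2 -nmSSr -[X in _ <= _ * X](nmS a). exact: (nm_aop (lmul a) (star a)).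
split.
- by move=> c a b; apply: adjop_eq => x; rewrite !lmulE amulDl amulZl.
- by move=> a b; apply: adjop_eq => x; rewrite aopM !lmulE amulA.
- move=> a; apply: adjop_eq => x; apply: (ip_inj (E := hself)) => z. by rewrite -ip_adj' /= starM starK amulA.
Qed.

(** [A] is a left ideal of its adjointable operators: multiplying an element of [A] by an operator,
    such as a resolvent, leads back to [A]. *)
Lemma op_lmul (T : adjop hself) a : T ** lmul a = lmul (aop T a).
apply: adjop_eq => x; rewrite aopM !lmulE; apply: (ip_inj (E := hself)) => z.
by rewrite ip_adj /= starM -amulA -[star a ** _](ip_adj T a z) starM -!amulA.
Qed.
Lemma pos_lmul (x : A) : positive x <-> np aid (lmul x).
exact: (positive_hom aid_l aid_r lmul_iso). Qed.
End SelfModule.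

(** * Positive elements and approximate units *)

Section Positive.
Context {R} {A : cstar R}.
Implicit Types (x y z : A) (t : R).

Lemma pos_sa x : positive x -> sa x.
by move=> [y ->]; rewrite /sa starM starK. Qed.
Lemma pos_star x : positive (star x ** x). by exists x. Qed.
Lemma pos_starr x : positive (x ** star x). by exists (star x); rewrite starK. Qed.
Lemma posD x y : positive x -> positive y -> positive (x + y).
have [[l _ _] _] := lmul_iso A.
move=> /pos_lmul px /pos_lmul py; apply/pos_lmul; rewrite (linD l); exact: npD.
Qed.
Lemma posZ t x : 0 <= t -> positive x -> positive (t%:C *: x).
have [[l _ _] _] := lmul_iso A.
move=> t0 /pos_lmul px; apply/pos_lmul; rewrite (linZ l); exact: npZ.
Qed.
Lemma pos0 : positive (0 : A). by exists 0; rewrite amulr0. Qed.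
Lemma pos_sum (I : Type) (r : seq I) (P : pred I) (F : I -> A) :
 (forall i, P i -> positive (F i)) -> positive (\sum_(i <- r | P i) F i).
by move=> PF; elim/big_rec: _ => [|i x Pi]; [exact: pos0|apply: posD; exact: PF]. Qed.
Lemma pos_conj x y : positive x -> positive (star y ** x ** y).
by move=> [z ->]; exists (z ** y); rewrite starM !amulA. Qed.
Lemma pos_mono x y : positive x -> positive (y - x) -> nm x <= nm y.
have [[l _ _] n] := lmul_iso A.
move=> /pos_lmul px /pos_lmul; rewrite (linB l) => pyx; rewrite -!n.
exact: (np_mono aid_l aid_r px pyx).
Qed.
Lemma pos_closed : closed [set x : A | positive x].
have [[l _ _] n] := lmul_iso A.
apply/closed_nmP => x h; apply/pos_lmul.
apply: (closed_nmP _).1 (np_closed aid_l aid_r) _ _ => d /h[y /pos_lmul py xy].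
by exists (lmul y) => //; rewrite -(linB l) n.
Qed.
Lemma pos_trans x y z : positive (y - x) -> positive (z - y) -> positive (z - x).
by move=> h1 h2; rewrite -(subrK y z) -addrA; exact: posD. Qed.

Lemma pos_sqrt x : positive x -> exists r, positive r /\ r ** r = x.
move=> px; have [[l lM _] n] := lmul_iso A.
have [r [pr rr lr]] := np_sqrt aid_l aid_r ((pos_lmul x).1 px).
have [b _ lb] : range (@lmul R A) r. apply: (sqrt_in aid_l aid_r (range_closed (lmul_iso A)) _ _ _ _ pr rr lr).
 - by move=> _ _ [u _ <-] [v _ <-]; exists (u + v) => //; rewrite (linD l).
 - by move=> c _ [u _ <-]; exists (c *: u) => //; rewrite (linZ l).
 - by move=> _ [u _ <-]; exists (x ** u) => //.
 - by [].
exists b; split; first by apply/pos_lmul; rewrite lb.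
by apply: (isohom_inj (lmul_iso A)); rewrite lM lb.
Qed.

Lemma pos_sq_le x : positive x -> nm x <= 1 -> positive (x - x ** x).
have [[l lM _] n] := lmul_iso A.
move=> px x1; have /pos_lmul px' := px; apply/pos_lmul; rewrite (linB l) lM.
have x1' : nm (lmul x) <= 1 by rewrite n.
have p1 := np_le_U aid_l (proj1 px') x1'.
have -> : lmul x - lmul x ** lmul x = lmul x ** (1%:C *: aid - lmul x).
 rewrite scale1r; ncu (@aid R A (hself A)) (@aid_l R A (hself A)) (@aid_r R A (hself A)).
apply: (np_comm aid_l aid_r) => //.
rewrite scale1r; ncu (@aid R A (hself A)) (@aid_l R A (hself A)) (@aid_r R A (hself A)).
Qed.

(** Take [k = h (h + t)^-1]. With [c = (h + t)^-1], [s - k s = t c s], whose squared norm is that of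
    [t^2 c s (star s) c], at most that of [t^2 c h c], hence at most [t]. *)
Lemma local_unit (h : A) t : positive h -> 0 < t -> exists k : A, [/\ positive k, nm k <= 1 &
 forall s : A, positive (h - s ** star s) -> nm (s - k ** s) ^+ 2 <= t].
move=> ph t0; have /pos_lmul ph' := ph; have [[l lM lS] n] := lmul_iso A.
have [c [pc hc lc c1]] := np_inv aid_l aid_r ph' t0.
have bc := lat_bicU aid_l aid_r lc; have [sc _] := pc.
pose k := aop c h; have kE : lmul k = lmul h ** c. have E := bic_comm bc (@bic_refl _ _ (lmul h)). by rewrite -op_lmul.
have hc1 := inv_est aid_l aid_r ph' t0 pc hc lc.
exists k; split.
- by apply/pos_lmul; rewrite kE; apply: (np_comm aid_l aid_r) => //; exact: (bic_comm (@bic_refl _ _ (lmul h)) bc).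
- by rewrite -n kE.
move=> s hs.
have E : lmul (s - k ** s) = t%:C *: (c ** lmul s).
 rewrite (linB l) lM kE -[lmul s in X in X - _]aid_l -[X in X ** lmul s - _]hc.
 ncu (@aid R A (hself A)) (@aid_l R A (hself A)) (@aid_r R A (hself A)).
rewrite -n E -nmSSr starZr starM sc.
have E2 : lmul (s ** star s) = lmul s ** star (lmul s) by rewrite lM lS.
have -> : t%:C *: (c ** lmul s) ** (t%:C *: (star (lmul s) ** c)) =
 (t * t)%:C *: (star c ** lmul (s ** star s) ** c) by rewrite sc E2; nc.
have tt0 : 0 <= t * t by rewrite mulr_ge0// ltW.
rewrite nmZ0//.
rewrite [leRHS](_ : t = t * t * t^-1); last by field; rewrite gt_eqF.
apply: ler_wpM2l => //.
via (nm (star c ** lmul h ** c)). apply: (np_mono aid_l aid_r).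
 by apply: (np_conj aid_l aid_r); apply/pos_lmul; exact: pos_starr. rewrite -amulBl -amulBr -(linB l).
 by apply: (np_conj aid_l aid_r); apply/pos_lmul.
rewrite sc; bnd (nmMr _ hc1); by rewrite mulr1.
Qed.

(** A single [h], the sum of all [s ** star s + star s ** s], dominates what is required on the left
    and, through adjoints, on the right. *)
Lemma approx_unit (S : seq A) t : 0 < t -> exists k : A, [/\ positive k, nm k <= 1 &
 forall s, s \in S -> nm (s - k ** s) <= t /\ nm (s - s ** k) <= t].
move=> t0; pose h := \sum_(s <- S) (s ** star s + star s ** s).
have pt (s : A) : positive (s ** star s + star s ** s) by apply: posD; [exact: pos_starr|exact: pos_star].
have ph : positive h by apply: pos_sum => s _.
have hs (s : A) : s \in S -> positive (h - (s ** star s + star s ** s)).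
 move=> sS; rewrite /h (big_rem s)//= addrAC subrr add0r; exact: pos_sum.
have [k [pk k1 kh]] := local_unit ph (mulr_gt0 t0 t0).
have sk := pos_sa pk.
exists k; split=> // s sS.
have sq (u : A) : positive (h - u ** star u) -> nm (u - k ** u) <= t. by move=> /kh h1; nra.
split; first apply: sq. apply: (@pos_trans _ (s ** star s + star s ** s)); last exact: hs.
 by rewrite addrC addKr; exact: pos_star.
rewrite -nmS starB starM sk; apply: sq; rewrite starK.
apply: (@pos_trans _ (s ** star s + star s ** s)); last exact: hs.
by rewrite addrK; exact: pos_starr.
Qed.

End Positive.

(** * The Hilbert module [A^J], rank-one operators and matrices *)

Lemma fin_bound (J : finType) (P : J -> nat -> Prop) : (forall j, \ev n, P j n) -> \ev n, forall j, P j n.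
move=> /(_ _)/cid h; pose f j := sval (h j).
exists (\max_j f j)%N => n fn j; apply: (svalP (h j)).
by apply: leq_trans fn; exact: (@leq_bigmax _ f j).
Qed.

(** A copy of [J -> A] under its own name, so that it can carry the norm of the Hilbert module
    [A^J]. *)
Definition hvec R (A : cstar R) (J : finType) : Type := J -> A.
HB.instance Definition _ R (A : cstar R) (J : finType) := GRing.Lmodule.copy (hvec A J) (J -> A).

Section Hvec.
Context {R} {A : cstar R} {J : finType}.
Implicit Types (x y z : hvec A J) (a : A).

Lemma hvDE x y j : (x + y) j = x j + y j. by []. Qed.
Lemma hvZE (c : R[i]) x j : (c *: x) j = c *: x j. by []. Qed.
Lemma hvNE x j : (- x) j = - x j. by []. Qed.

Definition hip x y : A := \sum_j star (x j) ** y j.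
Lemma hipE x y : hip x y = \sum_j star (x j) ** y j. by []. Qed.
Definition hact x a : hvec A J := fun j => x j ** a.

Lemma hipDr x y z : hip x (y + z) = hip x y + hip x z.
by rewrite -big_split; each j; rewrite amulDr. Qed.
Lemma hipZr (c : R[i]) x y : hip x (c *: y) = c *: hip x y.
by rewrite scaler_sumr; each j; rewrite amulZr. Qed.
Lemma hipS x y : star (hip x y) = hip y x.
by rewrite star_sum; each j; rewrite starM starK. Qed.
Lemma hip_act x y a : hip x (hact y a) = hip x y ** a.
by rewrite amulsl; each j; rewrite amulA. Qed.
Lemma hipDl x y z : hip (x + y) z = hip x z + hip y z.
by rewrite -hipS hipDr starD !hipS. Qed.
Lemma hipZl (c : R[i]) x y : hip (c *: x) y = conjc c *: hip x y.
by rewrite -hipS hipZr starZc hipS. Qed.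
Lemma hip_actl x y a : hip (hact x a) y = star a ** hip x y.
by rewrite -hipS hip_act starM hipS. Qed.
Lemma hipNr x y : hip x (- y) = - hip x y.
by rewrite -scaleN1r hipZr scaleN1r. Qed.
Lemma hipNl x y : hip (- x) y = - hip x y.
by rewrite -hipS hipNr starN hipS. Qed.
Lemma hip_pos x : positive (hip x x).
by apply: pos_sum => j _; exact: pos_star. Qed.

Definition hnm x : R := Num.sqrt (nm (hip x x)).

Lemma hnm_ge0 x : 0 <= hnm x. exact: sqrtr_ge0. Qed.
Lemma hnm_sq x : hnm x ^+ 2 = nm (hip x x). by rewrite sqr_sqrtr// nm_ge0. Qed.

Lemma nm_coord x j : nm (x j) <= hnm x.
rewrite -ler_sqr ?nnegrE ?nm_ge0 ?hnm_ge0// hnm_sq -nmSS.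
apply: pos_mono; first exact: pos_star.
rewrite /hip (bigD1 j)//= addrAC subrr add0r; apply: pos_sum => i _; exact: pos_star.
Qed.

Lemma hnm_eq0 x : hnm x = 0 -> x = 0.
move=> x0; apply/funext => j; apply: nm_le0; rewrite -[leRHS]x0; exact: nm_coord.
Qed.

Lemma hnm_le_sum x : hnm x <= \sum_j nm (x j).
have s0 : 0 <= \sum_j nm (x j) by apply: sumr_ge0 => j _; exact: nm_ge0.
rewrite -ler_sqr ?nnegrE ?hnm_ge0// hnm_sq.
bnd_sum; rewrite expr2 mulr_suml; each j.
rewrite nmSS expr2; apply: ler_wpM2l; first exact: nm_ge0.
by rewrite (bigD1 j)//= lerDl sumr_ge0// => i _; exact: nm_ge0.
Qed.

(** With [a = hip x y], the element [hip y y - star a ** a] is the inner square of [x a - y] plus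
    [star a (1 - hip x x) a], and both terms are positive. *)
Lemma hip_CS1 x y : nm (hip x x) <= 1 -> nm (hip x y) ^+ 2 <= nm (hip y y).
move=> x1; pose a := hip x y; rewrite -nmSS; apply: pos_mono; first exact: pos_star.
have E : hip y y - star a ** a = hip (hact x a - y) (hact x a - y) + (star a ** a - star a ** hip x x ** a).
 rewrite hipDl hipDr hipNl hipNr hipDr hipNr !hip_act !hip_actl -/a. have -> : hip y x = star a by rewrite /a hipS.
 by rewrite -/a; nc.
rewrite E; apply: posD; first exact: hip_pos.
have [[l lM lS] n] := lmul_iso A.
apply/pos_lmul; rewrite (linB l) !lM lS.
have h1 : nm (lmul (hip x x)) <= 1 by rewrite n.
have px := (pos_lmul (hip x x)).1 (hip_pos x).
have := np_conj aid_l aid_r (lmul a) (np_le_U aid_l (proj1 px) h1).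
by rewrite scale1r amulBr aid_r amulBl.
Qed.

Lemma hip_CS x y : nm (hip x y) <= hnm x * hnm y.
have [x0|x0] := eqVneq (hnm x) 0. rewrite (hnm_eq0 x0) /hip big1 ?nm0 ?mulr_ge0 ?hnm_ge0// => j _.
 by rewrite star0 amul0r.
have xp : 0 < hnm x by rewrite lt_neqAle eq_sym x0 hnm_ge0.
pose x' : hvec A J := (hnm x)^-1%:C *: x.
have h1 : nm (hip x' x') <= 1. rewrite hipZl hipZr conjc_real !nmZV// -hnm_sq mulfK// divff//.
have := hip_CS1 y h1; rewrite -hnm_sq ler_pXn2r ?nnegrE ?nm_ge0 ?hnm_ge0//.
by rewrite hipZl conjc_real nmZV// ler_pdivrMr// mulrC.
Qed.

Let hnormD x y : (hnm (x + y))%:C <= (hnm x)%:C + (hnm y)%:C :> R[i].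
rewrite -rmorphD lecR -ler_sqr ?nnegrE ?addr_ge0 ?hnm_ge0//.
rewrite hnm_sq hipDl !hipDr.
bnd nmD.
have := nmD (hip x x) (hip x y); have := nmD (hip y x) (hip y y).
have := hip_CS x y; have := hip_CS y x; rewrite -!hnm_sq.
set a := nm _; set b := nm _; set c := nm _; set d := nm _.
rewrite -/(nm); nra.
Qed.
Let hnormZ (c : R[i]) x : (hnm (c *: x))%:C = `|c| * (hnm x)%:C :> R[i].
have cE : `|c| = (Re `|c|)%:C by exact: (@normE _ (R[i]^o) c).
have c0 : 0 <= Re `|c| by exact: (@nm_ge0 _ (R[i]^o) c).
rewrite cE -rmorphM; congr (_%:C); rewrite /hnm hipZl hipZr !nmCZ.
have -> : `|conjc c| = `|c| by case: (c) => a b; rewrite !normc_def /= sqrrN.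
by rewrite mulrA sqrtrM ?sqr_ge0// sqrtr_sqr ger0_norm.
Qed.
Let hnorm_eq0 x : (hnm x)%:C = 0 :> R[i] -> x = 0.
by move=> [x0]; exact: hnm_eq0. Qed.

HB.instance Definition _ := Lmodule_isNormed.Build R[i] (hvec A J) hnormD hnormZ hnorm_eq0.

Lemma nm_hv x : nm x = hnm x. by []. Qed.

Let hvec_cvs (u : nat -> hvec A J) : caus u -> exists l, cvs u l.
move=> uc; have h j : {l | cvs (fun n => u n j) l}. apply: cid; apply: caus_cvs => d /uc[N k]; exists N => m n Nm Nn.
 by apply: le_lt_trans (k m n Nm Nn); exact: (nm_coord (u m - u n) j).
pose l : hvec A J := fun j => sval (h j); exists l => d d0.
have dM : 0 < d / (#|J|%:R + 1) by rewrite divr_gt0.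
have [j|N k] := @fin_bound J (fun j n => nm (u n j - l j) < d / (#|J|%:R + 1)). exact: (svalP (h j)).
exists N => n Nn; bnd hnm_le_sum.
via (\sum_(j : J) d / (#|J|%:R + 1)). by each j; apply/ltW/(k n Nn j).
rewrite (_ : \sum_(j : J) _ = d / (#|J|%:R + 1) * #|J|%:R); last first. by rewrite sumr_const mulr_natr.
by rewrite mulrAC ltr_pdivrMr// ltr_pM2l// ltrDl.
Qed.
HB.instance Definition _ := Uniform_isComplete.Build (hvec A J) (mk_complete hvec_cvs).

Program Definition hv : hmod A := @HMod R A (hvec A J) hip hipDr hipZr hipS _ _.
Next Obligation. by move=> x; rewrite nm_hv hnm_sq. Qed.
Next Obligation. by move=> x y; rewrite !nm_hv; exact: hip_CS. Qed.

Lemma ip_hv x y : ip (h := hv) x y = hip x y. by []. Qed.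

Lemma nm_hact x a : nm (hact x a) <= nm x * nm a.
rewrite -ler_sqr ?nnegrE ?mulr_ge0 ?nm_ge0// exprMn !nm_hv !hnm_sq.
rewrite hip_actl hip_act; bnd nmM; rewrite nmS.
by have := nmM (hip x x) a; have := nm_ge0 a; nra.
Qed.

Lemma aop_hact (T : adjop hv) x a : aop T (hact x a) = hact (aop T x) a.
by apply: (ip_inj (E := hv)) => z; rewrite ip_adj !ip_hv !hip_actl -!ip_hv ip_adj.
Qed.

Lemma theta_set x y : adj_set (E := hv) (fun z => hact x (hip y z)).
split. exists (nm x * nm y) => z; bnd nm_hact; rewrite -mulrA.
 by apply: ler_wpM2l; [exact: nm_ge0|exact: (ip_CS (h := hv))].
exists (fun z => hact y (hip x z)) => z w.
by rewrite !ip_hv hip_actl hip_act hipS.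
Qed.
(** The rank-one operator [|x><y|]. *)
Definition theta x y : adjop hv := mkop (theta_set x y).
Lemma thetaE x y z : aop (theta x y) z = hact x (hip y z). by []. Qed.

Lemma theta_star x y : star (theta x y) = theta y x.
apply: adjop_eq => z; apply: (ip_inj (E := hv)) => w.
by rewrite -ip_adj' !ip_hv hip_actl hip_act hipS.
Qed.
Lemma op_theta (T : adjop hv) x y : T ** theta x y = theta (aop T x) y.
by apply: adjop_eq => z; rewrite aopM aop_hact. Qed.
Lemma theta_op (T : adjop hv) x y : theta x y ** T = theta x (aop (star T) y).
by apply: adjop_eq => z; rewrite aopM !thetaE -!ip_hv ip_adj'. Qed.
Lemma theta_conj (T : adjop hv) x : T ** theta x x ** star T = theta (aop T x) (aop T x).
by rewrite op_theta theta_op starK. Qed.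

Lemma np_ip (T : adjop hv) z : np aid T -> positive (hip z (aop T z)).
move=> /(np_sqrt aid_l aid_r)[r [[sr _] <- _]].
have -> : hip z (aop (r ** r) z) = hip (aop r z) (aop r z). by rewrite aopM -!ip_hv ip_adj' sr.
exact: hip_pos.
Qed.

(** Let [Q] be the negative part of [T]. Testing on [Q z] gives [- <z, Q^3 z>], which must be
    positive, while [Q^3] is positive as well; so [Q^3], and then [Q], vanishes. *)
Lemma ip_np (T : adjop hv) : sa T -> (forall z, positive (hip z (aop T z))) -> np aid T.
move=> sT hT; have [P [Q [pP pQ E PQ [lP lQ]]]] := np_parts aid_l aid_r sT.
have bP := lat_bicU aid_l aid_r lP; have bQ := lat_bicU aid_l aid_r lQ.
have [sQ _] := pQ.
suff Q0 : Q = 0 by rewrite E Q0 subr0.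
have QQQ : Q ** (T ** Q) = - (Q ** Q ** Q). rewrite E; have -> : Q ** ((P - Q) ** Q) = P ** Q ** Q - Q ** Q ** Q.
 by ncc (@aid R A hv) (@aid_l R A hv) (@aid_r R A hv) T. by rewrite PQ amul0r sub0r.
have Q3 : np aid (Q ** Q ** Q). by apply: (np_comm aid_l aid_r) => //; [exact: sq_np aid_l aid_r _ sQ|rewrite amulA].
have [r [pr rr lr]] := np_sqrt aid_l aid_r Q3; have [sr _] := pr.
have rv z : aop r z = 0. have h1 := np_ip z Q3. have h2 : positive (- hip z (aop (Q ** Q ** Q) z)).
 have -> : - hip z (aop (Q ** Q ** Q) z) = hip z (aop (Q ** (T ** Q)) z). by rewrite QQQ -hipNr.
 by rewrite !aopM -ip_hv ip_adj' sQ. have h0 : hip z (aop (Q ** Q ** Q) z) = 0.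
 apply: (isohom_inj (lmul_iso A)); have [[l _ _] _] := lmul_iso A.
 rewrite (lin0 l); apply: (np_anti aid_l aid_r); first exact/pos_lmul. by rewrite -(linN l); apply/pos_lmul.
 apply: nm_eq0; apply/eqP; rewrite -sqrf_eq0 -(ip_nm (h := hv)) ip_adj sr -aopM rr. by rewrite ip_hv h0 nm0.
have r0 : r = 0 by apply: adjop_eq => z; rewrite rv.
have : Q ** Q ** (Q ** Q) = 0 by rewrite amulA -rr r0 !amul0r.
by move=> /(sq_eq0 (sa_sq sQ)) /(sq_eq0 sQ).
Qed.

Lemma theta_np x : np aid (theta x x).
apply: ip_np => [|z]; first by rewrite /sa theta_star.
by rewrite hip_act -hipS; exact: pos_star.
Qed.

Lemma nm_theta x : nm (theta x x) = nm x ^+ 2.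
apply/le_anti/andP; split. rewrite nm_op; apply: onm_le => [|z]; first exact: sqr_ge0.
 rewrite thetaE; bnd nm_hact; rewrite expr2 -mulrA. by apply: ler_wpM2l; [exact: nm_ge0|exact: (ip_CS (h := hv))].
have [->|n0] := eqVneq (nm x) 0; first by rewrite expr0n nm_ge0.
have xp : 0 < nm x by rewrite lt_neqAle eq_sym n0 nm_ge0.
have h := nm_aop (theta x x) x.
have h2 := ip_CS (h := hv) x (aop (theta x x) x).
have h3 : nm (ip (h := hv) x (aop (theta x x) x)) = nm x ^+ 4.
 rewrite ip_hv hip_act -{1}hipS nmSS -ip_hv ip_nm -exprM//.
rewrite h3 in h2; rewrite nm_op.
have h4 : nm x ^+ 4 <= nm x * (onm (theta x x) * nm x). by bnd h2; apply: ler_wpM2l => //; exact: ltW.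
have : nm x ^+ 2 * nm x ^+ 2 <= onm (theta x x) * nm x ^+ 2. lra.
by rewrite ler_pM2r// exprn_gt0.
Qed.

Definition hdelta (j : J) a : hvec A J := fun i => if i == j then a else 0.

Lemma hip_delta j a x : hip (hdelta j a) x = star a ** x j.
rewrite /hip (bigD1 j)//= /hdelta eqxx big1 ?addr0// => i /negbTE ->.
by rewrite star0 amul0r.
Qed.
Lemma nm_delta j a : nm (hdelta j a) = nm a.
by rewrite nm_hv /hnm hip_delta /hdelta eqxx nmSS sqrtr_sqr ger0_norm// nm_ge0.
Qed.
End Hvec.
Arguments hv {R} A J.

Section MatrixOperators.
Context {R} {A : cstar R} {J : finType}.
Local Notation E := (hv A J).
Local Notation V := (hvec A J).

Lemma nm_coord' (x : V) j : nm (x j) <= nm x.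
by rewrite nm_hv; exact: nm_coord. Qed.
Lemma nm_le_sum' (x : V) : nm x <= \sum_j nm (x j).
by rewrite nm_hv; exact: hnm_le_sum. Qed.

Definition mxact (Y : J -> J -> A) (v : V) : V := fun p => \sum_q Y p q ** v q.

Lemma mxact_nm (Y : J -> J -> A) v : nm (mxact Y v) <= (\sum_p \sum_q nm (Y p q)) * nm v.
apply: le_trans (nm_le_sum' _) _; rewrite mulr_suml; each p.
bnd_sum; rewrite mulr_suml; each q.
by bnd nmM; apply: ler_wpM2l; [exact: nm_ge0|exact: nm_coord'].
Qed.

Lemma mxo_set Y : adj_set (E := E) (mxact Y).
split; first by exists (\sum_p \sum_q nm (Y p q)) => v; exact: mxact_nm.
exists (mxact (fun p q => star (Y q p))) => x y; rewrite !ip_hv /hip.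
under eq_bigr => p _ do rewrite star_sum amulsl.
under [RHS]eq_bigr => p _ do rewrite amulsr.
rewrite exchange_big; each q; each p.
by rewrite starM amulA.
Qed.
Definition mxo (Y : J -> J -> A) : adjop E := mkop (mxo_set Y).

Lemma eq_mxo Y Z : (forall p q, Y p q = Z p q) -> mxo Y = mxo Z.
by move=> h; congr mxo; apply/funext => p; apply/funext => q. Qed.

Lemma mxoE Y v p : aop (mxo Y) v p = \sum_q Y p q ** v q. by []. Qed.

Lemma mxo_delta Y q a p : aop (mxo Y) (hdelta q a) p = Y p q ** a.
rewrite mxoE (bigD1 q)//= /hdelta eqxx big1 ?addr0// => i /negbTE ->.
by rewrite amulr0.
Qed.

Lemma nm_mxo Y : nm (mxo Y) <= \sum_p \sum_q nm (Y p q).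
rewrite nm_op; apply: onm_le => [|v]; last exact: mxact_nm.
by do 2 (apply: sumr_ge0 => ? _); exact: nm_ge0.
Qed.

Lemma nm_entry Y p q : nm (Y p q) <= nm (mxo Y).
have [->|n0] := eqVneq (nm (Y p q)) 0; first exact: nm_ge0.
have np : 0 < nm (Y p q) by rewrite lt_neqAle eq_sym n0 nm_ge0.
rewrite -(ler_pM2r np) -expr2 -nmSSr -(mxo_delta Y q (star (Y p q)) p).
have h := nm_aop (mxo Y) (hdelta q (star (Y p q))).
bnd nm_coord'; bnd h.
by rewrite nm_delta nmS.
Qed.

Lemma mxo_inj Y Y' : mxo Y = mxo Y' -> forall p q, Y p q = Y' p q.
move=> YY p q; apply/subr0_eq/star_eq0.
have : aop (mxo Y) (hdelta q (star (Y p q - Y' p q))) p =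
 aop (mxo Y') (hdelta q (star (Y p q - Y' p q))) p by rewrite YY.
rewrite !mxo_delta => /eqP; rewrite -subr_eq0 -amulBl => /eqP h.
by apply: nm_eq0; apply/eqP; rewrite nmSS sqrf_eq0 -[nm _ == 0]sqrf_eq0 -nmSSr h nm0.
Qed.

Lemma mxoD Y Z : mxo (fun p q => Y p q + Z p q) = mxo Y + mxo Z.
apply: adjop_eq => v; apply/funext => p; rewrite aopDx hvDE !mxoE -big_split.
by each q; rewrite amulDl.
Qed.
Lemma mxoZ (c : R[i]) Y : mxo (fun p q => c *: Y p q) = c *: mxo Y.
apply: adjop_eq => v; apply/funext => p; rewrite mxoE aopZx hvZE mxoE scaler_sumr.
by each q; rewrite amulZl.
Qed.
Lemma mxoM Y Z : mxo (fun p q => \sum_k Y p k ** Z k q) = mxo Y ** mxo Z.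
apply: adjop_eq => v; apply/funext => p; rewrite aopM !mxoE.
under eq_bigr => q _ do rewrite amulsl.
rewrite exchange_big; each k.
by rewrite amulsr; each q; rewrite amulA.
Qed.
Lemma mxoS Y : mxo (fun p q => star (Y q p)) = star (mxo Y).
apply: adjop_eq => v; apply: (ip_inj (E := E)) => w.
rewrite -ip_adj'; have [_ [T' h]] := mxo_set Y.
rewrite !ip_hv /hip.
under eq_bigr => p _ do rewrite star_sum amulsl.
under [RHS]eq_bigr => p _ do rewrite amulsr.
rewrite exchange_big; each q; each p.
by rewrite starM starK amulA.
Qed.
Lemma mxo_theta (x y : V) : theta x y = mxo (fun p q => x p ** star (y q)).
apply: adjop_eq => v; apply/funext => p; rewrite thetaE mxoE /hact /hip amulsr.
by each q; rewrite amulA.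
Qed.
Lemma mxo_sum (I : Type) (r : seq I) (Y : I -> J -> J -> A) :
 mxo (fun p q => \sum_(i <- r) Y i p q) = \sum_(i <- r) mxo (Y i).
elim: r => [|i r IH]. rewrite big_nil; apply: adjop_eq => v; apply/funext => p; rewrite mxoE.
 by rewrite big1// => q; rewrite big_nil amul0r.
rewrite big_cons -IH -mxoD; apply: eq_mxo => p q.
by rewrite big_cons.
Qed.

End MatrixOperators.

(** * Gram matrices and complete positivity *)

Definition gpos R (V : starAlgType R) (I : finType) (X : I -> I -> V) : Prop :=
 exists (L : finType) (z : L -> I -> V), forall p q, X p q = \sum_l star (z l p) ** z l q.

Section Gram.
Context {R}.

Lemma gpos_np (A : cstar R) (I : finType) (X : I -> I -> A) : gpos X -> np aid (mxo X).
move=> [L [z Xz]].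
have -> : mxo X = \sum_l theta (fun p => star (z l p)) (fun p => star (z l p)).
 under eq_bigr => l _ do rewrite mxo_theta. rewrite -mxo_sum; apply: eq_mxo => p q.
 by rewrite Xz; each l; rewrite starK.
elim/big_rec: _ => [|l T _]; first exact: np0.
by apply: npD; exact: theta_np.
Qed.

(** Matrices with entries in the image of [P] form a closed subspace that is stable under products,
    so the square root computed over [A] already has its entries there. *)
Lemma gpos_sqrt (P A : cstar R) (f : P -> A) (I : finType) (X : I -> I -> P) :
 isohom f -> np aid (mxo (fun p q => f (X p q))) ->
 exists Y : I -> I -> P, forall p q, X p q = \sum_k star (Y k p) ** Y k q.
move=> fi pX; have [[fl fM fS] fn] := fi.
have fsum (F : I -> P) : f (\sum_k F k) = \sum_k f (F k) by exact: lin_sum.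
pose g (Y : I -> I -> P) := mxo (fun p q => f (Y p q)).
have gcl : closed (range g). apply/closed_nmP => T h. pose d n : R := n.+1%:R^-1.
 have d0 n : 0 < d n by rewrite invr_gt0. have ex n : {Y | nm (T - g Y) < d n}.
 by apply: cid; have [_ [Y _ <-] TY] := h _ (d0 n); exists Y.
 pose u n := sval (ex n); have hu n : nm (T - g (u n)) < d n by exact: (svalP (ex n)).
 have hu' n : nm (g (u n) - T) < d n by rewrite nmBC. have gB Y Z : g Y - g Z = g (fun p q => Y p q - Z p q).
 rewrite /g -scaleN1r -mxoZ -mxoD; apply: eq_mxo => p q. by rewrite (linB fl) scaleN1r.
 have lim p q : {l | cvs (fun n => u n p q) l}. apply: cid; apply: caus_cvs => t t0; have t2 : 0 < t / 2 by lra.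
 have [N dN] := inv_nat_lt t2; exists N => m n /dN dm /dN dn.
 rewrite -fn; bnd (nm_entry (fun p q => f (u m p q - u n p q)) p q).
 rewrite -/(g (fun p q => u m p q - u n p q)) -gB. bnd (nm_tri _ T _); rewrite [ltRHS]splitr; apply: ltrD.
 exact: lt_trans (hu' m) dm. exact: lt_trans (hu n) dn.
 pose Y p q := sval (lim p q); have hY p q : cvs (fun n => u n p q) (Y p q) := svalP (lim p q).
 exists Y => //; apply: subr0_eq; apply: nm_small => t t0. have t2 : 0 < t / 2 by lra. have [N1 dN] := inv_nat_lt t2.
 pose M : R := #|I|%:R * #|I|%:R + 1. have M0 : 0 < M by rewrite ltr_wpDl//.
 have [pq|N2 k] := @fin_bound (I * I)%type (fun pq n => nm (u n pq.1 pq.2 - Y pq.1 pq.2) < t / 2 / M).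
 by apply: hY; rewrite divr_gt0. pose n := maxn N1 N2. have h1 : nm (g Y - g (u n)) <= t / 2. rewrite gB; bnd nm_mxo.
 via (\sum_(p : I) \sum_(q : I) t / 2 / M). each p; each q; rewrite fn nmBC.
 by apply/ltW/(k n (leq_maxr _ _) (p, q)). rewrite (_ : \sum_p _ = t / 2 / M * (#|I|%:R * #|I|%:R)); last first.
 by rewrite !sumr_const -mulrnA -natrM mulr_natr. rewrite mulrAC ler_pdivrMr// /M; lra.
 bnd (nm_tri _ (g (u n)) _); rewrite [leRHS]splitr; apply: lerD => //.
 by apply: ltW; apply: lt_trans (hu' n) _; exact: (dN n (leq_maxl _ _)).
have gD Y Z : g Y + g Z = g (fun p q => Y p q + Z p q). by rewrite -mxoD; apply: eq_mxo => p q; rewrite (linD fl).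
have gM Y Z : g Y ** g Z = g (fun p q => \sum_k Y p k ** Z k q). rewrite /g -mxoM; apply: eq_mxo => p q.
 by rewrite fsum; apply: eq_bigr => k.
have [r [pr rr lr]] := np_sqrt aid_l aid_r pX; have [sr _] := pr.
have [Y _ gY] : range g r. apply: (sqrt_in aid_l aid_r gcl _ _ _ _ pr rr lr).
 - by move=> _ _ [Y _ <-] [Z _ <-]; eexists.
 - move=> c _ [Y _ <-]; exists (fun p q => c *: Y p q) => //.
 by rewrite -mxoZ; apply: eq_mxo => p q; rewrite (linZ fl).
 - by move=> _ [Y _ <-]; rewrite gM.
 - by [].
exists Y => p q; apply: (isohom_inj fi).
have E : mxo (fun p q => f (X p q)) = mxo (fun p q => f (\sum_k star (Y k p) ** Y k q)).
 rewrite -rr -{1}sr -gY /g -mxoS -mxoM; apply: eq_mxo => i j. by rewrite fsum; each k; rewrite fM fS.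
exact: (mxo_inj E).
Qed.

Lemma gpos_sub (P A : cstar R) (f : P -> A) (I : finType) (X : I -> I -> P) :
 isohom f -> gpos (fun p q => f (X p q)) -> gpos X.
by move=> fi /gpos_np/(gpos_sqrt fi)[Y XY]; exists I, Y. Qed.

(** [mx_positive] asks for a square factor, whereas a Gram matrix may have any number of rows. The
    square root of a Gram matrix is a square factor. *)
Lemma gpos_mx (A : cstar R) n (X : 'M[A]_n) : mx_positive X <-> gpos (fun i j => X i j).
split=> [[Y ->]|/gpos_np/(gpos_sqrt (isohom_id A))[Y XY]]. by exists 'I_n, Y => p q; rewrite mxE; each k; rewrite mxE.
exists (\matrix_(i, j) Y i j); apply/matrixP => p q; rewrite mxE XY.
by each k; rewrite !mxE.
Qed.

Lemma gpos_comp (V : starAlgType R) (I I' : finType) (s : I' -> I) (X : I -> I -> V) :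
 gpos X -> gpos (fun p q => X (s p) (s q)).
by move=> [L [z h]]; exists L, (fun l p => z l (s p)) => p q. Qed.
Lemma gpos_ext (V : starAlgType R) (I : finType) (X Y : I -> I -> V) : (forall p q, X p q = Y p q) -> gpos X -> gpos Y.
by move=> XY [L [z h]]; exists L, z => p q; rewrite -XY. Qed.

Lemma gpos_hom (V W : starAlgType R) (f : V -> W) (I : finType) (X : I -> I -> V) :
 star_hom f -> gpos X -> gpos (fun p q => f (X p q)).
move=> [fl fM fS] [L [z h]]; exists L, (fun l p => f (z l p)) => p q.
by rewrite h (lin_sum fl); each l; rewrite fM fS.
Qed.

Lemma gpos_conj (V : starAlgType R) (I J : finType) (X : I -> I -> V) (x : J -> V) :
 gpos X -> gpos (fun (p q : I * J) => star (x p.2) ** X p.1 q.1 ** x q.2).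
move=> [L [z h]]; exists L, (fun l p => z l p.1 ** x p.2) => p q.
rewrite h amulsr amulsl; each l.
by rewrite starM !amulA.
Qed.

Lemma cp_gpos (V W : cstar R) (f : V -> W) (I : finType) (X : I -> I -> V) :
 completely_positive f -> gpos X -> gpos (fun p q => f (X p q)).
move=> [_ fcp] X0.
have /gpos_mx/fcp/gpos_mx : gpos (fun i j => (\matrix_(i, j) X (@enum_val I predT i) (@enum_val I predT j)) i j).
 by apply: gpos_ext (gpos_comp (@enum_val I predT) X0) => p q; rewrite mxE.
move/(gpos_comp (@enum_rank I)); apply: gpos_ext => p q.
by rewrite !mxE !enum_rankK.
Qed.

Lemma gpos_cp (V W : cstar R) (f : V -> W) : linear f ->
 (forall (I : finType) (X : I -> I -> V), gpos X -> gpos (fun p q => f (X p q))) -> completely_positive f.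
move=> fl fg; split=> // n X /gpos_mx/fg h; apply/gpos_mx.
by apply: gpos_ext h => p q; rewrite mxE.
Qed.

End Gram.

Global Opaque op_mul op_star theta mxo onm hip.

Lemma nm_le_sqrt R (V : normedModType R[i]) (x : V) (t : R) : 0 <= t -> nm x ^+ 2 <= t -> nm x <= Num.sqrt t.
move=> t0 h; rewrite -(@ler_pXn2r _ 2)// ?nnegrE ?nm_ge0 ?sqrtr_ge0//.
by rewrite [leRHS]sqr_sqrtr.
Qed.

(** * Perturbing a vector so that its rank-one operator commutes *)

Section Perturbation.
Context {R} {U : cstar R} (e : U).
Hypotheses (ex : forall x, e ** x = x) (xe : forall x, x ** e = x).
Implicit Types (t : R).
Local Notation "t %:U" := (t%:C *: e) (at level 2, format "t %:U").

(* Approximate polar decomposition: [r] behaves like (b + d)^(-1/2). *)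
Lemma inv_sqrt (b : U) d : np e b -> 0 < d -> exists t r : U, [/\ np e t /\ t ** t = b, np e r, bic b t /\ bic b r,
 nm (r ** b ** r) <= 1 /\ e - r ** b ** r = d%:C *: (r ** r) & nm (t - t ** (t ** r)) ^+ 2 <= d /\
 forall P, np e P -> np e (b - P) -> nm ((e - t ** r) ** P ** (e - t ** r)) <= d].
move=> pb d0; have [t [pt tt lt]] := np_sqrt ex xe pb.
have [c [pc bc lc _]] := np_inv ex xe pb d0.
have [r [pr rr lr]] := np_sqrt ex xe pc.
have [[st _] [sc _] [sr _]] := And3 pt pc pr.
have bt := lat_bicU ex xe lt; have bbc := lat_bicU ex xe lc.
have br : bic b r by apply: bic_trans bbc _; exact: lat_bicU.
have rbr : r ** b ** r = b ** c by rewrite -rr; ncc e ex xe b.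
have bc1 : nm (b ** c) <= 1 by exact: inv_est pb d0 pc bc lc.
pose w := t ** r.
have pw : np e w by apply: np_comm => //; ncc e ex xe b.
have ww : w ** w = b ** c by rewrite -rr -tt /w; ncc e ex xe b.
have [sw _] := pw.
have w1 : nm w <= 1 by rewrite -(@expr_le1 _ 2) ?nm_ge0// -nm_sq// ww.
have p1w : np e (e - w) by have := np_le_U ex sw w1; rewrite scale1r.
have ebc : e - b ** c = d%:C *: c by rewrite -[X in X - _]bc; ncu e ex xe.
have bw : bic b w by exact: bicM.
(* Here [(1 - w)^2 <= 1 - w^2 = d c], and multiplying by [b] leaves at most [d b c <= d]. *)
have key : nm ((e - w) ** b ** (e - w)) <= d. apply: (np_bnd ex xe); first exact: ltW.
 have := np_conj ex xe (e - w) pb; by rewrite starB sw (sa_unit ex). have -> : d%:U - (e - w) ** b ** (e - w) =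
 b ** ((e - w) ** w + (e - w) ** w) + d%:C *: (e - b ** c).
 have -> : b ** ((e - w) ** w + (e - w) ** w) = b ** (e - w ** w) - (e - w) ** b ** (e - w). by ncc e ex xe b.
 by rewrite ww; have -> : d%:U = d%:C *: (b ** c + (e - b ** c)); [nc|]; rewrite ebc; ncc e ex xe b.
 have pww : np e ((e - w) ** w) by apply: np_comm => //; ncc e ex xe b. apply: npD.
 apply: np_comm => //; first exact: npD. by ncc e ex xe b.
 by apply: npZ; [exact: ltW|rewrite ebc; apply: npZ => //; exact: ltW].
exists t, r; split => //. by rewrite rbr; rewrite rr.
split. rewrite -nmSS starB starM sw st -/w. have -> : (t - w ** t) ** (t - t ** w) = (e - w) ** b ** (e - w).
 by rewrite -tt; ncu e ex xe. exact: key.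
move=> P pP pbP; apply: le_trans key.
have se : star (e - w) = e - w by rewrite starB sw (sa_unit ex).
apply: np_mono => //; first by have := np_conj ex xe (e - w) pP; rewrite se.
rewrite -amulBl -amulBr.
by have := np_conj ex xe (e - w) pbP; rewrite se.
Qed.

(* The cut-off [f] of the perturbation lemma: [f^2 (D - eps)] is the positive
 part of [D - 2 eps]. *)
Lemma cutoff (D : U) t : np e D -> 0 < t -> exists P f : U, [/\ np e P /\ np e f, bic D P /\ bic D f, nm P <= nm D,
 f ** (D - t%:U) ** f = P & nm f <= 1 /\ np e ((3 * t)%:U - (e - f) ** (D + t%:U) ** (e - f))].
move=> pD t0; have [sD _] := pD.
have sD2 : sa (D - (2 * t)%:U) by apply: saB => //; exact: saU.
have [P [Q [pP pQ E PQ [lP lQ]]]] := np_parts ex xe sD2.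
have bD2 : bic D (D - (2 * t)%:U) by apply: bicB; [exact: bic_refl|exact: bicU].
have bP : bic D P by apply: bic_trans bD2 _; exact: lat_bicU.
have bQ : bic D Q by apply: bic_trans bD2 _; exact: lat_bicU.
have [c [pc cP lc c1]] := np_inv ex xe pP t0.
have bc : bic D c by apply: bic_trans bP _; exact: lat_bicU.
have Pc1 : nm (P ** c) <= 1 by exact: inv_est pP t0 pc cP lc.
have pPc : np e (P ** c) by apply: np_comm => //; ncc e ex xe D.
have [f [pf ff lf]] := np_sqrt ex xe pPc.
have bf : bic D f by apply: bic_trans (bicM bP bc) _; exact: lat_bicU.
have [[sP _] [sf _]] := conj pP pf.
have f1 : nm f <= 1 by rewrite -(@expr_le1 _ 2) ?nm_ge0// -nm_sq// ff.
have DE : D = P - Q + (2 * t)%:U by rewrite -E; nc.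
have ePc : e - P ** c = t%:C *: c by rewrite -[X in X - _]cP; ncu e ex xe.
have pDt : np e (D + t%:U) by apply: npD => //; apply: npU => //; exact: ltW.
have p1f : np e (e - f) by have := np_le_U ex sf f1; rewrite scale1r.
exists P, f; split => //.
- have [P0|P0] := eqVneq (nm P) 0; first by rewrite P0 nm_ge0. have Pp : 0 < nm P by rewrite lt_neqAle eq_sym P0 nm_ge0.
 rewrite -(ler_pM2l Pp) -expr2 -nm_sq//; apply: le_trans (nmM _ _). apply: np_mono => //; first exact: sq_np.
 have -> : P ** D - P ** P = (2 * t)%:C *: P - P ** Q by rewrite [in LHS]DE; ncu e ex xe.
 by rewrite PQ subr0; apply: npZ => //; lra.
- have -> : f ** (D - t%:U) ** f = f ** f ** (D - t%:U) by ncc e ex xe D. rewrite ff [in D - _]DE.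
 have -> : P ** c ** (P - Q + (2 * t)%:U - t%:U) = P ** ((P + t%:U) ** c) - c ** (P ** Q). by ncc e ex xe D.
 by rewrite cP PQ amulr0 subr0.
split => //.
(* Since [(1 - f)^2 <= 1 - f^2 = t c], it suffices that [t c (D + t) <= 3 t]. This holds because
   [D + t = P - Q + 3 t] and [t c = 1 - P c]. *)
have -> : (3 * t)%:U - (e - f) ** (D + t%:U) ** (e - f) =
 (2%:C *: (f ** (e - f))) ** (D + t%:U) + t%:C *: (c ** Q) + (2 * t)%:C *: (P ** c).
 have -> : 2%:C *: (f ** (e - f)) ** (D + t%:U) =
 (e - f ** f) ** (D + t%:U) - (e - f) ** (D + t%:U) ** (e - f) by ncc e ex xe D. rewrite ff ePc.
 have -> : t%:C *: c ** (D + t%:U) = (3 * t)%:C *: (t%:C *: c) + t%:C *: (P ** c) - t%:C *: (c ** Q).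
 by rewrite [in LHS]DE; ncc e ex xe D.
 have -> : (3 * t)%:U = (3 * t)%:C *: (e - P ** c) + (3 * t)%:C *: (P ** c) by nc. by rewrite ePc; nc.
apply: npD; last by apply: npZ => //; lra.
apply: npD. apply: np_comm => //; last by ncc e ex xe D. by apply: npZ => //; apply: np_comm => //; ncc e ex xe D.
by apply: npZ; [exact: ltW|apply: np_comm => //; ncc e ex xe D].
Qed.

End Perturbation.

Section PerturbVector.
Context {R} {A : cstar R} {J : finType}.
Local Notation E := (hv A J).

Lemma nm_theta2 (x y : hvec A J) : nm (theta x y) <= nm x * nm y.
rewrite nm_op; apply: onm_le => [|z]; first by rewrite mulr_ge0 ?nm_ge0.
rewrite thetaE; bnd nm_hact; rewrite -mulrA.
by apply: ler_wpM2l; [exact: nm_ge0|exact: (ip_CS (h := E))].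
Qed.

Lemma theta_dist (x y : hvec A J) : nm (theta x x - theta y y) <= nm (x - y) * (nm x + nm y).
have -> : theta x x - theta y y = theta (x - y) x + theta y (x - y). apply: adjop_eq => z; apply/funext => j.
 rewrite !aopDx aopNx !thetaE /hact !(hvDE, hvNE) hipDl hipNl; nc.
bnd nmD.
by have := nm_theta2 (x - y) x; have := nm_theta2 y (x - y); lra.
Qed.

(** Put [y = f rho] with the cut-off [f], and [b = theta y y = f G f]. As [G >= D - t], one has
    [b >= P], so [rho' = P^(1/2) b^(-1/2) y] makes sense as a limit and [theta rho' rho' = P]. The
    distances from [rho] to [y] and from [y] to [rho'] are at most [sqrt (3 t)] and [sqrt (2 t)].
    The operators [X n] record that [rho'] is reached from [rho] by operators. *)
Lemma perturb (rho : hvec A J) (D : adjop E) (t : R) : 0 < t -> np aid D -> nm (theta rho rho - D) <= t ->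
 exists (P : adjop E) (rho' : hvec A J) (X : nat -> adjop E), [/\ np aid P, bic D P, nm P <= nm D, theta rho' rho' = P
 & nm (rho' - rho) <= 4 * Num.sqrt t /\ cvs (fun n => aop (X n) rho : hvec A J) rho'].
move=> t0; have t3 : 0 <= 3 * t by rewrite mulr_ge0// ltW.
have t2 : 0 <= 2 * t by rewrite mulr_ge0// ltW.
pose e : adjop E := aid; have el : forall x : adjop E, e ** x = x := aid_l.
have er : forall x : adjop E, x ** e = x := aid_r.
rewrite -/e => pD Gt; set G := theta rho rho in Gt.
have [P [f [[pP pf] [bP bf] PD fP [f1 p3]]]] := cutoff el er pD t0.
have [[sP _] [sf _] [sD _]] := And3 pP pf pD.
have sG : sa G by rewrite /sa theta_star.
pose y := aop f rho : hvec A J; pose b := theta y y.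
have bE : b = f ** G ** f by rewrite -[X in _ ** X]sf theta_conj.
have pb : np e b := theta_np y.
have sGD : sa (G - D) by exact: saB.
have bP' : b - P = f ** (t%:C *: e + (G - D)) ** f. by rewrite bE -fP; ncu e el er.
have pbP : np e (b - P). rewrite bP' -[X in X ** _ ** _]sf; apply: (np_conj el er). exact: (np_ge_U el).
have nbP : nm (b - P) <= 2 * t. rewrite bP'; bnd nmM; bnd (ler_piMr (nm_ge0 _) f1).
 bnd (nmMl _ f1); rewrite mul1r; bnd nmD. by have := nmU el (ltW t0); lra.
have [s [ps ss ls]] := np_sqrt el er pP; have [s_s _] := ps.
have yrho : nm (y - rho) <= Num.sqrt (3 * t). apply: nm_le_sqrt => //.
 rewrite -nm_theta; have -> : y - rho = aop (f - e) rho by []. rewrite -theta_conj starB sf (sa_unit el).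
 have -> : (f - e) ** theta rho rho ** (f - e) = (e - f) ** G ** (e - f) by rewrite -/G; nc.
 have se : star (e - f) = e - f by rewrite starB sf (sa_unit el). apply: (np_bnd el er); first exact: t3.
 by have := np_conj el er (e - f) (theta_np rho); rewrite se. have -> : (3 * t)%:C *: e - (e - f) ** G ** (e - f) =
 ((3 * t)%:C *: e - (e - f) ** (D + t%:C *: e) ** (e - f)) +
 (e - f) ** (t%:C *: e - (G - D)) ** (e - f) by ncu e el er.
 apply: npD => //; rewrite -[X in X ** _ ** _]se; apply: (np_conj el er). exact: (np_le_U el).
pose d n : R := n.+1%:R^-1.
have d0 n : 0 < d n by rewrite invr_gt0.
have ex n : {r : adjop E * adjop E | [/\ np e r.1 /\ r.1 ** r.1 = b, np e r.2, bic b r.1 /\ bic b r.2,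
 nm (r.2 ** b ** r.2) <= 1 /\ e - r.2 ** b ** r.2 = (d n)%:C *: (r.2 ** r.2)
 & nm (r.1 - r.1 ** (r.1 ** r.2)) ^+ 2 <= d n /\
 forall P, np e P -> np e (b - P) -> nm ((e - r.1 ** r.2) ** P ** (e - r.1 ** r.2)) <= d n]}.
 by apply: cid; have [t' [r h]] := inv_sqrt el er pb (d0 n); exists (t', r).
have [q [pq qq lq]] := np_sqrt el er pb.
pose r n := (sval (ex n)).2.
(* The root of [b] delivered with each approximate inverse is the fixed [q], since positive square
   roots are unique. *)
have hr n : [/\ np e (r n), bic b (r n), nm (r n ** b ** r n) <= 1 /\ e - r n ** b ** r n = (d n)%:C *: (r n ** r n),
 nm (q - q ** (q ** r n)) ^+ 2 <= d n & nm ((e - q ** r n) ** P ** (e - q ** r n)) <= d n].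
 rewrite /r; case: (ex n) => -[t' r'] /= [[pt' t't'] pr' [bt' br'] [h1 h2] [h3 h4]]. have tq : t' = q.
 apply/subr0_eq/nm_le0; apply: (sqrt_close el er) => //. by rewrite qq t't' subrr; exact: np0.
 by rewrite qq t't' expr0n scale0r add0r subrr; exact: np0. by rewrite tq in h3 h4; split => //; exact: h4.
clearbody r; clear ex.
have bq := lat_bicU el er lq; have [sq _] := pq; have [sb _] := pb.
pose X n := s ** r n ** f.
pose rn n := aop (X n) rho : hvec A J.
have rnE n : rn n = aop (s ** r n) y by [].
(* Replacing [P] by the larger [b] bounds the difference by the norm of [q^2 (r n - r m)], and
   [q^2 r n] is within [sqrt (d n)] of [q]. *)
have dec m n : nm (rn n - rn m) <= Num.sqrt (d n) + Num.sqrt (d m).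
 have [prn bn [_ _] hn _] := hr n; have [prm bm [_ _] hm _] := hr m. have [[srn _] [srm _]] := conj prn prm.
 pose k := q ** (r n - r m). have bk : bic b k by apply: bicM => //; exact: bicB. have sk : sa k.
 apply: sa_comm => //; first exact: saB. by ncc e el er b.
 have -> : rn n - rn m = aop (s ** (r n - r m)) y by rewrite !rnE amulBr.
 have h1 : nm (aop (s ** (r n - r m)) y : hvec A J) <= nm (k ** q).
 rewrite -ler_sqr ?nnegrE ?nm_ge0// -nm_theta -theta_conj -/b.
 have -> : s ** (r n - r m) ** b ** star (s ** (r n - r m)) = star (k ** s) ** (k ** s).
 rewrite [star (k ** s)]starM [star (s ** _)]starM sk s_s starB srn srm -{1}qq.
 have -> : s ** k ** (k ** s) = s ** (k ** k) ** s by nc.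
 have -> : k ** k = (r n - r m) ** (q ** q) ** (r n - r m) by rewrite /k; ncc e el er b. by nc.
 rewrite nmSS -nmSSr -[leRHS]nmSSr [star (k ** s)]starM [star (k ** q)]starM sk s_s sq.
 have -> : k ** s ** (s ** k) = star k ** P ** k by rewrite sk -ss; nc.
 have -> : k ** q ** (q ** k) = star k ** b ** k by rewrite sk -qq; nc. apply: (np_mono el er); first exact: np_conj.
 by rewrite -amulBl -amulBr; exact: np_conj. bnd h1.
 have -> : k ** q = (q - q ** (q ** r m)) - (q - q ** (q ** r n)) by rewrite /k; ncc e el er b.
 bnd nmB; rewrite addrC; apply: lerD. by apply: nm_le_sqrt => //; exact: ltW. by apply: nm_le_sqrt => //; exact: ltW.
have d_small u : 0 < u -> \ev n, Num.sqrt (d n) < u.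
 move=> u0; have [N h] := inv_nat_lt (mulr_gt0 u0 u0); exists N => n /h dn.
 by rewrite -(ltr_pXn2r (n := 2)) ?nnegrE ?sqrtr_ge0 ?ltW// sqr_sqrtr 1?ltW// expr2.
have rc : caus rn. move=> u u0; have u2 : 0 < u / 2 by lra. have [N h] := d_small _ u2; exists N => m n /h dm /h dn.
 bnd (dec n m); lra.
have [rho' rl] := caus_cvs rc.
exists P, rho', X; split => //.
- have thn n : nm (theta (rn n) (rn n) - P) <= d n. have [prn bn [h1 h2] _ _] := hr n; have [srn _] := prn.
 have -> : theta (rn n) (rn n) - P = - ((d n)%:C *: (star (r n ** s) ** (r n ** s))).
 rewrite rnE -theta_conj -/b !starM srn s_s -ss.
 have -> : (d n)%:C *: (s ** r n ** (r n ** s)) = s ** ((d n)%:C *: (r n ** r n)) ** s by nc.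
 by rewrite -h2; ncu e el er. rewrite nmN nmZ0 ?(ltW (d0 n))// ler_piMr ?(ltW (d0 n))// nmSS -nmSSr starM srn s_s.
 apply: le_trans h1; apply: (np_mono el er).
 by have -> : r n ** s ** (s ** r n) = star (r n) ** P ** r n; [rewrite srn -ss; nc|exact: np_conj].
 have -> : r n ** b ** r n - r n ** s ** (s ** r n) = star (r n) ** (b - P) ** r n. by rewrite srn -ss; nc.
 exact: np_conj. apply: (@cvs_unique _ _ (fun n => theta (rn n) (rn n))). move=> u u0; pose M := 2 * nm rho' + 1.
 have M0 : 0 < M by have := nm_ge0 rho'; rewrite /M; lra.
 have [N1 k1] := rl 1 ltr01; have [N2 k2] := rl (u / M) (divr_gt0 u0 M0).
 exists (maxn N1 N2) => n; rewrite geq_max => /andP[/k1 n1 /k2 n2]. bnd theta_dist. via (nm (rn n - rho') * M).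
 apply: ler_wpM2l; first exact: nm_ge0. by have := nm_ler (rn n) rho'; rewrite /M; lra. by rewrite -ltr_pdivlMr.
 move=> u u0; have [N h] := inv_nat_lt u0; exists N => n /h dn. exact: le_lt_trans (thn n) dn.
split => //.
(* With [w = q r n], the distance from [rn n] to [y] is the norm of [s w - q]. It splits into
   [s (1 - w)], small because [P <= b], and [s - q], a difference of roots of [P] and [b]. *)
have ry : nm (rho' - y) <= Num.sqrt (2 * t). apply/ler_addgt0Pr => u u0; have u2 : 0 < u / 2 by lra.
 have [N1 k1] := d_small _ u2; have [N2 k2] := rl _ u2. pose n := maxn N1 N2.
 have [prn bn _ _ h3] := hr n; have [srn _] := prn. have h : nm (rn n - y) <= Num.sqrt (d n) + Num.sqrt (2 * t).
 have -> : rn n - y = aop (s ** r n - e) y by rewrite rnE. pose w := q ** r n; have bw : bic b w by exact: bicM.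
 have sw : sa w by apply: sa_comm => //; ncc e el er b.
 have -> : nm (aop (s ** r n - e) y : hvec A J) = nm (s ** w - q).
 apply/eqP; rewrite -(eqrXn2 (n := 2)) ?nm_ge0// -nm_theta -theta_conj -/b -nmSSr.
 rewrite !starB [star (s ** w)]starM [star (s ** r n)]starM srn s_s sw sq (sa_unit el) -qq.
 have qr : q ** r n = r n ** q by ncc e el er b.
 have -> : (s ** w - q) ** (w ** s - q) = (s ** r n - e) ** (q ** q) ** (r n ** s - e).
 rewrite /w {1}qr; ncu e el er. by []. have -> : s ** w - q = - (s ** (e - w)) + (s - q) by ncu e el er.
 bnd nmD; rewrite nmN; apply: lerD. apply: nm_le_sqrt; first exact: ltW.
 rewrite -nmSS starM s_s starB sw (sa_unit el).
 by have -> : (e - w) ** s ** (s ** (e - w)) = (e - w) ** P ** (e - w); [rewrite -ss; nc|exact: h3].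
 rewrite nmBC; apply: (sqrt_close el er) => //. by rewrite qq ss. rewrite qq ss sqr_sqrtr//.
 have -> : (2 * t)%:C *: e + P - b = (2 * t)%:C *: e - (b - P) by nc. by apply: (np_le_U el) => //; exact: saB.
 have n1 := k1 n (leq_maxl _ _); have n2 := k2 n (leq_maxr _ _). rewrite nmBC in n2; bnd (nm_tri _ (rn n) _).
 bnd (lerD (ltW n2) (le_trans h (lerD (ltW n1) (lexx _)))). by rewrite addrA -splitr addrC.
have h4 : Num.sqrt (3 * t) + Num.sqrt (2 * t) <= 4 * Num.sqrt t. rewrite !sqrtrM//. have : Num.sqrt 3 <= 2 :> R.
 by rewrite -ler_sqr ?nnegrE ?sqrtr_ge0// sqr_sqrtr//; lra. have : Num.sqrt 2 <= 2 :> R.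
 by rewrite -ler_sqr ?nnegrE ?sqrtr_ge0// sqr_sqrtr//; lra. have := sqrtr_ge0 t; nra.
bnd (nm_tri _ y _); apply: le_trans h4; rewrite addrC; exact: lerD.
Qed.

End PerturbVector.

(** * Scalar matrices and block algebras *)

Section ComplexComplete.
Context {R}.

Lemma nmc_def (c : R[i]^o) : nm c = Num.sqrt (Re c ^+ 2 + Im c ^+ 2).
by case: c => a b. Qed.

Lemma Re_nm (c : R[i]^o) : `|Re c| <= nm c.
rewrite nmc_def -sqrtr_sqr ler_sqrt; first by rewrite lerDl sqr_ge0.
by rewrite addr_ge0// sqr_ge0.
Qed.

Lemma Im_nm (c : R[i]^o) : `|Im c| <= nm c.
rewrite nmc_def -sqrtr_sqr ler_sqrt; first by rewrite lerDr sqr_ge0.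
by rewrite addr_ge0// sqr_ge0.
Qed.

Lemma nmc_le (c : R[i]^o) : nm c <= `|Re c| + `|Im c|.
rewrite nmc_def -[leRHS]ger0_norm ?addr_ge0// -sqrtr_sqr ler_sqrt ?sqr_ge0//.
rewrite sqrrD !real_normK ?num_real// addrAC lerDl.
by [].
Qed.

Lemma real_cvs (u : nat -> R) :
 (forall e, 0 < e -> exists N, forall m n, (N <= m)%N -> (N <= n)%N -> `|u m - u n| < e) ->
 exists l, forall e, 0 < e -> \ev n, `|u n - l| < e.
move=> uc; suff /cvg_ex[l /cvgrPdist_lt ul] : cvgn u.
 exists l => e /ul[N _ h]; exists N => n Nn; rewrite distrC; exact: h.
apply: cauchy_cvg; apply: cauchy_exP => e e0.
have [N uN] := uc e e0; exists (u N); exists N => // n Nn /=.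
by rewrite /=; exact: uN.
Qed.

Let complex_cvs (u : nat -> R[i]^o) : caus u -> exists l, cvs u l.
move=> uc.
have [a ua] : exists l, forall e, 0 < e -> \ev n, `|Re (u n) - l| < e.
 apply: real_cvs => e /uc[N h]; exists N => m n Nm Nn. apply: le_lt_trans (h m n Nm Nn).
 by have := Re_nm (u m - u n); case: (u m) => ? ?; case: (u n).
have [b ub] : exists l, forall e, 0 < e -> \ev n, `|Im (u n) - l| < e.
 apply: real_cvs => e /uc[N h]; exists N => m n Nm Nn. apply: le_lt_trans (h m n Nm Nn).
 by have := Im_nm (u m - u n); case: (u m) => ? ?; case: (u n).
exists (a +i* b) => e e0; have e2 : 0 < e / 2 by lra.
have [N1 h1] := ua _ e2; have [N2 h2] := ub _ e2.
exists (maxn N1 N2) => n; rewrite geq_max => /andP[/h1 k1 /h2 k2].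
bnd nmc_le; move: k1 k2; case: (u n) => c d /=; lra.
Qed.
HB.instance Definition _ := Uniform_isComplete.Build R[i]^o (mk_complete complex_cvs).
End ComplexComplete.

Definition Cx R : cstar R := R[i]^o.

Section ScalarMatrices.
Context {R} {A : cstar R} {J : finType}.
Local Notation E := (hv A J).
Local Notation C := (Cx R).
Local Notation L := (adjop (hv C J)).

Definition ent (T : L) (p q : J) : C := aop T (hdelta q (1 : C)) p.

Lemma ent_mxo (x : J -> J -> C) p q : ent (mxo x) p q = x p q.
by rewrite /ent mxo_delta [LHS]mulr1. Qed.

Lemma mxo_ent (T : L) : mxo (ent T) = T.
apply: adjop_eq => v; apply/funext => p; rewrite mxoE.
have -> : v = \sum_q v q *: hdelta q (1 : C).
 apply/funext => i; rewrite (_ : (\sum_q _) i = \sum_q v q *: hdelta q (1 : C) i); last first.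
 by elim/big_rec2: _ => // q _ y _ <-. rewrite (bigD1 i)//= /hdelta eqxx big1 ?addr0 ?[RHS]mulr1// => j /negbTE.
 by rewrite eq_sym => ->; rewrite scaler0.
rewrite aop_sum (_ : (\sum_q _) p = \sum_q v q *: ent T p q); last first. elim/big_rec2: _ => // q _ y _ <-.
 by rewrite aopZ.
each q; rewrite [LHS]mulrC; congr (_ * _).
rewrite (_ : (\sum_q0 _) q = \sum_q0 v q0 *: hdelta q0 (1 : C) q); last first. by elim/big_rec2: _ => // i _ y _ <-.
rewrite (bigD1 q)//= /hdelta eqxx big1 ?addr0 ?[LHS]mulr1// => j /negbTE.
by rewrite eq_sym => ->; rewrite scaler0.
Qed.

Lemma ent_inj (S T : L) : (forall p q, ent S p q = ent T p q) -> S = T.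
move=> h; rewrite -(mxo_ent S) -(mxo_ent T); congr mxo.
by apply/funext => p; apply/funext => q.
Qed.
Lemma entD (S T : L) p q : ent (S + T) p q = ent S p q + ent T p q. by []. Qed.
Lemma entZ (c : R[i]) (T : L) p q : ent (c *: T) p q = c *: ent T p q. by []. Qed.
Lemma entM (S T : L) p q : ent (S ** T) p q = \sum_k ent S p k * ent T k q.
by rewrite -{1}(mxo_ent S) -{1}(mxo_ent T) -mxoM ent_mxo. Qed.
Lemma entS (T : L) p q : ent (star T) p q = conjc (ent T q p).
by rewrite -{1}(mxo_ent T) -mxoS ent_mxo. Qed.
Lemma ent0 p q : ent 0 p q = 0. by []. Qed.
Lemma ent1 p q : ent aid p q = (p == q)%:R.
by rewrite /ent aidE /hdelta; case: eqP. Qed.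

Definition smact (x : J -> J -> C) (v : hvec A J) : hvec A J := fun p => \sum_q x p q *: v q.

Lemma smx_set x : adj_set (E := E) (smact x).
split. exists (\sum_p \sum_q nm (x p q)) => v. apply: le_trans (nm_le_sum' _) _; rewrite mulr_suml; each p.
 bnd_sum; rewrite mulr_suml; each q.
 by rewrite nmCZ; apply: ler_wpM2l; [exact (nm_ge0 (x p q : R[i]^o))|exact: nm_coord'].
exists (smact (fun p q => conjc (x q p))) => v w; rewrite !ip_hv !hipE.
under eq_bigr => p _ do rewrite star_sum amulsl.
under [RHS]eq_bigr => p _ do rewrite amulsr.
rewrite exchange_big; each q; each p.
by rewrite starZc amulZl amulZr.
Qed.
Definition smx (x : J -> J -> C) : adjop E := mkop (smx_set x).

(** The amplification [T (x) 1] of a scalar matrix, acting on [A^J]. *)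
Definition sop (T : L) : adjop E := smx (ent T).

Lemma sopE T v p : aop (sop T) v p = \sum_q ent T p q *: v q. by []. Qed.

Lemma sop_hom : star_hom sop.
split.
- move=> c S T; apply: adjop_eq => v; apply/funext => p.
 rewrite aopDx aopZx hvDE hvZE !sopE scaler_sumr -big_split; each q. by rewrite entD entZ scalerDl scalerA.
- move=> S T; apply: adjop_eq => v; apply/funext => p; rewrite aopM !sopE.
 under eq_bigr => q _ do rewrite entM scaler_suml. rewrite exchange_big; each k.
 by rewrite scaler_sumr; each q; rewrite scalerA.
- move=> T; apply: adjop_eq => v; apply: (ip_inj (E := E)) => w. rewrite -ip_adj'; have [_ [T' h]] := smx_set (ent T).
 rewrite !ip_hv !hipE. under eq_bigr => p _ do rewrite sopE star_sum amulsl.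
 under [RHS]eq_bigr => p _ do rewrite sopE amulsr. rewrite exchange_big; each q; each p.
 by rewrite entS starZc conjcK amulZl amulZr.
Qed.

Lemma sop1 : sop aid = aid.
apply: adjop_eq => v; apply/funext => p; rewrite sopE aidE (bigD1 p)//= ent1 eqxx scale1r.
by rewrite big1 ?addr0// => q; rewrite ent1 eq_sym => /negbTE ->; rewrite scale0r.
Qed.
Lemma nm_sop T : nm (sop T) <= nm T.
exact: (hom_contr aid_l aid_r sop_hom). Qed.

Lemma sop_np (T : L) : np aid T -> np aid (sop T).
have [l m s] := sop_hom.
move=> /(np_sqrt aid_l aid_r)[r [[sr _] <- _]]; rewrite m.
by apply: (sq_np aid_l aid_r); rewrite /sa -s sr.
Qed.

Definition dop (d : J -> A) : adjop E := mxo (fun p q => if p == q then d p else 0).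
Lemma dopE d v p : aop (dop d) v p = d p ** v p.
rewrite mxoE (bigD1 p)//= eqxx big1 ?addr0// => q; rewrite eq_sym => /negbTE ->.
by rewrite amul0r.
Qed.

Lemma dop_np d : (forall p, positive (d p)) -> np aid (dop d).
move=> dp; apply: ip_np. rewrite /sa /dop -mxoS; apply: eq_mxo => p q.
 by rewrite eq_sym; case: eqP => [->|_]; [exact: pos_sa|rewrite star0].
move=> z; rewrite hipE; apply: pos_sum => p _; rewrite dopE amulA.
exact: pos_conj.
Qed.

Lemma nm_dop d (M : R) : 0 <= M -> (forall p, positive (d p)) -> (forall p, nm (d p) <= M) -> nm (dop d) <= M.
move=> M0 dp dM; apply: (np_bnd aid_l aid_r) => //; first exact: dop_np.
apply: ip_np; first by apply: saB; [exact: (saU aid_l)|case: (dop_np dp)].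
move=> z; rewrite aopDx aopNx aopZx aidE hipDr hipNr hipZr !hipE.
rewrite scaler_sumr -sumrB; apply: pos_sum => p _; rewrite dopE amulA -amulZr.
have [[l lM lS] n] := lmul_iso A; apply/pos_lmul.
rewrite (linB l) !lM (linZ l) lS.
have h1 : nm (lmul (d p)) <= M by rewrite n.
have px := (pos_lmul (d p)).1 (dp p).
have := np_conj aid_l aid_r (lmul (z p)) (np_le_U aid_l (proj1 px) h1).
by rewrite amulBr amulZr aid_r amulBl amulZl amulZr.
Qed.

Lemma sop_dop (T : L) d : (forall p q, ent T p q != 0 -> d p = d q) -> sop T ** dop d = dop d ** sop T.
move=> h; apply: adjop_eq => v; apply/funext => p; rewrite !aopM sopE dopE sopE amulsr.
each q; rewrite dopE amulZr.
by have [->|/h ->//] := eqVneq (ent T p q) 0; rewrite !scale0r.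
Qed.

End ScalarMatrices.

(** The colour projections are locked so that conversion does not expand their matrices. *)
Lemma cproj_key : unit. exact tt. Qed.

Section Blocks.
Context {R} {J : finType}.
Local Notation C := (Cx R).
Local Notation L := (adjop (hv C J)).
Implicit Types S T : L.

Lemma nm_ent T a b : nm (ent T a b) <= nm T.
by rewrite -[in leRHS](mxo_ent T); exact: nm_entry. Qed.

Variable r : J -> J.

(** The matrices that are block diagonal for the fibres of [r]: a direct sum of full matrix
    algebras. *)
Definition block T : Prop := forall a b, r a != r b -> ent T a b = 0.

Lemma block0 : block 0. by []. Qed.
Lemma block1 : block aid.
by move=> a b; rewrite ent1; case: (a =P b) => [->|//]; rewrite eqxx. Qed.
Lemma blockD S T : block S -> block T -> block (S + T).
by move=> s t a b h; rewrite entD s// t// addr0. Qed.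
Lemma blockZ (c : R[i]) T : block T -> block (c *: T).
by move=> t a b h; rewrite entZ t// scaler0. Qed.
Lemma blockS T : block T -> block (star T).
by move=> t a b h; rewrite entS t 1?eq_sym// rmorph0. Qed.
Lemma blockM S T : block S -> block T -> block (S ** T).
move=> s t a b h; rewrite entM big1// => k _.
have [e|e] := eqVneq (r a) (r k); last by rewrite s// mul0r.
by rewrite t ?mulr0// -e.
Qed.

Variables (I : eqType) (kap : J -> I).

Definition cproj i : L := locked_with cproj_key
 (mxo (A := C) (fun a b => if a == b then (kap a == i)%:R else 0 : R[i])).

Lemma ent_cproj i a b : ent (cproj i) a b = if a == b then (kap a == i)%:R else 0 :> R[i].
by rewrite /cproj unlock ent_mxo. Qed.
Lemma cproj_block i : block (cproj i).
by move=> a b; rewrite ent_cproj; case: (a =P b) => [->|//]; rewrite eqxx. Qed.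

Lemma cprojS i : star (cproj i) = cproj i.
apply: ent_inj => a b; rewrite entS !ent_cproj eq_sym.
by case: eqP => [->|_]; [case: (_ == i); rewrite ?rmorph0 ?rmorph1|rewrite rmorph0].
Qed.

Lemma cprojMl i T a b : ent (cproj i ** T) a b = if kap a == i then ent T a b else 0.
rewrite entM (bigD1 a)//= ent_cproj eqxx big1 ?addr0 => [|k ka]. by case: eqP => _; rewrite ?mul1r ?mul0r.
by rewrite ent_cproj eq_sym (negbTE ka) mul0r.
Qed.

Lemma cprojMr i T a b : ent (T ** cproj i) a b = if kap b == i then ent T a b else 0.
rewrite entM (bigD1 b)//= ent_cproj eqxx big1 ?addr0 => [|k ka]. by case: eqP => _; rewrite ?mulr1 ?mulr0.
by rewrite ent_cproj (negbTE ka) mulr0.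
Qed.

Lemma cproj_idem i : cproj i ** cproj i = cproj i.
apply: ent_inj => a b; rewrite cprojMl ent_cproj.
by case: (a == b); case: (kap a == i).
Qed.

Lemma cproj_orth i j : i != j -> cproj i ** cproj j = 0.
move=> ij; apply: ent_inj => a b; rewrite cprojMl ent_cproj ent0.
by case: (kap a =P i) => // ->; rewrite (negbTE ij); case: (a == b).
Qed.

Hypothesis kr : forall a, kap (r a) = kap a.

Lemma cproj_comm i T : block T -> cproj i ** T = T ** cproj i.
move=> bT; apply: ent_inj => a b; rewrite cprojMl cprojMr.
have [e|/bT ->] := eqVneq (r a) (r b); last by case: ifP; case: ifP.
by rewrite -(kr a) e kr.
Qed.

Lemma nm_proj (p : L) : star p = p -> p ** p = p -> nm p <= 1.
move=> ps pp; have [->|p0] := eqVneq (nm p) 0; first exact: ler01.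
have ppos : 0 < nm p by rewrite lt_neqAle eq_sym p0 nm_ge0.
have := nm_sq ps; rewrite pp expr2 => h.
by rewrite -(ler_pM2l ppos) -h mulr1.
Qed.

End Blocks.

Lemma sum_cproj R (J I : finType) (kap : J -> I) : \sum_i cproj (R := R) kap i = aid.
apply: ent_inj => a b.
have -> : ent (\sum_i cproj (R := R) kap i) a b = \sum_i ent (cproj (R := R) kap i) a b.
 elim/big_rec2: _ => [|i x y _ <-]; [exact: ent0|exact: entD].
rewrite (bigD1 (kap a))//= ent_cproj eqxx big1 => [|i]; last first.
 by rewrite ent_cproj eq_sym => /negbTE ->; case: (a == b).
by rewrite ent1 addr0; case: (a == b).
Qed.

Section BlockMaps.
Context {R} {Q : cstar R} {J : finType}.

(** Complete positivity of a map into [M_J(C)], with a matrix of matrices flattened to the index set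
    [I * J]. *)
Definition cpm (psi : Q -> J -> J -> Cx R) : Prop := forall (I : finType) (X : I -> I -> Q),
 gpos X -> gpos (fun u v : I * J => psi (X u.1 v.1) u.2 v.2).

Record bmap (r : J -> J) (psi : Q -> J -> J -> Cx R) : Prop := Bmap { bm_lin : forall a b, linear (fun x => psi x a b);
 bm_cp : cpm psi; bm_contr : forall x, nm (mxo (psi x)) <= nm x; bm_block : forall x a b, r a != r b -> psi x a b = 0
}.

Lemma bm_linear r psi : bmap r psi -> linear (fun x => mxo (psi x)).
move=> h c x y; rewrite -mxoZ -mxoD; apply: eq_mxo => a b.
exact: (bm_lin h a b).
Qed.

Lemma bm_gpos psi (I : finType) (X : I -> I -> Q) : cpm psi -> gpos X -> gpos (fun u v => mxo (psi (X u v))).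
move=> h /h[M [z zE]].
case: (pickP (@predT J)) => [k0 _|J0]; last first. exists void, (fun _ _ => 0) => p q; rewrite big_pred0 => [|[]//].
 by apply: adjop_eq => v; apply/funext => j; have := J0 j.
exists M, (fun l u => mxo (fun k b => if k == k0 then z l (u, b) else 0)) => u v.
under eq_bigr => l _ do rewrite -mxoS -mxoM.
rewrite -mxo_sum; apply: eq_mxo => a b.
rewrite (zE (u, a) (v, b)); each l.
rewrite (bigD1 k0)//= eqxx big1 ?addr0// => k /negbTE ->.
by rewrite star0 amul0r.
Qed.

End BlockMaps.

(** * Approximations and their finite-dimensional models *)

Section Dim.
Context {R}.

(** The proposition [dr] selects the dimension: [False] gives nuclear dimension, [True]
    decomposition rank, so that one argument serves both. *)
Definition approx_at (dr : Prop) (P : cstar R) n (S : seq P) (e : R) : Prop :=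
 exists (F : cstar R) (psi : P -> F) (phi : F -> P), [/\ nuc_approx n psi phi, dr -> contractive phi
 & forall a, a \in S -> nm (phi (psi a) - a) < e].

Definition dim_le (dr : Prop) (P : cstar R) n : Prop := forall (S : seq P) (e : R), 0 < e -> approx_at dr n S e.

Lemma nm_ltC (V : normedModType R[i]) (x : V) (e : R) : `|x| < e%:C <-> nm x < e.
by rewrite normE ltcR. Qed.

Lemma nuc_dim_leE (P : cstar R) n : nuc_dim_le P n <-> dim_le False P n.
split=> h S e e0; have [F [psi [phi]]] := h S e e0. by move=> [h1 h2]; exists F, psi, phi; split => // a /h2/nm_ltC.
by move=> [h1 _ h2]; exists F, psi, phi; split => // a /h2/nm_ltC.
Qed.

Lemma dec_rank_leE (P : cstar R) n : dec_rank_le P n <-> dim_le True P n.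
split=> h S e e0; have [F [psi [phi]]] := h S e e0. by move=> [h1 h2 h3]; exists F, psi, phi; split => // a /h3/nm_ltC.
by move=> [h1 h2 h3]; exists F, psi, phi; split => //; [exact: h2|move=> a /h3/nm_ltC].
Qed.

End Dim.

Lemma fin_dim_sub R (A : cstar R) (D : cstarSubalg A) (K : finType) (e : K -> csubstar D) :
 (forall x : csubstar D, exists c : K -> R[i], val x = \sum_k c k *: val (e k)) -> finite_dimensional (csubstar D).
move=> h; exists #|K|, (fun i => e (enum_val i)) => x; have [c cE] := h x.
exists (fun i => c (enum_val i)); apply: val_inj; rewrite cE raddf_sum /=.
rewrite (reindex (enum_val (A := K))) //=; exists enum_rank => i _. exact: enum_valK.
exact: enum_rankK.
Qed.
Lemma val_iso R (A : cstar R) (D : cstarSubalg A) : isohom (fun x : csubstar D => val x).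
by split. Qed.

Section Model.
Context {R} {J : finType} (r : J -> J) (p : adjop (hv (Cx R) J)).
Local Notation L := (adjop (hv (Cx R) J)).
Hypotheses (ps : star p = p) (pp : p ** p = p) (pb : block r p).

(** The corner cut by [p] out of the block algebra; it will be the finite-dimensional algebra of the
    approximations. *)
Definition corner_set : set L := [set T | [/\ p ** T = T, T ** p = T & block r T]].

Program Definition corner_sub : starSubalg L := @StarSubalg R L corner_set _ _ _ _ _.
Next Obligation. by split; [rewrite amulr0|rewrite amul0r|exact: block0]. Qed.
Next Obligation.
move=> x y [x1 x2 x3] [y1 y2 y3]; split; last exact: blockD. by rewrite amulDr x1 y1.
by rewrite amulDl x2 y2.
Qed.
Next Obligation.
move=> c x [x1 x2 x3]; split; last exact: blockZ. by rewrite amulZr x1.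
by rewrite amulZl x2.
Qed.
Next Obligation.
move=> x y [x1 x2 x3] [y1 y2 y3]; split; last exact: blockM. by rewrite amulA x1.
by rewrite -amulA y2.
Qed.
Next Obligation.
move=> x [x1 x2 x3]; split; last exact: blockS. by rewrite -{1}ps -starM x2.
by rewrite -{1}ps -starM x1.
Qed.

Lemma closed_lip (V : normedModType R[i]) (W : normedModType R[i]) (f : V -> W) (M : R) :
 (forall x y, nm (f x - f y) <= M * nm (x - y)) -> closed [set x | f x = 0].
move=> fM; apply/(closed_nmP _) => x h; apply: nm_small => e e0.
have M1 : 0 < `|M| + 1 by rewrite ltr_wpDl.
have [y fy xy] := h _ (divr_gt0 e0 M1).
have := fM x y; rewrite fy subr0 => /le_trans; apply.
via ((`|M| + 1) * nm (x - y)). by apply: ler_wpM2r; [exact: nm_ge0|rewrite ler_wpDr// ler_norm].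
by rewrite mulrC -ler_pdivlMr// ltW.
Qed.

Lemma closed_eq_lin (V W : cstar R) (f : V -> W) (M : R) :
 linear f -> (forall x, nm (f x) <= M * nm x) -> closed [set x | f x = 0].
by move=> fl fM; apply: (closed_lip (M := M)) => x y; rewrite -(linB fl). Qed.

Lemma corner_closed : closed corner_set.
have -> : corner_set = [set T | p ** T - T = 0] `&` [set T | T ** p - T = 0] `&`
 \bigcap_(ab in [set ab : J * J | r ab.1 != r ab.2]) [set T | ent T ab.1 ab.2 = 0]. apply/seteqP; split=> T.
 by move=> [h1 h2 h3]; split => [|[a b] h /=]; [split => /=; rewrite ?h1 ?h2 subrr|exact: h3].
 move=> [[/eqP h1 /eqP h2] h3]; rewrite subr_eq0 in h1; rewrite subr_eq0 in h2.
 by split; [exact/eqP|exact/eqP|move=> a b h; exact: (h3 (a, b))].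
apply: closedI; [apply: closedI|apply: closed_bigI => ab _].
- apply: (closed_eq_lin (M := nm p + 1)) => [c x y|x]. by rewrite amulDr; nc.
 by bnd nmB; rewrite mulrDl mul1r lerD2r; exact: nmM.
- apply: (closed_eq_lin (M := nm p + 1)) => [c x y|x]. by rewrite amulDl; nc.
 by bnd nmB; rewrite mulrDl mul1r lerD2r mulrC; exact: nmM.
- apply: (@closed_lip _ (Cx R) (fun T => ent T ab.1 ab.2) 1) => x y.
 have -> : ent x ab.1 ab.2 - ent y ab.1 ab.2 = ent (x - y) ab.1 ab.2. by []. by rewrite mul1r; exact: nm_ent.
Qed.

Definition corner : cstarSubalg L := @CStarSubalg R L corner_sub corner_closed.
Definition Fm : cstar R := csubstar corner.

Lemma FmP (T : Fm) : [/\ p ** val T = val T, val T ** p = val T & block r (val T)].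
exact: (val_substar T). Qed.

Definition mkF (T : L) (bT : block r T) : Fm.
apply: (@mksub _ _ corner (p ** T ** p)); split.
- by rewrite !amulA pp.
- by rewrite -amulA pp.
- by apply: blockM => //; exact: blockM.
Defined.

Lemma mkFE T (bT : block r T) : val (mkF bT) = p ** T ** p. by []. Qed.

Definition bunit (ab : J * J) : L :=
 mxo (A := Cx R) (fun a b => if (r ab.1 == r ab.2) && ((a, b) == ab) then 1 else 0 : R[i]).

Lemma bunit_block ab : block r (bunit ab).
move=> a b h; rewrite ent_mxo; case: ((a, b) =P ab) => [E|_]; last by rewrite andbF.
by rewrite -E (negbTE h).
Qed.

Lemma block_bunit T : block r T -> T = \sum_ab ent T ab.1 ab.2 *: bunit ab.
move=> bT; apply: ent_inj => a b.
have -> : ent (\sum_(ab : J * J) ent T ab.1 ab.2 *: bunit ab) a b =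
 \sum_(ab : J * J) ent T ab.1 ab.2 * ent (bunit ab) a b.
 elim/big_rec2: _ => [|i x y _ <-]; [exact: ent0|by rewrite entD entZ].
rewrite (bigD1 (a, b))//= ent_mxo eqxx andbT big1 ?addr0 => [|ab h].
 by case: eqP => [_|/eqP/bT ->]; rewrite ?mulr1 ?mulr0.
by rewrite ent_mxo [_ == ab]eq_sym (negbTE h) andbF mulr0.
Qed.

Lemma Fm_fin : finite_dimensional Fm.
apply: (fin_dim_sub (e := fun ab => mkF (bunit_block ab))) => T.
have [T1 T2 T3] := FmP T; exists (fun ab => ent (val T) ab.1 ab.2).
transitivity (p ** val T ** p); first by rewrite T1.
rewrite [in LHS](block_bunit T3) amulsr amulsl.
by each ab; rewrite amulZr amulZl.
Qed.

Section Colours.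
Variables (n : nat) (kap : J -> 'I_n.+1).
Hypothesis kr : forall a, kap (r a) = kap a.

Definition colour_set i : set Fm := [set T | cproj kap i ** val T = val T].

Program Definition colour_sub i : starSubalg Fm := @StarSubalg R Fm (colour_set i) _ _ _ _ _.
Next Obligation. by move=> i; rewrite /colour_set /= amulr0. Qed.
Next Obligation. by move=> i x y h1 h2; rewrite /colour_set /= amulDr h1 h2. Qed.
Next Obligation. by move=> i c x h1; rewrite /colour_set /= amulZr h1. Qed.
Next Obligation. by move=> i x y h1 h2; rewrite /colour_set /= amulA h1. Qed.
Next Obligation.
move=> i x h1; rewrite /colour_set /= -{1}(cprojS kap i) -starM -(cproj_comm kr) ?h1//.
by case: (FmP x).
Qed.

Lemma colour_closed i : closed (colour_set i).
have -> : colour_set i = [set T : Fm | cproj kap i ** val T - val T = 0].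
 apply/seteqP; split=> T; rewrite /colour_set /=; first by move=> ->; rewrite subrr.
 by move/eqP; rewrite subr_eq0 => /eqP.
apply: (closed_lip (M := nm (cproj kap i) + 1)) => x y.
have [[vl _ _] vn] := val_iso corner.
have -> : nm (x - y) = nm (val x - val y) by rewrite -(linB vl) vn.
have -> : cproj kap i ** val x - val x - (cproj kap i ** val y - val y) =
 cproj kap i ** (val x - val y) - (val x - val y) by nc.
by bnd nmB; rewrite mulrDl mul1r lerD2r; exact: nmM.
Qed.

Definition colour i : cstarSubalg Fm := @CStarSubalg R Fm (colour_sub i) (@colour_closed i).

Lemma colour_ideal i : is_ideal (colour i).
move=> x y h; split; rewrite /= /colour_set /=. have [_ _ bx] := FmP x. by rewrite amulA (cproj_comm kr)// -amulA h.
by rewrite amulA h.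
Qed.

Lemma colour_sum : is_direct_sum colour.
have vl : linear (fun T : Fm => val T) by case: (val_iso corner).1.
move=> x; have [x1 x2 x3] := FmP x.
have qx i : [/\ p ** (cproj kap i ** val x) = cproj kap i ** val x,
 cproj kap i ** val x ** p = cproj kap i ** val x & block r (cproj kap i ** val x)].
 split; last by apply: blockM => //; exact: cproj_block. by rewrite amulA -(cproj_comm kr)// -amulA x1.
 by rewrite -amulA x2.
exists [ffun i => @mksub _ _ corner _ (qx i) : Fm]; split. split=> [i|].
 by rewrite ffunE /= /colour_set /= amulA cproj_idem. apply: val_inj; rewrite (lin_sum vl).
 under eq_bigr => i _ do rewrite ffunE /=. by rewrite -amulsl sum_cproj aid_l.
move=> y [y1 y2]; apply/ffunP => i; rewrite ffunE; apply: val_inj; rewrite /= y2 (lin_sum vl).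
rewrite amulsr (bigD1 i)//= y1 big1 ?addr0// => j ji.
by rewrite -(y1 j) amulA cproj_orth 1?eq_sym// amul0r.
Qed.

End Colours.
End Model.

Section HvecNorms.
Context {R} {A : cstar R} {J : finType}.
Implicit Types x y : hvec A J.

Lemma nm_hip x y : nm (hip x y) <= nm x * nm y.
by rewrite -ip_hv; exact: ip_CS. Qed.
Lemma nm_aop' (T : adjop (hv A J)) x : nm (aop T x : hvec A J) <= nm T * nm x.
by have h := nm_aop T x; rewrite -nm_op in h; exact h. Qed.
Lemma hip_adj (T : adjop (hv A J)) x y : hip (aop T x) y = hip x (aop (star T) y).
by rewrite -!ip_hv ip_adj. Qed.

Lemma nm_hip_op (T : adjop (hv A J)) x : nm (hip x (aop T x)) <= nm T * nm x ^+ 2.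
bnd nm_hip; rewrite expr2 mulrCA.
by apply: ler_wpM2l; [exact: nm_ge0|exact: nm_aop'].
Qed.

Lemma nm_hip_dist (T : adjop (hv A J)) x y :
 nm (hip x (aop T x) - hip y (aop T y)) <= nm T * (nm x + nm y) * nm (x - y).
have -> : hip x (aop T x) - hip y (aop T y) = hip (x - y) (aop T x) + hip y (aop T (x - y)).
 by rewrite hipDl hipNl aopB hipDr hipNr; nc.
bnd nmD.
have h1 := nm_hip (x - y) (aop T x); have h2 := nm_hip y (aop T (x - y)).
have h3 := ler_wpM2l (nm_ge0 (x - y)) (nm_aop' T x).
have h4 := ler_wpM2l (nm_ge0 y) (nm_aop' T (x - y)).
bnd (lerD (le_trans h1 h3) (le_trans h2 h4)).
by rewrite le_eqVlt; apply/orP; left; apply/eqP; ring.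
Qed.

End HvecNorms.

(** * From a commuting vector to a decomposable approximation *)

Section OutExact.
Context {R} {Q B : cstar R} (iota : Q -> B) (ii : isohom iota).
Context {J : finType} (r : J -> J) (n : nat) (kap : J -> 'I_n.+1).
Hypothesis kr : forall a, kap (r a) = kap a.
Variables (psi : Q -> J -> J -> Cx R) (hb : bmap r psi).
Local Notation L := (adjop (hv (Cx R) J)).
Variables (p : L) (ps : star p = p) (pp : p ** p = p) (pb : block r p).
Variables (eta : hvec B J) (c : R) (c0 : 0 <= c).
Let eti i : hvec B J := aop (sop (cproj kap i)) eta.
Hypothesis er : forall a b, exists q, iota q = star (eta a) ** eta b.
Hypothesis comm : forall i (T : L), [/\ p ** T = T, T ** p = T & block r T] ->
 sop T ** theta (eti i) (eti i) = theta (eti i) (eti i) ** sop T.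
Hypothesis ci : forall i, c * nm (eti i) ^+ 2 <= 1.

(** This is [c <eta, T eta>] pulled back along [iota]. Preimages are chosen for the entries
    [star (eta a) ** eta b] only, which keeps linearity in [T] visible. *)
Definition out_phi0 (T : L) : Q := \sum_a \sum_b (c%:C * ent T a b) *: sval (cid (er a b)).

Lemma out_phi0_lin : linear out_phi0.
move=> k S T; rewrite /out_phi0 scaler_sumr -big_split; each a.
rewrite scaler_sumr -big_split; each b.
by rewrite entD entZ mulrDr scalerDl scalerA mulrCA.
Qed.

Lemma out_phi0E T : iota (out_phi0 T) = c%:C *: hip eta (aop (sop T) eta).
have [[il _ _] _] := ii; rewrite /out_phi0 (lin_sum il) hipE scaler_sumr.
each a; rewrite (lin_sum il) sopE amulsr scaler_sumr.
by each b; rewrite (linZ il) (svalP (cid (er a b))) amulZr scalerA.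
Qed.

Lemma out_gpos (K : finType) (X : K -> K -> L) : gpos X -> gpos (fun u v => out_phi0 (X u v)).
move=> [M [z zE]]; apply: (gpos_sub ii); have [sl sm ss] := @sop_hom R B J.
exists (M * J)%type, (fun la u => (Num.sqrt c)%:C *: aop (sop (z la.1 u)) eta la.2) => u v.
rewrite out_phi0E zE (lin_sum sl).
have -> : aop (\sum_l sop (star (z l u) ** z l v)) eta = \sum_l aop (sop (star (z l u) ** z l v)) eta.
 by elim/big_rec2: _ => [|l y x _ <-]; rewrite ?aop0x ?aopDx.
rewrite -(pair_bigA _ (fun l a => star ((Num.sqrt c)%:C *: aop (sop (z l u)) eta a) **
 ((Num.sqrt c)%:C *: aop (sop (z l v)) eta a))) /=.
have -> : hip eta (\sum_l aop (sop (star (z l u) ** z l v)) eta) =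
 \sum_l hip (aop (sop (z l u)) eta) (aop (sop (z l v)) eta).
 elim/big_rec2: _ => [|l y x _ <-]; first by rewrite -ip_hv ip0r. by rewrite hipDr sm ss aopM hip_adj.
rewrite scaler_sumr; each l; rewrite hipE scaler_sumr; each a.
by rewrite starZr amulZl amulZr scalerA -rmorphM -expr2 sqr_sqrtr.
Qed.

Lemma out_nm T (v : hvec B J) : hip eta (aop (sop T) eta) = hip v (aop (sop T) v) ->
 c * nm v ^+ 2 <= 1 -> nm (out_phi0 T) <= nm T.
move=> e cv; rewrite -ii.2 out_phi0E nmZ0// e.
bnd (ler_wpM2l c0 (nm_hip_op _ _)); rewrite mulrCA.
bnd (ler_wpM2l (nm_ge0 _) cv); rewrite mulr1; exact: nm_sop.
Qed.

Lemma out_colour i T : block r T -> cproj kap i ** T = T ->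
 hip eta (aop (sop T) eta) = hip (eti i) (aop (sop T) (eti i)).
move=> bT qT; have [sl sm ss] := @sop_hom R B J.
rewrite /eti hip_adj -ss cprojS -!aopM -!sm; congr (hip _ (aop (sop _) _)).
by rewrite qT -(cproj_comm kr i bT) qT.
Qed.

Let bpsi s : block r (mxo (psi s)).
by move=> a b h; rewrite ent_mxo (bm_block hb). Qed.

Definition out_psi (s : Q) : Fm r ps := mkF ps pp pb (bpsi s).
Definition out_phi (T : Fm r ps) : Q := out_phi0 (val T).

Lemma out_exact : nuc_approx n out_psi out_phi.
have [vh vn] := val_iso (corner r ps); have [vl _ _] := vh.
have pnm := nm_proj ps pp.
split; first exact: Fm_fin.
- apply: gpos_cp => [k x y|I X gX]. apply: val_inj; rewrite vl !mkFE (bm_linear hb) amulDr amulDl amulZr amulZl. by [].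
 apply: (gpos_sub (val_iso (corner r ps))). have [M [z zE]] := bm_gpos (bm_cp hb) gX.
 exists M, (fun l u => z l u ** p) => u v; rewrite mkFE zE amulsr amulsl. by each l; rewrite starM ps !amulA.
- move=> x; rewrite !normE lecR -vn mkFE. bnd nmM; bnd (ler_piMr (nm_ge0 _) pnm).
 bnd (nmMl _ pnm); rewrite mul1r; exact: bm_contr hb x.
- apply: gpos_cp => [k x y|I X gX]. by rewrite /out_phi vl out_phi0_lin. by apply: out_gpos; exact: gpos_hom vh gX.
exists (colour ps kr); split; [exact: colour_ideal|exact: colour_sum|move=> i phi_i].
have [wh wn] := val_iso (colour ps kr i); have [wl _ _] := wh.
have iP (x : csubstar (colour ps kr i)) : cproj kap i ** val (val x) = val (val x). exact: (val_substar x).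
split.
- apply: gpos_cp => [k x y|I X gX]. by rewrite /phi_i /out_phi wl vl out_phi0_lin.
 by apply: out_gpos; apply: (gpos_hom vh); exact: gpos_hom wh gX.
- move=> x; rewrite !normE lecR -wn -vn; apply: (out_nm (v := eti i)); last exact: ci.
 by apply: out_colour (iP x); case: (FmP (val x)).
(* Order zero: with [v] the component of [eta] of this colour, [<v, x v> <v, y v> = <v, x (theta v
   v) y v>]. Moving [theta v v] past [x] leaves the product [x y = 0]. *)
move=> x y _ _ xy; apply: (isohom_inj ii); have [[il im _] _] := ii.
have xy0 : val (val x) ** val (val y) = 0. by have := congr1 (fun t : csubstar (colour ps kr i) => val (val t)) xy.
have [x1 x2 x3] := FmP (val x); have [y1 y2 y3] := FmP (val y).
have [sl sm ss] := @sop_hom R B J.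
rewrite im (lin0 il) !out_phi0E (out_colour x3 (iP x)) (out_colour y3 (iP y)).
rewrite amulZl amulZr -hip_act -aop_hact -thetaE -!aopM.
rewrite comm; last by [].
by rewrite -(amulA _ (sop (val (val x)))) -sm xy0 (lin0 sl) amulr0 amul0r aop0x -ip_hv ip0r !scaler0.
Qed.

Lemma out_contr : c * nm eta ^+ 2 <= 1 -> contractive out_phi.
by move=> h x; rewrite !normE lecR -(val_iso (corner r ps)).2; exact: (out_nm (v := eta)).
Qed.
Lemma out_approx s : iota (out_phi (out_psi s)) = c%:C *: hip eta (aop (sop (p ** mxo (psi s) ** p)) eta).
exact: out_phi0E. Qed.

End OutExact.

Lemma cvs_sum R (V : normedModType R[i]) (I : Type) (s : seq I) (u : I -> nat -> V) (l : I -> V) :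
 (forall i, cvs (u i) (l i)) -> cvs (fun n => \sum_(i <- s) u i n) (\sum_(i <- s) l i).
move=> h; elim: s => [|i s IH]. by rewrite big_nil; apply: cvs_ext (cvs_cst 0) => n; rewrite big_nil.
by rewrite big_cons; apply: cvs_ext (cvsD (h i) IH) => n; rewrite big_cons.
Qed.

Lemma scale_est R (x : R) : 0 <= x -> 0 <= 1 - ((1 + x) ^+ 2)^-1 <= 2 * x.
move=> x0; have h : 0 < (1 + x) ^+ 2 by rewrite exprn_gt0// ltr_pwDl.
have -> : 1 - ((1 + x) ^+ 2)^-1 = ((1 + x) ^+ 2 - 1) / (1 + x) ^+ 2. by rewrite mulrBl divff ?gt_eqF// mul1r.
rewrite ler_pdivrMr// divr_ge0 ?(ltW h)//=; last by nra.
by rewrite !expr2 in h; nra.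
Qed.

Lemma tau_exists R (M e : R) : 0 <= M -> 0 < e -> exists t : R, [/\ 0 < t, t <= 1 & t * (1 + M) < e].
move=> M0 e0; have h : 0 < e + (1 + M) by lra.
exists (e / (e + (1 + M))); split; first by rewrite divr_gt0. by rewrite ler_pdivrMr//; lra.
by rewrite mulrAC ltr_pdivrMr//; nra.
Qed.

(** * From approximate data to an approximation *)

Section OutPerturb.
Context {R}.

(* Approximate data over an ambient algebra [B]: [rho] generates, through the
 finite-dimensional blocks of [psi], an almost order zero map in each colour. *)
Record near_data (dr : Prop) (Q : cstar R) (n : nat) (S : seq Q) (t : R) : Prop :=
 NearData { near_data_ex : exists (B : cstar R) (iota : Q -> B) (J : finType)
 (r : J -> J) (kap : J -> 'I_n.+1) (psi : Q -> J -> J -> Cx R)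
 (p : adjop (hv (Cx R) J)) (rho : hvec B J) (d : J -> B),
 [/\ [/\ isohom iota, forall a, kap (r a) = kap a, bmap r psi & [/\ star p = p, p ** p = p & block r p]],
 [/\ forall a, positive (d a), forall a, nm (d a) <= 1 + t & forall a b, r a = r b -> d a = d b],
 forall i (v := aop (sop (p ** cproj kap i)) rho : hvec B J),
 nm (theta v v - sop (p ** cproj kap i) ** dop d) <= t, forall (X : adjop (hv B J)) a b, exists q,
 iota q = star ((aop X rho : hvec B J) a) ** (aop X rho : hvec B J) b
 & (dr -> nm (aop (sop p) rho : hvec B J) ^+ 2 <= 1 + t) /\ forall s, s \in S -> nm (iota s - hip (aop (sop p) rho)
 (aop (sop (mxo (psi s))) (aop (sop p) rho))) <= t] }.

(** Each colour component of [rho] is perturbed separately, and their sum [eta] is fed to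
    [out_exact]. The tolerance of the data is [t ^+ 2] because [perturb] loses a square root. *)
Lemma near_approx (Q : cstar R) (n : nat) (dr : Prop) (S : seq Q) (e : R) : 0 < e ->
 exists t, [/\ 0 < t, t <= 1 & near_data dr n S (t ^+ 2) -> approx_at dr n S e].
move=> e0.
have [K K0 SK] : exists2 K : R, 0 <= K & forall s, s \in S -> nm s <= K. elim: S => [|s S [K K0 SK]]; first by exists 0.
 exists (nm s + K); first by rewrite addr_ge0// nm_ge0.
 by move=> x; rewrite inE => /orP[/eqP ->|/SK]; have := nm_ge0 s; lra.
pose N : R := n.+1%:R.
have N1 : 1 <= N by rewrite ler1n.
(* The final error is at most [360 K N^3 t] from rescaling, [32 K N^2 t] from replacing the vector
   by [eta], and [t] from the data. *)
have M0 : 0 <= 400 * K * N ^+ 3. by apply: mulr_ge0; [exact: mulr_ge0|exact: exprn_ge0].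
have [t [t0 t1 te]] := tau_exists M0 e0.
exists t; split => // -[[B [iota [J [r [kap [psi [p [rho [d]]]]]]]]]].
move=> [[ii kr hb [ps pp pb]] [dp dn db] hv' hr [hdr hS]].
pose q i := cproj (R := R) kap i.
have tt : t ^+ 2 <= t by rewrite expr2; nra.
have tt0 : 0 < t ^+ 2 by rewrite exprn_gt0.
have [sl sm ss] := @sop_hom R B J.
have qb i : block r (q i) by exact: cproj_block.
have qn i : nm (q i) <= 1 by apply: nm_proj; [exact: cprojS|exact: cproj_idem].
have pq i : p ** q i = q i ** p by rewrite -(cproj_comm kr).
have pqs i : star (p ** q i) = p ** q i by rewrite starM ps cprojS -pq.
have pqp i : p ** q i ** (p ** q i) = p ** q i. by rewrite -amulA (amulA (q i)) -pq -amulA cproj_idem amulA pp.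
have pqn i : nm (p ** q i) <= 1 by exact: nm_proj.
pose v i : hvec B J := aop (sop (p ** q i)) rho.
pose D i := sop (p ** q i) ** dop d.
have sopd (T : adjop (hv (Cx R) J)) : block r T -> sop T ** dop d = dop d ** sop T.
 move=> bT; apply: sop_dop => a b h; apply: db; apply/eqP; apply: contraNT h. by move=> /bT ->.
have Dp i : np aid (D i). apply: (np_comm aid_l aid_r).
 - apply: sop_np; rewrite -pqp; apply: (sq_np aid_l aid_r); exact: pqs.
 - exact: dop_np.
 - by apply: sopd; exact: blockM.
have dn' : nm (dop d) <= 1 + t ^+ 2 by apply: nm_dop => //; lra.
have sn (T : adjop (hv (Cx R) J)) : nm T <= 1 -> nm (sop (A := B) T) <= 1. exact: le_trans (nm_sop _).
have Dn i : nm (D i) <= 1 + t ^+ 2. bnd (nmMl _ (sn _ (pqn i))); by rewrite mul1r.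
have ex i : {PRX : adjop (hv B J) * hvec B J * (nat -> adjop (hv B J)) |
 [/\ np aid PRX.1.1, bic (D i) PRX.1.1, nm PRX.1.1 <= nm (D i), theta PRX.1.2 PRX.1.2 = PRX.1.1
 & nm (PRX.1.2 - v i) <= 4 * t /\ cvs (fun n => aop (PRX.2 n) (v i) : hvec B J) PRX.1.2]}.
 apply: cid; have [P [rho' [X [k1 k2 k3 k4 [k5 k6]]]]] := perturb tt0 (Dp i) (hv' i).
 by exists (P, rho', X); rewrite sqrtr_sqr gtr0_norm in k5.
pose P i := (sval (ex i)).1.1; pose ro i := (sval (ex i)).1.2; pose X i := (sval (ex i)).2.
have exP i : [/\ np aid (P i), bic (D i) (P i), nm (P i) <= nm (D i), theta (ro i) (ro i) = P i
 & nm (ro i - v i) <= 4 * t /\ cvs (fun n => aop (X i n) (v i) : hvec B J) (ro i)]. exact: svalP (ex i).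
clearbody P ro X; clear ex.
(* [ro i] is only close to a vector of colour [i]; cutting it by [q i] restores exact orthogonality
   of the colours. *)
pose et i : hvec B J := aop (sop (q i)) (ro i); pose eta := \sum_i et i.
have qeta i : aop (sop (q i)) eta = et i. rewrite /eta aop_sum (bigD1 i)//= big1 ?addr0 => [|j ji].
 by rewrite -aopM -sm cproj_idem. by rewrite -aopM -sm cproj_orth 1?eq_sym// (lin0 sl).
have sopl (x : hvec B J) T : nm T <= 1 -> nm (aop (sop T) x : hvec B J) <= nm x.
 move=> /sn T1; bnd nm_aop'; by rewrite ler_piMl// nm_ge0.
have etv i : nm (et i - v i) <= 4 * t. have [_ _ _ _ [h _]] := exP i; apply: le_trans h.
 have -> : et i - v i = aop (sop (q i)) (ro i - v i). by rewrite aopB /v -aopM -sm pq amulA cproj_idem. exact: sopl.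
have pv : aop (sop p) rho = \sum_i v i. have -> : sop (A := B) p = \sum_i sop (p ** q i).
 by rewrite -(lin_sum sl) -amulsr sum_cproj. by elim/big_rec2: _ => [|i x y _ <-].
have sumN (u : 'I_n.+1 -> hvec B J) M : (forall i, nm (u i) <= M) -> nm (\sum_i u i) <= N * M. move=> uM; bnd_sum.
 bnd (ler_sum _ (fun i _ => uM i)). by rewrite sumr_const card_ord -[leLHS]mulr_natl.
have epv : nm (eta - aop (sop p) rho) <= N * (4 * t). by rewrite pv -sumrB; exact: sumN.
have vn i : nm (v i) <= 1 + t. rewrite -ler_sqr ?nnegrE ?nm_ge0//; last by lra. rewrite -nm_theta; bnd (nm_ler _ (D i)).
 by bnd (lerD (hv' i) (Dn i)); nra.
have etn i : nm (et i) <= 1 + 5 * t. by bnd (nm_ler _ (v i)); bnd (lerD (etv i) (vn i)); lra.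
have pvn : nm (aop (sop p) rho : hvec B J) <= N * (1 + t) by rewrite pv; exact: sumN.
have etan : nm eta <= N * (1 + 5 * t) by exact: sumN.
(* A colour component of [eta] has norm at most [1 + 5 t]. For decomposition rank the whole vector
   has norm at most [1 + t], plus [4 t] for each of the [N] colours moved. So [m] bounds both. *)
pose m := 1 + 5 * N * t; pose c := (m ^+ 2)^-1.
have Nt : 0 <= 5 * N * t by rewrite !mulr_ge0//; lra.
have m1 : 1 <= m by rewrite /m; lra.
have m0 : 0 < m ^+ 2 by rewrite exprn_gt0//; lra.
have c0 : 0 <= c by rewrite invr_ge0 ltW.
have cle (x : hvec B J) : nm x <= m -> c * nm x ^+ 2 <= 1.
 move=> xm; rewrite mulrC ler_pdivrMr// mul1r ler_pXn2r// ?nnegrE ?nm_ge0//; lra.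
have etm i : nm (et i) <= m. by bnd (etn i); rewrite /m lerD2l; apply: ler_wpM2r; [exact: ltW|lra].
(* [eta] is a limit of vectors [Z k rho], whose inner products lie in the range of [iota]; that
   range is closed. *)
have er a b : exists x, iota x = star (eta a) ** eta b. pose Z k := \sum_i sop (q i) ** X i k ** sop (p ** q i).
 have Zc : cvs (fun k => aop (Z k) rho : hvec B J) eta.
 apply: (@cvs_ext _ _ (fun k => \sum_i aop (sop (q i)) (aop (X i k) (v i)))).
 move=> k; rewrite /Z /v; elim/big_rec2: _ => [|i x y _ ->]; rewrite ?aop0x ?aopDx//.
 apply: cvs_sum => i; have [_ _ _ _ [_ h]] := exP i.
 apply: (cvs_dom (M := 1)) h => k; rewrite mul1r -aopB; exact: sopl.
 have Zc' j : cvs (fun k => (aop (Z k) rho : hvec B J) j) (eta j).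
 apply: (cvs_dom (M := 1)) Zc => k; rewrite mul1r -hvNE -hvDE; exact: nm_coord'.
 have h k : range iota (star ((aop (Z k) rho : hvec B J) a) ** (aop (Z k) rho : hvec B J) b).
 by have [x xE] := hr (Z k) a b; exists x.
 by have [x _ xE] := cvs_closed (range_closed ii) h (cvsM (cvsS (Zc' a)) (Zc' b)); exists x.
(* [T] commutes with [D i], hence with [P i], which belongs to the double commutant of [D i]. *)
have comm i (T : adjop (hv (Cx R) J)) : [/\ p ** T = T, T ** p = T & block r T] ->
 let w := aop (sop (cproj kap i)) eta in sop T ** theta w w = theta w w ** sop T.
 move=> [T1 T2 bT] w; have qT : q i ** T = T ** q i by exact: cproj_comm.
 rewrite {}/w qeta /et -theta_conj -ss cprojS; have [_ bP _ -> _] := exP i. have TP : sop T ** P i = P i ** sop T.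
 apply: bP; rewrite /D !amulA -sm -amulA -sopd// (amulA (sop (p ** q i))) -sm.
 by congr (sop _ ** _); rewrite amulA T2 -amulA qT amulA T1.
 rewrite !amulA -sm -qT sm -(amulA _ (sop T)) TP -!amulA; congr (_ ** (_ ** _)). by rewrite -!sm qT.
have ci i : c * nm (aop (sop (cproj kap i)) eta : hvec B J) ^+ 2 <= 1 by rewrite qeta; exact: cle.
exists (Fm r ps), (out_psi hb ps pp pb), (out_phi (p := p) c er).
split.
- exact: out_exact.
- move=> /hdr h; apply: out_contr => //; apply: cle. have h' : nm (aop (sop p) rho : hvec B J) <= 1 + t.
 rewrite -ler_sqr ?nnegrE ?nm_ge0//; last by lra. by bnd h; rewrite !expr2; nra.
 bnd (nm_ler _ (aop (sop p) rho)); bnd (lerD epv h'). by rewrite /m; nra.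
move=> s Ss; have [[il im is_] iN] := ii; rewrite -iN (linB il) out_approx//.
set T := sop (A := B) (p ** mxo (psi s) ** p); set pr := aop (sop p) rho.
have Tn : nm T <= K. bnd nm_sop; bnd nmM. have pn := nm_proj ps pp.
 bnd (ler_piMr (nm_ge0 _) pn); bnd (nmMl _ pn); rewrite mul1r. by bnd (bm_contr hb s); exact: SK.
have Tpr : hip pr (aop T pr) = hip pr (aop (sop (mxo (psi s))) pr).
 have ppr : aop (sop p) pr = pr by rewrite /pr -aopM -sm pp. by rewrite /T !sm !aopM ppr -{1}ps ss -hip_adj ppr.
have h1 := hS s Ss; rewrite -/pr -Tpr nmBC in h1.
have h2 := nm_hip_dist T eta pr.
have h3 := nm_hip_op T eta.
have /andP[c1 c2] := scale_est Nt; rewrite -/m -/c in c1 c2.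
have -> : c%:C *: hip eta (aop T eta) - iota s = - ((1 - c)%:C *: hip eta (aop T eta)) +
 (hip eta (aop T eta) - hip pr (aop T pr)) + (hip pr (aop T pr) - iota s) by nc.
bnd nmD; bnd (lerD (nmD _ _) h1).
rewrite nmN nmZ0//.
have e6 : nm eta <= 6 * N by bnd etan; nra.
have p2 : nm pr <= 2 * N by bnd pvn; nra.
have := nm_ge0 eta; have := nm_ge0 pr; have := nm_ge0 T; have := nm_ge0 (eta - pr).
move: (nm (eta - pr)) epv (nm pr) p2 (nm eta) e6 (nm T) Tn h2 h3.
move: (nm (hip eta _)) (nm (_ - _)) => x y.
move=> a1 g1 a2 g2 a3 g3 a4 g4 g5 g6 z1 z2 z3 z4.
have k1 : x <= K * (6 * N) ^+ 2. bnd g6; apply: ler_pM => //; first exact: exprn_ge0.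
 by rewrite ler_pXn2r// nnegrE//; lra.
have k2 : y <= K * (6 * N + 2 * N) * (N * (4 * t)). bnd g5; apply: ler_pM => //; first by rewrite mulr_ge0// addr_ge0.
 by apply: ler_pM => //; [exact: addr_ge0|exact: lerD].
have k3 : (1 - c) * x <= 2 * (5 * N * t) * (K * (6 * N) ^+ 2). bnd (ler_wpM2l c1 k1); apply: ler_wpM2r => //.
 by rewrite mulr_ge0// exprn_ge0//; lra.
apply: le_lt_trans te.
bnd (lerD (lerD k3 k2) tt).
have KN : 0 <= K * t * N ^+ 2 * (N - 1). by rewrite !mulr_ge0 ?exprn_ge0//; lra.
have KN3 : 0 <= K * t * N ^+ 3 by rewrite !mulr_ge0 ?exprn_ge0//; lra.
rewrite !expr2 !exprS expr0 mulr1 in KN KN3 *; nra.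
Qed.

End OutPerturb.

(** * Structure of finite-dimensional C*-algebras *)

Section FiniteDimensional.
Context {R} {F : cstar R}.
Implicit Types (x y z u s t : F).

Lemma fin_dependent : finite_dimensional F -> exists N, forall x : nat -> F,
 exists c : nat -> R[i], (exists2 k, (k < N)%N & c k != 0) /\ \sum_(k < N) c k *: x k = 0.
move=> [n [e eP]]; exists n.+1 => x.
have ex k : {c : 'I_n -> R[i] | x k = \sum_i c i *: e i} by exact: cid (eP (x k)).
pose M : 'M[R[i]]_(n.+1, n) := \matrix_(k, i) sval (ex k) i.
have kn : kermx M != 0. by rewrite kermx_eq0 -row_leq_rank -ltnNge ltnS rank_leq_col.
pose c := nz_row (kermx M).
have c0 : c != 0 by rewrite nz_row_eq0.
have cM : c *m M = 0 by apply/sub_kermxP; exact: nz_row_sub.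
exists (fun k => c ord0 (inord k)); split. move/rV0Pn : c0 => [k ck]; exists k => //. by rewrite inord_val.
have -> : \sum_(k < n.+1) c ord0 (inord k) *: x k = \sum_(k < n.+1) \sum_i (c ord0 k * M k i) *: e i.
 each k; rewrite inord_val (svalP (ex k)) scaler_sumr. by each i; rewrite scalerA mxE.
rewrite exchange_big big1// => i _; rewrite -scaler_suml.
have := congr1 (fun M : 'rV_n => M ord0 i) cM; rewrite !mxE => ->.
by rewrite scale0r.
Qed.

Hypothesis fd : finite_dimensional F.

Let qp z (k : nat) : F := iter k (amul z) z.

Let qp_mul z k u : qp z k ** u = iter k (amul z) (z ** u).
by elim: k => //= k IH; rewrite -amulA IH. Qed.

Let qp_comm z k : qp z k ** z = z ** qp z k.
by elim: k => //= k IH; rewrite -amulA IH. Qed.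

Let qp_star z k : sa z -> star (qp z k) = qp z k.
by move=> sz; elim: k => //= k IH; rewrite starM IH sz. Qed.

Let qp_ann z k u : z ** u = 0 -> qp z k ** u = 0.
by move=> h; rewrite qp_mul; elim: k => //= k ->; rewrite amulr0. Qed.

Let qp_fix z k u : z ** u = z -> qp z k ** u = qp z k.
by move=> h; rewrite qp_mul h. Qed.

(** Powers of [z] are linearly dependent. If the lowest coefficient of the relation is nonzero,
    division by it gives the claim. Otherwise the relation reads [z y = 0] with [y] a combination of
    powers of [z]; then [star y ** y = 0], so [y = 0] is a shorter relation. *)
Let local_inverse z : sa z -> exists (m : nat) (d : nat -> R[i]), z ** (\sum_(j < m) d j *: qp z j) = z.
move=> sz; have [N hN] := fin_dependent fd; have [c [cn c0]] := hN (qp z).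
elim: N c cn c0 {hN} => [|N IH] c [k kN ck]; first by [].
rewrite big_ord_recl /=; set y := \sum_(i < N) c i.+1 *: qp z i.
have -> : \sum_(i < N) c (bump 0 i) *: qp z (bump 0 i) = z ** y. by rewrite amulsr; each i; rewrite amulZr.
have [c0|c0] := eqVneq (c 0%N) 0; last first. move=> h; exists N, (fun j => - (c 0%N)^-1 * c j.+1).
 have -> : \sum_(j < N) (- (c 0%N)^-1 * c j.+1) *: qp z j = - (c 0%N)^-1 *: y.
 by rewrite scaler_sumr; each i; rewrite scalerA.
 have -> : z ** (- (c 0%N)^-1 *: y) = z - (c 0%N)^-1 *: (c 0%N *: z + z ** y). rewrite amulZr; nc.
 by rewrite h scaler0 subr0.
rewrite c0 scale0r add0r => zy; apply: (IH (fun k => c k.+1)).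
 by case: k kN ck => [|k] kN ck; [rewrite c0 eqxx in ck|exists k].
rewrite -/y; apply: star_eq0; rewrite {1}/y star_sum amulsl big1// => i _.
by rewrite starZc (qp_star _ sz) amulZl qp_ann// scaler0.
Qed.

Record is_proj s : Prop := IsProj { proj_sa : sa s; proj_sq : s ** s = s }.

(** The polynomial [s] without constant term from [local_inverse] satisfies [z s = z]. As [s] is
    made of powers of [z], this gives [s (star s) = s], so [s] is a projection, and it inherits what
    annihilates or fixes [z]. *)
Lemma support_proj z : sa z -> exists s t, [/\ is_proj s, z ** s = z /\ s ** z = z,
 s = z ** t, forall u, z ** u = 0 -> s ** u = 0 & forall u, u ** z = z -> u ** s = s].
move=> sz; have [m [d]] := local_inverse sz; set s := \sum_(j < m) _ => zs.
have sz' : star s ** z = z by rewrite -[RHS]sz -[in RHS]zs starM sz.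
have zs' : z ** star s = z. rewrite -[RHS]sz' /s star_sum amulsl amulsr; each j.
 by rewrite starZc (qp_star _ sz) amulZr amulZl qp_comm.
have ss' : s ** star s = s. by rewrite amulsl; each j; rewrite amulZl qp_fix.
have s_sa : sa s by rewrite /sa -{1}ss' starM starK.
have ssq : s ** s = s by rewrite -{2}s_sa.
exists s, (\sum_(j < m) d j *: iter j (amul z) s); split => //.
- by split => //; rewrite -{1}s_sa.
- rewrite -{1}ssq {1}/s amulsl amulsr; each j. by rewrite amulZl amulZr qp_mul -iterSr.
- by move=> u zu; rewrite amulsl big1// => j; rewrite amulZl qp_ann// scaler0.
- move=> u uz; rewrite amulsr; each j; rewrite amulZr; congr (_ *: _).
 by case: (nat_of_ord j) => //= k; rewrite amulA uz.
Qed.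

Definition orth_family m (p : 'I_m -> F) : Prop :=
 (forall i, is_proj (p i) /\ p i != 0) /\ forall i j, i != j -> p i ** p j = 0.

(** Multiplying a linear relation by one member of the family isolates the coefficient of that
    member. *)
Lemma orth_bound : exists N, forall m (p : 'I_m -> F), orth_family p -> (m <= N)%N.
have [N hN] := fin_dependent fd; exists N => m p [pp po]; rewrite leqNgt; apply/negP => Nm.
pose x k := if insub k is Some i then p i else 0.
have [c [[k kN ck]]] := hN x => /(congr1 (amul (x k))).
have km := ltn_trans kN Nm.
have xk : x k = p (Ordinal km) by rewrite /x insubT.
rewrite amulr0 amulsr (bigD1 (Ordinal kN))//= big1 ?addr0 => [|i ik].
 rewrite xk amulZr (proj_sq (pp _).1) => /eqP; rewrite scaler_eq0 (negbTE ck). by rewrite (negbTE (pp _).2).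
rewrite xk {1}/x insubT; first exact: ltn_trans (ltn_ord i) Nm.
move=> im; rewrite amulZr po ?scaler0//; apply: contraNneq ik => /(congr1 val) /= e.
by apply/eqP; apply: val_inj.
Qed.

Lemma extend_family m (q : 'I_m -> F) s : (forall i, is_proj (q i) /\ q i != 0) -> is_proj s -> s != 0 ->
 (forall i j, i != j -> q i ** q j = 0) -> (forall i, q i ** s = 0) -> exists q' : 'I_m.+1 -> F, orth_family q'.
move=> hq ps s0 qo qs.
have sq i : s ** q i = 0. by rewrite -(proj_sa ps) -(proj_sa (hq i).1) -starM qs star0.
exists (fun i => if unlift ord_max i is Some j then q j else s); split => [i|i j].
 by case: (unliftP ord_max i) => [j|] _.
case: (unliftP ord_max i) => [k|] ->; case: (unliftP ord_max j) => [l|] -> //; last by rewrite eqxx.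
by rewrite (inj_eq lift_inj); exact: qo.
Qed.

(* A maximal orthogonal family of projections consists of minimal projections
 adding up to a unit. *)
Lemma max_family : exists m (p : 'I_m -> F), [/\ orth_family p, forall x, (\sum_i p i) ** x = x
 & forall i x, exists c : R[i], p i ** x ** p i = c *: p i].
have [N hN] := orth_bound.
have ex0 : exists m, `[< exists p : 'I_m -> F, orth_family p >].
 by exists 0%N; apply/asboolP; exists (fun=> 0); split; case.
have bd m : `[< exists p : 'I_m -> F, orth_family p >] -> (m <= N)%N. by move=> /asboolP[p /hN].
have [m /asboolP[p [pp po]] mmax] := ex_maxnP ex0 bd.
have max (q : 'I_m.+1 -> F) : ~ orth_family q. by move=> h; have := mmax m.+1 (asboolT (ex_intro _ q h)); rewrite ltnn.
pose e := \sum_i p i.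
have pe i : p i ** e = p i. rewrite /e amulsr (bigD1 i)//= (proj_sq (pp i).1) big1 ?addr0// => j ji.
 by rewrite po// eq_sym.
have es : star e = e by rewrite star_sum; each i; exact: proj_sa (pp i).1.
have ep i : e ** p i = p i by rewrite -{1}es -{1}(proj_sa (pp i).1) -starM pe (proj_sa (pp i).1).
have ee : e ** e = e by rewrite {1 3}/e amulsl; each i.
(* Otherwise the support projection of [y ** star y], for [y = e x - x], is orthogonal to every
   [p i] and enlarges the maximal family. *)
have el x : e ** x = x. apply/eqP; rewrite -subr_eq0; apply/negPn/negP => y0.
 pose y := e ** x - x; pose z := y ** star y. have ez : e ** z = 0 by rewrite /z amulA /y amulBr amulA ee subrr amul0r.
 have sz : sa z by rewrite /sa starM starK. have [s [t [ps [zs sz'] _ sann _]]] := support_proj sz. have z0 : z != 0.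
 apply: contra y0 => /eqP h; rewrite -/y -[y]starK (star_eq0 (x := star y)) ?star0//. by rewrite starK.
 have s0 : s != 0 by apply: contraNneq z0 => h; rewrite -zs h amulr0. have zp i : z ** p i = 0.
 by rewrite -ep amulA -{1}sz -{1}es -starM ez star0 amul0r. have ps' i : p i ** s = 0.
 by rewrite -(proj_sa ps) -(proj_sa (pp i).1) -starM sann// star0. by have [q /max] := extend_family pp ps s0 po ps'.
have er x : x ** e = x by rewrite -[x]starK -{1}es -starM el.
exists m, p; split => // i.
have ppi := (pp i).1; have [si qi] := ppi.
(* no zero divisors: a support projection below a minimal one is everything *)
have nzd z : sa z -> p i ** z = z -> z != 0 -> exists t, p i = z ** t.
 move=> sz pz z0; have [s [t [ps [zs sz'] st sann sfix]]] := support_proj sz.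
 exists t; rewrite -st; apply/eqP; rewrite -subr_eq0; apply/negPn/negP => d0. have psE : p i ** s = s by exact: sfix.
 have spE : s ** p i = s by rewrite -{1}(proj_sa ps) -{1}si -starM psE (proj_sa ps).
 have s0 : s != 0 by apply: contraNneq z0 => h; rewrite -zs h amulr0. pose q j := if j == i then s else p j.
 have pd : is_proj (p i - s).
 by split; [exact: saB (proj_sa ps)|rewrite amulBl !amulBr qi psE spE (proj_sq ps) subrr subr0].
 have qpr j : is_proj (q j) /\ q j != 0 by rewrite /q; case: eqP. have sp j : j != i -> s ** p j = 0.
 by move=> ji; rewrite -spE -amulA po 1?eq_sym// amulr0. have ps' j : j != i -> p j ** s = 0.
 by move=> ji; rewrite -psE amulA po// amul0r. have qo j k : j != k -> q j ** q k = 0.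
 rewrite /q; case: (j =P i) => [->|/eqP ji]; case: (k =P i) => [->|/eqP ki].
 - by rewrite eqxx.
 - by move=> _; exact: sp.
 - by move=> _; exact: ps'.
 - exact: po. have qd j : q j ** (p i - s) = 0. rewrite /q; case: (j =P i) => [_|/eqP ji].
 by rewrite amulBr spE (proj_sq ps) subrr. by rewrite amulBr po// ps'// subrr.
 by have [q' /max] := extend_family qpr pd d0 qo qd.
have nzd2 y z : sa z -> p i ** z = z -> z != 0 -> y ** z = 0 -> y ** p i = 0.
 by move=> sz pz z0 yz; have [t ->] := nzd z sz pz z0; rewrite amulA yz amul0r.
(* Let [l] be the squared norm of [y] and [h = l p - y^2]. If [h] were nonzero, [p = h t] would
   force [p <= M h], that is, [y^2 <= (l - 1 / M) p], although [y^2] has norm [l]. *)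
have sascalar y : sa y -> p i ** y = y -> exists c : R, y = c%:C *: p i.
 move=> sy py; have yp : y ** p i = y by rewrite -{1}sy -{1}si -starM py. pose h := (nm y ^+ 2)%:C *: p i - y ** y.
 have sh : sa h by apply: saB; [exact: saZ|exact: sa_sq].
 have ph : p i ** h = h by rewrite /h amulBr amulZr qi amulA py. have h0 : h = 0.
 apply/eqP/negPn/negP => h0; have [t pt] := nzd h sh ph h0. pose l := nm y ^+ 2; have l0 : 0 <= l by exact: sqr_ge0.
 pose g := l%:C *: e - y ** y. have pg : np e g by apply: (np_le_U el); [exact: sa_sq|rewrite nm_sq].
 have hE : h = p i ** g ** p i. by rewrite amulBr amulBl amulZr amulZl er qi amulA py -amulA yp.
 have hpos : np e h by rewrite hE -{1}si; exact: np_conj. have hl : nm h <= l. have pn : nm (p i) <= 1.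
 have := nm_sq si; rewrite qi expr2 => /eqP; have [->//|p0] := eqVneq (nm (p i)) 0.
 by rewrite -{1}[nm (p i)]mulr1 => /eqP/(mulfI p0) <-. rewrite hE; bnd nmM; bnd (ler_piMr (nm_ge0 _) pn).
 bnd (nmMl _ pn); rewrite mul1r. by apply: (np_bnd el er) => //; rewrite opprB addrC subrK; exact: sq_np.
 pose M := nm t ^+ 2 * l. have pM : np e (M%:C *: h - p i).
 have -> : M%:C *: h - p i = (nm t ^+ 2)%:C *: (l%:C *: h - h ** h) +
 star h ** ((nm t ^+ 2)%:C *: e - t ** star t) ** h.
 have -> : star h ** ((nm t ^+ 2)%:C *: e - t ** star t) ** h =
 (nm t ^+ 2)%:C *: (h ** h) - (h ** t) ** star (h ** t). by rewrite starM sh; ncu e el er.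
 rewrite -pt si qi /M; nc. apply: npD. apply: npZ; first exact: sqr_ge0.
 have -> : l%:C *: h - h ** h = h ** (l%:C *: e - h) by ncu e el er.
 apply: (np_comm el er) => //; first exact: (np_le_U el). by ncu e el er.
 apply: (np_conj el er); apply: (np_le_U el). by rewrite /sa starM starK. by rewrite nmSSr.
 have [M0|M0] := leP M 0. have Me : M = 0 by apply/eqP; rewrite eq_le M0 mulr_ge0// sqr_ge0. have : p i = 0.
 apply: (np_anti el er); first by rewrite -qi; exact: sq_np. by rewrite Me scale0r add0r in pM.
 by move/eqP; rewrite (negbTE (pp i).2).
 (* then [y^2 <= (l - 1/M) p], contradicting [|y|^2 = l] *)
 have le2 : nm (y ** y) <= l - M^-1. have yl : 0 <= l - M^-1. rewrite subr_ge0 -div1r ler_pdivrMr// /M.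
 have : nm (p i) <= nm h * nm t by rewrite {1}pt nmM. have p1 : nm (p i) = 1. have := nm_sq si; rewrite qi expr2.
 have p0 : nm (p i) != 0 by apply: contraNneq (pp i).2 => /nm_eq0 ->.
 by rewrite -{1}[nm (p i)]mulr1 => /(mulfI p0).
 rewrite p1 => h1; have h2 : 1 <= (nm h * nm t) ^+ 2 by rewrite expr_ge1// mulr_ge0 ?nm_ge0.
 bnd h2; rewrite exprMn. have -> : l * (nm t ^+ 2 * l) = l ^+ 2 * nm t ^+ 2 by ring.
 apply: ler_wpM2r; first exact: sqr_ge0. by rewrite ler_pXn2r// nnegrE nm_ge0.
 apply: (np_bnd el er) => //; first exact: sq_np. have -> : (l - M^-1)%:C *: e - y ** y =
 (l - M^-1)%:C *: (e - p i) + M^-1%:C *: (M%:C *: h - p i).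
 have MM : M^-1%:C * M%:C = 1 :> R[i] by rewrite -rmorphM mulVf ?gt_eqF.
 have -> : M^-1%:C *: (M%:C *: h - p i) = h - M^-1%:C *: p i. by rewrite scalerBr scalerA MM scale1r.
 rewrite /h /l; nc. apply: npD; last by apply: npZ => //; rewrite invr_ge0 ltW. apply: npZ => //.
 have -> : e - p i = (e - p i) ** (e - p i). have : p i ** p i = p i by [].
 move=> q'; have -> : (e - p i) ** (e - p i) = e - 2%:C *: p i + p i ** p i by ncu e el er. by rewrite q'; nc.
 by apply: sq_np => //; apply: saB => //. rewrite nm_sq// -/l in le2. by have := M0; rewrite -invr_gt0; lra.
 (* Once [y^2 = l p], the difference of squares factors, and the absence of zero divisors makes one
    of the two factors vanish. *)
 have yy : (y - (nm y)%:C *: p i) ** (y + (nm y)%:C *: p i) = 0.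
 have -> : (y - (nm y)%:C *: p i) ** (y + (nm y)%:C *: p i) =
 - ((nm y ^+ 2)%:C *: (p i ** p i) - y ** y) + (nm y)%:C *: (y ** p i - p i ** y). rewrite expr2; nc.
 by rewrite qi -/h h0 yp py subrr scaler0 addr0 oppr0. have [u0|u0] := eqVneq (y + (nm y)%:C *: p i) 0.
 exists (- nm y); apply/eqP; rewrite rmorphN scaleNr -subr_eq0 opprK; exact/eqP.
 exists (nm y); apply/eqP; rewrite -subr_eq0. have := nzd2 _ _ _ _ u0 yy; rewrite amulBl yp amulZl qi => -> //.
 by apply: saD => //; exact: saZ. by rewrite amulDr py amulZr qi.
move=> x; pose a := p i ** x ** p i.
have ap : p i ** a = a by rewrite /a !amulA qi.
have ap' : p i ** star a = star a. by rewrite !starM si !amulA qi.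
have [c1 e1] := sascalar (a + star a) ltac:(by rewrite /sa starD starK addrC) ltac:(by rewrite amulDr ap ap').
pose I : R[i] := 0 +i* 1.
have cI : conjc I = - I by apply/eqP; rewrite eq_complex /= oppr0 !eqxx.
have II : I * I = -1 by apply/eqP; rewrite eq_complex /= !(mul0r, mulr0, mulr1, addr0, sub0r, oppr0) !eqxx.
have [c2 e2] := sascalar (I *: (a - star a)) ltac:(by rewrite /sa starZc starB starK cI scaleNr -scalerN opprB)
 ltac:(by rewrite amulZr amulBr ap ap').
exists (2^-1 * (c1%:C - I * c2%:C)).
have -> : p i ** x ** p i = 2^-1 *: ((a + star a) - I *: (I *: (a - star a))).
 rewrite scalerA II scaleN1r opprK addrACA subrr addr0. have -> : a + a = 2 *: a by rewrite scaler_nat.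
 by rewrite scalerA mulVf ?scale1r//.
by rewrite e1 e2 !scalerA -scalerBl scalerA.
Qed.

(** The minimal projections are grouped by Murray-von Neumann equivalence, with [r] choosing a
    representative and [v a] a partial isometry onto [p a] from it. If [y = p a ** x ** p b] is
    nonzero, [star y ** y] is a positive multiple of [p b], so a rescaled [y] is a partial isometry
    and the two projections are equivalent. *)
Lemma fin_units : exists m (p : 'I_m -> F) (r : 'I_m -> 'I_m) (v : 'I_m -> F),
 [/\ orth_family p, forall x, (\sum_i p i) ** x = x, forall i x, exists c : R[i], p i ** x ** p i = c *: p i,
 forall a, [/\ r (r a) = r a, v a ** star (v a) = p a & star (v a) ** v a = p (r a)]
 & forall a b x, r a != r b -> p a ** x ** p b = 0].
have [m [p [[pp po] p1 pm]]] := max_family.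
pose conn a b v := v ** star v = p a /\ star v ** v = p b.
pose C a b := `[< exists v, conn a b v >].
have sp a := proj_sa (pp a).1; have qp' a := proj_sq (pp a).1.
have Cr a : C a a by apply/asboolP; exists (p a); split; rewrite sp qp'.
have Cs a b : C a b -> C b a. by move=> /asboolP[v [h1 h2]]; apply/asboolP; exists (star v); split; rewrite starK.
have Ct a b c : C a b -> C b c -> C a c.
 move=> /asboolP[v [v1 v2]] /asboolP[w [w1 w2]]; apply/asboolP; exists (v ** w); split.
 have -> : v ** w ** star (v ** w) = v ** (w ** star w) ** star v by rewrite starM; nc.
 by rewrite w1 -v2 !amulA -amulA v1.
 have -> : star (v ** w) ** (v ** w) = star w ** (star v ** v) ** w by rewrite starM; nc.
 by rewrite v2 -w1 !amulA -amulA w2.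
pose r a := if [pick c | C a c] is Some c then c else a.
have Cra a : C a (r a). by rewrite /r; case: pickP => // /(_ a).
have rC a b : C a b -> r a = r b. move=> ab; have e : C a =1 C b.
 by move=> c; apply/idP/idP; apply: Ct => //; exact: Cs.
 rewrite /r (eq_pick e); case: pickP => // /(_ b); by rewrite Cr.
have ex a : {v | conn a (r a) v} by apply: cid; exact/asboolP/Cra.
exists m, p, r, (fun a => sval (ex a)); split => //. move=> a; have [h1 h2] := svalP (ex a); split => //.
 by apply: rC; apply: Cs.
move=> a b x rab; apply/eqP/negPn/negP => y0; case/negP: rab; apply/eqP; apply: rC.
pose y := p a ** x ** p b.
have ay : p a ** y = y by rewrite /y !amulA qp'.
have yb : y ** p b = y by rewrite /y -amulA qp'.
have [c cE] : exists c : R[i], star y ** y = c *: p b. have [c h] := pm b (star y ** y); exists c; rewrite -h.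
 by rewrite -amulA -[X in _ = _ ** X]amulA yb amulA -[in RHS](sp b) -starM yb.
have cr : c = (Re c)%:C. have : star (star y ** y) = star y ** y by rewrite starM starK.
 rewrite cE starZc sp => /eqP; rewrite -subr_eq0 -scalerBl scaler_eq0 (negbTE (pp b).2) orbF.
 rewrite subr_eq0; case: (c) => u w /=; rewrite eq_complex /= => /andP[_ /eqP h].
 by apply/eqP; rewrite eq_complex /= eqxx; apply/eqP; lra.
set t := Re c in cr.
have z0 : star y ** y != 0 by apply: contra y0 => /eqP/star_eq0 /eqP.
have t0 : 0 < t. rewrite ltNge; apply/negP => t0; case/negP: z0; apply/eqP/nm_le0; rewrite -(nm0 F).
 apply: pos_mono; first exact: pos_star. have -> : 0 - star y ** y = (- t)%:C *: p b by rewrite cE cr rmorphN; nc.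
 apply: posZ; first by rewrite oppr_ge0. by rewrite -qp' -{1}sp; exact: pos_star.
pose k := (Num.sqrt t)^-1; have kk : k ^+ 2 * t = 1. by rewrite exprVn sqr_sqrtr ?ltW// mulVf// gt_eqF.
pose v := k%:C *: y; apply/asboolP; exists v.
have vb : star v ** v = p b. rewrite /v starZr amulZl amulZr cE cr !scalerA -!rmorphM -expr2 kk. by rewrite scale1r.
split => //; have vpb : v ** p b = v by rewrite /v amulZl yb.
have [c' c'E] : exists c' : R[i], v ** star v = c' *: p a. have [c' h] := pm a (v ** star v); exists c'; rewrite -h.
 have av : p a ** v = v by rewrite /v amulZr ay. by rewrite amulA av -amulA -[in RHS](sp a) -starM av.
have vv : (v ** star v) ** (v ** star v) = v ** star v. by rewrite -amulA (amulA (star v)) vb amulA vpb.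
have c'0 : c' != 0. apply: contraNneq (pp b).2 => h; rewrite h scale0r in c'E.
 by rewrite -qp' -vb amulA -(amulA (star v)) c'E amulr0 amul0r.
move: vv; rewrite c'E amulZl amulZr qp' => /eqP.
rewrite -subr_eq0 scalerA -scalerBl scaler_eq0 (negbTE (pp a).2) orbF subr_eq0.
by rewrite -{3}[c']mulr1 => /eqP/(mulfI c'0) ->; rewrite scale1r.
Qed.

End FiniteDimensional.

Lemma cp_gram R (W P : cstar R) (f : W -> P) (b : bool -> W) :
 completely_positive f -> exists (L : finType) (z : L -> bool -> P),
 forall p q, f (star (b p) ** b q) = \sum_l star (z l p) ** z l q.
move=> cf; apply: (cp_gpos (X := fun p q => star (b p) ** b q) cf).
exists unit, (fun _ => b) => p q; by rewrite big_const card_unit /= addr0.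
Qed.

(** * Order zero maps *)

Section OrderZero.
Context {R} {W P : cstar R} (f : W -> P).
Hypotheses (cf : completely_positive f) (oz : order_zero f).

Lemma pos_sum0 (A : cstar R) (L : finType) (x : L -> A) : \sum_l star (x l) ** x l = 0 -> forall l, x l = 0.
move=> h l; apply: star_eq0; apply: nm_le0; rewrite -(nm0 A) -h.
apply: pos_mono; first exact: pos_star.
rewrite (bigD1 l)//= addrAC subrr add0r; apply: pos_sum => k _; exact: pos_star.
Qed.

(** In a Gram decomposition of [f] on [g] and [g ** star u], the hypothesis kills every vector
    attached to [g], hence also the mixed term. *)
Lemma oz_ideal_l (g u : W) y : f (star g ** g) ** y = 0 -> f (u ** (star g ** g)) ** y = 0.
have [L [z zE]] := cp_gram (fun t => if t then g else g ** star u) cf.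
rewrite (zE true true) => h.
have z0 l : z l true ** y = 0. apply: (@pos_sum0 _ _ (fun l => z l true ** y)) l.
 have -> : \sum_l star (z l true ** y) ** (z l true ** y) = star y ** ((\sum_l star (z l true) ** z l true) ** y).
 rewrite amulsl amulsr; each l; rewrite starM; nc. by rewrite h amulr0.
have -> : u ** (star g ** g) = star (g ** star u) ** g by rewrite starM starK amulA.
by rewrite (zE false true) amulsl big1// => l; rewrite -amulA z0 amulr0.
Qed.

Lemma oz_ideal_r (g u : W) y : y ** f (star g ** g) = 0 -> y ** f (star g ** g ** u) = 0.
have [L [z zE]] := cp_gram (fun t => if t then g else g ** u) cf.
rewrite (zE true true) => h.
have z0 l : z l true ** star y = 0. apply: (@pos_sum0 _ _ (fun l => z l true ** star y)) l.
 have -> : \sum_l star (z l true ** star y) ** (z l true ** star y) =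
 y ** (\sum_l star (z l true) ** z l true) ** star y. rewrite amulsr amulsl; each l; rewrite starM starK; nc.
 by rewrite h amul0r.
rewrite -amulA (zE true false) amulsr big1// => l _.
by rewrite amulA -[y]starK -starM z0 star0 amul0r.
Qed.

(** Order zero is stated for positive elements only. This extends it to products with arbitrary [u]
    on the left and [v] on the right, as matrix units require. *)
Lemma oz_prod (g h u v : W) : star g ** g ** (star h ** h) = 0 -> f (u ** (star g ** g)) ** f (star h ** h ** v) = 0.
move=> gh; apply: oz_ideal_r; apply: oz_ideal_l; apply: oz => //. by exists g.
by exists h.
Qed.

End OrderZero.

(** The Gram matrix of the unit and [x] is hermitian, and its mixed entries are the values at [x]
    and [star x]. *)
Lemma cp_map_star R (W P : cstar R) (f : W -> P) (e : W) :
 (forall x, e ** x = x) -> (forall x, x ** e = x) -> completely_positive f -> forall x, f (star x) = star (f x).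
move=> ex xe cf x; have es := sa_unit ex.
have [L [z zE]] := cp_gram (fun t => if t then e else x) cf.
have := zE false true; have := zE true false => /=; rewrite es ex xe => -> ->.
by rewrite star_sum; each l; rewrite starM starK.
Qed.

(** * Matrix units and coordinates *)

Section Units.
Context {R} {F : cstar R}.
Variables (m : nat) (p : 'I_m -> F) (r : 'I_m -> 'I_m) (v : 'I_m -> F).
Hypotheses (pf : orth_family p) (p1 : forall x, (\sum_i p i) ** x = x).
Hypothesis pm : forall i x, exists c : R[i], p i ** x ** p i = c *: p i.
Hypothesis vr : forall a, [/\ r (r a) = r a, v a ** star (v a) = p a & star (v a) ** v a = p (r a)].
Hypothesis pr : forall a b x, r a != r b -> p a ** x ** p b = 0.
Implicit Types (a b c d : 'I_m) (x y : F).

Lemma unit_sa a : star (p a) = p a. exact: proj_sa (pf.1 a).1. Qed.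
Lemma unit_sq a : p a ** p a = p a. exact: proj_sq (pf.1 a).1. Qed.

Lemma unit_vp a : v a ** p (r a) = v a.
have [_ v1 v2] := vr a; apply/subr0_eq/star_eq0.
rewrite starB starM unit_sa amulBl !amulBr.
have -> : star (v a) ** (v a ** p (r a)) = p (r a) ** p (r a) by rewrite amulA v2.
have -> : p (r a) ** star (v a) ** v a = p (r a) ** p (r a) by rewrite -amulA v2.
have -> : p (r a) ** star (v a) ** (v a ** p (r a)) = p (r a) ** p (r a) ** p (r a). by rewrite -v2; nc.
by rewrite !unit_sq v2 subrr.
Qed.
Lemma unit_pv a : p a ** v a = v a.
by have [_ v1 v2] := vr a; rewrite -v1 -amulA v2 unit_vp. Qed.

Lemma unit_r x : x ** (\sum_i p i) = x.
rewrite -[RHS]starK -[in RHS](p1 (star x)) starM starK; congr (_ ** _).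
by rewrite star_sum; each i; rewrite unit_sa.
Qed.

(** The matrix unit [e_ab] when [a] and [b] lie in one block. *)
Definition mu a b : F := v a ** star (v b).

Lemma muS a b : star (mu a b) = mu b a. by rewrite starM starK. Qed.
Lemma mu_diag a : mu a a = p a. by case: (vr a). Qed.

Lemma unit_vv a b : a != b -> star (v a) ** v b = 0.
move=> ab; rewrite -(unit_pv a) -(unit_pv b) starM unit_sa -amulA (amulA (p a)) pf.2//.
by rewrite amul0r amulr0.
Qed.

Lemma muM a b c d : r a = r b -> mu a b ** mu c d = if b == c then mu a d else 0.
move=> ab; rewrite /mu amulA -(amulA (v a)); case: eqP => [<-|/eqP bc]. by have [_ _ ->] := vr b; rewrite -ab unit_vp.
by rewrite unit_vv// amulr0 amul0r.
Qed.

Lemma scal_inj a (c d : R[i]) : c *: p a = d *: p a -> c = d.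
move/eqP; rewrite -subr_eq0 -scalerBl scaler_eq0 (negbTE (pf.1 a).2) orbF subr_eq0.
by move/eqP.
Qed.

(** The coefficient of [x] at [e_ab], read off in the minimal corner of the representative [r a],
    and zero by convention off the blocks. *)
Definition mcoord x a b : Cx R := if r a == r b then sval (cid (pm (r a) (star (v a) ** x ** v b))) else 0 : R[i].

Lemma mcoordE x a b : r a = r b -> star (v a) ** x ** v b = mcoord x a b *: p (r a).
move=> ab; rewrite /mcoord ab eqxx; case: cid => c /= <-.
by rewrite -ab !amulA -{1}(unit_sa (r a)) -starM unit_vp ab -!amulA unit_vp.
Qed.
Lemma mcoord_uniq x a b (c : R[i]) : r a = r b -> star (v a) ** x ** v b = c *: p (r a) -> mcoord x a b = c.
by move=> ab; rewrite mcoordE// => /scal_inj. Qed.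
Lemma mcoord_off x a b : r a != r b -> mcoord x a b = 0.
by rewrite /mcoord => /negbTE ->. Qed.

Lemma mcoord_lin a b : linear (fun x => mcoord x a b).
move=> c x y; have [ab|ab] := eqVneq (r a) (r b); last by rewrite !mcoord_off// scaler0 addr0.
apply: mcoord_uniq => //; rewrite amulDr amulDl amulZr amulZl !mcoordE//.
by rewrite scalerDl scalerA.
Qed.

Lemma vxv0 x a b : r a != r b -> star (v a) ** x ** v b = 0.
move=> ab; rewrite -(unit_pv a) -(unit_pv b) starM unit_sa.
have -> : star (v a) ** p a ** x ** (p b ** v b) = star (v a) ** (p a ** x ** p b) ** v b by nc.
by rewrite pr// amulr0 amul0r.
Qed.

Lemma mcoordM x y a b : mcoord (x ** y) a b = \sum_k mcoord x a k * mcoord y k b.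
have [ab|ab] := eqVneq (r a) (r b); last first. rewrite mcoord_off// big1// => k _; have [ak|ak] := eqVneq (r a) (r k).
 by rewrite [mcoord y k b]mcoord_off ?mulr0// -ak. by rewrite mcoord_off ?mul0r.
apply: mcoord_uniq => //; rewrite -{1}[x]unit_r !(amulsr, amulsl) scaler_suml.
each k; have [_ <- _] := vr k.
have -> : star (v a) ** (x ** (v k ** star (v k)) ** y) ** v b =
 (star (v a) ** x ** v k) ** (star (v k) ** y ** v b) by nc.
have [ak|ak] := eqVneq (r a) (r k). rewrite !mcoordE -?ak// amulZl amulZr scalerA unit_sq. by [].
by rewrite vxv0// amul0r mcoord_off// mul0r scale0r.
Qed.

Lemma mcoordS x a b : mcoord (star x) a b = conjc (mcoord x b a).
have [ab|ab] := eqVneq (r a) (r b); last first. rewrite (mcoord_off _ ab) [mcoord x b a]mcoord_off 1?eq_sym//.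
 by apply/eqP; rewrite /= oppr0.
apply: mcoord_uniq => //.
have -> : star (v a) ** star x ** v b = star (star (v b) ** x ** v a). by rewrite !starM starK amulA.
by rewrite mcoordE// starZc unit_sa ab.
Qed.

Lemma mcoord_sum x : x = \sum_a \sum_b mcoord x a b *: mu a b.
rewrite -{1}[x]p1 -{1}[_ ** x]unit_r !amulsl; each a.
rewrite amulsr; each b.
have [ab|ab] := eqVneq (r a) (r b); last by rewrite pr// mcoord_off// scale0r.
have [_ <- _] := vr a; have [_ <- _] := vr b; rewrite /mu.
have -> : v a ** star (v a) ** x ** (v b ** star (v b)) = v a ** (star (v a) ** x ** v b) ** star (v b) by nc.
by rewrite mcoordE// amulZr amulZl unit_vp.
Qed.

Lemma mcoord_hom : star_hom (fun x => mxo (mcoord x)).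
split.
- move=> c x y; rewrite -mxoZ -mxoD; apply: eq_mxo => a b. exact: mcoord_lin.
- move=> x y; rewrite -mxoM; apply: eq_mxo => a b. exact: mcoordM.
- move=> x; rewrite -mxoS; apply: eq_mxo => a b. exact: mcoordS.
Qed.

Lemma mcoord_bmap (P : cstar R) (psi : P -> F) : completely_positive psi ->
 contractive psi -> bmap r (fun s => mcoord (psi s)).
move=> cp ct; split.
- by move=> a b c x y; rewrite cp.1 mcoord_lin.
- move=> I X /(cp_gpos cp)[L [z zE]].
 exists (L * 'I_m)%type, (fun lk ua => mcoord (z lk.1 ua.1) lk.2 ua.2) => -[u a] [w b] /=.
 rewrite zE (lin_sum (mcoord_lin a b)) -(pair_bigA _ (fun l k => star (mcoord (z l u) k a) ** mcoord (z l w) k b)) /=.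
 each l; rewrite mcoordM; each k. by rewrite mcoordS.
- move=> x; bnd (hom_contr aid_l aid_r mcoord_hom _). by have := ct x; rewrite !normE lecR.
- by move=> x a b; exact: mcoord_off.
Qed.

End Units.

(** * Matricial data of an approximation *)

Section QData.
Context {R} {P : cstar R}.

(* A matricial form of an approximation: [w] collects the images of the first
 columns of the matrix units of the finite-dimensional algebra. *)
Definition qdata (dr : Prop) n (S : seq P) (e : R) : Prop :=
 exists (J : finType) (r : J -> J) (kap : J -> 'I_n.+1) (psi : P -> J -> J -> Cx R) (w : J -> P),
 [/\ [/\ forall a, kap (r a) = kap a, forall a, r (r a) = r a & bmap r psi],
 forall a b, kap a = kap b -> a != b -> star (w a) ** w b = 0,
 forall a, star (w a) ** w a = star (w (r a)) ** w (r a) /\ nm (w a) <= 1,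
 dr -> nm (\sum_a w a ** star (w a)) <= 1 + e
 & forall s, s \in S -> nm (\sum_a \sum_b psi s a b *: (w a ** star (w b)) - s) <= e].

Lemma seq_bound (S : seq P) : exists2 K : R, 0 <= K & forall s, s \in S -> nm s <= K.
elim: S => [|s S [K K0 SK]]; first by exists 0.
exists (nm s + K); first by rewrite addr_ge0// nm_ge0.
move=> x; rewrite inE => /orP[/eqP ->|/SK h]; first by lra.
by bnd h; rewrite lerDr nm_ge0.
Qed.

Section FromUnits.
Context {F : cstar R} (m n : nat).
Variables (p : 'I_m -> F) (r : 'I_m -> 'I_m) (v : 'I_m -> F).
Hypotheses (pf : orth_family p) (p1 : forall x, (\sum_i p i) ** x = x).
Hypothesis pm : forall i x, exists c : R[i], p i ** x ** p i = c *: p i.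
Hypothesis vr : forall a, [/\ r (r a) = r a, v a ** star (v a) = p a & star (v a) ** v a = p (r a)].
Hypothesis pr : forall a b x, r a != r b -> p a ** x ** p b = 0.
Variables (phi : F -> P) (I : 'I_n.+1 -> cstarSubalg F).
Hypotheses (cphi : completely_positive phi) (Iid : forall i, is_ideal (I i)) (Ids : is_direct_sum I).
Hypothesis Iphi : forall i (phi_i := fun x : csubstar (I i) => phi (val x)),
 [/\ completely_positive phi_i, contractive phi_i & order_zero phi_i].
Local Notation mu := (mu v).
Let muM := muM pf vr.

(** Decompose [p b] along the ideals. By minimality each compressed component is a multiple of
    [p b]; one multiple is nonzero, and then [p b] itself lies in that ideal. *)
Let colour_ex b : exists i, ssa_set (I i) (p b).
have [y [[yI yE] _]] := Ids (p b).
pose c i := sval (cid (pm b (y i))).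
have cE i : p b ** y i ** p b = c i *: p b := svalP (cid (pm b (y i))).
case: (pickP (fun i => c i != 0)) => [i ci|c0]. exists i; rewrite -[p b](scale1r) -(mulVf ci) -scalerA -cE; apply: ssaZ.
 by apply: (Iid _ _).2; apply: (Iid _ _).1.
case/negP: (pf.1 b).2; apply/eqP.
rewrite -(unit_sq pf b) -{1}(unit_sq pf b) {2}yE amulsr amulsl big1// => i _.
by rewrite cE; move/negbFE : (c0 i) => /eqP ->; rewrite scale0r.
Qed.

(** The colour is chosen at the representative [r a], so that it is constant on blocks. *)
Let kap a : 'I_n.+1 := sval (cid (colour_ex (r a))).

Let kapr a b : r a = r b -> kap a = kap b. by rewrite /kap => ->. Qed.
Let rr a : r (r a) = r a. by case: (vr a). Qed.

Let muI a b : r a = r b -> ssa_set (I (kap a)) (mu a b).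
move=> ab; rewrite /mu -(unit_vp pf vr a).
apply: (Iid _ _).2; apply: (Iid _ _).1; exact: svalP (cid (colour_ex (r a))).
Qed.

Let ozE i (g h u w : F) : ssa_set (I i) g -> ssa_set (I i) h -> ssa_set (I i) u ->
 ssa_set (I i) w -> star g ** g ** (star h ** h) = 0 -> phi (u ** (star g ** g)) ** phi (star h ** h ** w) = 0.
move=> gI hI uI wI gh; have [c _ o] := Iphi i.
apply: (oz_prod (f := fun x : csubstar (I i) => phi (val x)) c o (g := mksub gI) (h := mksub hI) (mksub uI) (mksub wI)).
exact: val_inj.
Qed.

Let mu_orth a b d c : r a = r b -> r d = r c -> kap a = kap d -> b != d -> phi (mu a b) ** phi (mu d c) = 0.
move=> ab dc ad bd; have sq x : star (p x) ** p x = p x by rewrite unit_sa// unit_sq.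
have muI' x y : r x = r y -> kap x = kap a -> ssa_set (I (kap a)) (mu x y). by move=> xy <-; exact: muI.
have := ozE (i := kap a) (g := p b) (h := p d) (u := mu a b) (w := mu d c).
rewrite !sq -!(mu_diag vr) !muM ?eqxx//; apply => //; try exact: muI'.
- by apply: muI' => //; exact: kapr.
- by rewrite (negbTE bd).
Qed.

(** In the 2 by 2 corner of [b] and [e], the positive elements [g] and [h] with entries [1, 1, 1, 1]
    and [1, -1, -1, 1] are orthogonal. Expanding [phi (e_ab g) phi (h e_bc) = 0], the mixed terms
    vanish by [mu_orth] and the stated equality remains. *)
Let mu_swap a b e c : r a = r b -> r a = r e -> r a = r c ->
 phi (mu a b) ** phi (mu b c) = phi (mu a e) ** phi (mu e c).
move=> ab ae ac; have [->//|be] := eqVneq b e.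
have eb : e != b by rewrite eq_sym.
have muI' x y : r x = r y -> r x = r a -> ssa_set (I (kap a)) (mu x y). by move=> xy xa; rewrite -(kapr xa); exact: muI.
have [rb re rc] : [/\ r b = r a, r e = r a & r c = r a] by [].
have rE : (r a = r a) * (r b = r a) * (r e = r a) * (r c = r a) by [].
pose g := (mu b b + mu e e) + (mu b e + mu e b).
pose h := (mu b b + mu e e) - (mu b e + mu e b).
have gS : star g = g by rewrite /g !starD !muS (addrC (mu e b)).
have hS : star h = h by rewrite /h starB !starD !muS (addrC (mu e b)).
have tab : (mu b b ** mu b b = mu b b) * (mu b b ** mu e e = 0) * (mu b b ** mu b e = mu b e) *
 (mu b b ** mu e b = 0) * (mu e e ** mu b b = 0) * (mu e e ** mu e e = mu e e) *
 (mu e e ** mu b e = 0) * (mu e e ** mu e b = mu e b) * (mu b e ** mu b b = 0) *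
 (mu b e ** mu e e = mu b e) * (mu b e ** mu b e = 0) * (mu b e ** mu e b = mu b b) *
 (mu e b ** mu b b = mu e b) * (mu e b ** mu e e = 0) * (mu e b ** mu b e = mu e e) * (mu e b ** mu e b = 0).
 by do !split; rewrite muM ?rE// ?eqxx// ?(negbTE be) ?(negbTE eb).
have gg : g ** g = 2%:C *: g. by rewrite !(amulDl, amulDr) !tab /g; nc.
have hh : h ** h = 2%:C *: h. by rewrite !(amulBl, amulBr, amulDl, amulDr) !tab /h; nc.
have gh : g ** h = 0. by rewrite !(amulBl, amulBr, amulDl, amulDr) !tab; nc.
have gI : ssa_set (I (kap a)) g by apply: ssaD; apply: ssaD; apply: muI'; rewrite ?rE.
have hI : ssa_set (I (kap a)) h.
 by rewrite /h -scaleN1r; apply: ssaD; [|apply: ssaZ]; apply: ssaD; apply: muI'; rewrite ?rE.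
have := ozE gI hI (muI' a b ab erefl) (muI' b c (etrans rb ac) rb).
rewrite gS hS gg hh amulZl amulZr gh !scaler0 => /(_ erefl).
rewrite amulZr amulZl.
have -> : mu a b ** g = mu a b + mu a e. by rewrite !amulDr !muM ?rE// !eqxx (negbTE be) !addr0.
have -> : h ** mu b c = mu b c - mu e c. by rewrite !(amulBl, amulDl) !muM ?rE// !eqxx (negbTE eb) addr0 add0r.
have [pl _] := cphi; rewrite !(linZ pl) amulZl amulZr scalerA => /eqP.
rewrite scaler_eq0 mulf_eq0 orbb eq_complex /= pnatr_eq0 /= => /eqP.
rewrite (linD pl) (linB pl) !(amulDl, amulBr).
rewrite (mu_orth (b := b) (d := e)) ?rE//; last exact: kapr.
rewrite (mu_orth (b := e) (d := b)) ?rE//; last exact: kapr.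
by rewrite subr0 add0r => /eqP; rewrite subr_eq0 => /eqP.
Qed.

Local Notation M := (adjop (hself P)).
Let U a b : M := lmul (phi (mu a b)).
Let el := p1.
Let er x : x ** (\sum_i p i) = x := unit_r pf p1 x.

Let U_star a b : star (U a b) = U b a.
by have [[_ _ <-] _] := lmul_iso P; rewrite -(cp_map_star el er cphi) muS. Qed.

Let U_orth a b d c : r a = r b -> r d = r c -> kap a = kap d -> b != d -> U a b ** U d c = 0.
have [[ll <- _] _] := lmul_iso P => ab dc ad bd.
by rewrite mu_orth// (lin0 ll).
Qed.

Let U_swap a b e c : r a = r b -> r a = r e -> r a = r c -> U a b ** U b c = U a e ** U e c.
by have [[_ lM _] _] := lmul_iso P => ab ae ac; rewrite -!lM (mu_swap ab ae ac). Qed.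

Let U_np a : np aid (U a a).
apply/pos_lmul; have [L [z zE]] := cp_gram (fun _ => p a) cphi.
rewrite (mu_diag vr) -(unit_sq pf) -{1}(unit_sa pf) (zE true true).
by apply: pos_sum => l _; exact: pos_star.
Qed.

Let U_nm a : nm (U a a) <= 1.
rewrite (lmul_iso P).2; have [_ c _] := Iphi (kap a).
have := c (mksub (muI (erefl (r a)))); rewrite !normE lecR => /le_trans; apply.
rewrite -(val_iso (I (kap a))).2 /= (mu_diag vr).
have := nm_sq (unit_sa pf a); rewrite unit_sq// expr2 => h.
have [->//|p0] := eqVneq (nm (p a)) 0.
by move/eqP : h; rewrite -{1}[nm (p a)]mulr1 => /eqP/(mulfI p0) <-.
Qed.

(** The column [w a] is [phi (e_ar) (phi (e_rr) + d)^(-1/2)] with [r = r a]. Its inner products with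
    columns of its colour are exactly orthogonal, and [star (w a) ** w a] depends on the block only,
    by [mu_swap]. The error in recovering [phi (e_ab)] is [d (phi (e_aa) + d)^-1 phi (e_ab)], of
    norm at most [d]. *)
Lemma units_qdata (d : R) : 0 < d -> exists (kap : 'I_m -> 'I_n.+1) (w : 'I_m -> P), [/\ forall a, kap (r a) = kap a,
 forall a b, kap a = kap b -> a != b -> star (w a) ** w b = 0,
 forall a, star (w a) ** w a = star (w (r a)) ** w (r a) /\ nm (w a) <= 1
 & forall a b, r a = r b -> nm (phi (mu a b) - w a ** star (w b)) <= d].
move=> d0; have [[ll lM lS] lN] := lmul_iso P.
have ex a : {ck : M * M | [/\ [/\ np aid ck.1, (U a a + d%:C *: aid) ** ck.1 = aid & lat (U a a) ck.1]
 & [/\ np aid ck.2, ck.2 ** ck.2 = ck.1 & lat (U a a) ck.2]]}.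
 apply: cid; have [c [c1 c2 c3 _]] := np_inv aid_l aid_r (U_np a) d0. have [k [k1 k2 k3]] := np_sqrt aid_l aid_r c1.
 by exists (c, k); split; split => //=; exact: lat_trans c3 k3.
pose c a := (sval (ex a)).1; pose k a := (sval (ex a)).2.
have cP a : [/\ np aid (c a), (U a a + d%:C *: aid) ** c a = aid & lat (U a a) (c a)]. by case: (svalP (ex a)).
have kP a : [/\ np aid (k a), k a ** k a = c a & lat (U a a) (k a)]. by case: (svalP (ex a)).
clearbody c k; clear ex.
have sk a : star (k a) = k a by case: (kP a) => -[].
have sc a : star (c a) = c a by case: (cP a) => -[].
have kU a : k a ** U a a = U a a ** k a. have [_ _ l] := kP a.
 exact: (bic_comm (lat_bicU aid_l aid_r l) (@bic_refl _ _ _)).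
have cU a : c a ** U a a = U a a ** c a. have [_ _ l] := cP a.
 exact: (bic_comm (lat_bicU aid_l aid_r l) (@bic_refl _ _ _)).
have cUd a : c a ** (U a a + d%:C *: aid) = aid. have [_ h _] := cP a.
 by rewrite -[RHS]h amulDr amulDl cU amulZr amulZl aid_l aid_r.
have Uc1 a : nm (U a a ** c a) <= 1 by have [h1 h2 h3] := cP a; exact: (inv_est aid_l aid_r (U_np a) d0 h1 h2 h3).
(* As [lmul] has a left ideal as image, [k U_ra] is realised by an element of [P]; the adjoint of
   that element realises [U_ar k]. *)
pose w a := star (aop (k (r a)) (star (phi (mu a (r a))))).
have wE a : lmul (w a) = U a (r a) ** k (r a). by rewrite lS -op_lmul starM lS starK sk.
clearbody w.
exists kap, w; split.
- by move=> a; apply: kapr.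
- move=> a b ab nab; apply: (isohom_inj (lmul_iso P)); rewrite lM lS !wE (lin0 ll). rewrite starM U_star sk.
 have -> : k (r a) ** U (r a) a ** (U b (r b) ** k (r b)) = k (r a) ** (U (r a) a ** U b (r b)) ** k (r b) by nc.
 rewrite U_orth ?amulr0 ?amul0r//. by rewrite -ab; apply: kapr.
- move=> a; split. apply: (isohom_inj (lmul_iso P)); rewrite !lM !lS !wE !starM !U_star !sk !rr.
 have h x : k (r a) ** U (r a) x ** (U x (r a) ** k (r a)) = k (r a) ** (U (r a) x ** U x (r a)) ** k (r a) by nc.
 by rewrite !h (@U_swap (r a) a (r a)). rewrite -lN -(@expr_le1 _ 2) ?nm_ge0// -nmSS wE starM U_star sk.
 have -> : k (r a) ** U (r a) a ** (U a (r a) ** k (r a)) = k (r a) ** (U (r a) a ** U a (r a)) ** k (r a) by nc.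
 rewrite (@U_swap (r a) a (r a)) ?rr//. have -> : k (r a) ** (U (r a) (r a) ** U (r a) (r a)) ** k (r a) =
 U (r a) (r a) ** (U (r a) (r a) ** (k (r a) ** k (r a))).
 by rewrite !amulA kU -!amulA; congr (_ ** _); rewrite !amulA kU. have [_ -> _] := kP (r a).
 by bnd (nmMl _ (U_nm _)); rewrite mul1r.
move=> a b ab; rewrite -lN (linB ll) lM lS !wE starM U_star sk -ab -/(U a b).
have [_ kk _] := kP (r a).
have -> : U a (r a) ** k (r a) ** (k (r a) ** U (r a) b) = U a (r a) ** c (r a) ** U (r a) b. by rewrite -kk; nc.
have Uca : U a (r a) ** c (r a) = c a ** U a (r a). have [_ h _] := cP (r a).
 have e1 : U a (r a) ** (U (r a) (r a) + d%:C *: aid) = (U a a + d%:C *: aid) ** U a (r a).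
 by rewrite amulDr amulDl (@U_swap a (r a) a (r a))// amulZr amulZl aid_l aid_r.
 transitivity (c a ** ((U a a + d%:C *: aid) ** U a (r a)) ** c (r a)). by rewrite amulA cUd aid_l.
 by rewrite -e1 -!amulA h aid_r.
have -> : U a b - U a (r a) ** c (r a) ** U (r a) b = d%:C *: (c a ** U a b).
 rewrite Uca -amulA (@U_swap a (r a) a b)//.
 have -> : d%:C *: (c a ** U a b) = c a ** (U a a + d%:C *: aid) ** U a b - c a ** (U a a ** U a b).
 rewrite amulDr amulZr aid_r; nc. by rewrite cUd aid_l.
rewrite nmZ0 ?(ltW d0)//; rewrite ler_piMr ?(ltW d0)//.
rewrite -(@expr_le1 _ 2) ?nm_ge0// -nmSSr starM U_star sc.
have -> : c a ** U a b ** (U b a ** c a) = c a ** (U a b ** U b a) ** c a by nc.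
rewrite (@U_swap a b a)//.
have -> : c a ** (U a a ** U a a) ** c a = (U a a ** c a) ** (U a a ** c a). by rewrite !amulA cU.
bnd nmM; apply: mulr_ile1 => //; exact: nm_ge0.
Qed.

End FromUnits.

Lemma dim_qdata dr n (S : seq P) (e : R) : dim_le dr P n -> 0 < e -> qdata dr n S e.
move=> h e0; have [K K0 SK] := seq_bound S; have e2 : 0 < e / 2 by lra.
have [F [psi [phi [[fd cpsi ctpsi cphi [I [Iid Ids Iphi]]] hdr hS]]]] := h S _ e2.
have [m [p [r [v [pf p1 pm vr pr]]]]] := fin_units fd.
pose N : R := m%:R; have N0 : 0 <= N by exact: ler0n.
(* There are [N] diagonal terms in the norm bound and [N^2] terms with coefficients at most [K] in
   the reproduction, each with an error of at most [d]. *)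
pose d := e / (2 * (1 + N + N ^+ 2 * K)).
have M0 : 0 <= N ^+ 2 * K by rewrite mulr_ge0// sqr_ge0.
have D0 : 0 < 2 * (1 + N + N ^+ 2 * K) by lra.
have d0 : 0 < d by exact: divr_gt0.
have dE : d * (1 + N + N ^+ 2 * K) = e / 2. by rewrite /d; field; lra.
have [kap [w [kr worth wn wd]]] := units_qdata pf p1 pm vr cphi Iid Ids Iphi d0.
exists 'I_m, r, kap, (fun s => mcoord r v pm (psi s)), w; split => //.
- split => //; first by move=> a; case: (vr a). exact: mcoord_bmap.
- move=> /hdr ct. have -> : \sum_a w a ** star (w a) = phi (\sum_a p a) - \sum_a (phi (mu v a a) - w a ** star (w a)).
 rewrite (lin_sum cphi.1) -sumrB; each a. by rewrite (mu_diag vr) opprB addrC subrK. bnd nmB; apply: lerD.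
 apply: le_trans (_ : nm (\sum_a p a) <= 1); last exact: nm_unit p1. by have := ct (\sum_a p a); rewrite !normE lecR.
 bnd_sum. bnd (ler_sum _ (fun a _ => wd a a erefl)). rewrite sumr_const card_ord -[leLHS]mulr_natl -/N.
 by have := ltW d0; nra.
move=> s Ss; set c := mcoord r v pm (psi s).
have cE : phi (psi s) = \sum_a \sum_b c a b *: phi (mu v a b).
 rewrite {1}(mcoord_sum pf p1 pm vr pr (psi s)) (lin_sum cphi.1); each a.
 by rewrite (lin_sum cphi.1); each b; rewrite (linZ cphi.1).
have cn a b : nm (c a b) <= K. bnd (nm_entry c a b).
 bnd (bm_contr (mcoord_bmap pf p1 pm vr pr cpsi ctpsi) s); exact: SK.
have -> : \sum_a \sum_b c a b *: (w a ** star (w b)) - s =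
 - (\sum_a \sum_b c a b *: (phi (mu v a b) - w a ** star (w b))) + (phi (psi s) - s).
 rewrite cE addrA; congr (_ - s); rewrite -sumrN -big_split; each a. rewrite -sumrN -big_split; each b.
 by rewrite /= scalerBr opprB subrK.
bnd nmD; rewrite nmN.
via (N * (N * (K * d)) + e / 2). apply: lerD; last exact: ltW (hS s Ss). bnd_sum. via (\sum_(a < m) \sum_(b < m) K * d).
 each a; bnd_sum; each b. have [ab|ab] := eqVneq (r a) (r b).
 rewrite nmCZ; apply: (ler_pM (nm_ge0 (c a b : R[i]^o)) (nm_ge0 _)); first exact: cn. exact: wd.
 by rewrite /c mcoord_off// scale0r nm0 mulr_ge0// ltW.
 have sc (x : R) : \sum_(a < m) x = N * x by rewrite sumr_const card_ord mulr_natl. by rewrite sc sc.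
have h1 : 0 <= d * (1 + N) by rewrite mulr_ge0 ?ltW//; lra.
have -> : N * (N * (K * d)) = d * (1 + N + N ^+ 2 * K) - d * (1 + N) by ring.
lra.
Qed.

End QData.

Lemma sum_pair (V : nmodType) (I J : finType) (F : I * J -> V) : \sum_u F u = \sum_i \sum_j F (i, j).
by rewrite pair_bigA; apply: eq_bigr => -[i j]. Qed.
Lemma half_complex R : (2^-1 : R)%:C = 2^-1 :> R[i].
by rewrite fmorphV rmorph_nat. Qed.

(** * Positive generators and contractivity of completely positive maps *)

Section PositiveParts.
Context {R} {A : cstar R}.
Implicit Types x y : A.

(** The parts found among operators are [(r + x) / 2] and [(r - x) / 2] with [r] the root of [x^2],
    and [sqrt_in] puts [r] in [A]. *)
Lemma pos_parts x : sa x -> exists p q : A, [/\ positive p, positive q & x = p - q].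
move=> sx; have ii := lmul_iso A; have [[ll lM lS] lN] := ii.
pose e : adjop (hself A) := aid; have el : forall T : adjop (hself A), e ** T = T := aid_l.
have er : forall T : adjop (hself A), T ** e = T := aid_r.
have sX : sa (lmul x) by rewrite /sa -lS sx.
have [P [Q [pP pQ XE PQ _]]] := np_parts el er sX.
have [sP _] := pP; have [sQ _] := pQ.
have QP : Q ** P = 0 by rewrite -sP -sQ -starM PQ star0.
have [r [pr rr lr]] := np_sqrt el er (sq_np el er sX).
have PQr : (P + Q) ** (P + Q) = lmul x ** lmul x. by rewrite XE !(amulDl, amulDr, amulNl, amulNr) PQ QP; nc.
have rE : r = P + Q. apply/subr0_eq/nm_le0; apply: (sqrt_close el er) => //.
 - exact: npD.
 - by rewrite PQr rr subrr; exact: np0.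
 - by rewrite PQr rr expr0n scale0r add0r subrr; exact: np0.
have [k _ kE] : range (@lmul R A) r. apply: (sqrt_in el er (range_closed ii) _ _ _ _ pr rr lr).
 - by move=> u v [a _ <-] [b _ <-]; exists (a + b) => //; rewrite (linD ll).
 - by move=> c u [a _ <-]; exists (c *: a) => //; rewrite (linZ ll).
 - by move=> u [a _ <-]; exists (x ** x ** a) => //; rewrite !lM.
 - by exists (x ** x) => //.
have PE : lmul (2^-1%:C *: (k + x)) = P. rewrite (linZ ll) (linD ll) kE rE XE; nc.
have QE : lmul (2^-1%:C *: (k - x)) = Q. rewrite (linZ ll) (linB ll) kE rE XE; nc.
exists (2^-1%:C *: (k + x)), (2^-1%:C *: (k - x)); split.
- by apply/pos_lmul; rewrite PE.
- by apply/pos_lmul; rewrite QE.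
- by apply: (isohom_inj ii); rewrite (linB ll) PE QE.
Qed.

Lemma pos_decomp x : exists (p : 'I_4 -> A) (c : 'I_4 -> R[i]),
 [/\ forall i, positive (p i), forall i, nm (c i : R[i]^o) <= 1 & x = \sum_i c i *: p i].
pose I : R[i] := 0 +i* 1.
have cI : conjc I = - I by apply/eqP; rewrite eq_complex /= oppr0 !eqxx.
have II : I * I = -1 by apply/eqP; rewrite eq_complex /= !(mul0r, mulr0, mulr1, addr0, sub0r, oppr0) !eqxx.
pose h : R[i] := (2^-1 : R)%:C; have hs : conjc h = h by apply/eqP; rewrite eq_complex /= oppr0 !eqxx.
have hh : h + h = 1 by rewrite /h half_complex [RHS]splitr div1r.
have [p1 [q1 [pp1 pq1 e1]]] : exists p q : A, [/\ positive p, positive q & h *: (x + star x) = p - q].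
 by apply: pos_parts; rewrite /sa starZc starD starK hs addrC.
have [p2 [q2 [pp2 pq2 e2]]] : exists p q : A, [/\ positive p, positive q & (h * I) *: (star x - x) = p - q].
 have hI : conjc (h * I) = conjc h * conjc I by exact: rmorphM.
 apply: pos_parts; rewrite /sa starZc starB starK hI hs cI mulrN scaleNr -scalerN opprB. by [].
pose pv := [:: p1; q1; p2; q2]; pose cv : seq R[i] := [:: 1; -1; I; - I].
exists (fun i => nth 0 pv i), (fun i => nth 0 cv i); split.
- by case=> -[|[|[|[|//]]]].
- have n1 : nm (1 : R[i]^o) <= 1 by rewrite nmc_def /= expr0n addr0 expr1n sqrtr1.
 have nI : nm (I : R[i]^o) <= 1 by rewrite nmc_def /= expr0n add0r expr1n sqrtr1.
 by case=> -[|[|[|[|//]]]] _ /=; rewrite ?nmN.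
rewrite !big_ord_recl big_ord0 /= addr0 scale1r scaleN1r scaleNr addrA -e1 -scalerBr -e2.
rewrite scalerA mulrCA II mulrN1 scaleNr -scalerN opprB -scalerDr addrACA subrr addr0.
by rewrite scalerDr -scalerDl hh scale1r.
Qed.

(** Each element of the finite set is split into four positive ones. After division by [M] all of
    these are below their sum [c^2], of norm at most one; the tolerance [e / (4 M)] pays for the
    scaling and for the four terms. *)
Lemma dim_le_pos dr n : (forall (I : finType) (s : I -> A) (c : A) (e : R), 0 < e -> positive c -> nm c <= 1 ->
 (forall i, positive (s i)) -> (forall i, positive (c ** c - s i)) -> approx_at dr n (codom s) e) -> dim_le dr A n.
move=> h S e e0.
have ex x : {pc : ('I_4 -> A) * ('I_4 -> R[i]) | [/\ forall i, positive (pc.1 i),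
 forall i, nm (pc.2 i : R[i]^o) <= 1 & x = \sum_i pc.2 i *: pc.1 i]}.
 by apply: cid; have [p [c H]] := pos_decomp x; exists (p, c).
pose N := size S; pose u (k : 'I_N * 'I_4) := (sval (ex (nth 0 S k.1))).1 k.2.
have pu k : positive (u k) by rewrite /u; case: (svalP (ex (nth 0 S k.1))).
pose M := 1 + \sum_k nm (u k).
have M1 : 1 <= M by rewrite lerDl; apply: sumr_ge0 => k _; exact: nm_ge0.
have M0 : 0 < M by apply: lt_le_trans ltr01 M1.
pose s k := M^-1%:C *: u k.
have ps k : positive (s k) by apply: posZ => //; rewrite invr_ge0 ltW.
have pc : positive (\sum_k s k) by apply: pos_sum.
have [c [cp cc]] := pos_sqrt pc.
have c1 : nm c <= 1. rewrite -(@expr_le1 _ 2) ?nm_ge0// -nm_sq; last exact: pos_sa.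
 rewrite cc -scaler_sumr nmZ0 ?invr_ge0 ?(ltW M0)// mulrC ler_pdivrMr// mul1r. by bnd_sum; rewrite lerDr.
have e'0 : 0 < e / (4 * M) by rewrite divr_gt0// mulr_gt0.
have sc k : positive (c ** c - s k). by rewrite cc (bigD1 k)//= addrAC subrr add0r; apply: pos_sum => j.
have [F [psi [phi [na hdr hS]]]] := h _ s c _ e'0 cp c1 ps sc.
exists F, psi, phi; split => // a aS.
have [_ [psl _] _ [phl _] _] := na.
pose i : 'I_N := Ordinal (etrans (index_mem a S) aS).
have [p4 c4 aE] := svalP (ex a); set pv := (sval (ex a)).1 in p4 aE; set cv := (sval (ex a)).2 in c4 aE.
have uE j : u (i, j) = pv j by rewrite /u nth_index.
have Ms j : pv j = M%:C *: s (i, j). by rewrite scalerA -rmorphM mulfV ?gt_eqF// scale1r.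
have -> : phi (psi a) - a = \sum_j (cv j * M%:C) *: (phi (psi (s (i, j))) - s (i, j)).
 rewrite {1 2}aE (lin_sum psl) (lin_sum phl) -sumrB; each j.
 transitivity (phi (psi ((cv j * M%:C) *: s (i, j))) - (cv j * M%:C) *: s (i, j)). by rewrite Ms scalerA.
 by rewrite (linZ psl) (linZ phl) scalerBr.
apply: le_lt_trans (nm_sum _ _ _) _.
have bnd j : nm ((cv j * M%:C) *: (phi (psi (s (i, j))) - s (i, j))) < e / 4.
 have sS : s (i, j) \in codom s by exact: codom_f. have := hS _ sS; rewrite -scalerA nmCZ nmZ0 ?(ltW M0)// => H.
 via (M * nm (phi (psi (s (i, j))) - s (i, j))). rewrite ler_piMl// ?mulr_ge0 ?nm_ge0 ?(ltW M0)//; exact: c4 j.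
 rewrite mulrC -ltr_pdivlMr//; apply: lt_le_trans H _. by rewrite invfM mulrA.
rewrite !big_ord_recl big_ord0 addr0; move: (bnd ord0) (bnd (lift ord0 ord0)).
move: (bnd (lift ord0 (lift ord0 ord0))) (bnd (lift ord0 (lift ord0 (lift ord0 ord0)))).
move: (nm) (nm _) (nm _) (nm _) => a1 a2 a3 a4; lra.
Qed.

End PositiveParts.

Section CpContr.
Context {R}.

(* Cauchy-Schwarz for the Gram matrix of an approximate unit and [x]. *)
Lemma cp_contr (Q C : cstar R) (f : Q -> C) (K : R) : linear f ->
 (forall b : bool -> Q, gpos (fun p q => f (star (b p) ** b q))) -> (forall x, nm (f x) <= K * nm x) ->
 (forall u, positive u -> nm u <= 1 -> nm (f u) <= 1) -> forall x, nm (f x) <= nm x.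
move=> fl fg fK f1 x.
have fp u : positive u -> nm (f u) <= nm u. move=> pu; have [->|u0] := eqVneq u 0; first by rewrite (lin0 fl) !nm0.
 have n0 : 0 < nm u. by rewrite lt_neqAle nm_ge0 andbT eq_sym; apply: contraNneq u0 => /nm_eq0 ->.
 have h : nm ((nm u)^-1%:C *: u) <= 1 by rewrite nmZV// divff// gt_eqF.
 have := f1 _ (posZ _ pu) h; rewrite (linZ fl) nmZV//. by rewrite ler_pdivrMr// mul1r; apply; rewrite invr_ge0 ltW.
apply/ler_addgt0Pr => e e0; have t0 : 0 < e / (`|K| + 1) by exact: divr_gt0.
have [k [pk k1 kx]] := approx_unit [:: x] t0; have [kx1 _] := kx x (mem_head _ _).
have [L [z zE]] := fg (fun t => if t then k else x).
pose z1 : hvec C L := fun l => z l true; pose z2 : hvec C L := fun l => z l false.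
have e11 : f (k ** k) = hip z1 z1 by rewrite hipE -(zE true true) (pos_sa pk).
have e12 : f (k ** x) = hip z1 z2 by rewrite hipE -(zE true false) (pos_sa pk).
have e22 : f (star x ** x) = hip z2 z2 by rewrite hipE -(zE false false).
have n1 : nm z1 <= 1. rewrite -(@expr_le1 _ 2) ?nm_ge0// nm_hv hnm_sq -e11; apply: f1.
 by rewrite -{1}(pos_sa pk); exact: pos_star. by bnd nmM; rewrite mulr_ile1// nm_ge0.
have n2 : nm z2 <= nm x. rewrite -ler_sqr ?nnegrE ?nm_ge0// nm_hv hnm_sq -e22 -nmSS. by apply: fp; exact: pos_star.
have -> : f x = f (k ** x) + f (x - k ** x) by rewrite -(linD fl) addrC subrK.
bnd nmD; apply: lerD. rewrite e12; bnd nm_hip. by apply: le_trans n2; rewrite ler_piMl// nm_ge0.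
bnd fK; via ((`|K| + 1) * nm (x - k ** x)). by apply: ler_wpM2r; [exact: nm_ge0|rewrite ler_wpDr// ler_norm].
by rewrite mulrC -ler_pdivlMr.
Qed.

End CpContr.

Section Amplify.
Context {R} {P C : cstar R} (f : P -> C) (fi : isohom f).
Context {J : finType} (r : J -> J) (psi : P -> J -> J -> Cx R) (hb : bmap r psi).
Variable I : finType.

Definition amp (y : I -> I -> P) : adjop (hv (Cx R) (I * J)%type) := mxo (fun u v => psi (y u.1 v.1) u.2 v.2).

Lemma nm_psi x a b : nm (psi x a b) <= nm x.
by bnd (nm_entry (psi x) a b); exact: bm_contr hb x. Qed.

Lemma amp_bnd y (M : R) : (forall i j, nm (y i j) <= M) -> nm (amp y) <= (#|{: I * J}| ^ 2)%:R * M.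
move=> yM; bnd nm_mxo.
via (\sum_(u : I * J) \sum_(v : I * J) M). by each u; each v; bnd nm_psi.
have sc (x : R) : \sum_(u : I * J) x = #|{: I * J}|%:R * x by rewrite sumr_const mulr_natl.
by rewrite sc sc mulrA -natrM.
Qed.

Lemma ampB y z : amp (fun i j => y i j - z i j) = amp y - amp z.
rewrite -[- amp z]scaleN1r /amp -mxoZ -mxoD; apply: eq_mxo => u v.
by rewrite (linB (bm_lin hb u.2 v.2)) scaleN1r.
Qed.
Lemma amp_np y : gpos y -> np aid (amp y).
by move=> /(bm_cp hb)/gpos_np. Qed.

Let amp_diag k : positive k -> nm k <= 1 -> nm (amp (fun i j => if i == j then k else 0)) <= 1.
move=> pk k1; set D := amp _.
pose slice (v : hvec (Cx R) (I * J)%type) i : hvec (Cx R) J := fun b => v (i, b).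
have DE v i a : (aop D v : hvec (Cx R) _) (i, a) = (aop (mxo (psi k)) (slice v i) : hvec (Cx R) J) a.
 rewrite /D /amp !mxoE sum_pair /= (bigD1 i)//= eqxx [X in _ + X]big1 ?addr0// => j ji.
 rewrite big1// => b _; rewrite eq_sym (negbTE ji) (lin0 (bm_lin hb a b)). by rewrite amul0r.
have gp (x : P) : positive x -> np aid (mxo (psi x)).
 move=> [y ->]; apply: (gpos_np (X := fun p q => psi (star y ** y) p q)).
 have gu : gpos (fun _ _ : unit => star y ** y).
 by exists unit, (fun _ _ => y) => p q; rewrite big_const card_unit /= addr0.
 apply: (gpos_ext (X := fun p q : J => (fun u v : unit * J => psi (star y ** y) u.2 v.2) (tt, p) (tt, q))) => //.
 have H := gpos_comp (fun p : J => (tt, p)) (bm_cp hb gu); exact: H.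
have pD : np aid D. apply: amp_np; have [x xE] := pk. exists I, (fun l p => if l == p then x else 0) => p q.
 rewrite (bigD1 p)//= eqxx big1 ?addr0 => [|l /negbTE ->]; last by rewrite star0 amul0r.
 by case: eqP => _; rewrite ?amulr0//.
have [sD _] := pD.
apply: (np_bnd aid_l aid_r ler01 pD); apply: ip_np; first exact: (saB (saU aid_l _) sD).
move=> z; rewrite aopDx aopNx aopZx aidE.
have -> : hip z (1%:C *: z - aop D z) = \sum_i hip (slice z i) (aop (1%:C *: aid - mxo (psi k)) (slice z i)).
 rewrite hipE sum_pair. each i; rewrite hipE; each b. by rewrite !hvDE !hvNE DE.
apply: pos_sum => i _; apply: np_ip; apply: (np_le_U aid_l); first by case: (gp _ pk).
by bnd (bm_contr hb k).
Qed.

(** [psi] is contractive on [P], and here matrices over [P] are needed. With an approximate unit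
    [k], the matrix [y] is close to [k y k], which is below the diagonal matrix of [k^2]; the
    amplification of the latter is block diagonal with blocks [psi (k^2)]. *)
Lemma amp_contr y : gpos y -> nm (mxo (fun i j => f (y i j))) <= 1 -> nm (amp y) <= 1.
move=> gy y1; apply/ler_addgt0Pr => e e0.
pose N : R := (#|{: I * J}| ^ 2)%:R; have N0 : 0 <= N by exact: ler0n.
have t0 : 0 < e / (2 * N + 1) by rewrite divr_gt0//; lra.
have [k [pk k1 ky]] := approx_unit [seq y ij.1 ij.2 | ij <- enum {: I * I}] t0.
have kyk i j : nm (y i j - k ** y i j ** k) <= 2 * (e / (2 * N + 1)).
 have [h1 h2] : nm (y i j - k ** y i j) <= e / (2 * N + 1) /\ nm (y i j - y i j ** k) <= e / (2 * N + 1).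
 by apply: ky; apply/mapP; exists (i, j); rewrite ?mem_enum.
 have -> : y i j - k ** y i j ** k = (y i j - k ** y i j) + k ** (y i j - y i j ** k) by nc.
 bnd nmD; rewrite mulr_natl mulr2n; apply: lerD => //. by bnd (nmMl _ k1); rewrite mul1r.
have gk : gpos (fun i j => k ** y i j ** k). have [L [z zE]] := gy; exists L, (fun l i => z l i ** k) => i j.
 rewrite zE amulsr amulsl; each l; rewrite starM (pos_sa pk); nc.
have [fh fN] := fi; have [fl fM fS] := fh.
have gd : gpos (fun i j => (if i == j then k ** k else 0) - k ** y i j ** k).
 have [|Y YE] := gpos_sqrt (X := fun i j => (if i == j then k ** k else 0) - k ** y i j ** k) fi; last by exists I, Y.
 have gfy := gpos_np (gpos_hom fh gy); have [sfy _] := gfy.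
 have -> : mxo (fun p q => f ((if p == q then k ** k else 0) - k ** y p q ** k)) =
 star (dop (fun=> f k)) ** (1%:C *: aid - mxo (fun i j => f (y i j))) ** dop (fun=> f k) :> adjop (hv C I).
 have sd : star (dop (fun=> f k)) = dop (fun=> f k) :> adjop (hv C I). rewrite /dop -mxoS; apply: eq_mxo => p q.
 by rewrite eq_sym; case: eqP => _; rewrite ?star0// -fS (pos_sa pk).
 rewrite sd; apply: adjop_eq => v; apply/funext => i.
 rewrite !aopM dopE aopDx aopNx aopZx aidE hvDE hvNE hvZE dopE !mxoE amulBr. rewrite amulZr scale1r amulsr.
 under eq_bigr => j _ do rewrite (linB fl) amulBl. rewrite sumrB; congr (_ - _); last first.
 by each j; rewrite dopE !fM; nc. rewrite (bigD1 i)//= eqxx big1 ?addr0 => [|j ji]; first by rewrite fM amulA.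
 by rewrite eq_sym (negbTE ji) (lin0 fl) amul0r. apply: (np_conj aid_l aid_r); apply: (np_le_U aid_l) => //.
have h1 : nm (amp (fun i j => k ** y i j ** k)) <= 1. apply: le_trans (amp_diag (k := k ** k) _ _).
 - by apply: (np_mono aid_l aid_r); [exact: amp_np|rewrite -ampB; exact: amp_np].
 - by rewrite -{1}(pos_sa pk); exact: pos_star.
 - by bnd nmM; rewrite mulr_ile1// nm_ge0.
bnd (nm_ler _ (amp (fun i j => k ** y i j ** k))); rewrite addrC; apply: lerD => //.
rewrite -ampB; bnd (amp_bnd kyk); rewrite -/N.
rewrite mulrA -[leRHS]mul1r mulrA mulrC -ler_pdivlMl//.
have D0 : 0 < 2 * N + 1 by lra. have -> : (2 * N + 1)^-1^-1 * (1 * e) = N * (2 * e) + e by rewrite invrK; ring. lra.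
by rewrite invr_gt0; lra.
Qed.

End Amplify.

(** Within one colour the columns are orthogonal, so the rank-one operator of that colour is the
    diagonal of [star (w a) ** w a], of norm at most one. There are [n + 1] colours. *)
Lemma colour_norm R (P : cstar R) (J : finType) n (kap : J -> 'I_n.+1) (w : J -> P) :
 (forall a b, kap a = kap b -> a != b -> star (w a) ** w b = 0) ->
 (forall a, nm (w a) <= 1) -> nm (\sum_a w a ** star (w a)) <= n.+1%:R.
move=> wo w1; pose om k : hvec P J := fun a => if kap a == k then star (w a) else 0.
have -> : \sum_a w a ** star (w a) = \sum_k hip (om k) (om k). under [RHS]eq_bigr => k _ do rewrite hipE.
 rewrite exchange_big; each a. rewrite (bigD1 (kap a))//= /om eqxx starK big1 ?addr0// => k.
 by rewrite eq_sym => /negbTE ->; rewrite amulr0.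
bnd_sum.
via (\sum_(k < n.+1) 1); last by rewrite sumr_const card_ord.
each k; rewrite -hnm_sq -nm_hv -nm_theta.
have -> : theta (om k) (om k) = dop (fun a => if kap a == k then star (w a) ** w a else 0).
 rewrite mxo_theta /dop; apply: eq_mxo => a b; rewrite /om.
 have [<-|ab] := eqVneq a b; first by case: eqP => _; rewrite ?amul0r// starK.
 case: (kap a =P k) => [ka|_]; last by rewrite amul0r.
 by case: (kap b =P k) => [kb|_]; rewrite ?star0 ?amulr0// starK wo// ka.
apply: nm_dop => // a; first by case: eqP => _; [exact: pos_star|exact: pos0].
case: eqP => _; last by rewrite nm0.
by rewrite nmSS expr_le1// nm_ge0.
Qed.

Section CutProjection.
Context {R}.

(** [p] is the spectral projection of [Y] for values above [h], obtained as the support of the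
    positive part of [Y - h]. *)
Lemma cut_proj_fin (F : cstar R) (e : F) (Y : F) (h : R) :
 (forall x, e ** x = x) -> (forall x, x ** e = x) -> finite_dimensional F ->
 np e Y -> 0 < h -> exists p : F, [/\ is_proj p, np e (h^-1%:C *: Y - p) & np e (h%:C *: e - (e - p) ** Y ** (e - p))].
move=> el er fd pY h0; have [sY _] := pY.
have sX : sa (Y - h%:C *: e) by apply: saB => //; exact: (saU el).
have [A [B [pA pB XE AB _]]] := np_parts el er sX.
have [sA _] := pA; have [sB _] := pB.
have [p [t [pp [Ap pA'] _ pann _]]] := support_proj fd sA.
have [sp qp] := pp; have pB0 : p ** B = 0 by exact: pann.
have Bp0 : B ** p = 0 by rewrite -sp -sB -starM pB0 star0.
have YE : Y = h%:C *: e + A - B by rewrite -addrA -XE addrC subrK.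
have hh : h^-1%:C * h%:C = 1 :> R[i] by rewrite -rmorphM mulVf ?gt_eqF.
have spe : sa (e - p) by apply: saB => //; exact: (sa_unit el).
exists p; split => //. have E1 : (e - p) ** Y ** (e - p) = h%:C *: (e - p) - B.
 have -> : (e - p) ** Y ** (e - p) = h%:C *: (e - 2%:C *: p + p ** p) + (A - p ** A - (A ** p) + (p ** A) ** p) -
 (B - p ** B - B ** p + (p ** B) ** p) by rewrite [in LHS]YE; ncu e el er. by rewrite qp pA' pB0 Bp0; nc.
 have pY1 : np e ((e - p) ** Y ** (e - p)) by have := np_conj el er (e - p) pY; rewrite spe.
 have -> : h^-1%:C *: Y - p = h^-1%:C *: ((e - p) ** Y ** (e - p)) + h^-1%:C *: A.
 rewrite E1 YE -[X in _ - X]scale1r -hh; nc. by apply: npD; apply: npZ => //; rewrite invr_ge0 ltW.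
have -> : h%:C *: e - (e - p) ** Y ** (e - p) = h%:C *: p + B.
 have -> : (e - p) ** Y ** (e - p) = h%:C *: (e - 2%:C *: p + p ** p) + (A - p ** A - (A ** p) + (p ** A) ** p) -
 (B - p ** B - B ** p + (p ** B) ** p) by rewrite [in LHS]YE; ncu e el er. by rewrite qp pA' pB0 Bp0; nc.
apply: npD => //; apply: npZ; first exact: ltW.
by rewrite -qp; exact: sq_np.
Qed.

Lemma cut_proj (J : finType) (r : J -> J) (Y : adjop (hv (Cx R) J)) (h : R) :
 np aid Y -> block r Y -> 0 < h -> exists p, [/\ star p = p, p ** p = p, block r p,
 np aid (h^-1%:C *: Y - p) & nm ((aid - p) ** Y ** (aid - p)) <= h].
move=> pY bY h0; have as1 : star (aid : adjop (hv (Cx R) J)) = aid := sa_unit aid_l.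
have mk (T : adjop (hv (Cx R) J)) : block r T -> corner_set r aid T. by move=> bT; split; rewrite ?aid_l ?aid_r.
have b1 : block r (aid : adjop (hv (Cx R) J)) by exact: block1.
pose F := Fm r as1; pose e : F := mksub (S := corner r as1) (mk _ b1).
pose YF : F := mksub (S := corner r as1) (mk _ bY).
have [[vl vM vS] vN] := val_iso (corner r as1).
have el (x : F) : e ** x = x by apply: val_inj; exact: aid_l.
have er (x : F) : x ** e = x by apply: val_inj; exact: aid_r.
have val1 (t : R) (x : F) : val (t%:C *: e - x) = t%:C *: aid - val x. by rewrite (linB vl).
have npv (x : F) : np e x <-> np aid (val x). split=> -[s [t ht]].
 by split; [rewrite /sa -vS s|exists t; rewrite -val1 vN].
 by split; [apply: val_inj; rewrite vS|exists t; rewrite -vN val1].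
have pYF : np e YF by apply/npv.
have [p [[sp qp] h1 h2]] := cut_proj_fin el er (Fm_fin as1 (aid_l aid) b1) pYF h0.
exists (val p); split.
- by rewrite -vS sp.
- by rewrite -vM qp.
- by case: (FmP p).
- by move/npv : h1; rewrite (linB vl).
- apply: (np_bnd aid_l aid_r); first exact: ltW. have sap : star (aid - val p) = aid - val p :> adjop (hv (Cx R) J).
 by rewrite starB as1 -vS sp. by have := np_conj aid_l aid_r (aid - val p) pY; rewrite sap.
 by move/npv : h2; rewrite val1 !vM (linB vl).
Qed.

End CutProjection.

(** * Transfer of approximations between two subalgebras *)

Section Transfer.
Context {R} {P Q C : cstar R} (fP : P -> C) (fQ : Q -> C).
Hypotheses (iP : isohom fP) (iQ : isohom fQ).
Context {m : nat} (x : 'I_m.+1 -> C).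
Local Notation I := 'I_m.+1.
Let H := \sum_i x i ** star (x i).
Hypothesis H1 : nm H <= 1.
Hypothesis xP : forall i j q, exists p, fP p = star (x i) ** fQ q ** x j.
Hypothesis xQ : forall i j c, exists q, fQ q = x i ** c ** star (x j).

Definition pl i j q : P := sval (cid (xP i j q)).
Let plE i j q : fP (pl i j q) = star (x i) ** fQ q ** x j := svalP (cid (xP i j q)).

Let pl_lin i j : linear (pl i j).
have [[ql _ _] _] := iQ; have [[pl' _ _] _] := iP.
move=> c a b; apply: (isohom_inj iP); rewrite pl' !plE ql amulDr amulDl.
by rewrite amulZr amulZl.
Qed.

Let H_sa : sa H.
by rewrite /sa star_sum; each i; rewrite starM starK. Qed.

Let x1 i : nm (x i) <= 1.
rewrite -(@expr_le1 _ 2) ?nm_ge0// -nmSSr; apply: le_trans H1.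
apply: pos_mono; first exact: pos_starr.
by rewrite /H (bigD1 i)//= addrAC subrr add0r; apply: pos_sum => j _; exact: pos_starr.
Qed.

Let pl_nm i j q : nm (pl i j q) <= nm q.
rewrite -iP.2 plE; bnd nmM; bnd (ler_piMr (nm_ge0 _) (x1 j)).
by apply: le_trans (nmMl _ _) _; rewrite ?nmS ?x1// mul1r iQ.2.
Qed.

Let chi : hvec C I := fun i => star (x i).

Let hip_chi : hip chi chi = H.
by rewrite hipE; each i; rewrite starK. Qed.

Let chi1 : nm chi <= 1.
by rewrite -(@expr_le1 _ 2) ?nm_ge0// hnm_sq hip_chi. Qed.

Section Data.
Context {J0 : finType} (n : nat) (r0 : J0 -> J0) (kap0 : J0 -> 'I_n.+1).
Variables (psi0 : P -> J0 -> J0 -> Cx R) (w : J0 -> P).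
Hypotheses (kr0 : forall a, kap0 (r0 a) = kap0 a) (hb0 : bmap r0 psi0).
Hypothesis wo : forall a b, kap0 a = kap0 b -> a != b -> star (w a) ** w b = 0.
Hypothesis wr : forall a, star (w a) ** w a = star (w (r0 a)) ** w (r0 a) /\ nm (w a) <= 1.
Local Notation J := (I * J0)%type.

(** Sending every first index to [ord0] merges the copies of a block into one block, as in the
    tensor product of a full matrix algebra with the block algebra. *)
Definition tr_r (u : J) : J := (ord0, r0 u.2).
Definition tr_kap (u : J) := kap0 u.2.
Definition tr_psi (q : Q) (u v : J) : Cx R := psi0 (pl u.1 v.1 q) u.2 v.2.
Let W a := fP (w a).
(** Chosen so that [<tr_rho, T tr_rho>] is the sum of [T_(ia)(jb) x_i W_a (star W_b) (star x_j)]: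
    the approximation over [P] is put between [x_i] and [star x_j]. *)
Definition tr_rho : hvec C J := fun u => star (W u.2) ** star (x u.1).
Definition tr_d (u : J) : C := star (W u.2) ** W u.2.

Let psi_cp : cpm tr_psi.
move=> K X gX.
have gY : gpos (fun k l : K * I => pl k.2 l.2 (X k.1 l.1)). apply: (gpos_sub iP).
 apply: (gpos_ext (X := fun k l : K * I => star (x k.2) ** fQ (X k.1 l.1) ** x l.2)). by [].
 exact: (gpos_conj x (gpos_hom iQ.1 gX)).
have h := gpos_comp (fun u : K * J => ((u.1, u.2.1), u.2.2)) (bm_cp hb0 gY).
exact: h.
Qed.

Let psi_lin : linear (fun q => mxo (tr_psi q)).
move=> c a b; rewrite -mxoZ -mxoD; apply: eq_mxo => u v.
by rewrite /tr_psi pl_lin (bm_lin hb0).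
Qed.

Let gpl q : positive q -> gpos (fun i j => pl i j q) /\ nm (mxo (fun i j => fP (pl i j q))) <= nm q.
have [[ql qM qS] qN] := iQ.
move=> [v ->]; split. apply: (gpos_sub iP); exists unit, (fun _ i => fQ v ** x i) => i j.
 by rewrite big_const card_unit /= addr0 plE qM qS starM !amulA.
pose X : hvec C I := fun i => star (fQ v ** x i).
have -> : mxo (fun i j => fP (pl i j (star v ** v))) = theta X X. rewrite mxo_theta; apply: eq_mxo => i j.
 by rewrite plE qM qS /X starK starM !amulA.
rewrite nm_theta nm_hv hnm_sq.
have -> : hip X X = fQ v ** H ** star (fQ v). rewrite amulsr amulsl; each i; rewrite /X starK starM; nc.
rewrite nmSS -qN expr2; bnd nmM; rewrite nmS.
by apply: ler_wpM2r; [exact: nm_ge0|bnd nmM; rewrite ler_piMr// nm_ge0].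
Qed.

Lemma tr_bmap : bmap tr_r tr_psi.
split.
- by move=> u v c a b; rewrite /tr_psi pl_lin (bm_lin hb0).
- by [].
- apply: (@cp_contr _ _ _ _ (#|{: J}| ^ 2)%:R psi_lin).
 + move=> b; apply: (bm_gpos (X := fun p q => star (b p) ** b q) psi_cp).
 by exists unit, (fun _ => b) => p q; rewrite big_const card_unit /= addr0.
 + move=> q; apply: (amp_bnd hb0 (y := fun i j => pl i j q)) => i j; exact: pl_nm.
 + move=> u pu u1; have [g1 g2] := gpl pu. by apply: (amp_contr iP hb0 g1); exact: le_trans g2 u1.
move=> q u v; rewrite /tr_r xpair_eqE eqxx /= => uv.
by rewrite /tr_psi (bm_block hb0).
Qed.
Lemma tr_psi_np q : positive q -> np aid (mxo (tr_psi q)).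
by move=> pq; have [g _] := gpl pq; exact: (amp_np hb0 g). Qed.

Let Wo a b : kap0 a = kap0 b -> a != b -> star (W a) ** W b = 0.
have [[pl' pM pS] _] := iP.
by move=> ab nab; rewrite -pS -pM wo// (lin0 pl').
Qed.

Lemma tr_d_pos u : positive (tr_d u). exact: pos_star. Qed.
Lemma tr_d_nm u : nm (tr_d u) <= 1.
by rewrite nmSS expr_le1 ?nm_ge0// iP.2; case: (wr u.2). Qed.
Lemma tr_d_r u v : tr_r u = tr_r v -> tr_d u = tr_d v.
have [[pl' pM pS] _] := iP.
move=> [uv]; rewrite /tr_d /W -!pS -!pM; congr fP.
by rewrite (wr u.2).1 (wr v.2).1 uv.
Qed.

(** An operator commutes with the right action, so the factors [star (x i)] stay outermost. The
    product is then a sum of terms [x i ** c ** star (x j)], each in the image of [Q]. *)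
Lemma tr_range (X : adjop (hv C J)) u v : exists q,
 fQ q = star ((aop X tr_rho : hvec C J) u) ** (aop X tr_rho : hvec C J) v.
pose ri i : hvec C J := fun u => if u.1 == i then star (W u.2) else 0.
have rE : tr_rho = \sum_i hact (ri i) (star (x i)).
 apply/funext => u'; have -> : (\sum_i hact (ri i) (star (x i))) u' = \sum_i ri i u' ** star (x i).
 by elim/big_rec2: _ => [|i y z _ <-]. rewrite (bigD1 u'.1)//= /ri eqxx big1 ?addr0// => i.
 by rewrite eq_sym => /negbTE ->; rewrite amul0r.
have XE u' : (aop X tr_rho : hvec C J) u' = \sum_i (aop X (ri i) : hvec C J) u' ** star (x i).
 rewrite rE aop_sum; elim/big_rec2: _ => [|i y z _ <-]; first by []. by rewrite aop_hact.
have ex i j : {q | fQ q = x i ** (star ((aop X (ri i) : hvec C J) u) ** (aop X (ri j) : hvec C J) v) ** star (x j)}.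
 by apply: cid.
exists (\sum_i \sum_j sval (ex i j)); have [[ql _ _] _] := iQ.
rewrite (lin_sum ql) !XE star_sum amulsl; each i.
rewrite (lin_sum ql) amulsr; each j.
by rewrite (svalP (ex i j)) starM starK !amulA.
Qed.

Lemma tr_rho_nm : nm tr_rho ^+ 2 <= nm (\sum_a w a ** star (w a)).
have [[pl' pM pS] pN] := iP.
rewrite nm_hv hnm_sq -pN; set V := \sum_a w a ** star (w a).
have pV : positive (fP V). rewrite (lin_sum pl'); apply: pos_sum => a _; rewrite pM pS; exact: pos_starr.
have -> : hip tr_rho tr_rho = hip chi (aop (dop (fun=> fP V)) chi). rewrite !hipE sum_pair; each i.
 rewrite dopE (lin_sum pl') amulsl amulsr; each a. by rewrite pM pS starM !starK !amulA.
bnd nm_hip_op.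
via (nm (dop (fun=> fP V) : adjop (hv C I))). by rewrite ler_piMr ?nm_ge0// expr_le1// nm_ge0.
by apply: nm_dop => //; exact: nm_ge0.
Qed.

(* Columns [w] as a map of Hilbert modules and its adjoint. *)
Let Wf (xi : hvec C J) : hvec C I := fun i => \sum_b W b ** xi (i, b).
Let Ws (z : hvec C I) : hvec C J := fun u => star (W u.2) ** z u.1.

Let W_adj xi z : hip (Wf xi) z = hip xi (Ws z).
rewrite !hipE sum_pair; each i; rewrite star_sum amulsl.
by each b; rewrite starM amulA.
Qed.

Let V q i j : C := \sum_a \sum_b psi0 (pl i j q) a b *: (W a ** star (W b)).

Let hip_Ws q z : hip (Ws z) (aop (sop (mxo (tr_psi q))) (Ws z)) = hip z (aop (mxo (V q)) z).
rewrite !hipE sum_pair; each i.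
transitivity (\sum_a \sum_j \sum_b psi0 (pl i j q) a b *: (star (z i) ** W a ** (star (W b) ** z j))).
 each a; rewrite sopE sum_pair starM starK amulsr. each j; rewrite amulsr; each b. by rewrite ent_mxo amulZr.
rewrite exchange_big mxoE amulsr; each j.
rewrite /V amulsl amulsr; each a.
rewrite amulsl amulsr; each b.
by rewrite amulZl amulZr !amulA.
Qed.

Let kr u : tr_kap (tr_r u) = tr_kap u. exact: kr0. Qed.

Section Estimates.
Variables (c1 : Q) (ex e1 : R).
Hypotheses (pc : positive c1) (nc1 : nm c1 <= 1) (ex0 : 0 <= ex) (e10 : 0 <= e1).
Hypothesis hx : nm (fQ c1 - H ** fQ c1) <= ex.
Let M : R := (m.+1 ^ 2)%:R.

Definition good q := forall i j, nm (\sum_a \sum_b psi0 (pl i j q) a b *: (w a ** star (w b)) - pl i j q) <= e1.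

Let V_dist q : good q -> nm (mxo (V q) - mxo (fun i j => fP (pl i j q))) <= M * e1.
have [[pl' pM pS] pN] := iP; move=> gq.
rewrite -[- mxo (fun _ => _)]scaleN1r -mxoZ -mxoD; bnd nm_mxo.
via (\sum_(i < m.+1) \sum_(j < m.+1) e1); last first.
 have sc (y : R) : \sum_(i < m.+1) y = m.+1%:R * y by rewrite sumr_const card_ord mulr_natl.
 by rewrite sc sc mulrA -natrM.
each i; each j; rewrite scaleN1r.
apply: le_trans (gq i j); rewrite -pN (linB pl') (lin_sum pl'); rewrite le_eqVlt; apply/orP; left.
apply/eqP; congr (nm (_ - _)); each a; rewrite (lin_sum pl').
by each b; rewrite (linZ pl') pM pS.
Qed.

Let T : adjop (hv C I) := 1%:C *: aid - theta chi chi.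

Let T_np : np aid T.
apply: (np_le_U aid_l); first exact: (theta_np chi).1.
by rewrite nm_theta expr_le1// nm_ge0.
Qed.

Let TE z : aop T z = z - hact chi (hip chi z).
by rewrite aopDx scale1r. Qed.

Let X : hvec C I := hact chi (fQ c1).

Let TX : nm (hip X (aop T X)) <= ex.
have X1 : nm X <= 1. by bnd nm_hact; rewrite iQ.2 mulr_ile1// nm_ge0.
bnd nm_hip; via (nm (aop T X : hvec C I)). by rewrite ler_piMl// nm_ge0.
have -> : aop T X = hact chi (fQ c1 - H ** fQ c1). rewrite TE /X hip_act hip_chi; apply/funext => i.
 by rewrite /hact amulBr.
bnd nm_hact; apply: le_trans hx.
by rewrite ler_piMl// nm_ge0.
Qed.

Let pl_c i j : fP (pl i j (c1 ** c1)) = X i ** star (X j).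
have [[ql qM qS] qN] := iQ; have [_ _] := iQ.1 => _.
by rewrite plE qM starM starK -qS (pos_sa pc) !amulA.
Qed.

(** On one colour the difference is, up to sign and compression by [Pk], [Ws T Wf] with
    [T = 1 - theta chi chi]. Let [S] be the root of [T]. As [p] is at most [Y / h] for
    [Y = tr_psi (c1^2)], the squared norm of [Pk Ws S] is at most that of [S V S / h]. Here [V] is
    within [M e1] of [theta X X] for [X = chi c1], and [<X, T X>] is at most [ex] because [H] nearly
    fixes [c1]. The adjoint operator [S Wf Pk] contributes the same bound. *)
Lemma tr_gram (p : adjop (hv (Cx R) J)) (h : R) : good (c1 ** c1) -> 0 < h ->
 star p = p -> p ** p = p -> block tr_r p -> np aid (h^-1%:C *: mxo (tr_psi (c1 ** c1)) - p) ->
 forall k (v := aop (sop (p ** cproj tr_kap k)) tr_rho : hvec C J),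
 nm (theta v v - sop (p ** cproj tr_kap k) ** dop tr_d) <= h^-1 * (ex + M * e1).
move=> gc h0 ps pp pb hp k; cbv zeta.
pose v : hvec C J := aop (sop (p ** cproj tr_kap k)) tr_rho; rewrite -/v.
have [sl sm ss] := @sop_hom R C J.
pose q := cproj (R := R) tr_kap k; pose Pk := sop (A := C) (p ** q).
have pq : p ** q = q ** p by rewrite /q -(cproj_comm kr).
have pqs : star (p ** q) = p ** q by rewrite starM ps /q cprojS -/q -pq.
have pqp : p ** q ** (p ** q) = p ** q. by rewrite -amulA (amulA q) -pq -amulA cproj_idem amulA pp.
have Pks : star Pk = Pk by rewrite /Pk -ss pqs.
have PkP : Pk ** Pk = Pk by rewrite /Pk -sm pqp.
have Pkq : Pk = Pk ** sop q by rewrite /Pk -sm -amulA cproj_idem.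
have qPk : Pk = sop q ** Pk by rewrite /Pk -sm pq amulA cproj_idem.
have [S [pS SS _]] := np_sqrt aid_l aid_r T_np; have [sS _] := pS.
have S1 : nm S <= 1. rewrite -(@expr_le1 _ 2) ?nm_ge0// -nm_sq// SS; apply: (np_bnd aid_l aid_r) => //.
 have -> : 1%:C *: aid - T = theta chi chi by rewrite /T opprB addrC subrK. exact: theta_np.
pose B := h^-1 * (ex + M * e1).
have B0 : 0 <= B by rewrite mulr_ge0 ?invr_ge0 ?(ltW h0)// addr_ge0// mulr_ge0//.
have bnd1 z : nm (aop Pk (Ws (aop S z)) : hvec C J) ^+ 2 <= B * nm z ^+ 2. set y := Ws (aop S z).
 rewrite nm_hv hnm_sq hip_adj Pks -aopM PkP. have np1 : np aid (h^-1%:C *: mxo (tr_psi (c1 ** c1)) - p ** q).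
 have -> : h^-1%:C *: mxo (tr_psi (c1 ** c1)) - p ** q =
 (h^-1%:C *: mxo (tr_psi (c1 ** c1)) - p) + (p - p ** q) by rewrite addrA subrK. apply: (npD hp).
 have -> : p - p ** q = (p - p ** q) ** (p - p ** q).
 have pqp' : p ** q ** p = p ** q by rewrite -amulA -pq amulA pp.
 by rewrite amulBl !amulBr pqp pqp' (amulA p p) pp subrr subr0.
 by apply: (sq_np aid_l aid_r); rewrite /sa starB pqs ps.
 have le1 : nm (hip y (aop Pk y)) <= nm (h^-1%:C *: hip y (aop (sop (mxo (tr_psi (c1 ** c1)))) y)). apply: pos_mono.
 apply: np_ip; apply: sop_np; rewrite -pqp; exact: (sq_np aid_l aid_r). have := np_ip y (sop_np np1).
 by rewrite (linB sl) (linZ sl) hipDr hipNr hipZr. bnd le1; rewrite nmZ0 ?invr_ge0 ?(ltW h0)// /B -mulrA.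
 apply: ler_wpM2l; first by rewrite invr_ge0 ltW. rewrite hip_Ws. have Sz : nm (aop S z : hvec C I) <= nm z.
 by bnd nm_aop'; rewrite ler_piMl// nm_ge0.
 have -> : mxo (V (c1 ** c1)) = theta X X + (mxo (V (c1 ** c1)) - mxo (fun i j => fP (pl i j (c1 ** c1)))).
 rewrite [in theta _ _]mxo_theta addrC.
 have -> : mxo (fun i j => X i ** star (X j)) = mxo (fun i j => fP (pl i j (c1 ** c1))). by apply: eq_mxo => i j.
 by rewrite subrK. rewrite aopDx hipDr mulrDl; bnd nmD; apply: lerD.
 rewrite thetaE hip_act -[hip (aop S z) X]hipS nmSS.
 have -> : hip X (aop S z) = hip (aop S X) z by rewrite hip_adj sS. via ((nm (aop S X : hvec C I) * nm z) ^+ 2).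
 by rewrite ler_pXn2r// ?nnegrE ?mulr_ge0 ?nm_ge0//; exact: nm_hip.
 rewrite exprMn; apply: ler_wpM2r; first exact: sqr_ge0. by rewrite hnm_sq hip_adj sS -aopM SS.
 bnd nm_hip_op; apply: ler_pM.
 - exact: nm_ge0.
 - exact: sqr_ge0.
 - exact: V_dist.
 - by rewrite ler_pXn2r// nnegrE nm_ge0.
have bnd2 xi : nm (aop S (Wf (aop Pk xi)) : hvec C I) ^+ 2 <= B * nm xi ^+ 2. set z := aop S (Wf _).
 have e : nm z ^+ 2 <= nm xi * (Num.sqrt B * nm z). rewrite {1}nm_hv hnm_sq {1}/z hip_adj sS W_adj hip_adj Pks.
 bnd nm_hip; apply: ler_wpM2l; first exact: nm_ge0.
 rewrite -ler_sqr ?nnegrE ?nm_ge0//; last by rewrite mulr_ge0 ?nm_ge0.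
 by bnd (bnd1 z); rewrite exprMn (sqr_sqrtr B0).
 have [z0|z0] := eqVneq (nm z) 0; first by rewrite z0 expr0n mulr_ge0 ?sqr_ge0.
 have zp : 0 < nm z by rewrite lt_neqAle eq_sym z0 nm_ge0. have : nm z <= Num.sqrt B * nm xi.
 by rewrite -(ler_pM2r zp); bnd e; rewrite mulrCA mulrA.
 rewrite -ler_sqr ?nnegrE ?nm_ge0//; last by rewrite mulr_ge0 ?nm_ge0. by rewrite exprMn (sqr_sqrtr B0).
have sopd : sop (p ** q) ** dop tr_d = Pk ** dop tr_d ** Pk.
 rewrite -amulA -sop_dop ?amulA ?PkP// => u u' e; apply: tr_d_r.
 apply/eqP; apply: contraNT e => e; apply/eqP; move: u u' e. by apply: blockM => //; exact: cproj_block.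
have -> : theta v v - sop (p ** q) ** dop tr_d = - (Pk ** (dop tr_d - theta tr_rho tr_rho) ** Pk).
 by rewrite sopd /v -/Pk -theta_conj Pks; nc.
rewrite nmN nm_op; apply: onm_le => // xi.
(* The columns of one colour are orthogonal, so there [Ws Wf] acts as the diagonal [tr_d], while
   [Ws chi] is [tr_rho]. Hence [Ws T Wf] is [dop tr_d - theta tr_rho tr_rho] on that colour. *)
have key : aop (Pk ** (dop tr_d - theta tr_rho tr_rho) ** Pk) xi = aop Pk (Ws (aop S (aop S (Wf (aop Pk xi))))).
 rewrite Pkq -!aopM SS -!amulA aopM [in RHS]aopM; congr (aop Pk _). rewrite -Pkq !aopM; set z := aop Pk xi.
 have zq u : tr_kap u != k -> z u = 0. move=> uk; rewrite /z qPk aopM sopE big1// => u' _; rewrite ent_cproj.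
 by rewrite (negbTE uk); case: eqP => _; rewrite scale0r. clearbody z.
 apply/funext => -[i a]; rewrite !sopE; apply: eq_bigr => -[j b] _.
 rewrite ent_cproj; case: eqP => [[<- <-]|_]; last by rewrite !scale0r.
 case: (_ =P k) => [ka|_]; last by rewrite !scale0r. congr (_ *: _); rewrite aopDx aopNx hvDE hvNE dopE thetaE.
 rewrite /Ws TE hvDE hvNE amulBr /hact; congr (_ - _).
 rewrite /Wf /= [in RHS](bigD1 a)//= amulDr [X in _ = X + _]amulA amulsr [X in _ + X]big1 ?addr0// => b' ba.
 have [kb|kb] := eqVneq (kap0 b') k; last by rewrite zq// !amulr0. by rewrite amulA Wo ?amul0r 1?eq_sym// kb.
 rewrite /tr_rho /chi /= !amulA; congr (_ ** _). rewrite !hipE sum_pair; apply: eq_bigr => i' _; rewrite /Wf amulsr.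
 by apply: eq_bigr => b' _; rewrite starM !starK amulA.
have Bx : 0 <= B * nm xi by apply: mulr_ge0 => //; exact: nm_ge0.
rewrite key -/B -ler_sqr ?nnegrE ?nm_ge0//.
bnd bnd1; bnd (ler_wpM2l B0 (bnd2 _)).
by rewrite exprMn mulrA.
Qed.

(* [s <= c1^2], so that [s] is almost fixed by [H]. *)
Lemma tr_approx s : positive s -> positive (c1 ** c1 - s) -> good s ->
 nm (hip tr_rho (aop (sop (mxo (tr_psi s))) tr_rho) - fQ s) <= M * e1 + 2 * ex.
have [[ql qM qS] qN] := iQ; move=> ps pcs gs.
have -> : tr_rho = Ws chi by [].
rewrite hip_Ws.
have -> : hip chi (aop (mxo (V s)) chi) - fQ s =
 hip chi (aop (mxo (V s) - mxo (fun i j => fP (pl i j s))) chi) + (H ** fQ s ** H - fQ s).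
 have -> : H ** fQ s ** H = hip chi (aop (mxo (fun i j => fP (pl i j s))) chi). rewrite hipE /H amulsl amulsl; each i.
 rewrite mxoE amulsr amulsr; each j. by rewrite plE starK !amulA. by rewrite hipDr hipNr addrA subrK.
bnd nmD; apply: lerD. bnd nm_hip_op; apply: le_trans (V_dist gs). by rewrite ler_piMr ?nm_ge0// expr_le1// nm_ge0.
have sS : star (fQ s) = fQ s by rewrite -qS (pos_sa ps).
have cS : star (fQ c1) = fQ c1 by rewrite -qS (pos_sa pc).
have s1 : nm s <= 1. bnd (pos_mono ps pcs); bnd nmM. by rewrite mulr_ile1// nm_ge0.
have d1 : nm (fQ s - H ** fQ s) <= ex. apply: le_trans hx; rewrite -ler_sqr ?nnegrE ?nm_ge0// -!nmSSr.
 have [g gE] : positive (c1 ** c1 - s ** s).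
 have -> : c1 ** c1 - s ** s = (c1 ** c1 - s) + (s - s ** s) by rewrite addrA subrK.
 by apply: posD => //; exact: pos_sq_le. apply: pos_mono; first exact: pos_starr.
 have -> : (fQ c1 - H ** fQ c1) ** star (fQ c1 - H ** fQ c1) - (fQ s - H ** fQ s) ** star (fQ s - H ** fQ s) =
 star (fQ g - fQ g ** H) ** (fQ g - fQ g ** H).
 have gE' : star (fQ g) ** fQ g = fQ c1 ** fQ c1 - fQ s ** fQ s by rewrite -qS -!qM -gE (linB ql).
 rewrite !starB !starM H_sa cS sS. have -> : (star (fQ g) - H ** star (fQ g)) ** (fQ g - fQ g ** H) =
 (star (fQ g) ** fQ g) - H ** (star (fQ g) ** fQ g) - (star (fQ g) ** fQ g) ** H +
 H ** (star (fQ g) ** fQ g) ** H by nc. rewrite gE'; nc. exact: pos_star.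
have -> : H ** fQ s ** H - fQ s = - ((fQ s - H ** fQ s) ** H) - star (fQ s - H ** fQ s).
 by rewrite starB starM H_sa sS; nc.
bnd nmB; rewrite nmN nmS mulr_natl mulr2n; apply: lerD => //.
by bnd nmM; apply: le_trans d1; rewrite ler_piMr// nm_ge0.
Qed.

(** With [Y = tr_psi s] one has [Y^2 <= Y <= tr_psi (c1^2)], so the squared norm of [Y (1 - p)] is
    at most [h]; two such terms make up [Y - p Y p]. *)
Lemma tr_cut s (p : adjop (hv (Cx R) J)) (h : R) : positive s -> positive (c1 ** c1 - s) ->
 star p = p -> p ** p = p -> 0 <= h -> nm ((aid - p) ** mxo (tr_psi (c1 ** c1)) ** (aid - p)) <= h ->
 nm (hip tr_rho (aop (sop (mxo (tr_psi s))) tr_rho) -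
 hip (aop (sop p) tr_rho) (aop (sop (mxo (tr_psi s))) (aop (sop p) tr_rho))) <= 2 * Num.sqrt h * nm tr_rho ^+ 2.
move=> psi pcs ps pp h0 hh; have [sl sm ss] := @sop_hom R C J.
set Y := mxo (tr_psi s) in hh *; set Y0 := mxo (tr_psi (c1 ** c1)) in hh.
pose e : adjop (hv (Cx R) J) := aid; have el : forall y : adjop (hv (Cx R) J), e ** y = y := aid_l.
have er : forall y : adjop (hv (Cx R) J), y ** e = y := aid_r.
have pY : np e Y by exact: tr_psi_np.
have [sY _] := pY.
have Y1 : nm Y <= 1. bnd (bm_contr tr_bmap s); bnd (pos_mono psi pcs). by bnd nmM; rewrite mulr_ile1// nm_ge0.
have pYY : np e (Y0 - Y ** Y). have -> : Y0 - Y ** Y = (Y0 - Y) + Y ** (1%:C *: e - Y) by ncu e el er.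
 apply: npD; first by rewrite -(linB psi_lin); exact: tr_psi_np.
 apply: (np_comm el er pY); first exact: (np_le_U el sY Y1). by ncu e el er.
have spe : star (e - p) = e - p by rewrite starB ps (sa_unit el).
have n1 : nm (Y ** (e - p)) <= Num.sqrt h. apply: nm_le_sqrt => //; rewrite -nmSS starM spe sY; apply: le_trans hh.
 apply: (np_mono el er). by have := np_conj el er (e - p) (sq_np el er sY); rewrite spe !amulA.
 have := np_conj el er (e - p) pYY; rewrite spe. by have -> : (e - p) ** (Y0 - Y ** Y) ** (e - p) =
 (e - p) ** Y0 ** (e - p) - (e - p) ** Y ** (Y ** (e - p)) by nc.
have n2 : nm (Y - p ** Y ** p) <= 2 * Num.sqrt h. have -> : Y - p ** Y ** p = star (Y ** (e - p)) + p ** (Y ** (e - p)).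
 by rewrite starM spe sY; ncu e el er.
 have -> : 2 * Num.sqrt h = Num.sqrt h + Num.sqrt h by rewrite mulr_natl mulr2n.
 bnd nmD; rewrite nmS; apply: lerD; first exact: n1. by bnd (nmMl _ (nm_proj ps pp)); rewrite mul1r.
have -> : hip tr_rho (aop (sop Y) tr_rho) - hip (aop (sop p) tr_rho) (aop (sop Y) (aop (sop p) tr_rho)) =
 hip tr_rho (aop (sop (Y - p ** Y ** p)) tr_rho). by rewrite (linB sl) hipDr hipNr !sm hip_adj -ss ps.
bnd nm_hip_op; apply: ler_wpM2r; first exact: sqr_ge0.
exact: le_trans (nm_sop _) n2.
Qed.

End Estimates.
End Data.
End Transfer.

(** The elements [star (x i) q (x j)] lead from [Q] to matrices over [P], and [x i a (star (x j))]
    leads back. The composite [q |-> H q H] is nearly the identity below [c^2]. The lemma is applied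
    in both directions between [A^alpha] and the crossed product. *)
Lemma transfer R (P Q C : cstar R) (fP : P -> C) (fQ : Q -> C) dr n : isohom fP -> isohom fQ ->
 (forall (c : Q) (e : R), positive c -> nm c <= 1 -> 0 < e ->
 exists m (x : 'I_m.+1 -> C) (H := \sum_i x i ** star (x i)), [/\ nm H <= 1, nm (fQ c - H ** fQ c) <= e,
 forall i j q, exists p, fP p = star (x i) ** fQ q ** x j
 & forall i j a, exists q, fQ q = x i ** a ** star (x j)]) -> dim_le dr P n -> dim_le dr Q n.
move=> iP iQ hx hP; apply: dim_le_pos => I0 s c1 e e0 pc nc1 ps pcs.
have [t [t0 t1 key]] := near_approx n dr (codom s) e0; apply: key.
set tau := t ^+ 2; have tau0 : 0 < tau by rewrite exprn_gt0.
have tau1 : tau <= 1 by rewrite /tau expr_le1// ltW.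
pose N : R := n.+1%:R; have N1 : 1 <= N by rewrite ler1n.
(* The loss in [tr_cut] is [2 sqrt h] times the squared norm of [tr_rho], itself at most [N]; this
   value of [h] makes it [tau / 4]. *)
pose h := (tau / (8 * N)) ^+ 2.
have hb : 0 < tau / (8 * N) by rewrite divr_gt0//; lra.
have h0 : 0 < h by rewrite exprn_gt0.
have hs : Num.sqrt h = tau / (8 * N) by rewrite sqrtr_sqr gtr0_norm.
have h1 : h <= 1. rewrite expr_le1//; last exact: ltW. by rewrite ler_pdivrMr; lra.
(* [tr_gram] divides its errors by [h], so [ex], and [e1] below, are taken proportional to
   [h * tau]. *)
have ex0 : 0 < h * tau / 8 by rewrite divr_gt0// mulr_gt0.
have [m [x [H1 hxc xP xQ]]] := hx c1 _ pc nc1 ex0.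
pose M : R := (m.+1 ^ 2)%:R; have M1 : 1 <= M by rewrite ler1n expn_gt0.
have M0 : 0 < M by apply: lt_le_trans ltr01 M1.
pose e1 := h * tau / (4 * M); have e10 : 0 < e1 by apply: divr_gt0; apply: mulr_gt0.
have Me : M * e1 = h * tau / 4 by rewrite /e1; field; rewrite gt_eqF.
have e1t : e1 <= tau. rewrite /e1 ler_pdivrMr ?mulr_gt0//; via tau; first by rewrite ler_piMl// ltW.
 by rewrite ler_peMr ?ltW//; lra.
pose SP := [seq pl xP ij.1 ij.2 q | ij <- enum {: 'I_m.+1 * 'I_m.+1}, q <- c1 ** c1 :: codom s].
have [J0 [r0 [kap0 [psi0 [w [[kr0 rr0 hb0] wo wr wdr wS]]]]]] := dim_qdata SP hP e10.
have gd q : q \in c1 ** c1 :: codom s -> good xP psi0 w e1 q.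
 by move=> qS i j; apply: wS; apply: (allpairs_f (fun ij q => pl xP ij.1 ij.2 q) (x := (i, j))); rewrite ?mem_enum.
have g0 : good xP psi0 w e1 (c1 ** c1) by apply: gd; rewrite mem_head.
have trb := tr_bmap iP iQ H1 xP hb0.
have pcc : positive (c1 ** c1) by rewrite -{1}(pos_sa pc); exact: pos_star.
have bY : block (tr_r r0 : 'I_m.+1 * J0 -> _) (mxo (tr_psi xP psi0 (c1 ** c1))).
 by move=> u v uv; rewrite ent_mxo (bm_block trb).
have [p [ps' pp pb hp1 hp2]] := cut_proj (tr_psi_np iP iQ H1 xP hb0 pcc) bY h0.
have rho_n := tr_rho_nm iP H1 w.
have rhoN : nm (tr_rho fP x w) ^+ 2 <= N. by bnd rho_n; apply: colour_norm wo _ => a; case: (wr a).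
split; exists C, fQ, ('I_m.+1 * J0)%type, (tr_r r0), (tr_kap kap0), (tr_psi xP psi0), p, (tr_rho fP x w), (tr_d fP w).
split.
- by split => // u; rewrite /tr_kap /tr_r /= kr0.
- split; first by move=> u; exact: tr_d_pos. by move=> u; bnd (tr_d_nm iP wr u); rewrite lerDl ltW.
 exact: (tr_d_r iP wr).
- move=> k; have := tr_gram iP iQ H1 kr0 wo wr pc nc1 (ltW ex0) (ltW e10) hxc g0 h0 ps' pp pb hp1 k.
 cbv zeta => /le_trans; apply; rewrite -/M Me.
 have -> : h^-1 * (h * tau / 8 + h * tau / 4) = tau * (3 / 8) by field; rewrite gt_eqF. lra.
- exact: (tr_range fP iQ xQ w).
split. move=> d; via (nm (tr_rho fP x w) ^+ 2). rewrite ler_pXn2r ?nnegrE ?nm_ge0//; bnd nm_aop'.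
 by rewrite ler_piMl ?nm_ge0//; apply: le_trans (nm_sop _) (nm_proj ps' pp).
 by bnd rho_n; bnd (wdr d); rewrite lerD2l.
move=> _ /codomP[l ->].
have gl : good xP psi0 w e1 (s l) by apply: gd; rewrite inE codom_f orbT.
have E1 := tr_approx iP iQ H1 pc nc1 hxc (ps l) (pcs l) gl.
have E2 := tr_cut iP iQ H1 w hb0 nc1 (ps l) (pcs l) ps' pp (ltW h0) hp2.
rewrite nmBC; bnd (nm_tri _ (hip (tr_rho fP x w) (aop (sop (mxo (tr_psi xP psi0 (s l)))) (tr_rho fP x w))) _).
rewrite nmBC; bnd (lerD E2 E1); rewrite hs -/M Me.
have k1 : 2 * (tau / (8 * N)) * nm (tr_rho fP x w) ^+ 2 <= tau / 4. via (2 * (tau / (8 * N)) * N).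
 by apply: ler_wpM2l => //; rewrite mulr_ge0// ltW. by rewrite le_eqVlt; apply/orP; left; apply/eqP; field; lra.
have k2 : h * tau <= tau by rewrite ler_piMl// ltW.
bnd (lerD k1 (lexx _)); move: k2 tau0.
by generalize (h * tau) tau; clear => a b; lra.
Qed.

(** * The Hahn-Banach theorem *)

Section HahnBanach.
Context {R} {V : normedModType R[i]}.
Implicit Types (x y v : V) (p q : V -> R).

Definition sublin p : Prop := [/\ forall x y, p (x + y) <= p x + p y, forall t x, 0 <= t -> p (t%:C *: x) = t * p x
 & forall x, p x <= nm x].

Lemma sublin0 p : sublin p -> p 0 = 0.
by case=> _ h _; have := h 0 0 (lexx _); rewrite scaler0 mul0r. Qed.

Lemma sublinN p x : sublin p -> - p (- x) <= p x.
move=> h; have [hD _ _] := h; have := hD x (- x); rewrite subrr (sublin0 h).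
by lra.
Qed.

Lemma sublin_ge p x : sublin p -> - nm x <= p x.
move=> h; have := sublinN x h; have [_ _ hn] := h.
by have := hn (- x); rewrite nmN; lra.
Qed.
Lemma sublin_nm : sublin (fun x : V => nm x).
by split=> [x y|t x t0|x]; rewrite ?nmZ0//; exact: nmD. Qed.

(** The shift is the infimum over [t >= 0] of [q (y + t v) - t q v]. A minimal sublinear functional
    agrees with all its shifts, which makes it additive. *)
Lemma sublin_shift q v : sublin q -> exists2 q', sublin q' &
 (forall y, q' y <= q y) /\ forall y t, 0 <= t -> q' y <= q (y + t%:C *: v) - t * q v.
move=> h; have [hD hZ hn] := h.
pose S y := [set s : R | exists2 t, 0 <= t & s = q (y + t%:C *: v) - t * q v].
have lb y : lbound (S y) (- q (- y)). move=> _ [t t0 ->]; have := hD (- y) (y + t%:C *: v).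
 by rewrite addrA addNr add0r hZ//; lra.
have hl y : has_lbound (S y) by exists (- q (- y)).
have ne y : S y !=set0 by exists (q (y + 0%:C *: v) - 0 * q v); exists 0.
have up y t : 0 <= t -> inf (S y) <= q (y + t%:C *: v) - t * q v. by move=> t0; apply: ge_inf => //; exists t.
have upq y : inf (S y) <= q y. by have := up y 0 (lexx _); rewrite scale0r addr0 mul0r subr0.
exists (fun y => inf (S y)) => //; split=> [x y|t x t0|x].
- rewrite -lerBlDr; apply: lb_le_inf => // _ [s s0 ->]. rewrite lerBlDr -lerBlDl; apply: lb_le_inf => // _ [t t0 ->].
 have := up (x + y) (s + t) (addr_ge0 s0 t0). have -> : x + y + (s + t)%:C *: v = (x + s%:C *: v) + (y + t%:C *: v).
 by rewrite rmorphD scalerDl addrACA. have := hD (x + s%:C *: v) (y + t%:C *: v); lra.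
- have [->|tn] := eqVneq t 0. rewrite mul0r scale0r; apply/le_anti/andP; split. by rewrite -(sublin0 h).
 apply: lb_le_inf => // _ [s s0 ->]; rewrite add0r hZ//; lra. have tp : 0 < t by rewrite lt_neqAle eq_sym tn.
 apply/le_anti/andP; split. rewrite -ler_pdivrMl//; apply: lb_le_inf => // _ [s s0 ->].
 rewrite ler_pdivrMl//; have := up (t%:C *: x) (t * s) (mulr_ge0 t0 s0).
 by rewrite rmorphM -scalerA -scalerDr hZ// mulrBr mulrA. apply: lb_le_inf => // _ [s s0 ->].
 have := up x (s / t) (divr_ge0 s0 t0).
 rewrite -(ler_pM2l tp) mulrBr -(hZ t _ t0) scalerDr scalerA -rmorphM /= mulrCA divff// mulr1.
 by rewrite mulrA mulrCA divff// mulr1.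
- exact: le_trans (upq x) (hn x).
Qed.

(** Zorn's lemma: a chain has its pointwise infimum as lower bound, and the common bound [- nm x]
    keeps that infimum finite. *)
Lemma minimal_sublin p0 : sublin p0 -> exists q, [/\ sublin q, forall x, q x <= p0 x &
 forall q', sublin q' -> (forall x, q' x <= q x) -> q' = q].
move=> h0; pose T := {p : V -> R | sublin p /\ forall x, p x <= p0 x}.
pose Rl (p q : T) := `[< forall x, sval q x <= sval p x >].
have [||||[q [hq hq0]] qm] := @Zorn T Rl.
- by move=> t; apply/asboolP.
- move=> r s t /asboolP rs /asboolP st; apply/asboolP => x. exact: le_trans (st x) (rs x).
- move=> [s hs] [t ht] /asboolP /= st /asboolP /= ts.
 have e : s = t by apply/funext => x; apply: le_anti; rewrite ts st. by move: hs ht; rewrite e => hs ht; congr exist.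
- move=> A tot; have [[a Aa]|nA] := pselect (exists a, A a); last first.
 by exists (exist _ p0 (conj h0 (fun x => lexx _))) => s As; case: nA; exists s. pose S x := [set sval p x | p in A].
 have lb x : has_lbound (S x). by exists (- nm x) => _ [p _ <-]; exact: (sublin_ge x (svalP p).1).
 have ne x : S x !=set0 by exists (sval a x); exists a. have up x (p : T) : A p -> inf (S x) <= sval p x.
 by move=> Ap; apply: ge_inf => //; exists p. have hs : sublin (fun x => inf (S x)). split=> [x y|t x t0|x].
 + rewrite -lerBlDr; apply: lb_le_inf => // _ [p Ap <-].
 rewrite lerBlDr -lerBlDl; apply: lb_le_inf => // _ [q Aq <-]. have [/asboolP qp|/asboolP pq] := tot p q Ap Aq.
 have := up (x + y) q Aq; have := (svalP q).1 => -[hD _ _]. have := hD x y; have := qp x; lra.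
 have := up (x + y) p Ap; have := (svalP p).1 => -[hD _ _]. have := hD x y; have := pq y; lra.
 + have [->|tn] := eqVneq t 0. rewrite mul0r scale0r; apply/le_anti/andP; split.
 by bnd (up 0 a Aa); rewrite (sublin0 (svalP a).1). apply: lb_le_inf => // _ [p Ap <-].
 by rewrite (sublin0 (svalP p).1). have tp : 0 < t by rewrite lt_neqAle eq_sym tn. apply/le_anti/andP; split.
 rewrite -ler_pdivrMl//; apply: lb_le_inf => // _ [p Ap <-]. rewrite ler_pdivrMl//; have [_ hZ _] := (svalP p).1.
 by rewrite -hZ//; exact: up. apply: lb_le_inf => // _ [p Ap <-]; have [_ hZ _] := (svalP p).1.
 by rewrite hZ// ler_pM2l//; exact: up.
 + by bnd (up x a Aa); have [_ _ hn] := (svalP a).1. have hs0 x : inf (S x) <= p0 x.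
 by bnd (up x a Aa); exact: (svalP a).2. pose Pp (p : V -> R) := sublin p /\ forall x, p x <= p0 x.
 by exists (exist Pp (fun x => inf (S x)) (conj hs hs0)) => s As; apply/asboolP => x /=; exact: up.
exists q; split=> // q' hq' le.
have hq'0 x : q' x <= p0 x by exact: le_trans (le x) (hq0 x).
pose Pp (p : V -> R) := sublin p /\ forall x, p x <= p0 x.
have h : Rl (exist _ q (conj hq hq0)) (exist Pp q' (conj hq' hq'0)) by apply/asboolP.
by have [] := qm _ h.
Qed.

(** The descent starts from the norm shifted along [v], whose value at [- v] is at most [- nm v]. A
    linear functional below it must attain the norm at [v]. *)
Lemma real_hahn_banach v : exists u : V -> R,
 [/\ forall x y, u (x + y) = u x + u y, forall t x, u (t%:C *: x) = t * u x, forall x, u x <= nm x & u v = nm v].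
have [p0 h0 [_ p0s]] := sublin_shift v sublin_nm.
have [q [hq q0 qm]] := minimal_sublin h0.
have [hD hZ hn] := hq.
have add x y : q (x + y) = q x + q y. apply/eqP; rewrite eq_le hD /=. have [q' hq' [le s]] := sublin_shift x hq.
 have := s y 1 ler01; rewrite (qm _ hq' le) scale1r [y + x]addrC; lra.
have opp x : q (- x) = - q x. by apply/eqP; rewrite -addr_eq0 -add addNr (sublin0 hq).
exists q; split=> // [t x|]. have [t0|/ltW t0] := leP 0 t; first exact: hZ.
 have := hZ (- t) x; rewrite oppr_ge0 t0 => /(_ isT).
 by rewrite rmorphN scaleNr opp mulNr => /eqP; rewrite eqr_opp => /eqP.
apply/eqP; rewrite eq_le hn /= -lerN2 -opp.
bnd q0; bnd (p0s (- v) 1 ler01).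
by rewrite scale1r addNr nm0 mul1r add0r.
Qed.

(** The complex functional is [u x - i u (i x)]. Multiplying [x] by the conjugate of its value makes
    the value real, so the real bound gives the complex one; at [v] the real part already exhausts
    the norm, and the imaginary part vanishes. *)
Theorem hahn_banach v : exists ell : V -> R[i]^o, [/\ linear ell, forall x, nm (ell x) <= nm x & ell v = (nm v)%:C].
have [u [uD uZ un uv]] := real_hahn_banach v.
pose ell x : R[i]^o := u x +i* (- u ('i *: x)).
have u0 : u 0 = 0 by have := uZ 0 0; rewrite scaler0 mul0r.
have uN x : u (- x) = - u x by apply/eqP; rewrite -addr_eq0 -uD addNr u0.
have ellD x y : ell (x + y) = ell x + ell y. by rewrite /ell scalerDr !uD; rewrite opprD.
have ellZ (c : R[i]) x : ell (c *: x) = c * ell x. have cE : c *: x = (Re c)%:C *: x + (Im c)%:C *: ('i *: x).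
 by rewrite scalerA -scalerDl mulrC -complexE. have iE : 'i *: (c *: x) = (Re c)%:C *: ('i *: x) - (Im c)%:C *: x.
 rewrite cE scalerDr !scalerA -scalerBl -scalerDl; congr (_ *: _). by apply: complex_eq => /=; ring.
 rewrite /ell iE cE !uD uN !uZ; case: (c) => a b; apply/eqP; rewrite eq_complex /=.
 by apply/andP; split; apply/eqP; ring.
have lin : linear ell by move=> c x y; rewrite ellD ellZ.
have bnd x : nm (ell x) <= nm x. have [/eqP e0|e0] := eqVneq (nm (ell x)) 0; first by rewrite (eqP e0) nm_ge0.
 have ep : 0 < nm (ell x) by rewrite lt_neqAle eq_sym e0 nm_ge0.
 rewrite -(ler_pM2l ep); apply: le_trans (_ : u (conjc (ell x) *: x) <= _).
 have -> : u (conjc (ell x) *: x) = Re (conjc (ell x) * ell x). by rewrite -ellZ.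
 rewrite -expr2 nmc_def sqr_sqrtr ?addr_ge0 ?sqr_ge0//. by case: (ell x) => a b /=; lra. bnd un; rewrite nmCZ.
 by have -> : Re `|conjc (ell x)| = nm (ell x) by rewrite -[RHS]nmS.
exists ell; split=> //.
have rv : Re (ell v) = nm v by [].
have := bnd v; have n0 := nm_ge0 v.
rewrite nmc_def rv => h.
have : Im (ell v) ^+ 2 <= 0. have : Num.sqrt (nm v ^+ 2 + Im (ell v) ^+ 2) ^+ 2 <= nm v ^+ 2.
 by rewrite ler_sqr ?nnegrE. by rewrite sqr_sqrtr ?addr_ge0 ?sqr_ge0//; lra.
rewrite le_eqVlt ltNge sqr_ge0 orbF sqrf_eq0 => /eqP i0.
by move: rv i0; case: (ell v) => a b /= -> ->.
Qed.

End HahnBanach.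

(** * States *)

Section States.
Context {R}.

(* A norm-one functional attaining its norm at a positive element [b] of a unital
 algebra takes the value [1] at the unit, since [2 b / ‖b‖ - 1] is a contraction. *)
Lemma state (A : cstar R) (b : A) : positive b -> b != 0 ->
 exists f : A -> R[i]^o, [/\ linear f, forall x, nm (f x) <= nm x,
 forall x, positive x -> 0 <= f x :> R[i] & f b = (nm b)%:C].
move=> bp bn0.
have nb : 0 < nm b. by rewrite lt_neqAle nm_ge0 andbT eq_sym; apply: contra bn0 => /eqP/nm_eq0 ->.
have [[lL lM lS] lN] := lmul_iso A.
have [ell [el en eb]] := hahn_banach (lmul b).
have e1 : ell aid = 1. pose c := ell aid. have n1 : nm (c : R[i]^o) <= 1. have h : nm (aid : adjop (hself A)) <= 1.
 by apply: nm_unit; exact: aid_l. exact: le_trans (en aid) h. have np1 : np aid (lmul b) by exact/pos_lmul.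
 have hb : nm ((2 / nm b)%:C *: lmul b - aid) <= 1. pose t := 2 / nm b; have t0 : 0 <= t by rewrite divr_ge0 ?ltW.
 have sl : sa (lmul b) by case: np1. apply: (sa_bnd (@aid_l _ _ _) (@aid_r _ _ _) ler01).
 - by apply: saB; [exact: saZ|exact: (sa_unit (@aid_l _ _ _))].
 - have -> : 1%:C *: aid - (t%:C *: lmul b - aid) = t%:C *: ((nm b)%:C *: aid - lmul b).
 rewrite scalerBr scalerA -rmorphM /= mulfVK ?gt_eqF// scale1r opprB addrA.
 by congr (_ - _); rewrite rmorph_nat scaler_nat. apply: npZ => //; apply: (np_le_U (@aid_l _ _ _)) => //.
 by rewrite lN.
 - by rewrite scale1r addrCA subrr addr0; exact: npZ. have h2 : nm (2 - c : R[i]^o) <= 1.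
 apply: le_trans hb; apply: le_trans (en _); rewrite le_eqVlt; apply/orP; left; apply/eqP.
 congr nm; rewrite (linB el) (linZ el) eb lN -/c; congr (_ - _).
 by rewrite -[_ *: _]/(_ * _) -rmorphM mulfVK ?gt_eqF// rmorph_nat. have := Re_nm c; have := Re_nm (2 - c : R[i]^o).
 move=> g1 g2; have r1 : Re c = 1. have /ler_normlP[_ k1] := le_trans g2 n1; have /ler_normlP[_ k2] := le_trans g1 h2.
 by move: k1 k2; case: (c) => a a' /=; lra. have i0 : Im c ^+ 2 <= 0.
 have : nm (c : R[i]^o) ^+ 2 <= 1 by rewrite expr_le1 ?nm_ge0.
 by rewrite nmc_def sqr_sqrtr ?addr_ge0 ?sqr_ge0// r1; lra.
 move: i0; rewrite le_eqVlt ltNge sqr_ge0 orbF sqrf_eq0 => /eqP i0. by apply/eqP; rewrite eq_complex r1 i0 !eqxx.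
pose f x := ell (lmul x).
have fl : linear f by move=> c x y; rewrite /f lL el.
(* Adding [i t] to a self-adjoint [x] raises the squared norm by at most [t^2], whereas an imaginary
   part [b'] of the value would contribute [2 b' t] in addition; a large [t] of the right sign gives
   a contradiction. *)
have re x : sa x -> Im (f x) = 0. move=> sx; apply/eqP; apply/negP => /negP b0; set b' := Im (f x) in b0.
 have key t : 2 * b' * t <= nm x ^+ 2. pose y := lmul x + ((0 +i* t) : R[i]) *: aid.
 have yy : star y ** y = lmul x ** lmul x + (t ^+ 2)%:C *: aid.
 rewrite /y starD starZ -lS sx (sa_unit (@aid_l _ _ _)).
 rewrite amulDl !amulDr !amulZr !amulZl !aid_l !aid_r scalerA -addrA; congr (_ + _).
 rewrite addrA -scalerDl; set u := (X in X *: _ + _); have -> : u = 0.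
 by apply/eqP; rewrite eq_complex /= !addr0 subrr eqxx. rewrite scale0r add0r; congr (_ *: _).
 by apply: complex_eq => /=; ring. have ny : nm y ^+ 2 <= nm x ^+ 2 + t ^+ 2. rewrite -nmSS yy; bnd nmD.
 apply: lerD; first by rewrite -lM lN; bnd nmM. exact: (nmU (@aid_l _ _ _) (sqr_ge0 _)).
 have ey : ell y = f x + (0 +i* t) by rewrite /y (linD el) (linZ el) e1 [_ *: _]mulr1.
 have : nm (ell y) ^+ 2 <= nm y ^+ 2 by rewrite ler_sqr ?nnegrE ?nm_ge0.
 rewrite ey nmc_def sqr_sqrtr ?addr_ge0 ?sqr_ge0//. have -> : Re (f x + (0 +i* t)) = Re (f x).
 by case: (f x) => ? ? /=; rewrite addr0. have -> : Im (f x + (0 +i* t)) = b' + t by rewrite /b'; case: (f x).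
 have := sqr_ge0 (Re (f x)); have := sqr_ge0 b'. lra. have := key (b' * ((nm x ^+ 2 + 1) / b' ^+ 2)).
 have -> : 2 * b' * (b' * ((nm x ^+ 2 + 1) / b' ^+ 2)) = 2 * (nm x ^+ 2 + 1) by field. by have := sqr_ge0 (nm x); lra.
exists f; split=> //.
- by move=> x; rewrite -[leRHS]lN; exact: en.
- move=> x xp; have i0 := re x (pos_sa xp). have nx := (pos_lmul x).1 xp.
 have h : nm ((nm x)%:C *: aid - lmul x) <= nm x. by apply: (np_nm (@aid_l _ _ _) (@aid_r _ _ _) nx); rewrite lN.
 have := le_trans (en _) h. rewrite (linB el) (linZ el) e1 [_ *: _]mulr1 -/(f x) => h2.
 have /ler_normlP[_ k] := le_trans (Re_nm _) h2. rewrite lecE; lra.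
- by rewrite /f eb lN.
Qed.

End States.

(** * Continuous functions on a compact group *)

Section GroupFunctions.
Context {R} {G}.

Lemma cont_near (T : topologicalType) (V : normedModType R[i]) (F : T -> V) : continuous F <->
 forall s e, 0 < e -> \forall t \near s, nm (F t - F s) < e.
split=> [Fc s e e0|h s]. have /cvgrPdist_lt/(_ _ (gt0C e0)) := Fc s. by apply: filterS => t; rewrite normE ltcR nmBC.
apply/cvgrPdist_lt => e /real_gt0[t t0 ->].
by apply: filterS (h s t t0) => x; rewrite normE ltcR nmBC.
Qed.

Lemma real_cont_near (T : topologicalType) (F : T -> R) : continuous F <->
 forall s e, 0 < e -> \forall t \near s, `|F t - F s| < e.
split=> [Fc s e e0|h s]. have /cvgrPdist_lt/(_ _ e0) := Fc s. by apply: filterS => t; rewrite distrC.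
apply/cvgrPdist_lt => e e0.
by apply: filterS (h s e e0) => x; rewrite distrC.
Qed.

Lemma cont_Re (T : topologicalType) (F : T -> R[i]^o) : continuous F -> continuous (fun s => Re (F s)).
move=> /cont_near h; apply/real_cont_near => s e e0.
apply: filterS (h s e e0) => t; apply: le_lt_trans.
by apply: le_trans (Re_nm _); rewrite raddfB.
Qed.

Lemma cont_Im (T : topologicalType) (F : T -> R[i]^o) : continuous F -> continuous (fun s => Im (F s)).
move=> /cont_near h; apply/real_cont_near => s e e0.
apply: filterS (h s e e0) => t; apply: le_lt_trans.
by apply: le_trans (Im_nm _); rewrite raddfB.
Qed.

Lemma cont_complex (T : topologicalType) (F : T -> R) : continuous F -> continuous (fun s => (F s)%:C : R[i]^o).
move=> /real_cont_near h; apply/cont_near => s e e0.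
apply: filterS (h s e e0) => t; apply: le_lt_trans.
bnd nmc_le.
by rewrite /= !subr0 normr0 addr0.
Qed.

Lemma cont_lip (T : topologicalType) (V W : normedModType R[i]) (f : V -> W) (M : R) (F : T -> V) :
 (forall x y, nm (f x - f y) <= M * nm (x - y)) -> continuous F -> continuous (fun s => f (F s)).
move=> hf /cont_near h; apply/cont_near => s e e0.
have M0 : 0 < Num.max M 0 + 1 by rewrite ltr_pwDr// le_max lexx orbT.
apply: filterS (h s _ (divr_gt0 e0 M0)) => t; rewrite ltr_pdivlMr// mulrC.
apply: le_lt_trans; bnd hf.
by apply: ler_wpM2r; rewrite ?nm_ge0// ler_wpDr// le_max lexx.
Qed.

Lemma mulg_cont (g : G) : continuous (fun s => (g * s)%g).
move=> s; apply: (@continuous_comp _ _ _ (fun h => (g, h)) (fun p => (p.1 * p.2)%g)).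
 by apply: cvg_pair; [exact: cvg_cst|exact: cvg_id].
exact: mulg_continuous2.
Qed.

Lemma unif_cont (cG : compact [set: G]) (V : normedModType R[i]) (F : G -> V) (e : R) : continuous F -> 0 < e ->
 nbhs (1%g : G) [set t | forall s, nm (F (s * t)%g - F s) < e].
move=> /cont_near Fc e0; have /compact_near_coveringP nc := cG.
have h := nc G (nbhs (1%g : G)) (fun t s => nm (F (s * t)%g - F s) < e) _ _.
have : \forall t \near nbhs (1%g : G), [set: G] `<=` (fun s => nm (F (s * t)%g - F s) < e). apply: h => x _.
 have e2 : 0 < e / 2 by rewrite divr_gt0.
 have m1 : nbhs (x, 1%g : G) (fun p : G * G => nm (F (p.1 * p.2)%g - F x) < e / 2).
 have h2 := @mulg_continuous2 G (x, 1%g) (fun y => nm (F y - F x) < e / 2). by apply: h2; rewrite mulg1; exact: Fc.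
 have m2 : nbhs (x, 1%g : G) (fun p : G * G => nm (F p.1 - F x) < e / 2).
 have h2 := @cvg_fst G G (nbhs x) (nbhs (1%g : G)) _ (fun y => nm (F y - F x) < e / 2). by apply: h2; exact: Fc.
 have : nbhs (x, 1%g : G) (fun p : G * G => nm (F (p.1 * p.2)%g - F p.1) < e).
 apply: filterS2 m1 m2 => -[s t] /= k1 k2. bnd (nm_tri _ (F x) _); rewrite [nm (F x - _)]nmBC.
 by rewrite [e]splitr; exact: ltrD. by [].
by apply: filterS => t ht s; exact: ht.
Qed.

(** Finitely many translates of a bump function cover the group, and division by the root of the sum
    of their squares normalises them. It is the squares that add up to one because tower elements
    occur on both sides of an element. *)
Lemma partition_unity (cG : compact [set: G]) (hG : hausdorff_space G) (W : set G) :
 nbhs (1%g : G) W -> exists m (g : 'I_m -> G) (h : 'I_m -> G -> R),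
 [/\ forall i, continuous (h i), forall i s, 0 <= h i s, forall s, \sum_i h i s ^+ 2 = 1
 & forall i s, h i s != 0 -> W ((g i)^-1 * s)%g].
rewrite nbhsE => -[V [Vo V1] VW].
have nG := compact_normal hG cG.
have cV : closed (~` V) by rewrite closedC.
have := @normal_completely_regular R _ nG (hausdorff_accessible hG) 1%g _ cV (fun h => h V1).
move/(@uniform_separatorP G R) => -[f [fc f01 f1 fV]].
have f0 : f 1%g = 0 by apply: f1; exists 1%g.
have fb s : 0 <= f s <= 1 by have := f01 (f s) (ex_intro2 _ _ s I erefl); rewrite /= in_itv.
pose b s := 1 - f s.
have b0 s : 0 <= b s by rewrite subr_ge0; case/andP: (fb s).
have bc g : continuous (fun s => b (g^-1 * s)%g).
 move=> s; apply: (@continuous_comp _ _ _ (fun s => (g^-1 * s)%g) b); first exact: mulg_cont.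
 by apply: cvgB; [exact: cvg_cst|exact: fc].
have bV s : b s != 0 -> V s. move=> bs; have [//|nV] := pselect (V s); case/eqP: bs. by rewrite /b (fV (f s)) ?subrr//.
pose PG := pointed_group G.
have cP : compact [set: PG] := cG.
rewrite compact_cover in cP.
have := cP PG setT (fun g => [set s | 0 < b (g^-1 * s)%g]) _ _.
move=> [||D' _ cov].
- move=> x _; have /continuousP := bc x.
 have -> : [set s : PG | 0 < b (x^-1 * s)%g] = (fun s => b (x^-1 * s)%g) @^-1` [set y | 0 < y] by []. by apply.
- move=> s _; exists s => //=; rewrite mulVg /b f0 subr0. exact: ltr01.
pose sD : seq PG := finmap.enum_fset D'; pose m := size sD.
pose g (i : 'I_m) : G := nth (1%g : G) sD i.
pose k i s := b ((g i)^-1 * s)%g.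
pose K s := \sum_i k i s ^+ 2.
have K0 s : 0 < K s. have [x xD xs] := cov s I. have xD' : (index x sD < m)%N by rewrite index_mem.
 rewrite /K (bigD1 (Ordinal xD')) //= ltr_pwDl ?sumr_ge0// => [|i _]; last exact: sqr_ge0.
 by rewrite exprn_gt0// /k /g nth_index.
have kc i : continuous (k i) by exact: bc.
have Kc : continuous K. rewrite /K; elim: (index_enum _) => [|i r' IH].
 by under eq_fun do rewrite big_nil; move=> s; exact: cvg_cst. under eq_fun do rewrite big_cons expr2.
 by move=> s; apply: cvgD; [apply: cvgM; exact: kc|exact: IH].
exists m, g, (fun i s => k i s / Num.sqrt (K s)); split.
- move=> i s; apply: cvgM; first exact: kc. apply: cvgV; first by rewrite sqrtr_eq0 -ltNge.
 by apply: (@continuous_comp _ _ _ K Num.sqrt); [exact: Kc|exact: sqrt_continuous].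
- by move=> i s; rewrite divr_ge0 ?sqrtr_ge0// b0.
- move=> s; under eq_bigr do rewrite exprMn exprVn sqr_sqrtr ?(ltW (K0 _))//.
 by rewrite -mulr_suml -/(K s) divff// gt_eqF.
- move=> i s; rewrite mulf_eq0 negb_or => /andP[ks _]; exact/VW/bV.
Qed.

End GroupFunctions.

(** * Integration over the group *)

Section Cintegral.
Context {R} {G} (cG : compact [set: G]).
Variable mu : probability (borel_group G) R.
Local Notation I := (@cintegral R G mu).
Local Notation BG := (borel_group G).

Lemma borel_open (U : set G) : open U -> measurable (U : set BG).
by move=> oU; apply: sub_sigma_algebra. Qed.

Lemma cont_measurable (f : G -> R) : continuous f -> measurable_fun [set: BG] (f : BG -> R).
move=> fc; apply: (measurability _ (measurable_realfun.RGenOInfty.measurableE R)).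
move=> /= _ [_ [a ->]] <-; rewrite setTI; apply: borel_open.
by move/continuousP : fc; apply.
Qed.

Lemma cont_bound (V : normedModType R[i]) (F : G -> V) : continuous F ->
 exists2 M : R, 0 <= M & forall s, nm (F s) <= M.
move=> /cont_near Fc.
have nc : continuous (fun s => nm (F s)). apply/real_cont_near => s e e0; apply: filterS (Fc s e e0) => t.
 apply: le_lt_trans; rewrite ler_norml; apply/andP; split.
 by have := nm_ler (F s) (F t); rewrite [nm (F s - _)]nmBC; lra. by have := nm_ler (F t) (F s); lra.
have cc : compact ((fun s => nm (F s)) @` [set: G]). by apply: continuous_compact => //; apply: continuous_subspaceT.
have [M [_ /(_ (M + 1)) hM]] := @compact_bounded R R^o _ cc.
have hM' s : nm (F s) <= M + 1. by bnd ler_norm; apply: hM; [rewrite ltrDl|exists s].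
by exists (M + 1) => //; apply: le_trans (nm_ge0 _) (hM' 1%g).
Qed.

Let mu1 : mu setT = 1%E := probability_setT mu.
Let fmu1 : fine (mu setT) = 1. by rewrite mu1. Qed.

Lemma cont_integrable (f : G -> R) : continuous f -> mu.-integrable [set: BG] (EFin \o (f : BG -> R)).
move=> fc; apply: measurable_bounded_integrable => //.
- by refine (eq_ind_r (fun x => (x < +oo)%E) _ mu1); exact: ltry.
- exact: cont_measurable.
- have [M M0 fM] := cont_bound (cont_complex fc). exists M; split; first exact: num_real.
 move=> x Mx s _ /=; apply: le_trans (ltW Mx); apply: le_trans (fM s). exact: (Re_nm ((f s)%:C : R[i]^o)).
Qed.

Section Linear.
Variables (f g : G -> R[i]^o) (fc : continuous f) (gc : continuous g).

Lemma cintD : I (fun s => f s + g s) = I f + I g.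
apply: complex_eq => /=. have fi := cont_integrable (cont_Re fc); have gi := cont_integrable (cont_Re gc).
 rewrite -(RintegralD measurableT fi gi). by apply: eq_Rintegral => s _; rewrite raddfD.
have fi := cont_integrable (cont_Im fc); have gi := cont_integrable (cont_Im gc).
rewrite -(RintegralD measurableT fi gi).
by apply: eq_Rintegral => s _; rewrite raddfD.
Qed.

Lemma cintZ (c : R[i]) : I (fun s => c * f s) = c * I f.
have iR := cont_integrable (cont_Re fc); have iI := cont_integrable (cont_Im fc).
have zint (a : R) (k : G -> R) : continuous k -> mu.-integrable [set: BG] (EFin \o (fun s => a * k s)).
 by move=> kc; apply: (@cont_integrable (fun s => a * k s)) => s; apply: cvgM; [exact: cvg_cst|exact: kc].
have cR := cont_Re fc; have cI := cont_Im fc.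
case: c => a b; apply: complex_eq => /=. rewrite -!RintegralZl// -RintegralB//; try exact: zint.
 by apply: eq_Rintegral => s _; case: (f s).
rewrite -!RintegralZl// -RintegralD//; try exact: zint.
by apply: eq_Rintegral => s _; case: (f s) => x y /=.
Qed.
Lemma cintN : I (fun s => - f s) = - I f.
by rewrite -mulN1r -cintZ; congr I; apply/funext => s; rewrite mulN1r. Qed.

Lemma cint_conj : I (fun s => conjc (f s)) = conjc (I f).
have iI := cont_integrable (cont_Im fc).
apply: complex_eq => /=. by apply: eq_Rintegral => s _; case: (f s).
rewrite -mulN1r -RintegralZl//.
by apply: eq_Rintegral => s _; case: (f s) => x y /=; rewrite mulN1r.
Qed.

Lemma cint_le (M : R) : (forall s, nm (f s) <= M) -> Re (I f) <= M.
move=> fM; have -> : M = \int[mu]_(s in [set: BG]) M. by rewrite Rintegral_cst// fmu1 mulr1.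
have i1 := cont_integrable (cont_Re fc).
have i2 : mu.-integrable [set: BG] (EFin \o (fun=> M)). by apply: (@cont_integrable (fun=> M)) => s; exact: cvg_cst.
apply: (le_Rintegral measurableT i1 i2).
by move=> s _; apply: le_trans (ler_norm _) (le_trans (Re_nm _) (fM s)).
Qed.

End Linear.

Lemma cint_cst (c : R[i]) : I (fun=> c) = c.
by case: c => a b; rewrite /cintegral !Rintegral_cst// !fmu1 !mulr1.
Qed.

(** Multiplying the integrand by the conjugate of the integral reduces the bound to real parts. *)
Lemma cint_bnd (f : G -> R[i]^o) (M : R) : continuous f -> (forall s, nm (f s) <= M) -> nm (I f : R[i]^o) <= M.
move=> fc fM; set c : R[i]^o := I f.
have M0 : 0 <= M by exact: le_trans (nm_ge0 _) (fM 1%g).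
have [/eqP e0|e0] := eqVneq (nm c) 0; first by rewrite (eqP e0).
have ep : 0 < nm c by rewrite lt_neqAle eq_sym e0 nm_ge0.
rewrite -(ler_pM2l ep) -expr2.
have -> : nm c ^+ 2 = Re (I (fun s => conjc c * f s)). rewrite cintZ// -/c nmc_def sqr_sqrtr ?addr_ge0 ?sqr_ge0//.
 by case: (c) => a b /=; ring.
apply: (@cint_le (fun s => conjc c * f s)). by move=> s; apply: (@cvgM R[i]); [exact: cvg_cst|exact: fc].
move=> s; have -> : nm c * M = nm (star c) * M by congr (_ * _); symmetry; exact: nmS.
bnd (nmM (star c) (f s)).
by apply: ler_wpM2l; [exact: nm_ge0|exact: fM].
Qed.

Hypothesis mu_inv : left_invariant mu.

Lemma Rint_shift (f : G -> R) g : continuous f ->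
 (\int[mu]_(s in [set: BG]) f (g * s)%g = \int[mu]_(s in [set: BG]) f s)%R.
move=> fc; rewrite /Rintegral; congr fine.
have mg : measurable_fun [set: BG] (fun s : BG => (g * s)%g : BG).
 apply: (@measurability _ _ BG BG setT _ (@open (pointed_group G))) => //.
 move=> _ [U oU <-]; rewrite setTI; apply: borel_open. by have /continuousP := @mulg_cont G g; apply.
have fgc : continuous (fun s => f (g * s)%g).
 by move=> s; apply: (@continuous_comp _ _ _ (fun s => (g * s)%g) f); [exact: mulg_cont|exact: fc].
have := @integral_pushforward _ _ BG BG R _ mg mu setT (EFin \o f) _ _ _.
rewrite preimage_setT => <-//; last 2 first.
- by apply/measurable_realfun.measurable_EFinP; exact: cont_measurable.
- exact: (cont_integrable fgc).
apply: eq_measure_integral => X mX _; rewrite /pushforward.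
apply: (etrans _ (mu_inv g^-1%g mX)); rewrite /= /pushforward; congr (mu _).
apply/seteqP; split=> [s Xs|_ [s Xs <-]] /=. by exists (g * s)%g => //; rewrite mulKg.
by rewrite mulgA mulgV mul1g.
Qed.

Lemma cint_shift (f : G -> R[i]^o) g : continuous f -> I (fun s => f (g * s)%g) = I f.
move=> fc; rewrite /cintegral; congr (_ +i* _); apply: Rint_shift. exact: cont_Re.
exact: cont_Im.
Qed.

End Cintegral.

Section WeakIntegral.
Context {R} {G} (cG : compact [set: G]) (hG : hausdorff_space G).
Variable mu : probability (borel_group G) R.
Local Notation I := (@cintegral R G mu).

Lemma cint_sum (K : finType) (u : K -> G -> R[i]^o) : (forall k, continuous (u k)) ->
 I (fun s => \sum_k u k s) = \sum_k I (u k).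
move=> uc.
suff : continuous (fun s => \sum_(k <- index_enum K) u k s) /\
 I (fun s => \sum_(k <- index_enum K) u k s) = \sum_(k <- index_enum K) I (u k) by case.
elim: (index_enum K) => [|k r [IHc IH]].
 rewrite big_nil; under eq_fun do rewrite big_nil; split; first by move=> s; exact: cvg_cst. exact: cint_cst.
rewrite big_cons -IH; under eq_fun do rewrite big_cons; split.
 by move=> s; apply: (@cvgD R[i] R[i]^o); [exact: uc|exact: IHc].
exact: (@cintD _ _ cG mu _ _ (uc k) IHc).
Qed.

Lemma cont_sum (K : finType) (u : K -> G -> R[i]^o) : (forall k, continuous (u k)) ->
 continuous (fun s => \sum_k u k s).
move=> uc; elim: (index_enum K) => [|k r IH]. by under eq_fun do rewrite big_nil; move=> s; exact: cvg_cst.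
under eq_fun do rewrite big_cons.
by move=> s; apply: (@cvgD R[i] R[i]^o); [exact: uc|exact: IH].
Qed.

Section Functionals.
Context {V : normedModType R[i]}.

Lemma bounded_continuous (W : normedModType R[i]) (T : V -> W) M : linear T ->
 (forall x, nm (T x) <= M * nm x) -> continuous T.
move=> Tl TM; have -> : T = (fun x => T (id x)) by [].
by apply: (@cont_lip _ _ V W T M id) => [x y|x]; [rewrite -(linB Tl)|exact: cvg_id].
Qed.

Lemma continuous_bounded (ell : V -> R[i]^o) : linear ell -> continuous ell ->
 exists2 M, 0 <= M & forall x, nm (ell x) <= M * nm x.
move=> el /cont_near/(_ 0 1 ltr01)/nbhs_ballP[_ /real_gt0[t t0 ->]] h.
have tp : 0 <= 2 / t by rewrite divr_ge0 ?ltW.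
exists (2 / t) => // x.
have [/eqP x0|x0] := eqVneq (nm x) 0. by rewrite (nm_eq0 (eqP x0)) (lin0 el) !nm0 mulr0.
have xp : 0 < nm x by rewrite lt_neqAle eq_sym x0 nm_ge0.
pose c := t / (2 * nm x); have c0 : 0 < c by rewrite divr_gt0// mulr_gt0.
have : nm (ell (c%:C *: x)) < 1. have := h (c%:C *: x); rewrite (lin0 el) subr0; apply.
 rewrite -ball_normE /= sub0r normrN normE ltcR nmZ0 ?ltW// /c. have -> : t / (2 * nm x) * nm x = t / 2 by field. lra.
rewrite (linZ el); have -> : nm (c%:C * ell x : R[i]^o) = c * nm (ell x) := nmZ0 (ell x) (ltW c0).
move=> /ltW cx; rewrite -(ler_pM2l c0); bnd cx.
have -> : c * (2 / t * nm x) = 1 by rewrite /c; field; rewrite x0 gt_eqF.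
exact: lexx.
Qed.

Lemma vint_functional (F : G -> V) v (ell : V -> R[i]^o) M : is_vintegral mu F v ->
 linear ell -> (forall x, nm (ell x) <= M * nm x) -> ell v = I (fun s => ell (F s)).
by move=> h el eM; apply: h => //; exact: bounded_continuous el eM. Qed.

Lemma vint_uniq (F : G -> V) v w : is_vintegral mu F v -> is_vintegral mu F w -> v = w.
move=> hv hw; apply/subr0_eq/nm_le0.
have [ell [el en ev]] := hahn_banach (v - w).
have en' x : nm (ell x) <= 1 * nm x by rewrite mul1r.
have : ell (v - w) = 0. by rewrite (linB el) (vint_functional hv el en') (vint_functional hw el en') subrr.
by rewrite ev => /(congr1 (@Re R)) /= ->.
Qed.
Lemma vintE (F : G -> V) v : is_vintegral mu F v -> vintegral mu F = v.
by move=> hv; apply: (@vint_uniq F) => //; apply: xgetPex; exists v. Qed.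

Lemma vint_bnd (F : G -> V) v w M : continuous F -> is_vintegral mu F v ->
 (forall s, nm (F s - w) <= M) -> nm (v - w) <= M.
move=> Fc hv hM; have [ell [el en ev]] := hahn_banach (v - w).
have en' x : nm (ell x) <= 1 * nm x by rewrite mul1r.
have ec := bounded_continuous el en'.
have eFc : continuous (fun s => ell (F s)). by move=> s; apply: (@continuous_comp _ _ _ F ell); [exact: Fc|exact: ec].
have E : ell (v - w) = I (fun s => ell (F s - w)). rewrite (linB el) (vint_functional hv el en').
 have -> : (fun s => ell (F s - w)) = (fun s => ell (F s) + - ell w). by apply/funext => s; rewrite (linB el).
 rewrite (@cintD _ _ cG mu _ _ eFc (fun s => cvg_cst (- ell w))). by rewrite cint_cst.
have -> : nm (v - w) = nm (ell (v - w)).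
 rewrite ev; apply/esym/nm_eqE; rewrite normc_def expr0n addr0 sqrtr_sqr ger0_norm ?nm_ge0//.
have cE : continuous (fun s => ell (F s - w)). have -> : (fun s => ell (F s - w)) = (fun s => ell (F s) - ell w).
 by apply/funext => s; rewrite (linB el). by move=> s; apply: (@cvgB R[i] R[i]^o); [exact: eFc|exact: cvg_cst].
rewrite E; apply: (@cint_bnd _ _ cG mu _ M cE) => s.
exact: le_trans (en _) (hM s).
Qed.

Lemma vint_map (W : normedModType R[i]) (T : V -> W) M (F : G -> V) v : linear T ->
 (forall x, nm (T x) <= M * nm x) -> is_vintegral mu F v -> is_vintegral mu (fun s => T (F s)) (T v).
move=> Tl TM hv ell el ec; have := hv (fun x => ell (T x)); apply. by move=> c x y; rewrite Tl el.
by move=> x; apply: continuous_comp; [exact: bounded_continuous Tl TM x|exact: ec].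
Qed.

Lemma vint_conj_map (T : V -> V) (F : G -> V) v : {morph T : x y / x + y} ->
 (forall c x, T (c *: x) = conjc c *: T x) -> (forall x, nm (T x) = nm x) ->
 continuous F -> is_vintegral mu F v -> is_vintegral mu (fun s => T (F s)) (T v).
move=> TD TZ TN Fc hv ell el ec.
have [M M0 eM] := continuous_bounded el ec.
pose k x : R[i]^o := conjc (ell (T x)).
have kl : linear k. move=> c x y; rewrite /k TD TZ el. by rewrite rmorphD rmorphM /= conjcK.
have kM x : nm (k x) <= M * nm x.
 by rewrite -TN; apply: le_trans (eM (T x)); rewrite le_eqVlt; apply/orP; left; apply/eqP; exact: nmS.
have kc := bounded_continuous kl kM.
have kFc : continuous (fun s => k (F s)). by move=> s; apply: (@continuous_comp _ _ _ F k); [exact: Fc|exact: kc].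
have := vint_functional hv kl kM; rewrite /k => /(congr1 conjc); rewrite conjcK => ->.
by rewrite -cint_conj//; congr I; apply/funext => s; rewrite conjcK.
Qed.

Lemma vint_add (F H : G -> V) v w : continuous F -> continuous H -> is_vintegral mu F v -> is_vintegral mu H w ->
 is_vintegral mu (fun s => F s + H s) (v + w).
move=> Fc Hc hv hw ell el ec; rewrite (linD el) hv// hw// -cintD//.
- by congr I; apply/funext => s; rewrite (linD el).
- by move=> s; apply: (@continuous_comp _ _ _ F ell); [exact: Fc|exact: ec].
- by move=> s; apply: (@continuous_comp _ _ _ H ell); [exact: Hc|exact: ec].
Qed.
Lemma vint_cst (v : V) : is_vintegral mu (fun=> v) v.
by move=> ell _ _; rewrite cint_cst. Qed.

Lemma vint_shift (mu_inv : left_invariant mu) (F : G -> V) v g : continuous F ->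
 is_vintegral mu F v -> is_vintegral mu (fun s => F (g * s)%g) v.
move=> Fc hv ell el ec; rewrite hv//.
rewrite (@cint_shift _ _ cG _ mu_inv (fun s => ell (F s)) g)// => s.
by apply: (@continuous_comp _ _ _ F ell); [exact: Fc|exact: ec].
Qed.

(** Riemann sums weighted by the integrals of a squared partition of unity adapted to the uniform
    continuity of [F]. The error is uniform over functionals with a common bound, as comparison
    through Hahn-Banach functionals demands. *)
Lemma vint_sums (F : G -> V) (e : R) : continuous F -> 0 < e -> exists m (c : 'I_m -> R) (g : 'I_m -> G),
 [/\ forall i, 0 <= c i, \sum_i c i = 1 & forall (ell : V -> R[i]^o) M, 0 <= M -> linear ell ->
 (forall x, nm (ell x) <= M * nm x) ->
 nm (ell (\sum_i (c i)%:C *: F (g i)) - I (fun s => ell (F s)) : R[i]^o) <= M * e].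
move=> Fc e0.
have [m [g [h [hc h0 h1 hW]]]] := @partition_unity R G cG hG _ (unif_cont cG Fc e0).
have hc2 i : continuous (fun s => (h i s ^+ 2)%:C : R[i]^o). apply: (@cont_complex R G (fun s => h i s ^+ 2)) => s.
 have -> : (fun s0 => h i s0 ^+ 2) = (fun s0 => h i s0 * h i s0). by []. by apply: cvgM; exact: hc.
pose C i := I (fun s => (h i s ^+ 2)%:C).
pose c i := Re (C i).
have CE i : C i = (c i)%:C. apply/eqP; rewrite eq_complex /= eqxx /=; apply/eqP. by rewrite Rintegral_cst// mul0r.
exists m, c, g; split.
- by move=> i; apply: Rintegral_ge0 => s _; exact: sqr_ge0.
- have : \sum_i C i = 1. rewrite -cint_sum// -[RHS](cint_cst mu); congr I; apply/funext => s. by rewrite -rmorph_sum h1.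
 under eq_bigr do rewrite CE. by rewrite -rmorph_sum => /(congr1 (@Re R)).
move=> ell M M0 el eM; have ec := bounded_continuous el eM.
have eFc : continuous (fun s => ell (F s)). by move=> s; apply: (@continuous_comp _ _ _ F ell); [exact: Fc|exact: ec].
pose u i s : R[i]^o := (h i s ^+ 2)%:C * (ell (F (g i)) - ell (F s)).
have uc i : continuous (u i). move=> s; apply: (@cvgM R[i]); first exact: hc2.
 by apply: (@cvgB R[i] R[i]^o); [exact: cvg_cst|exact: eFc].
have -> : ell (\sum_i (c i)%:C *: F (g i)) - I (fun s => ell (F s)) = I (fun s => \sum_i u i s).
 have -> : (fun s => \sum_i u i s) = (fun s => (\sum_i (ell (F (g i)) * (h i s ^+ 2)%:C : R[i]^o)) + - ell (F s)).
 apply/funext => s; rewrite /u; under eq_bigr do rewrite mulrBr.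
 rewrite sumrB; congr (_ - _); first by each i; rewrite mulrC. by rewrite -mulr_suml -rmorph_sum h1 mul1r.
 pose w i s : R[i]^o := ell (F (g i)) * (h i s ^+ 2)%:C. have wc i : continuous (w i).
 by move=> s; apply: (@cvgM R[i]); [exact: cvg_cst|exact: hc2]. have c2 : continuous (fun s => - ell (F s)).
 by move=> s; apply: (@cvgN R[i] R[i]^o); exact: eFc.
 rewrite (@cintD _ _ cG mu _ _ (cont_sum wc) c2) (@cintN _ _ cG mu _ eFc) (cint_sum wc).
 congr (_ - _); rewrite (lin_sum el); each i.
 by rewrite (linZ el) -[_ *: _]/(_ * _) -CE mulrC (@cintZ _ _ cG mu _ (hc2 i)).
apply: (@cint_bnd _ _ cG mu _ (M * e) (cont_sum uc)) => s.
bnd_sum.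
have -> : M * e = \sum_i h i s ^+ 2 * (M * e) by rewrite -mulr_suml h1 mul1r.
each i.
rewrite /u -[_ * _ in X in nm X]/((h i s ^+ 2)%:C *: (_ : R[i]^o)) nmZ0 ?sqr_ge0//.
have [->|hn] := eqVneq (h i s) 0; first by rewrite expr0n !mul0r.
apply: ler_wpM2l; first exact: sqr_ge0.
rewrite -(linB el); bnd eM; apply: ler_wpM2l => //.
by have := hW i s hn (g i); rewrite mulgA mulgV mul1g nmBC => /ltW.
Qed.

End Functionals.

Section Existence.
Context {V : completeNormedModType R[i]}.

(** Riemann sums of precision [1 / (n + 1)] form a Cauchy sequence: a functional norming the
    difference of two of them sees two approximations of one scalar integral. *)
Lemma vint_ex (F : G -> V) : continuous F -> exists v, is_vintegral mu F v.
move=> Fc.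
have ap n : exists v : V, forall (ell : V -> R[i]^o) M, 0 <= M -> linear ell -> (forall x, nm (ell x) <= M * nm x) ->
 nm (ell v - I (fun s => ell (F s)) : R[i]^o) <= M * n.+1%:R^-1. have n0 : 0 < n.+1%:R^-1 :> R by rewrite invr_gt0.
 by have [m [c [g [_ _ h]]]] := vint_sums Fc n0; exists (\sum_i (c i)%:C *: F (g i)).
have [v hv] := choice ap.
have vd m n : nm (v m - v n) <= m.+1%:R^-1 + n.+1%:R^-1. have [ell [el en ev]] := hahn_banach (v m - v n).
 have en' x : nm (ell x) <= 1 * nm x by rewrite mul1r. have -> : nm (v m - v n) = nm (ell (v m - v n)).
 by rewrite ev; apply/esym/nm_eqE; rewrite normc_def expr0n addr0 sqrtr_sqr ger0_norm ?nm_ge0.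
 rewrite (linB el); bnd (nm_tri _ (I (fun s => ell (F s)) : R[i]^o) _).
 rewrite [X in _ + X]nmBC -[X in _ <= X + _]mul1r -[X in _ <= _ + X]mul1r. by apply: lerD; apply: hv.
have vc : caus v. move=> e e0; have [N hN] := inv_nat_lt (divr_gt0 e0 (@ltr0n R 2)).
 exists N => m n /hN hm /hN hn; bnd (vd m n). by rewrite [e]splitr; exact: ltrD.
have [w vw] := caus_cvs vc.
exists w => ell el ec; have [M M0 eM] := continuous_bounded el ec.
apply/subr0_eq/nm_small => e e0.
have M1 : 0 < M + 1 by rewrite ltr_wpDl.
have d0 : 0 < e / (2 * (M + 1)) by rewrite divr_gt0// mulr_gt0.
have [N1 h1] := vw _ d0; have [N2 h2] := inv_nat_lt d0.
pose n := maxn N1 N2.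
have k1 := h1 n (leq_maxl _ _); have k2 := h2 n (leq_maxr _ _).
bnd (nm_tri _ (ell (v n)) _); rewrite -(linB el).

have g1 : M * nm (v n - w) <= M * (e / (2 * (M + 1))) by apply: ler_wpM2l => //; exact: ltW.
have g2 : M * n.+1%:R^-1 <= M * (e / (2 * (M + 1))) by apply: ler_wpM2l => //; exact: ltW.
have g3 : M * (e / (2 * (M + 1))) + M * (e / (2 * (M + 1))) <= e.
 have -> : M * (e / (2 * (M + 1))) + M * (e / (2 * (M + 1))) = e * (M / (M + 1)). by field; rewrite gt_eqF.
 by rewrite ler_piMr ?(ltW e0)// ler_pdivrMr// mul1r lerDl.
bnd (lerD (eM _) (hv n ell M M0 el eM)).
by rewrite [nm (w - _)]nmBC; apply: le_trans (lerD g1 g2) g3.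
Qed.
Lemma vintP (F : G -> V) : continuous F -> is_vintegral mu F (vintegral mu F).
by move=> /vint_ex[v hv]; apply: xgetPex; exists v. Qed.

Lemma vint_cone (S : set V) (F : G -> V) : closed S -> S 0 -> (forall x y, S x -> S y -> S (x + y)) ->
 (forall (t : R) x, 0 <= t -> S x -> S (t%:C *: x)) -> continuous F -> (forall s, S (F s)) -> S (vintegral mu F).
move=> /closed_nmP Sc S0 SD SZ Fc SF; apply: Sc => e e0.
have e2 : 0 < e / 2 by rewrite divr_gt0.
have [m [c [g [c0 _ h]]]] := vint_sums Fc e2.
set v := vintegral mu F; set w := \sum_i (c i)%:C *: F (g i) in h.
exists w. by rewrite /w; elim/big_ind: _ => // i _; exact: SZ.
apply: le_lt_trans (_ : e / 2 < e); last by lra.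
rewrite nmBC; have [ell [el en ev]] := hahn_banach (w - v).
have en' x : nm (ell x) <= 1 * nm x by rewrite mul1r.
have -> : nm (w - v) = nm (ell (w - v)).
 by rewrite ev; apply/esym/nm_eqE; rewrite normc_def expr0n addr0 sqrtr_sqr ger0_norm ?nm_ge0.
rewrite (linB el) (vint_functional (vintP Fc) el en').
by rewrite -[leRHS]mul1r; apply: h.
Qed.

End Existence.
End WeakIntegral.

(** * Averaging over the group *)

Section Average.
Context {R} {G} {A : cstar R}.
Hypotheses (cG : compact [set: G]) (hG : hausdorff_space G).
Variable (mu : probability (borel_group G) R) (alpha : cstarAction G A).
Hypothesis mu_inv : left_invariant mu.
Implicit Types x y : A.

Lemma nm_act g x : nm (alpha g x) = nm x.
by rewrite /nm act_norm. Qed.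
Lemma act_positive g x : positive x -> positive (alpha g x).
by case=> y ->; exists (alpha g y); rewrite act_amul act_star. Qed.

Lemma act_cont_near x e : 0 < e -> nbhs (1%g : G) [set t | nm (alpha t x - x) < e].
move=> e0; have /cont_near/(_ 1%g e e0) := @act_continuous _ _ _ alpha x.
by rewrite act1.
Qed.

Definition avg x : A := vintegral mu (alpha ^~ x).

Lemma avgP x : is_vintegral mu (alpha ^~ x) (avg x).
by apply: (vintP cG hG); exact: act_continuous. Qed.

Lemma avg_linear : linear avg.
move=> c x y; apply: vintE.
have -> : alpha^~ (c *: x + y) = (fun s => c *: alpha s x + alpha s y). by apply/funext => s; rewrite act_linear.
have Zl : linear (fun z : A => c *: z). by move=> d u v; rewrite scalerDr !scalerA [c * d]mulrC.
have ZM (z : A) : nm (c *: z) <= Re `|c| * nm z by rewrite nmCZ.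
have h := vint_map Zl ZM (avgP x).
apply: (vint_add cG _ _ h (avgP y)); last exact: act_continuous.
move=> s; apply: (@continuous_comp _ _ _ (alpha^~ x) (fun z : A => c *: z)). exact: act_continuous.
exact: (bounded_continuous Zl ZM).
Qed.

Lemma avg_fixed x g : alpha g (avg x) = avg x.
have aM z : nm (alpha g z) <= 1 * nm z by rewrite mul1r nm_act.
have h1 := vint_map (act_linear alpha g) aM (avgP x).
have h2 := @vint_shift _ _ cG _ _ mu_inv _ _ g (@act_continuous _ _ _ alpha x) (avgP x).
apply: (vint_uniq h1).
by have -> : (fun s => alpha g (alpha s x)) = (fun s => alpha (g * s)%g x) by apply/funext => s; rewrite actM.
Qed.

Lemma avg_id x : (forall g, alpha g x = x) -> avg x = x.
move=> fx; apply: vintE.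
have -> : alpha^~ x = (fun=> x) by apply/funext => s.
exact: vint_cst.
Qed.

Lemma avg_star x : avg (star x) = star (avg x).
apply: vintE.
have -> : alpha^~ (star x) = (fun s => star (alpha s x)). by apply/funext => s; rewrite act_star.
apply: (vint_conj_map cG (@starD _ _) _ (@nmS _ _) _ (avgP x)). by move=> c z; exact: starZc.
exact: act_continuous.
Qed.
Lemma avg_bnd x w M : (forall s, nm (alpha s x - w) <= M) -> nm (avg x - w) <= M.
by move=> h; apply: (vint_bnd cG _ (avgP x) h); exact: act_continuous. Qed.
Lemma avg_nm x : nm (avg x) <= nm x.
by rewrite -[avg x]subr0; apply: avg_bnd => s; rewrite subr0 nm_act. Qed.

Lemma avg_pos x : positive x -> positive (avg x).
move=> px; apply: (@vint_cone _ _ cG hG _ _ [set y : A | positive y]).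
- exact: pos_closed.
- exact: pos0.
- by move=> u v; exact: posD.
- by move=> t u; exact: posZ.
- exact: act_continuous.
- by move=> s; exact: act_positive.
Qed.

(* [E' x], the integral of [alpha_{s^-1} x], is unchanged when [x] is moved by the
 action, and [E = E' o E = E']. *)
Lemma avg_act g x : avg (alpha g x) = avg x.
have Vc z : continuous (fun s => alpha s^-1%g z).
 move=> s; apply: (@continuous_comp _ _ _ (fun s : G => s^-1%g) (alpha^~ z)). exact: invg_continuous.
 exact: act_continuous.
pose E' z := vintegral mu (fun s => alpha s^-1%g z).
have E'P z : is_vintegral mu (fun s => alpha s^-1%g z) (E' z) by exact: (vintP cG hG).
have E'l : linear E'. move=> c u v; apply: vintE.
 have -> : (fun s => alpha s^-1%g (c *: u + v)) = (fun s => c *: alpha s^-1%g u + alpha s^-1%g v).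
 by apply/funext => s; rewrite act_linear. have Zl : linear (fun z : A => c *: z).
 by move=> d u' v'; rewrite scalerDr !scalerA [c * d]mulrC.
 have ZM (z : A) : nm (c *: z) <= Re `|c| * nm z by rewrite nmCZ.
 apply: (vint_add cG _ _ (vint_map Zl ZM (E'P u)) (E'P v)) => //.
 move=> s; apply: (@continuous_comp _ _ _ (fun s => alpha s^-1%g u) (fun z : A => c *: z)). exact: Vc.
 exact: (bounded_continuous Zl ZM).
have E'M z : nm (E' z) <= 1 * nm z. rewrite mul1r -[E' z]subr0; apply: (vint_bnd cG (Vc z) (E'P z)) => s.
 by rewrite subr0 nm_act.
have E'act h z : E' (alpha h z) = E' z. apply: vintE. have := @vint_shift _ _ cG _ _ mu_inv _ _ h^-1%g (Vc z) (E'P z).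
 have -> // : (fun s => alpha (h^-1 * s)^-1%g z) = (fun s => alpha s^-1%g (alpha h z)).
 by apply/funext => s; rewrite invgM invgK actM.
have E'id z : (forall h, alpha h z = z) -> E' z = z. move=> fz; apply: vintE.
 have -> : (fun s => alpha s^-1%g z) = (fun=> z) by apply/funext => s. exact: vint_cst.
have EE z : avg z = E' z. rewrite -[LHS]E'id; last by move=> h; exact: avg_fixed. have := vint_map E'l E'M (avgP z).
 have -> : (fun s => E' (alpha s z)) = (fun=> E' z) by apply/funext => s.
 by move=> h; apply: (vint_uniq h); exact: vint_cst.
by rewrite !EE.
Qed.

(** An approximate unit for [S] need not remain one under the action. One for the finitely many
    translates [alpha (g i) s], near which the whole orbits lie, is uniformly good on the orbits and
    therefore survives averaging. *)
Lemma inv_approx_unit (S : seq A) (t : R) : 0 < t -> exists k : A, [/\ positive k, nm k <= 1, forall g, alpha g k = k &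
 forall s, s \in S -> nm (s - k ** s) <= t].
move=> t0; have t3 : 0 < t / 3 by rewrite divr_gt0.
have Wn : nbhs (1%g : G) [set w | forall x, x \in S -> nm (alpha w x - x) < t / 3].
 elim: S => [|x S IH]; first by apply: filterS filterT => w _ x. apply: filterS2 IH (act_cont_near x t3) => w h1 h2 y.
 by rewrite inE => /orP[/eqP ->|/h1].
have [m [g [h [_ _ h1 hW]]]] := @partition_unity R G cG hG _ Wn.
have [k [pk k1 hk]] := approx_unit [seq alpha (g i) x | i <- enum 'I_m, x <- S] t3.
exists (avg k); split.
- exact: avg_pos.
- exact: le_trans (avg_nm _) k1.
- by move=> u; exact: avg_fixed.
move=> x xS; rewrite nmBC.
have l : linear (fun z => z ** x) by move=> c u v; rewrite amulDl amulZl.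
have lM z : nm (z ** x) <= nm x * nm z by rewrite mulrC; exact: nmM.
have hv := vint_map l lM (avgP k).
apply: (vint_bnd cG _ hv). move=> s; apply: (@continuous_comp _ _ _ (alpha^~ k) (fun z => z ** x)).
 exact: act_continuous. exact: (bounded_continuous l lM).
move=> s; have [i hi] : exists i, h i s^-1%g != 0. apply: contrapT => no; have : \sum_i h i s^-1%g ^+ 2 = 0.
 apply: big1 => i _; apply/eqP; rewrite sqrf_eq0. by apply: contrapT => /negP hi; apply: no; exists i.
 by rewrite h1 => /eqP; rewrite oner_eq0.
have := hW i _ hi x xS; set w := ((g i)^-1 * s^-1)%g => hw.
have sE : s^-1%g = (g i * w)%g by rewrite /w mulgA mulgV mul1g.
have -> : alpha s k ** x - x = alpha s (k ** alpha s^-1%g x - alpha s^-1%g x). by rewrite actB act_amul actVK.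
rewrite nm_act sE actM; set y := alpha (g i) x.
have yS : y \in [seq alpha (g i) x | i <- enum 'I_m, x <- S]. by apply/allpairsP; exists (i, x); rewrite mem_enum.
have [hy _] := hk y yS.
set z := alpha (g i) (alpha w x).
have zy : nm (z - y) < t / 3 by rewrite /z /y -actB nm_act.
have -> : k ** z - z = k ** (z - y) + (k ** y - y) + (y - z) by rewrite amulBr; nc.
bnd nmD; bnd (lerD (nmD _ _) (lexx _)).
have : nm (k ** (z - y)) <= t / 3. by bnd nmM; rewrite -[leRHS]mul1r; apply: ler_pM; rewrite ?nm_ge0// ltW.
rewrite [nm (y - z)]nmBC [nm (k ** y - y)]nmBC; move: hy zy.
lra.
Qed.

End Average.

(** * Positive forms and covariant representations *)

Section Forms.
Context {R} {V : lmodType R[i]} (s : V -> V -> R[i]).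
Hypotheses (sl : forall x, linear (s x : V -> R[i]^o))
 (sh : forall x y, s y x = conjc (s x y)) (sp : forall x, 0 <= Re (s x x)).

Lemma form_CS x y : nm (s x y : R[i]^o) ^+ 2 <= Re (s x x) * Re (s y y).
have key t : 0 <= Re (s y y) - 2 * t * nm (s x y : R[i]^o) ^+ 2 + t ^+ 2 * nm (s x y : R[i]^o) ^+ 2 * Re (s x x).
 have := sp (y - (t%:C * s x y) *: x). have sD u v w : s u (v + w) = s u v + s u w := linD (sl u) v w.
 have sZ u c v : s u (c *: v) = c * s u v := linZ (sl u) c v.
 have E : s (y - (t%:C * s x y) *: x) (y - (t%:C * s x y) *: x) =
 s y y - t%:C * s x y * conjc (s x y) - conjc (t%:C * s x y) * s x y + conjc (t%:C * s x y) * (t%:C * s x y) * s x x.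
 have sDl u v w : s (u + v) w = s u w + s v w by rewrite [s (u + v) w]sh sD rmorphD [s u w]sh [s v w]sh.
 have sZl u c v : s (c *: u) v = conjc c * s u v by rewrite [s (c *: u) v]sh sZ rmorphM [s u v]sh.
 rewrite -scaleNr sDl !sD !sZl !sZ (sh x y); ring.
 have i0 : Im (s x x) = 0 by have := sh x x; case: (s x x) => a b [] /=; lra.
 rewrite E nmc_def (sqr_sqrtr (addr_ge0 (sqr_ge0 _) (sqr_ge0 _))); move: i0.
 case: (s x y) (s x x) (s y y) => a b [a1 b1] [a2 b2] /= ->. lra.
set c := nm _ in key *; set a := Re (s x x) in key *; set b := Re _ in key *.
have a0 : 0 <= a by exact: sp.
(* For a null vector [x] the inequality [key] is linear in [t], and a large [t] leaves only [c = 0].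
   Otherwise [t = 1 / a] is optimal. *)
have [/eqP az|an] := eqVneq a 0. rewrite (eqP az) mul0r; have [//|cp] := leP (c ^+ 2) 0.
 have := key ((b + 1) / (2 * c ^+ 2)); rewrite (eqP az) mulr0 addr0.
 have -> : 2 * ((b + 1) / (2 * c ^+ 2)) * c ^+ 2 = b + 1. by field; move: cp; rewrite exprn_even_gt0. by lra.
have ap : 0 < a by rewrite lt_neqAle eq_sym an.
have := key a^-1.
have -> : b - 2 * a^-1 * c ^+ 2 + a^-1 ^+ 2 * c ^+ 2 * a = b - c ^+ 2 / a by field.
by rewrite subr_ge0 ler_pdivrMr// mulrC.
Qed.

End Forms.

Section HilbertModule.
Context {R} (H : hilbertSpace R).
Implicit Types x y : H.
Local Notation "<< x , y >>" := (hs_inner H x y : Cx R).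

Lemma hs_lin y : linear (fun x => << x, y >> : R[i]^o).
by move=> c u v; rewrite linearPl. Qed.
Lemma hs_herm x y : << y, x >> = conjc << x, y >>.
by rewrite hermC mul1r. Qed.
Lemma hs_nm x : << x, x >> = (nm x ^+ 2)%:C.
by rewrite -hs_norm normE -rmorphXn. Qed.

Lemma hs_CS x y : nm << y, x >> <= nm x * nm y.
have := @form_CS R H (fun x y => << y, x >>) (fun x => hs_lin x) (fun x y => hs_herm y x).
move=> /(_ _ x y); rewrite !hs_nm /= -exprMn ler_sqr ?nnegrE ?mulr_ge0 ?nm_ge0//; apply.
by move=> z; rewrite hs_nm sqr_ge0.
Qed.

Lemma hs_self x : nm << x, x >> = nm x ^+ 2.
by rewrite hs_nm; apply: nm_eqE; rewrite normc_def expr0n addr0 sqrtr_sqr ger0_norm ?sqr_ge0.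
Qed.

(** [hs_inner] is linear in its first argument and [ip] in its second, hence the exchange. *)
Definition hs_mod : hmod (Cx R) := @HMod R (Cx R) H (fun x y => << y, x >>)
 (fun x => linD (hs_lin x)) (fun c x => linZ (hs_lin x) c) (fun x y => esym (hs_herm y x)) hs_self hs_CS.

End HilbertModule.

Section Covariant.
Context {R} {G} {A : cstar R} (alpha : cstarAction G A).
Variables (H : hilbertSpace R) (p : A -> H -> H) (u : G -> H -> H).
Hypothesis cr : covariant_rep alpha p u.

Lemma rep_adj a : adj_set (E := hs_mod H) (p a).
split. have [M hM] := cr_bounded cr a; exists (Re M) => xi. have := hM xi; rewrite !normE lecE /= => /andP[_].
 by case: (M) => m m' /=; rewrite mulr0 subr0.
exists (p (star a)) => x y /=.
by rewrite -[a in LHS]starK -(cr_star cr).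
Qed.

Definition rep_op a : adjop (hs_mod H) := mkop (rep_adj a).

Lemma rep_hom : star_hom rep_op.
split.
- by move=> c a b; apply: adjop_eq => xi; rewrite /aop /= (cr_linear2 cr).
- by move=> a b; apply: adjop_eq => xi; rewrite /aop /= (cr_amul cr).
- move=> a; apply: adjop_eq => xi; apply: ip_inj => z. by rewrite -ip_adj' /= (cr_star cr).
Qed.

Lemma rep_nm a xi : nm (p a xi) <= nm a * nm xi.
have h := hom_contr (@aid_l _ _ _) (@aid_r _ _ _) rep_hom a.
have := nm_aop (rep_op a) xi; rewrite -nm_op => k.
by bnd k; apply: ler_wpM2r; rewrite ?nm_ge0.
Qed.

Lemma unitary_nm g xi : nm (u g xi) = nm xi.
apply/eqP; rewrite -(@eqrXn2 _ 2) ?nm_ge0//.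
by rewrite -!hs_self (cr_unitary_inner cr).
Qed.
Lemma rep_lin a x y : p a (x - y) = p a x - p a y.
exact: (linB (cr_linear cr a)). Qed.

Lemma rep_linl a b x : p (a - b) x = p a x - p b x.
by rewrite -[a - b]addrC -scaleN1r (cr_linear2 cr) scaleN1r addrC.
Qed.

Lemma integrand_cont (f : G -> A) xi : continuous f -> continuous (fun s => p (f s) (u s xi)).
move=> /cont_near fc; have /cont_near uc := @cr_unitary_cont _ _ _ _ _ _ _ cr xi.
apply/cont_near => s e e0.
have m0 : 0 < e / (2 * (nm xi + 1)) by rewrite divr_gt0// mulr_gt0// ltr_wpDl ?nm_ge0.
have m1 : 0 < e / (2 * (nm (f s) + 1)) by rewrite divr_gt0// mulr_gt0// ltr_wpDl ?nm_ge0.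
apply: filterS2 (fc s _ m0) (uc s _ m1) => t h1 h2.
have -> : p (f t) (u t xi) - p (f s) (u s xi) = p (f t - f s) (u t xi) + p (f s) (u t xi - u s xi).
 by rewrite rep_lin rep_linl addrA subrK.
bnd nmD.
via (nm (f t - f s) * nm xi + nm (f s) * nm (u t xi - u s xi)). by apply: lerD; bnd rep_nm; rewrite ?unitary_nm.
have k1 : nm (f t - f s) * nm xi <= e / (2 * (nm xi + 1)) * nm xi. by apply: ler_wpM2r; [exact: nm_ge0|exact: ltW].
have k2 : nm (f s) * nm (u t xi - u s xi) <= nm (f s) * (e / (2 * (nm (f s) + 1))).
 by apply: ler_wpM2l; [exact: nm_ge0|exact: ltW].
bnd (lerD k1 k2).
have half z : 0 <= z -> e / (2 * (z + 1)) * z < e / 2.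
 move=> z0; have -> : e / (2 * (z + 1)) * z = e / 2 * (z / (z + 1)). by field; rewrite gt_eqF// ltr_wpDl.
 rewrite -[ltRHS]mulr1 ltr_pM2l ?divr_gt0// ltr_pdivrMr ?ltr_wpDl// mul1r ltrDl. exact: ltr01.
by rewrite [e in ltRHS]splitr [nm (f s) * _]mulrC; apply: ltrD; apply: half; exact: nm_ge0.
Qed.

End Covariant.

(** * The fixed point algebra as a corner of the crossed product *)

Section Crossed.
Context {R} {G} {A : cstar R} {alpha : cstarAction G A}.
Hypotheses (cG : compact [set: G]) (hG : hausdorff_space G).
Variable C : crossedProduct alpha.
Local Notation mu := (cp_haar C).
Local Notation emb := (@cp_emb _ _ _ _ C).
Local Notation E := (avg mu alpha).
Let mu_inv : left_invariant mu := @cp_haar_inv _ _ _ _ C.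

Lemma emb_le (f : cont_alg G A) (M : R) : (forall s, nm (val f s) <= M) -> nm (emb f) <= M.
move=> fM; have M0 : 0 <= M by exact: le_trans (nm_ge0 _) (fM 1%g).
have : (rnorm (emb f) <= M%:E)%E. rewrite cp_norm; apply: ge_ereal_sup => _ [H [p [u [cr ->]]]].
 apply: ge_ereal_sup => _ [xi xi1 <-]; rewrite /rnorm lee_fin.
 have x1 : nm xi <= 1 by move: xi1; rewrite /= normE lecE /= eqxx.
 have Fc := @integrand_cont _ _ _ _ _ _ _ cr _ xi (val_substar f : continuous (val f)). have h := vintP cG hG mu Fc.
 rewrite -[X in Re `|X|]subr0 -/(nm _); apply: (vint_bnd cG Fc h) => s. rewrite subr0; bnd (rep_nm cr _ _).
 rewrite (unitary_nm cr) -[leRHS]mulr1. by apply: ler_pM; rewrite ?nm_ge0.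
by [].
Qed.
Lemma cst_cont_set (a : A) : cont_set (fun _ : G => a).
by move=> t; exact: cvg_cst. Qed.

Definition cst_fun (a : A) : cont_alg G A := mksub (S := cont_alg G A) (@cst_cont_set a).

(** Formally this is [a p], where the projection [p] is the integral of the canonical unitaries. The
    relation [p b p = E(b) p] explains the product rules that follow. *)
Definition jmap (a : A) : C := emb (cst_fun a).

Lemma jmap_lin : linear jmap.
move=> c a b; rewrite /jmap -cp_linear; congr emb; apply: val_inj.
by [].
Qed.
Lemma jmap_le a : nm (jmap a) <= nm a.
by apply: emb_le => s. Qed.

Lemma orb_cont (a b : A) : cont_set (fun s : G => a ** alpha s b).
move=> s; apply: cvg_amul; first exact: cvg_cst.
exact: act_continuous.
Qed.

Definition orb_fun (a b : A) : cont_alg G A := mksub (S := cont_alg G A) (@orb_cont a b).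

Lemma star_orb_cont (a : A) : cont_set (fun s : G => alpha s (star a)).
by move=> s; exact: act_continuous. Qed.

Definition star_fun a : cont_alg G A := mksub (S := cont_alg G A) (@star_orb_cont a).

Lemma jmap_star a : star (jmap a) = emb (star_fun a).
by rewrite -(@cp_star _ _ _ _ C (cst_fun a) (star_fun a)). Qed.

Lemma jmap_mul a b : jmap a ** jmap b = jmap (a ** E b).
rewrite /jmap -(@cp_convolution _ _ _ _ C (cst_fun a) (cst_fun b) (cst_fun (a ** E b)))//.
move=> s /=; apply/esym/vintE.
have l : linear (amul a) by move=> c u v; rewrite amulDr amulZr.
exact: (vint_map l (fun z => nmM a z) (avgP cG hG mu alpha b)).
Qed.

Lemma jmap_starl a b : star (jmap a) ** jmap b = jmap (E (star a ** b)).
rewrite jmap_star /jmap -(@cp_convolution _ _ _ _ C (star_fun a) (cst_fun b) (cst_fun (E (star a ** b))))//.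
move=> s /=; rewrite /avg; congr vintegral; apply/funext => t.
by rewrite act_amul.
Qed.

Lemma jmap_starr a b : jmap a ** star (jmap b) = emb (orb_fun a (star b)).
rewrite jmap_star /jmap -(@cp_convolution _ _ _ _ C (cst_fun a) (star_fun b) (orb_fun a (star b)))//.
move=> s /=; apply/esym/vintE.
have -> : (fun t => a ** alpha t (alpha (t^-1 * s)%g (star b))) = (fun=> a ** alpha s (star b)).
 by apply/funext => t; rewrite -actM mulgA mulgV mul1g.
exact: vint_cst.
Qed.

Lemma emb_jmap (f : cont_alg G A) b : exists c, emb f ** jmap b = jmap c.
pose c := vintegral mu (fun t => val f t ** alpha t b); exists c.
by rewrite -(@cp_convolution _ _ _ _ C f (cst_fun b) (cst_fun c)).
Qed.

Local Notation B := (csubstar (fixed_alg alpha)).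
Definition jB (b : B) : C := jmap (val b).

Lemma fixedP (b : B) g : alpha g (val b) = val b.
exact: (val_substar b). Qed.

Lemma jB_hom : star_hom jB.
split.
- by move=> c x y; rewrite -jmap_lin.
- by move=> x y; rewrite jmap_mul avg_id// => g; exact: fixedP.
- move=> x; rewrite /jB jmap_star /jmap; congr emb; apply: val_inj. by apply/funext => s /=; rewrite act_star fixedP.
Qed.

Definition avgB (x : A) : B :=
 mksub (S := fixed_alg alpha) (fun g => avg_fixed cG hG alpha mu_inv x g : alpha g (E x) = E x).

Hypothesis jB_nm : forall b, nm (jB b) = nm b.

Lemma jB_iso : isohom jB.
by split; [exact: jB_hom|exact: jB_nm]. Qed.

Lemma cp_approx (x : C) e : 0 < e -> exists f, nm (x - emb f) < e.
move=> e0; have := @cp_dense _ _ _ _ C (interior (ball x e%:C)) _ _.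
case.
- by exists x; apply: nbhsx_ballx; exact: gt0C.
- exact: open_interior.
move=> _ [] /[swap] -[f _ <-] /interior_subset; rewrite -ball_normE /= normE ltcR => h.
by exists f.
Qed.

(** For [x = emb f] the product [emb f ** jmap b] is some [jmap c], and [star (jmap a) ** jmap c]
    comes from the average of [star a ** c]. Density and closedness of the isometric image give all
    [x]. *)
Lemma jmap_corner (x : C) a b : exists q, jB q = star (jmap a) ** x ** jmap b.
suff : range jB (star (jmap a) ** x ** jmap b) by case=> q _ <-; exists q.
move: (range_closed jB_iso) => /closed_nmP; apply => e e0.
pose M := nm (jmap a) * nm (jmap b) + 1.
have M0 : 0 < M by rewrite ltr_wpDl ?mulr_ge0 ?nm_ge0.
have [f hf] := cp_approx x (divr_gt0 e0 M0).
have [c hc] := emb_jmap f b.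
exists (star (jmap a) ** emb f ** jmap b). by rewrite -amulA hc jmap_starl; exists (avgB (star a ** c)).
rewrite -amulBl -amulBr.
bnd nmM; bnd (ler_wpM2r (nm_ge0 _) (nmM _ _)).
rewrite nmS; move: hf; rewrite ltr_pdivlMr//; apply: le_lt_trans.
have := nm_ge0 (x - emb f); rewrite /M; move: (nm _) (nm _) (nm _) => u v w w0.
have -> : v * w * u = w * (v * u) by ring.
lra.
Qed.

End Crossed.

(* The completion is realised by the functionals [x |-> lim s(x, v_n)] on [V], for
 Cauchy sequences [v]; the inner product with [s(-, w)] is evaluation at [w]. *)
Section Completion.
Context {R} (V : lmodType R[i]) (s : V -> V -> R[i]).
Hypotheses (sl : forall x, linear (s x : V -> R[i]^o))
 (sh : forall x y, s y x = conjc (s x y)) (sp : forall x, 0 <= Re (s x x)).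
Local Notation C := (R[i]^o)%type.
Implicit Types (x y v w : V).

Definition snorm x : R := Num.sqrt (Re (s x x)).
Local Notation q := snorm.

Lemma snorm_ge0 x : 0 <= q x. exact: sqrtr_ge0. Qed.

Lemma snorm_sq x : s x x = (q x ^+ 2)%:C.
rewrite sqr_sqrtr//; have := sh x x; case: (s x x) => a b [] /= h.
by apply/eqP; rewrite eq_complex /=; lra.
Qed.

Lemma snorm_CS x y : nm (s x y : C) <= q x * q y.
rewrite -ler_sqr ?nnegrE ?nm_ge0 ?mulr_ge0 ?snorm_ge0// exprMn !sqr_sqrtr//.
exact: form_CS.
Qed.

Let sD u v w : s u (v + w) = s u v + s u w := linD (sl u) v w.
Let sZ u c v : s u (c *: v) = c * s u v := linZ (sl u) c v.
Let sB u v w : s u (v - w) = s u v - s u w := linB (sl u) v w.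
Let s0 u : s u 0 = 0 := lin0 (sl u).
Let sBl u v w : s (u - v) w = s u w - s v w.
by rewrite [s (u - v) w]sh sB rmorphB [s u w]sh [s v w]sh. Qed.

(** [v] represents [xi] up to [e]. Estimates in the completion are carried out with such
    representatives instead of Cauchy sequences. *)
Definition app (xi : V -> C) (e : R) v : Prop := forall x, nm (xi x - s x v : C) <= e * q x.

Definition compl_set : set (V -> C) := [set xi | forall e, 0 < e -> exists v, app xi e v].

Definition comp_pred : {pred V -> C} := fun xi => `[< compl_set xi >].

Lemma comp_predP xi : reflect (compl_set xi) (xi \in comp_pred).
exact: asboolP. Qed.

Lemma app_lin (c : R[i]) xi eta e f v w : app xi e v -> app eta f w ->
 app (c *: xi + eta) (nm (c : C) * e + f) (c *: v + w).
move=> h1 h2 x; rewrite sD sZ.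
have -> : (c *: xi + eta) x - (c * s x v + s x w) = c *: (xi x - s x v : C) + (eta x - s x w).
 by rewrite scalerBr opprD addrACA.
bnd nmD; rewrite mulrDl; apply: lerD; last exact: h2.
rewrite nmCZ -mulrA; apply: ler_wpM2l; first exact: (nm_ge0 (c : C)).
exact: h1.
Qed.
Lemma app_le xi e f v : e <= f -> app xi e v -> app xi f v.
by move=> ef h x; bnd (h x); apply: ler_wpM2r; rewrite ?snorm_ge0. Qed.

Let comp_submod : GRing.submod_closed comp_pred.
split. apply/comp_predP => e e0; exists 0 => x. by rewrite s0 subr0 nm0 mulr_ge0 ?snorm_ge0 ?ltW.
move=> c xi eta /comp_predP h1 /comp_predP h2; apply/comp_predP => e e0.
have c0 := nm_ge0 (c : C).
have d0 : 0 < e / (2 * (nm (c : C) + 1)) by rewrite divr_gt0// mulr_gt0// ltr_wpDl.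
have [v hv] := h1 _ d0; have [w hw] := h2 _ (divr_gt0 e0 (@ltr0n R 2)).
exists (c *: v + w); apply: app_le (app_lin c hv hw).
have -> : nm (c : C) * (e / (2 * (nm (c : C) + 1))) = e / 2 * (nm (c : C) / (nm (c : C) + 1)).
 by field; rewrite gt_eqF// ltr_wpDl.
have : e / 2 * (nm (c : C) / (nm (c : C) + 1)) <= e / 2.
 by rewrite ler_piMr ?divr_ge0 ?ltW// ltr_pdivrMr ?ltr_wpDl// mul1r ltrDl.
lra.
Qed.
HB.instance Definition _ := GRing.isSubmodClosed.Build R[i] (V -> C) comp_pred comp_submod.

(* The instances below depend on the proofs [sl], [sh] and [sp], which therefore
 have to be recoverable from the type. *)
Definition compl := let _ := (sl, sh, sp) in {xi : V -> C | xi \in comp_pred}.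
HB.instance Definition _ := SubChoice.on compl.
HB.instance Definition _ := [SubChoice_isSubLmodule of compl by <:].

Definition cfun_of (xi : compl) : V -> C := val xi.
Coercion cfun_of : compl >-> Funclass.
Definition mkcompl xi (h : compl_set xi) : compl := exist _ xi (introT (comp_predP xi) h).
Lemma complP (xi : compl) : compl_set xi. by apply/comp_predP; exact: valP. Qed.
Lemma compl_eq (xi eta : compl) : (forall x, xi x = eta x) -> xi = eta.
by move=> h; apply: val_inj; apply/funext. Qed.
Lemma complD (xi eta : compl) x : cfun_of (xi + eta) x = xi x + eta x. by []. Qed.
Lemma complZ c (xi : compl) x : cfun_of (c *: xi) x = c * xi x. by []. Qed.
Lemma complB (xi eta : compl) x : cfun_of (xi - eta) x = xi x - eta x. by []. Qed.
Lemma hat_subproof v : compl_set (fun x => s x v).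
by move=> e e0; exists v => x; rewrite subrr nm0 mulr_ge0 ?snorm_ge0 ?ltW. Qed.
Definition hat v : compl := mkcompl (hat_subproof v).

Lemma hatE v x : hat v x = s x v. by []. Qed.
Lemma hat_lin : linear hat.
by move=> c v w; apply: compl_eq => x; rewrite !hatE sD sZ. Qed.
Lemma app_hat v : app (hat v) 0 v.
by move=> x; rewrite subrr nm0 mul0r. Qed.

Lemma compl_sub (xi : compl) x y : xi (x - y) = xi x - xi y.
apply/subr0_eq/nm_small => e e0.
pose K := q (x - y) + (q x + q y) + 1.
have K0 : 0 < K by rewrite ltr_wpDl// !addr_ge0 ?snorm_ge0.
have [v hv] := complP xi (divr_gt0 e0 K0).
have -> : xi (x - y) - (xi x - xi y) =
 (xi (x - y) - s (x - y) v) - ((xi x - s x v) - (xi y - s y v)) :> C by rewrite sBl; ring.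
bnd nmB; bnd (lerD (lexx _) (nmB _ _)).
bnd (lerD (hv _) (lerD (hv _) (hv _))).
rewrite -!mulrDr -mulrA ler_piMr ?(ltW e0)// mulrC ler_pdivrMr// mul1r /K lerDl.
exact: ler01.
Qed.

Lemma compl_bnd (xi : compl) : exists2 M, 0 <= M & forall x, nm (xi x) <= M * q x.
have [v hv] := complP xi ltr01; exists (1 + q v); first by rewrite addr_ge0 ?snorm_ge0.
move=> x; bnd (nm_ler _ (s x v : C)); rewrite mulrDl; apply: lerD; first exact: hv.
by rewrite mulrC; exact: snorm_CS.
Qed.

Lemma app_snorm (xi : compl) M e v : 0 <= M -> 0 <= e -> (forall x, nm (xi x) <= M * q x) -> app xi e v -> q v <= M + e.
move=> M0 e0 hM hv; have [->|v0] := eqVneq (q v) 0; first exact: addr_ge0.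
have vp : 0 < q v by rewrite lt_neqAle eq_sym v0 snorm_ge0.
rewrite -(ler_pM2r vp) mulrDl -expr2.
have -> : q v ^+ 2 = nm (s v v : C).
 by rewrite snorm_sq; apply/esym/nm_eqE; rewrite normc_def expr0n addr0 sqrtr_sqr ger0_norm ?sqr_ge0.
bnd (nm_ler _ (xi v)); rewrite addrC; apply: lerD; first exact: hM.
by rewrite nmBC.
Qed.

Lemma app_dist (xi : compl) e f v w : 0 <= e -> 0 <= f -> app xi e v -> app xi f w -> q (v - w) <= e + f.
move=> e0 f0 hv hw; have [->|v0] := eqVneq (q (v - w)) 0; first exact: addr_ge0.
have vp : 0 < q (v - w) by rewrite lt_neqAle eq_sym v0 snorm_ge0.
rewrite -(ler_pM2r vp) mulrDl -expr2; set x := v - w in vp *.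
have -> : q x ^+ 2 = nm (s x x : C).
 by rewrite snorm_sq; apply/esym/nm_eqE; rewrite normc_def expr0n addr0 sqrtr_sqr ger0_norm ?sqr_ge0.
rewrite {2}/x sB; bnd (nm_tri _ (xi x) _).
by rewrite nmBC; apply: lerD.
Qed.

(** The value is characterised by an estimate valid for every representative of [eta], not by one
    chosen sequence; identities between inner products then reduce to identities for [s] up to small
    errors. *)
Lemma inner_ex (xi eta : compl) : exists c : C, forall M e w, 0 <= M -> 0 <= e ->
 (forall x, nm (xi x) <= M * q x) -> app eta e w -> nm (c - xi w) <= M * e.
have [M M0 hM] := compl_bnd xi.
have i0 n : 0 < n.+1%:R^-1 :> R by rewrite invr_gt0.
have [w hw] := choice (fun n => complP eta (i0 n)).
have dist K n e v : 0 <= K -> 0 <= e -> (forall x, nm (xi x) <= K * q x) -> app eta e v ->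
 nm (xi (w n) - xi v) <= K * (n.+1%:R^-1 + e). move=> K0 e0 hK hv; rewrite -compl_sub; bnd hK.
 by apply: ler_wpM2l => //; exact: app_dist (ltW (i0 n)) e0 (hw n) hv.
have cs : caus (fun n => xi (w n)). move=> e e0; have M1 : 0 < M + 1 by rewrite ltr_wpDl.
 have [N hN] := inv_nat_lt (divr_gt0 e0 (mulr_gt0 (@ltr0n R 2) M1)).
 exists N => m n /hN h1 /hN h2; bnd (dist _ _ _ _ M0 (ltW (i0 n)) hM (hw n)).
 apply: le_lt_trans (_ : M * (e / (M + 1)) < e). apply: ler_wpM2l => //.
 have -> : e / (M + 1) = e / (2 * (M + 1)) + e / (2 * (M + 1)) by field; rewrite gt_eqF. by apply: lerD; exact: ltW.
 by rewrite mulrCA gtr_pMr// ltr_pdivrMr// mul1r ltrDl.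
have [c hc] := @caus_cvs R (Cx R) _ cs.
exists c => K e v K0 e0 hK hv; apply/ler_addgt0Pr => d d0.
have K1 : 0 < K + 1 by rewrite ltr_wpDl.
have [N hN] := hc _ (divr_gt0 d0 (@ltr0n R 2)).
have [N' hN'] := inv_nat_lt (divr_gt0 d0 (mulr_gt0 (@ltr0n R 2) K1)).
pose n := maxn N N'; have := hN n (leq_maxl _ _); have := hN' n (leq_maxr _ _) => h1 h2.
bnd (nm_tri _ (xi (w n)) _).
have h3 := dist K n e v K0 e0 hK hv; rewrite mulrDr in h3.
have h4 : K * n.+1%:R^-1 <= d / 2. bnd (ler_wpM2l K0 (ltW h1)).
 have -> : K * (d / (2 * (K + 1))) = d / 2 * (K / (K + 1)) by field; rewrite gt_eqF.
 by rewrite ler_piMr ?divr_ge0 ?(ltW d0)// ler_pdivrMr// mul1r lerDl.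
rewrite nmBC; bnd (lerD (ltW h2) h3); move: h4.
by move: (K * _) (K * _) => a b; lra.
Qed.

Definition inner xi eta : C := sval (cid (inner_ex xi eta)).

Lemma innerP (xi eta : compl) M e w : 0 <= M -> 0 <= e ->
 (forall x, nm (xi x) <= M * q x) -> app eta e w -> nm (inner xi eta - xi w) <= M * e.
exact: (svalP (cid (inner_ex xi eta))). Qed.

Lemma inner_hat xi w : inner xi (hat w) = xi w.
have [M M0 hM] := compl_bnd xi; apply/subr0_eq/nm_le0.
by have := innerP M0 (lexx 0) hM (app_hat w); rewrite mulr0.
Qed.

Lemma inner_small (eta : compl) (c : C) (K : R) : 0 <= K ->
 (forall e w, 0 < e -> e <= 1 -> app eta e w -> nm c <= K * e) -> c = 0.
move=> K0 h; apply: nm_small => e e0.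
have K1 : 0 < K + 1 by rewrite ltr_wpDl.
pose d := Num.min 1 (e / (K + 1)).
have d0 : 0 < d by rewrite lt_min ltr01 divr_gt0.
have [w hw] := complP eta d0.
bnd (h d w d0 _ hw); first by rewrite ge_min lexx.
bnd (ler_wpM2l K0 (_ : d <= e / (K + 1))); first by rewrite ge_min lexx orbT.
by rewrite mulrCA ler_piMr ?(ltW e0)// ler_pdivrMr// mul1r lerDl.
Qed.

Lemma inner_lin eta : linear (inner^~ eta : compl -> C).
move=> c xi zeta; apply: subr0_eq.
have [M1 p1 h1] := compl_bnd xi; have [M2 p2 h2] := compl_bnd zeta.
have [M3 p3 h3] := compl_bnd (c *: xi + zeta).
have c0 := nm_ge0 (c : C).
apply: (@inner_small eta _ (M3 + (nm (c : C) * M1 + M2))); first by rewrite !addr_ge0// mulr_ge0.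
move=> e w e0 _ hw; have E := ltW e0.
have -> : inner (c *: xi + zeta) eta - (c *: inner xi eta + inner zeta eta) =
 (inner (c *: xi + zeta) eta - cfun_of (c *: xi + zeta) w) -
 (c *: (inner xi eta - cfun_of xi w) + (inner zeta eta - cfun_of zeta w)).
 rewrite complD complZ -[c *: inner xi eta]/(c * inner xi eta).
 by rewrite -[c *: (inner xi eta - _)]/(c * (inner xi eta - _)); ring.
bnd nmB; bnd (lerD (lexx _) (nmD _ _)).
rewrite nmCZ !mulrDl -mulrA; apply: lerD; first exact: innerP.
apply: lerD; last exact: innerP.
by apply: ler_wpM2l => //; exact: innerP.
Qed.

Lemma inner_herm xi eta : inner eta xi = conjc (inner xi eta).
apply: subr0_eq.
have [M1 p1 h1] := compl_bnd xi; have [M2 p2 h2] := compl_bnd eta.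
apply: (@inner_small eta _ (M1 + (M2 + 1) + (M2 + (M1 + 1)))); first by rewrite !addr_ge0.
move=> e w e0 e1 hw; have E := ltW e0; have [v hv] := complP xi e0.
have k1 : nm (inner xi eta - s w v) <= (M1 + (M2 + 1)) * e.
 bnd (nm_tri _ (xi w) _); rewrite mulrDl; apply: lerD; first exact: innerP.
 bnd (hv w); rewrite mulrC; apply: ler_wpM2r => //. by bnd (app_snorm p2 E h2 hw); rewrite lerD2l.
have k2 : nm (inner eta xi - s v w) <= (M2 + (M1 + 1)) * e.
 bnd (nm_tri _ (eta v) _); rewrite mulrDl; apply: lerD; first exact: innerP.
 bnd (hw v); rewrite mulrC; apply: ler_wpM2r => //. by bnd (app_snorm p1 E h1 hv); rewrite lerD2l.
have -> : inner eta xi - conjc (inner xi eta) = (inner eta xi - s v w) - conjc (inner xi eta - s w v).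
 by rewrite [s v w]sh; ring.
bnd nmB; rewrite addrC [leRHS]mulrDl; apply: lerD => //.
by have -> : nm (conjc (inner xi eta - s w v) : C) = nm (inner xi eta - s w v) by exact: nmS.
Qed.

Lemma inner_pos xi : 0 <= Re (inner xi xi).
have [M p h] := compl_bnd xi; apply/ler_addgt0Pr => e e0.
have K1 : 0 < 2 * M + 1 by rewrite ltr_wpDl// mulr_ge0.
pose d := Num.min 1 (e / (2 * M + 1)).
have d0 : 0 < d by rewrite lt_min ltr01 divr_gt0.
have d1 : d <= 1 by rewrite ge_min lexx.
have [w hw] := complP xi d0.
have k1 := innerP p (ltW d0) h hw; have k2 := hw w; have k3 := app_snorm p (ltW d0) h hw.
have k4 : nm (inner xi xi - s w w) <= (2 * M + 1) * d. bnd (nm_tri _ (xi w) _). have k5 : d * q w <= d * (M + 1).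
 by apply: ler_wpM2l; [exact: ltW|bnd k3; rewrite lerD2l]. bnd (lerD k1 (le_trans k2 k5)).
 by rewrite le_eqVlt; apply/orP; left; apply/eqP; ring.
have k6 : (2 * M + 1) * d <= e. bnd (ler_wpM2l (ltW K1) (_ : d <= e / (2 * M + 1))). by rewrite ge_min lexx orbT.
 by rewrite mulrCA divff ?gt_eqF// mulr1.
have := le_trans (Re_nm _) (le_trans k4 k6); rewrite raddfB snorm_sq /= => /ler_normlP[k7 _].
have := sqr_ge0 (q w); lra.
Qed.

Lemma inner_le (xi : compl) M : 0 <= M -> (forall x, nm (xi x) <= M * q x) -> Re (inner xi xi) <= M ^+ 2.
move=> p h; apply/ler_addgt0Pr => e e0.
have K1 : 0 < 2 * M + 1 by rewrite ltr_wpDl// mulr_ge0.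
pose d := e / (2 * M + 1); have d0 : 0 < d by rewrite divr_gt0.
have [w hw] := complP xi d0.
have k1 := innerP p (ltW d0) h hw; have k3 := app_snorm p (ltW d0) h hw.
have k2 : nm (xi w) <= M * (M + d) by bnd (h w); exact: ler_wpM2l.
have := le_trans (Re_nm (inner xi xi)) (le_trans (nm_ler _ (xi w)) (lerD k1 k2)).
move=> /ler_normlP[_ k4]; bnd k4.
have -> : M * d + M * (M + d) = M ^+ 2 + 2 * M * d by ring.
by rewrite lerD2l mulrA ler_pdivrMr// mulrC ler_pM2l// lerDl.
Qed.

Lemma inner_bound (xi : compl) x : nm (xi x) <= Num.sqrt (Re (inner xi xi)) * q x.
have := @form_CS R compl (fun xi eta => inner eta xi) (fun xi => inner_lin xi)
 (fun xi eta => inner_herm eta xi) inner_pos (hat x) xi.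
rewrite !inner_hat hatE snorm_sq /= => h.
rewrite -ler_sqr ?nnegrE ?nm_ge0 ?mulr_ge0 ?snorm_ge0 ?sqrtr_ge0// exprMn sqr_sqrtr ?inner_pos//.
by rewrite mulrC.
Qed.

Definition cnorm (xi : compl) : R := Num.sqrt (Re (inner xi xi)).

Lemma cnorm_le (xi : compl) M : 0 <= M -> (forall x, nm (xi x) <= M * q x) -> cnorm xi <= M.
move=> M0 h; rewrite -ler_sqr ?nnegrE ?sqrtr_ge0// sqr_sqrtr ?inner_pos//.
exact: inner_le.
Qed.

Definition compl_norm xi : R[i] := (cnorm xi)%:C.

Let compl_normD xi eta : compl_norm (xi + eta) <= compl_norm xi + compl_norm eta.
rewrite -rmorphD lecR; apply: cnorm_le; first by rewrite addr_ge0 ?sqrtr_ge0.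
by move=> x; rewrite mulrDl; bnd nmD; apply: lerD; exact: inner_bound.
Qed.

Let compl_normZ (c : R[i]) xi : compl_norm (c *: xi) = `|c| * compl_norm xi.
have le (d : R[i]) eta : cnorm (d *: eta) <= nm (d : C) * cnorm eta.
 apply: cnorm_le; first by rewrite mulr_ge0 ?sqrtr_ge0 ?(nm_ge0 (d : C)).
 move=> x; rewrite complZ -mulrA -[d * _]/(d *: (cfun_of eta x : C)) nmCZ.
 by apply: ler_wpM2l; [exact: (nm_ge0 (d : C))|exact: inner_bound].
have cE : `|c| = (nm (c : C))%:C := normE (c : C).
rewrite cE -rmorphM; congr (_%:C); apply/eqP; rewrite eq_le le /=.
have [->|c0] := eqVneq c 0. by rewrite (nm0 (R[i]^o : normedModType R[i])) mul0r sqrtr_ge0.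
have np : 0 < nm (c : C). by rewrite lt_neqAle (nm_ge0 (c : C)) andbT eq_sym; apply: contra c0 => /eqP/(@nm_eq0 _ C) ->.
have := le c^-1 (c *: xi); rewrite scalerA mulVf// scale1r.
have -> : nm (c^-1 : C) = (nm (c : C))^-1. by apply: nm_eqE; rewrite normfV -fmorphV.
by rewrite mulrC ler_pdivlMr// mulrC.
Qed.

Let compl_norm_eq0 xi : compl_norm xi = 0 -> xi = 0.
move=> /(congr1 (@Re R)) /= h; apply: compl_eq => x; apply: nm_le0.
by bnd inner_bound; rewrite -/(cnorm xi) h mul0r.
Qed.
HB.instance Definition _ := Lmodule_isNormed.Build R[i] compl compl_normD compl_normZ compl_norm_eq0.

Lemma nm_compl (xi : compl) : nm xi = cnorm xi. by []. Qed.

Lemma compl_le (xi : compl) x : nm (xi x) <= nm xi * q x. exact: inner_bound. Qed.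

Let compl_cvs (u : nat -> compl) : caus u -> exists l, cvs u l.
move=> uc.
have pc x : exists l : C, cvs (fun n => u n x) l.
 apply: (@caus_cvs R (Cx R) (fun n => u n x)) => e e0; have q1 : 0 < q x + 1 by rewrite ltr_wpDl ?snorm_ge0.
 have [N hN] := uc _ (divr_gt0 e0 q1). exists N => m n hm hn; rewrite -complB; bnd compl_le.
 bnd (ler_wpM2r (snorm_ge0 x) (ltW (hN m n hm hn))). by rewrite -mulrA gtr_pMr// mulrC ltr_pdivrMr// mul1r ltrDl.
have [l hl] := choice pc.
have unif e : 0 < e -> \ev n, forall x, nm (l x - u n x) <= e * q x.
 move=> e0; have [N hN] := uc _ e0; exists N => n hn x; apply/ler_addgt0Pr => d d0.
 have [N' hN'] := hl x _ d0; pose m := maxn N N'. bnd (nm_tri _ (u m x) _); rewrite addrC; apply: lerD.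
 rewrite -complB; bnd compl_le. by apply: ler_wpM2r; [exact: snorm_ge0|apply/ltW/hN => //; exact: leq_maxl].
 by rewrite nmBC; apply/ltW/hN'; exact: leq_maxr.
have lP : compl_set l. move=> e e0; have e2 := divr_gt0 e0 (@ltr0n R 2).
 have [N hN] := unif _ e2; have [v hv] := complP (u N) e2. exists v => x; bnd (nm_tri _ (u N x) _).
 by rewrite [e]splitr mulrDl; apply: lerD; [exact: hN|exact: hv].
exists (mkcompl lP) => e e0; have e2 := divr_gt0 e0 (@ltr0n R 2).
have [N hN] := unif _ e2; exists N => n hn.
apply: le_lt_trans (_ : e / 2 < e); last by lra.
rewrite nm_compl; apply: cnorm_le; first exact: ltW.
by move=> x; rewrite nmBC; exact: hN.
Qed.
HB.instance Definition _ := Uniform_isComplete.Build compl (mk_complete compl_cvs).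

Let inner_bilin1 eta : zmod_morphism (inner^~ eta).
by move=> x y; exact: (linB (inner_lin eta)). Qed.
Let inner_bilin2 xi : zmod_morphism (inner xi).
move=> x y; rewrite [LHS]inner_herm (linB (inner_lin xi)) rmorphB.
by rewrite [inner xi x]inner_herm [inner xi y]inner_herm.
Qed.
Let inner_bilin3 eta : scalable_for *%R (inner^~ eta).
by move=> c x; exact: (linZ (inner_lin eta)). Qed.
Let inner_bilin4 xi : scalable_for (conjc \; *%R) (inner xi).
move=> c x; rewrite [LHS]inner_herm (linZ (inner_lin xi)) [inner xi x]inner_herm.
by rewrite rmorphM.
Qed.
HB.instance Definition _ := isBilinear.Build R[i] compl compl R[i] *%R (conjc \; *%R) inner
 inner_bilin1 inner_bilin2 inner_bilin3 inner_bilin4.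
Let inner_h (x y : compl) : inner x y = (-1) ^+ false * conjc (inner y x).
by rewrite mul1r inner_herm. Qed.
HB.instance Definition _ := isHermitianSesquilinear.Build R[i] compl false conjc inner inner_h.
Let inner_self xi : inner xi xi = (cnorm xi ^+ 2)%:C.
rewrite sqr_sqrtr ?inner_pos//; have := inner_herm xi xi; case: (inner xi xi) => a b [] /= h.
by apply/eqP; rewrite eq_complex /=; lra.
Qed.
Let inner_gt0 xi : xi != 0 -> 0 < inner xi xi.
move=> x0; rewrite inner_self ltcR exprn_gt0// lt_neqAle sqrtr_ge0 andbT eq_sym.
by apply: contra x0 => /eqP h; apply/eqP/compl_norm_eq0; rewrite /compl_norm h.
Qed.
HB.instance Definition _ := isDotProduct.Build R[i] compl inner inner_gt0.
Let inner_norm (xi : compl) : `|xi| ^+ 2 = inner xi xi.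
by rewrite inner_self rmorphXn. Qed.

Definition compl_hilbert : hilbertSpace R := @HilbertSpace R compl (inner : {dot compl for conjc}) inner_norm.

End Completion.

Lemma pos_val R (A : cstar R) (D : cstarSubalg A) (b : csubstar D) : positive (val b) <-> positive b.
have iso : isohom (fun b : csubstar D => lmul (val b)). exact: (isohom_comp (@val_iso R A D) (lmul_iso A)).
rewrite (positive_hom (@aid_l _ _ _) (@aid_r _ _ _) iso b); exact: pos_lmul.
Qed.

(** * The representation induced by a state of the fixed point algebra *)

Section Representation.
Context {R} {G} {A : cstar R} {alpha : cstarAction G A}.
Hypotheses (cG : compact [set: G]) (hG : hausdorff_space G).
Variable C : crossedProduct alpha.
Local Notation mu := (cp_haar C).
Local Notation B := (csubstar (fixed_alg alpha)).
Local Notation E := (avgB cG hG C).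
Let mu_inv : left_invariant mu := @cp_haar_inv _ _ _ _ C.

Lemma avgB_lin : linear E.
by move=> c x y; apply: val_inj; exact: (avg_linear cG hG). Qed.
Lemma avgB_pos x : positive x -> positive (E x).
by move=> px; apply/pos_val; exact: avg_pos. Qed.
Lemma avgB_act g x : E (alpha g x) = E x.
by apply: val_inj; exact: avg_act. Qed.
Lemma avgB_star x : E (star x) = star (E x).
by apply: val_inj; exact: avg_star. Qed.
Lemma avgB_nm x : nm (E x) <= nm x.
exact: avg_nm. Qed.
Lemma avgB_val (b : B) : E (val b) = b.
by apply: val_inj; apply: avg_id => g; exact: fixedP. Qed.

Section State.
Variable f : B -> R[i]^o.
Hypotheses (fl : linear f) (fn : forall x, nm (f x) <= nm x) (fp : forall x, positive x -> 0 <= f x :> R[i]).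

Lemma state_star x : f (star x) = conjc (f x).
have [p [c [pp _ ->]]] := pos_decomp x.
rewrite star_sum !(lin_sum fl) rmorph_sum; each i.
rewrite starZc (pos_sa (pp i)) !(linZ fl) -![_ *: _]/(_ * _) rmorphM; congr (_ * _).
have := fp (pp i); case: (f (p i)) => a b; rewrite lecE /= => /andP[/eqP -> _].
by apply/eqP; rewrite oppr0.
Qed.

(** The GNS form of the state [f] composed with averaging. Averaging absorbs the action, so the
    action preserves the form and becomes unitary in the completion. *)
Definition gns_form x y : R[i] := f (E (star x ** y)).
Local Notation s := gns_form.

Lemma gns_lin x : linear (s x : A -> R[i]^o).
by move=> c u v; rewrite /s amulDr amulZr avgB_lin fl. Qed.
Lemma gns_herm x y : s y x = conjc (s x y).
by rewrite -state_star -avgB_star starM starK. Qed.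
Lemma gns_pos x : 0 <= Re (s x x).
by have := fp (avgB_pos (pos_star x)); rewrite lecE => /andP[]. Qed.

Local Notation q := (snorm s).

Lemma gns_act g x y : s (alpha g x) (alpha g y) = s x y.
by rewrite /s -act_star -act_amul avgB_act. Qed.
Lemma gns_mulr a x y : s x (a ** y) = s (star a ** x) y.
by rewrite /s starM starK amulA. Qed.
Lemma snorm_act g x : q (alpha g x) = q x.
by rewrite /snorm gns_act. Qed.

Lemma snorm_le x : q x <= nm x.
rewrite -ler_sqr ?nnegrE ?nm_ge0 ?sqrtr_ge0// sqr_sqrtr ?gns_pos//.
apply: le_trans (ler_norm _) (le_trans (Re_nm (f _)) _); bnd fn.
by bnd avgB_nm; rewrite nmSS.
Qed.

Lemma snorm_mul a x : q (a ** x) <= nm a * q x.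
rewrite -ler_sqr ?nnegrE ?mulr_ge0 ?nm_ge0 ?sqrtr_ge0// exprMn !sqr_sqrtr ?gns_pos//.
have pz : positive ((nm a ^+ 2)%:C *: (star x ** x) - star (a ** x) ** (a ** x)).
 apply/pos_lmul; have [[l lM lS] n] := lmul_iso A.
 have -> : lmul ((nm a ^+ 2)%:C *: (star x ** x) - star (a ** x) ** (a ** x)) =
 star (lmul x) ** ((nm a ^+ 2)%:C *: aid - lmul (star a ** a)) ** lmul x.
 rewrite (linB l) (linZ l) !lM !lS lM starM. by rewrite amulBr amulBl amulZr amulZl aid_r !amulA.
 apply: (np_conj (@aid_l _ _ _) (@aid_r _ _ _)). apply: (np_le_U (@aid_l _ _ _)); last by rewrite n nmSS.
 by rewrite /sa -lS starM starK.
have := fp (avgB_pos pz); rewrite (linB avgB_lin) (linZ avgB_lin) (linB fl) (linZ fl).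
rewrite lecE => /andP[_]; rewrite raddfB /= subr_ge0.
rewrite -/(s (a ** x) (a ** x)) -/(s x x).
by case: (s x x) => u v /=; rewrite mul0r subr0.
Qed.

Local Notation H := (compl_hilbert gns_lin gns_herm gns_pos).
Local Notation V := (compl gns_lin gns_herm gns_pos).
Local Notation "[^ v ]" := (hat gns_lin gns_herm gns_pos v).

Lemma rep_subproof a (xi : V) : compl_set s (fun x => cfun_of xi (star a ** x)).
move=> e e0; have a1 : 0 < nm a + 1 by rewrite ltr_wpDl ?nm_ge0.
have [v hv] := complP xi (divr_gt0 e0 a1); exists (a ** v) => x.
rewrite gns_mulr; bnd hv.
bnd (ler_wpM2l _ (snorm_mul _ _)); first by rewrite divr_ge0 ?ltW.
rewrite nmS mulrA; apply: ler_wpM2r; first exact: sqrtr_ge0.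
by rewrite -mulrA ler_piMr ?(ltW e0)// mulrC ler_pdivrMr// mul1r lerDl.
Qed.

Definition grep a (xi : H) : H := mkcompl gns_lin gns_herm gns_pos (rep_subproof a xi).

Lemma unit_subproof g (xi : V) : compl_set s (fun x => cfun_of xi (alpha g^-1%g x)).
move=> e e0; have [v hv] := complP xi e0; exists (alpha g v) => x.
have -> : s x (alpha g v) = s (alpha g^-1%g x) v. by rewrite -(gns_act g (alpha g^-1%g x)) actVK.
by bnd hv; rewrite snorm_act.
Qed.

Definition gunit g (xi : H) : H := mkcompl gns_lin gns_herm gns_pos (unit_subproof g xi).

Lemma actKV g x : alpha g^-1%g (alpha g x) = x.
by rewrite -actM mulVg act1. Qed.
Lemma grep_hat a v : grep a [^ v] = [^ (a ** v)].
by apply: compl_eq => x; rewrite -[LHS]/(s (star a ** x) v) -gns_mulr. Qed.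

Lemma gunit_hat g v : gunit g [^ v] = [^ alpha g v].
apply: compl_eq => x; rewrite -[LHS]/(s (alpha g^-1%g x) v).
by rewrite -(gns_act g (alpha g^-1%g x)) actVK.
Qed.

Lemma hat_dense (xi : H) e : 0 < e -> exists v, nm (xi - [^ v] : H) <= e.
move=> e0; have [v hv] := complP (xi : V) e0; exists v.
by apply: cnorm_le => //; exact: ltW.
Qed.

Lemma dense_eq (phi psi : H -> R[i]^o) (K L : R) : (forall x y, nm (phi x - phi y) <= K * nm (x - y)) ->
 (forall x y, nm (psi x - psi y) <= L * nm (x - y)) -> (forall v, phi [^ v] = psi [^ v]) -> forall xi, phi xi = psi xi.
move=> h1 h2 e xi; apply/subr0_eq/nm_small => d d0.
pose M := Num.max K 0 + Num.max L 0 + 1.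
have M0 : 0 < M by rewrite ltr_wpDl// addr_ge0 ?le_max ?lexx ?orbT.
have [v hv] := hat_dense xi (divr_gt0 d0 M0).
bnd (nm_tri _ (phi [^ v]) _); rewrite [in X in _ + X]e [X in _ + X]nmBC.
bnd (lerD (h1 _ _) (h2 _ _)); rewrite -mulrDl.
via (M * nm (xi - [^ v])). apply: ler_wpM2r; first exact: nm_ge0. have k1 : K <= Num.max K 0 by rewrite le_max lexx.
 have k2 : L <= Num.max L 0 by rewrite le_max lexx. by rewrite /M; lra.
by move: hv; rewrite ler_pdivlMr// mulrC.
Qed.

Lemma grep_nm a xi : nm (grep a xi) <= nm a * nm xi.
apply: cnorm_le; first by rewrite mulr_ge0 ?nm_ge0.
move=> x; bnd (compl_le (xi : V) (star a ** x)).
rewrite [nm a * _]mulrC -mulrA; apply: ler_wpM2l; first exact: nm_ge0.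
by bnd snorm_mul; rewrite nmS.
Qed.

Lemma gunit_nm g xi : nm (gunit g xi) <= nm xi.
apply: cnorm_le; first exact: nm_ge0.
by move=> x; bnd (compl_le (xi : V) (alpha g^-1%g x)); rewrite snorm_act.
Qed.
Lemma grep_lin a : linear (grep a).
by move=> c x y; apply: compl_eq. Qed.
Lemma gunit_lin g : linear (gunit g).
by move=> c x y; apply: compl_eq. Qed.

Let ipB (x y z : H) : hs_inner H x (y - z) = hs_inner H x y - hs_inner H x z.
by rewrite linearBr. Qed.

Let ipCS (x y : H) : nm (hs_inner H x y : R[i]^o) <= nm x * nm y.
by rewrite mulrC; exact: hs_CS. Qed.

Lemma gns_covariant : covariant_rep (H := H) alpha grep gunit.
split.
- move=> a; exists (nm a)%:C => xi; rewrite -rmorphM lecR; exact: grep_nm.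
- exact: grep_lin.
- move=> c a b xi; apply: compl_eq => x. pose phi (xi : H) : R[i]^o := cfun_of xi (star (c *: a + b) ** x).
 pose psi (xi : H) : R[i]^o := c * cfun_of xi (star a ** x) + cfun_of xi (star b ** x).
 apply: (@dense_eq phi psi (q (star (c *: a + b) ** x)) (nm (c : R[i]^o) * q (star a ** x) + q (star b ** x))).
 + by move=> y z; rewrite mulrC; exact: (compl_le (y - z : V)).
 + move=> y z; have -> : psi y - psi z =
 c *: (cfun_of (y - z : V) (star a ** x) : R[i]^o) + cfun_of (y - z : V) (star b ** x).
 by rewrite /psi !complB -[_ *: _]/(_ * _); ring.
 bnd nmD; rewrite nmCZ mulrDl -mulrA ![_ * nm (y - z)]mulrC; apply: lerD.
 by apply: ler_wpM2l; [exact: (nm_ge0 (c : R[i]^o))|exact: (compl_le (y - z : V))]. exact: (compl_le (y - z : V)).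
 + move=> v; rewrite /phi /psi !hatE -!gns_mulr amulDl amulZl. by rewrite (linD (gns_lin x)) (linZ (gns_lin x)).
- by move=> a b xi; apply: compl_eq => x; congr (cfun_of xi); rewrite starM amulA.
- move=> a xi eta.
 apply: (@dense_eq (fun eta => hs_inner H (grep a xi) eta) (fun eta => hs_inner H xi (grep (star a) eta))
 (nm (grep a xi)) (nm xi * nm a)).
 + by move=> x y; rewrite -ipB.
 + move=> x y; rewrite -ipB -(linB (grep_lin _)); bnd ipCS. rewrite -mulrA; apply: ler_wpM2l; first exact: nm_ge0.
 by bnd grep_nm; rewrite nmS.
 + by move=> v; rewrite grep_hat; apply: etrans (inner_hat _ _) _; apply/esym/inner_hat.
- exact: gunit_lin.
- move=> g xi eta. apply: (@dense_eq (fun eta => hs_inner H (gunit g xi) (gunit g eta)) (fun eta => hs_inner H xi eta)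
 (nm (gunit g xi)) (nm xi)).
 + move=> x y; rewrite -ipB -(linB (gunit_lin _)); bnd ipCS. by apply: ler_wpM2l; [exact: nm_ge0|exact: gunit_nm].
 + by move=> x y; rewrite -ipB.
 + move=> v; rewrite gunit_hat; apply: etrans (inner_hat _ _) _.
 apply: etrans (_ : cfun_of xi v = _); last by apply/esym/inner_hat.
 by rewrite -[LHS]/(cfun_of xi (alpha g^-1%g (alpha g v))) actKV.
- by move=> xi; apply: compl_eq => x; congr (cfun_of xi); rewrite invg1 act1.
- by move=> g h xi; apply: compl_eq => x; congr (cfun_of xi); rewrite invgM actM.
- move=> xi; apply/cont_near => g e e0. have e4 : 0 < e / 4 by rewrite divr_gt0. have [v hv] := hat_dense xi e4.
 have /cont_near/(_ g _ e4) := @act_continuous _ _ _ alpha v. apply: filterS => h hh.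
 have -> : gunit h xi - gunit g xi = gunit h (xi - [^ v]) - gunit g (xi - [^ v]) + [^ (alpha h v - alpha g v)].
 rewrite !(linB (gunit_lin _)) !gunit_hat (linB (hat_lin gns_lin gns_herm gns_pos)).
 have zz (Z : zmodType) (a b c d : Z) : a - b = a - c - (b - d) + (c - d). by rewrite opprB addrAC !subrKA.
 exact: zz. bnd nmD; bnd (lerD (nmB _ _) (lexx _)).
 have k1 : nm [^ (alpha h v - alpha g v)] <= nm (alpha h v - alpha g v). apply: cnorm_le; first exact: nm_ge0.
 move=> x; rewrite hatE mulrC; bnd (snorm_CS gns_lin gns_herm gns_pos _ _).
 by apply: ler_wpM2l; [exact: sqrtr_ge0|exact: snorm_le]. have k2 := le_trans (gunit_nm h (xi - [^ v])) hv.
 have k3 := le_trans (gunit_nm g (xi - [^ v])) hv. have k4 := le_lt_trans k1 hh; move: k2 k3 k4 e0.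
 move: (nm) (nm _) (nm _) => a b c; lra.
- move=> g a xi; apply: compl_eq => x. rewrite -[LHS]/(cfun_of xi (star (alpha g a) ** x)).
 rewrite -[RHS]/(cfun_of xi (alpha g^-1%g^-1%g (star a ** alpha g^-1%g x))). by rewrite invgK act_amul act_star actVK.
Qed.

(** Let [k] be an invariant element that is nearly a unit for [star b ** b]. Because its class is
    fixed by the unitaries, the integrated form of the constant function [b] sends it to the class
    of [b k], of squared norm [f (k (star b) b k)], which is close to [f (star b ** b)]. *)
Lemma jB_state (b : B) (e : R) : 0 < e -> Re (f (star b ** b)) - e <= nm (jB C b) ^+ 2.
move=> e0; set c := star b ** b.
have e2 : 0 < e / 2 by rewrite divr_gt0.
have [k [pk k1 kf hk]] := inv_approx_unit cG hG alpha mu_inv [:: val c] e2.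
have /hk{}hk : val c \in [:: val c] by rewrite inE.
pose kB : B := mksub (S := fixed_alg alpha) (kf : fixed_set alpha k).
have : nm ([^ (val b ** k)] : H) <= nm (jB C b). have up : (rnorm ([^ (val b ** k)] : H) <= rnorm (jB C b))%E.
 rewrite /jB /jmap cp_norm; apply: le_trans (ereal_sup_ubound _); last first.
 by exists H, grep, gunit; split; [exact: gns_covariant|]. apply: ereal_sup_ubound; exists [^ k].
 rewrite /= normE lecR; apply: le_trans k1; apply: cnorm_le; first exact: nm_ge0.
 move=> x; rewrite hatE mulrC; bnd (snorm_CS gns_lin gns_herm gns_pos _ _).
 by apply: ler_wpM2l; [exact: sqrtr_ge0|exact: snorm_le]. congr rnorm; rewrite /integrated_form; apply: vintE.
 have -> : (fun s => grep (val (cst_fun (G := G) (val b)) s) (gunit s [^ k])) = (fun=> [^ (val b ** k)]).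
 by apply/funext => t; rewrite gunit_hat kf grep_hat. exact: vint_cst. by [].
rewrite -ler_sqr ?nnegrE ?nm_ge0//; apply: le_trans.
rewrite nm_compl /cnorm sqr_sqrtr ?inner_pos//.
have -> : inner [^ (val b ** k)] [^ (val b ** k)] = f (kB ** c ** kB).
 rewrite inner_hat hatE /gns_form; congr f; apply: val_inj => /=. rewrite starM (pos_sa pk).
 have -> : k ** star (val b) ** (val b ** k) = val (kB ** c ** kB) by rewrite /= /c !amulA.
 exact: (congr1 val (avgB_val _)).
have : nm (c - kB ** c ** kB) <= e. rewrite -[c - _]/(c - kB ** c ** kB).
 have -> : c - kB ** c ** kB = (c - kB ** c) + kB ** (c - c ** kB) by nc. have h2 : nm (c - c ** kB) <= e / 2.
 have ks : star kB = kB by apply: val_inj; exact: (pos_sa pk). have cs : star c = c by rewrite /c starM starK.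
 by rewrite -nmS starB (starM c) ks cs. bnd nmD; rewrite [e]splitr; apply: lerD => //.
 by bnd nmM; rewrite -[leRHS]mul1r; apply: ler_pM; rewrite ?nm_ge0.
move=> h; have := le_trans (Re_nm _) (le_trans (fn _) h).
by rewrite (linB fl) => /ler_normlP[_]; lra.
Qed.

End State.

(** The lower bound uses a state that norms [star b ** b]. *)
Theorem jB_isometric (b : B) : nm (jB C b) = nm b.
apply/le_anti/andP; split; first exact: jmap_le.
have [->|b0] := eqVneq b 0; first by rewrite nm0 nm_ge0.
have c0 : star b ** b != 0 by apply: contra b0 => /eqP /star_eq0 ->.
have [f [fl fn fp fc]] := state (pos_star b) c0.
rewrite -ler_sqr ?nnegrE ?nm_ge0//; apply/ler_addgt0Pr => e e0.
by have := jB_state fl fn fp b e0; rewrite fc /= nmSS lerBlDr.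
Qed.

End Representation.

(** * Weighted sums and null sequences *)

Section WeightedSum.
Context {R} {A : cstar R} {J : finType}.

Lemma nm_dop_gen (d : J -> A) (M : R) : 0 <= M -> (forall p, nm (d p) <= M) -> nm (dop d) <= M.
move=> M0 dM.
have dd : star (dop d) ** dop d = dop (fun p => star (d p) ** d p). rewrite /dop -mxoS -mxoM; apply: eq_mxo => p r.
 rewrite (bigD1 p)//= eqxx big1 ?addr0 => [|k kp].
 by case: (eqVneq p r) => [->//|pr]; rewrite ?amulr0// eq_sym (negbTE pr) amulr0.
 by rewrite (negbTE kp) star0 amul0r.
rewrite -ler_sqr ?nnegrE ?nm_ge0// -nmSS dd; apply: nm_dop; first exact: sqr_ge0. by move=> p; exact: pos_star.
by move=> p; rewrite nmSS ler_sqr ?nnegrE ?nm_ge0.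
Qed.

(** The sum is [<v, diag(m) v>] for the vector [v] with entries [star (z j)], so the number of terms
    does not enter the bound. *)
Lemma nm_weighted (z m : J -> A) (M : R) : 0 <= M -> (forall j, nm (m j) <= M) ->
 nm (\sum_j z j ** m j ** star (z j)) <= M * nm (\sum_j z j ** star (z j)).
move=> M0 mM; pose v : hvec A J := fun j => star (z j).
have -> : \sum_j z j ** m j ** star (z j) = hip v (aop (dop m) v). by rewrite hipE; each j; rewrite dopE starK amulA.
have -> : \sum_j z j ** star (z j) = hip v v. by rewrite hipE; each j; rewrite starK.
bnd nm_hip_op; rewrite -hnm_sq -nm_hv.
by apply: ler_wpM2r; [exact: sqr_ge0|exact: nm_dop_gen].
Qed.

End WeightedSum.

Section NullSequences.
Context {R} {A : cstar R}.
Implicit Types u v b : nat -> A.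

Definition nul u := cvs u 0.
Definition bdd u := exists2 M : R, 0 <= M & forall n, nm (u n) <= M.

Lemma nulD u v : nul u -> nul v -> nul (fun n => u n + v n).
by move=> hu hv; rewrite /nul -[0](addr0 0); exact: cvsD. Qed.
Lemma nul_dom u v (M : R) : (forall n, nm (v n) <= M * nm (u n)) -> nul u -> nul v.
by move=> h; apply: (@cvs_dom _ _ _ _ _ _ _ M) => n; rewrite !subr0. Qed.
Lemma nulN u : nul u -> nul (fun n => - u n).
by apply: (@nul_dom _ _ 1) => n; rewrite nmN mul1r. Qed.

Lemma nulMl b u : bdd b -> nul u -> nul (fun n => b n ** u n).
move=> [M M0 bM]; apply: (@nul_dom _ _ M) => n; bnd nmM.
by apply: ler_wpM2r => //; exact: nm_ge0.
Qed.

Lemma nulMr b u : bdd b -> nul u -> nul (fun n => u n ** b n).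
move=> [M M0 bM]; apply: (@nul_dom _ _ M) => n; bnd nmM.
by rewrite mulrC; apply: ler_wpM2r => //; exact: nm_ge0.
Qed.

Lemma nul0 : nul (fun=> 0). exact: cvs_cst. Qed.
Lemma nul_ext u v : (forall n, u n = v n) -> nul u -> nul v.
exact: cvs_ext. Qed.

Lemma nul_sum (I : finType) (u : I -> nat -> A) : (forall i, nul (u i)) -> nul (fun n => \sum_i u i n).
move=> h; elim: (index_enum I) => [|i r IH]. by apply: nul_ext nul0 => n; rewrite big_nil.
by apply: nul_ext (nulD (h i) IH) => n; rewrite big_cons.
Qed.

Lemma nul_ev u e : nul u -> 0 < e -> \ev n, nm (u n) <= e.
move=> h e0; have [N hN] := h e e0; exists N => n /hN; rewrite subr0; exact: ltW.
Qed.

Lemma bdd_cst d : bdd (fun=> d). by exists (nm d) => //; exact: nm_ge0. Qed.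
Lemma bddD u v : bdd u -> bdd v -> bdd (fun n => u n + v n).
move=> [M M0 h] [N N0 k]; exists (M + N); first exact: addr_ge0.
by move=> n; bnd nmD; exact: lerD.
Qed.
Lemma bddM u v : bdd u -> bdd v -> bdd (fun n => u n ** v n).
move=> [M M0 h] [N N0 k]; exists (M * N); first exact: mulr_ge0.
by move=> n; bnd nmM; apply: ler_pM; rewrite ?nm_ge0.
Qed.

End NullSequences.

Section FunctionAlgebra.
Context {R} {G}.

Lemma substarD (V : starAlgType R) (S : starSubalg V) (f h : S) : val (f + h) = val f + val h.
by []. Qed.
Lemma substarZ (V : starAlgType R) (S : starSubalg V) (c : R[i]) (f : S) : val (c *: f) = c *: val f.
by []. Qed.
Lemma substarM (V : starAlgType R) (S : starSubalg V) (f h : S) : val (f ** h) = val f ** val h.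
by []. Qed.
Lemma fctM (V : starAlgType R) (T : Type) (F H : T -> V) s : (F ** H) s = F s ** H s.
by []. Qed.

Implicit Types f h : @scalar_cont R G.
Lemma scD f h s : val (f + h) s = (val f s : R[i]) + val h s.
by rewrite substarD. Qed.
Lemma scM f h s : val (f ** h) s = (val f s : R[i]) * val h s.
by rewrite substarM fctM. Qed.
Lemma scS f s : val (star f) s = conjc (val f s : R[i]).
by []. Qed.
Lemma scZ (c : R[i]) f s : val (c *: f) s = c * (val f s : R[i]).
by rewrite substarZ. Qed.
Lemma sc_sum (I : finType) (f : I -> @scalar_cont R G) s : val (\sum_i f i) s = \sum_i (val (f i) s : R[i]).
by elim: (index_enum I) => [|i r IH]; rewrite ?big_nil// !big_cons scD IH.
Qed.

End FunctionAlgebra.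

(** * Sequences lifting the Rokhlin homomorphism *)

Section Lifts.
Context {R} {G} {A : cstar R} {alpha : cstarAction G A}.
Hypotheses (cG : compact [set: G]) (hG : hausdorff_space G).
Variable mu : probability (borel_group G) R.
Hypothesis mu_inv : left_invariant mu.
Variables (D : invSubalg alpha) (phi : @scalar_cont R G -> central_quot D).
Hypotheses (sepD : separable_set (ssa_set D)) (phi_hom : star_hom phi) (phi_cont : forall f, central_cont (phi f))
 (phi_unit : forall y, central_cont y -> phi (scalar_cont1 G) ** y = y /\ y ** phi (scalar_cont1 G) = y)
 (phi_act : forall g f, phi (left_translation g f) = central_act g (phi f)).
Implicit Types (a b : linf A) (f : @scalar_cont R G) (d : A).

Let etaL : linear (@seq_eta R A) := let: And3 h _ _ := seq_eta_hom A in h.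
Let etaM : {morph @seq_eta R A : x y / x ** y} := let: And3 _ h _ := seq_eta_hom A in h.
Let etaS : {morph @seq_eta R A : x / star x} := let: And3 _ _ h := seq_eta_hom A in h.

(** The bounded sequence [a] represents [phi f]. Being a relation, it makes compatibility with the
    operations independent of any choice of lifts. *)
Definition lifts a f : Prop := exists xh : commutant D, val xh = seq_eta a /\ phi f = central_kappa xh.

(** Continuity of the orbit of the sequence at the unit of the group, uniformly in the index; this
    is what membership in the continuous part of the sequence algebra provides. *)
Definition equi (u : nat -> A) : Prop := forall e, 0 < e ->
 nbhs (1%g : G) [set t | forall n, nm (alpha t (u n) - u n) <= e].

Lemma bdd_linf a : bdd (val a).
have [M hM] := val_substar a; exists (Re M). have := le_trans (normr_ge0 _) (hM 0%N); by rewrite lecE => /andP[].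
by move=> n; have := hM n; rewrite normE lecE => /andP[].
Qed.

Lemma lifts_ex f : exists2 a, lifts a f & equi (val a).
have [x [a ac ea] kx] := phi_cont f.
exists a; first by exists x.
move=> e e0.
pose v0 : {uniform nat -> A} := val (linf_act alpha 1%g a).
have : nbhs v0 [set v : nat -> A | forall n, nm (v n - v0 n) < e].
 apply/uniform_nbhs; exists [set xy : A * A | nm (xy.2 - xy.1) < e]; split.
 rewrite -entourage_ballE; exists e%:C; first exact: gt0C. by move=> [x1 x2]; rewrite -ball_normE /= normE ltcR nmBC.
 by move=> v hv n; exact: hv.
move=> hv.
have h2 : nbhs (1%g : G) [set t | forall n, nm (val (linf_act alpha t a) n - v0 n) < e]. exact: (ac 1%g _ hv).
apply: filterS h2 => t ht n.
by have := ht n; rewrite /v0 /= act1 => /ltW.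
Qed.

Lemma lifts_lin (c : R[i]) a b f h : lifts a f -> lifts b h -> lifts (c *: a + b) (c *: f + h).
move=> [x [xa fx]] [y [yb hy]]; have [pL _ _] := phi_hom.
have [kL _ _] := quot_pi_hom (annihilator D).
exists (c *: x + y); split; first by rewrite etaL -xa -yb.
by rewrite pL fx hy /central_kappa kL.
Qed.

Lemma lifts_mul a b f h : lifts a f -> lifts b h -> lifts (a ** b) (f ** h).
move=> [x [xa fx]] [y [yb hy]]; have [_ pM _] := phi_hom.
have [_ kM _] := quot_pi_hom (annihilator D).
exists (x ** y); split; first by rewrite etaM -xa -yb.
by rewrite pM fx hy /central_kappa kM.
Qed.

Lemma lifts_star a f : lifts a f -> lifts (star a) (star f).
move=> [x [xa fx]]; have [_ _ pS] := phi_hom.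
have [_ _ kS] := quot_pi_hom (annihilator D).
exists (star x); split; first by rewrite etaS -xa.
by rewrite pS fx /central_kappa kS.
Qed.

Lemma lifts_act g a f : lifts a f -> lifts (linf_act alpha g a) (left_translation g f).
move=> [x [xa fx]]; exists (commutant_act g x); split. by rewrite -seq_actE -xa.
by rewrite phi_act fx central_actE.
Qed.
Lemma eta_nul a b : seq_eta a = seq_eta b -> nul (fun n => val a n - val b n).
by move/quot_piP => h; apply/cvsP. Qed.

Lemma lifts_eq a b f d : lifts a f -> lifts b f -> ssa_set D d -> nul (fun n => (val a n - val b n) ** d).
move=> [x [xa fx]] [y [yb fy]] Dd.
have : central_kappa x = central_kappa y by rewrite -fx.
move/quot_piP => /(_ d Dd)[h _].
have h' : seq_eta ((a - b) ** mksub (S := linf A) (cst_linf d)) = seq_eta 0.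
 rewrite etaM (linB etaL) -xa -yb (lin0 etaL); exact: h.
by apply: nul_ext (eta_nul h') => n /=; rewrite subr0.
Qed.

Lemma lifts_comm a f d : lifts a f -> ssa_set D d -> nul (fun n => val a n ** d - d ** val a n).
move=> [x [xa fx]] Dd; have := val_substar x d Dd; rewrite xa.
by rewrite /seq_const -!etaM => /eta_nul.
Qed.

(** [phi 1] is a unit for the continuous part only, so it is tested on a sequence [k] of invariant
    elements that is an approximate unit for a dense sequence of [D]. Invariance puts [k] in the
    continuous part; since [k n ** d] tends to [d], the relation for [k] passes to [d]. *)
Lemma lifts_unit a d : lifts a (scalar_cont1 G) -> ssa_set D d -> nul (fun n => val a n ** d - d).
move=> [x [xa fx]] Dd.
have [Y [/countable_injP[i iinj] YD DY]] := sepD.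
pose pt m : A := if pselect (exists2 y, Y y & i y = m) is left h then s2val (cid2 h) else 0.
have ptY y : Y y -> pt (i y) = y. rewrite /pt => Yy; case: pselect => [h|]; last by case; exists y.
 by case: (cid2 h) => z Yz iz /=; apply: iinj => //; exact: mem_set.
have i0 n : 0 < n.+1%:R^-1 :> R by rewrite invr_gt0.
have [k hk] := choice (fun n => inv_approx_unit cG hG alpha mu_inv [seq pt j | j <- iota 0 n.+1] (i0 n)).
have kd z : ssa_set D z -> nul (fun n => z - k n ** z). move=> Dz e e0; have e4 : 0 < e / 4 by rewrite divr_gt0.
 have [y Yy hy] : exists2 y, Y y & nm (z - y) < e / 4. have := DY z Dz (ball z (e / 4)%:C) (nbhsx_ballx _ _ (gt0C e4)).
 by case=> y [Yy]; rewrite -ball_normE /= normE ltcR => h; exists y.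
 have [N hN] := inv_nat_lt e4; exists (maxn N (i y)) => n hn; rewrite subr0. have [_ k1 _ /(_ y) hky] := hk n.
 have yn : y \in [seq pt j | j <- iota 0 n.+1]. apply/mapP; exists (i y); last by rewrite ptY.
 by rewrite mem_iota add0n ltnS (leq_trans (leq_maxr _ _) hn).
 have h1 := le_lt_trans (hky yn) (hN n (leq_trans (leq_maxl _ _) hn)).
 have -> : z - k n ** z = (z - y) + (y - k n ** y) - k n ** (z - y) by nc. bnd nmB; bnd (lerD (nmD _ _) (lexx _)).
 have h2 : nm (k n ** (z - y)) <= nm (z - y) by rewrite -[leRHS]mul1r; exact: nmMl.
 by move: h1 h2 hy e0; move: (nm _) (nm _) (nm _) => p q r; lra.
have kl : linf_set k. by exists 1 => n; rewrite normE -[1]/(1%:C) lecR; have [] := hk n.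
pose u : linf A := mksub (S := linf A) kl.
have bk : bdd k by exists 1 => // n; have [] := hk n.
have uc : commutant_set D (seq_eta u).
 move=> z Dz; apply/eqP; rewrite -subr_eq0 /seq_const -!etaM -(linB etaL); apply/eqP.
 rewrite -(lin0 etaL); apply/quot_piP; rewrite subr0; apply/cvsP. have h1 := kd z Dz; have h2 := kd _ (ssaS Dz).
 have h3 : nul (fun n => z - z ** k n).
 apply: (@nul_dom _ _ _ _ 1) h2 => n; rewrite mul1r -[leRHS]nmS starB starM starK.
 by have [pk _ _ _] := hk n; rewrite (pos_sa pk). have h4 : nul (fun n => k n ** z - z ** k n).
 by apply: nul_ext (nulD h3 (nulN h1)) => n; nc. exact: h4.
pose uh : commutant D := mksub (S := commutant D) uc.
have cu : central_cont (central_kappa uh). exists uh => //; exists u => //.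
 have lc : (fun g => val (linf_act alpha g u) : {uniform nat -> A}) = (fun=> val u).
 by apply/funext => g; apply/funext => n /=; have [_ _ -> _] := hk n.
 change (continuous (fun g => val (linf_act alpha g u) : {uniform nat -> A})); rewrite lc. by move=> g; exact: cvg_cst.
have [ph1 _] := phi_unit cu; have [_ kM _] := quot_pi_hom (annihilator D).
move: ph1; rewrite fx /central_kappa -kM => /quot_piP /(_ d Dd)[h _].
have h' : seq_eta ((a ** u - u) ** mksub (S := linf A) (cst_linf d)) = seq_eta 0.
 by rewrite etaM (linB etaL) etaM (lin0 etaL) -xa; exact: h.
have n1 : nul (fun n => (val a n ** k n - k n) ** d - 0) := eta_nul h'.
have n2 := kd d Dd.
have n3 := nulD (nulD n1 (nulMl (bdd_linf a) n2)) (nulN n2).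
by apply: nul_ext n3 => n /=; nc.
Qed.

Lemma lifts0 : lifts 0 0.
have [pL _ _] := phi_hom; have [kL _ _] := quot_pi_hom (annihilator D).
exists 0; split; first by rewrite (lin0 etaL).
by rewrite (lin0 pL) /central_kappa (lin0 kL).
Qed.
Lemma lifts_add a b f h : lifts a f -> lifts b h -> lifts (a + b) (f + h).
by move=> ha hb; have := lifts_lin 1 ha hb; rewrite !scale1r. Qed.
Lemma lifts_scale (c : R[i]) a f : lifts a f -> lifts (c *: a) (c *: f).
by move=> ha; have := lifts_lin c ha lifts0; rewrite !addr0. Qed.

Lemma lifts_scalar (c : R[i]) a d : lifts a (c *: scalar_cont1 G) -> ssa_set D d ->
 nul (fun n => val a n ** d - c *: d).
move=> ha Dd; have [x hx _] := lifts_ex (scalar_cont1 G).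
have h1 := lifts_eq ha (lifts_scale c hx) Dd.
have h2 := lifts_unit hx Dd.
have h3 : nul (fun n => c *: (val x n ** d - d)). by apply: (@nul_dom _ _ _ _ (Re `|c|)) h2 => n; rewrite nmCZ.
apply: nul_ext (nulD h1 h3) => n /=; rewrite amulBl amulZl scalerBr addrA subrK.
by [].
Qed.

Lemma lifts_sum (I : finType) (a : I -> linf A) (f : I -> @scalar_cont R G) :
 (forall i, lifts (a i) (f i)) -> lifts (\sum_i a i) (\sum_i f i).
move=> h; have [pL _ _] := phi_hom; have [kL _ _] := quot_pi_hom (annihilator D).
elim: (index_enum I) => [|i r IH]. rewrite !big_nil; exists 0; split; first by rewrite (lin0 etaL).
 by rewrite (lin0 pL) /central_kappa (lin0 kL).
by rewrite !big_cons -[a i]scale1r -[f i]scale1r; apply: lifts_lin.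
Qed.

Lemma equi_add u v : equi u -> equi v -> equi (fun n => u n + v n).
move=> hu hv e e0; have e2 := divr_gt0 e0 (@ltr0n R 2).
apply: filterS2 (hu _ e2) (hv _ e2) => t h1 h2 n.
rewrite actD opprD addrACA; bnd nmD.
by rewrite [e]splitr; exact: lerD.
Qed.

Lemma equi_star u : equi u -> equi (fun n => star (u n)).
move=> hu e e0; apply: filterS (hu e e0) => t h n.
by rewrite act_star -starB nmS.
Qed.

Lemma equi_scale (c : R) u : equi u -> equi (fun n => c%:C *: u n).
move=> hu e e0; have c1 : 0 < `|c| + 1 by rewrite ltr_wpDl.
apply: filterS (hu _ (divr_gt0 e0 c1)) => t h n.
rewrite actZ -scalerBr nmZ; bnd (ler_wpM2l (normr_ge0 _) (h n)).
by rewrite mulrCA ler_piMr ?(ltW e0)// ler_pdivrMr// mul1r lerDl.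
Qed.

Lemma equi_mul u v : bdd u -> bdd v -> equi u -> equi v -> equi (fun n => u n ** v n).
move=> [M M0 bu] [N N0 bv] hu hv e e0.
have K0 : 0 < M + N + 1 by rewrite ltr_wpDl// addr_ge0.
have d0 := divr_gt0 e0 K0.
apply: filterS2 (hu _ d0) (hv _ d0) => t h1 h2 n.
have -> : alpha t (u n ** v n) - u n ** v n = (alpha t (u n) - u n) ** alpha t (v n) + u n ** (alpha t (v n) - v n).
 by rewrite act_amul; nc.
bnd nmD; bnd (lerD (nmM _ _) (nmM _ _)); rewrite nm_act.
via (e / (M + N + 1) * N + M * (e / (M + N + 1))). by apply: lerD; apply: ler_pM; rewrite ?nm_ge0.
rewrite mulrC -mulrDl -[leRHS]mulr1 mulrCA; apply: ler_wpM2l; first exact: ltW.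
by rewrite ler_pdivrMr// mul1r [N + M]addrC lerDl.
Qed.
Lemma equi_cst d : equi (fun=> d).
by move=> e e0; apply: filterS (act_cont_near alpha d e0) => t h n; exact: ltW. Qed.

Definition real_fun (h : G -> R) (hc : continuous h) : @scalar_cont R G :=
 mksub (S := @scalar_cont R G) (cont_complex hc : cont_set _).

Lemma lifts_real (h : G -> R) (hc : continuous h) : exists a,
 [/\ lifts a (real_fun hc), equi (val a) & forall n, star (val a n) = val a n].
have [a ha ea] := lifts_ex (real_fun hc).
exists ((2^-1)%:C *: (star a + a)); split.
- have := lifts_scale (2^-1)%:C (lifts_add (lifts_star ha) ha).
 have -> // : (2^-1)%:C *: (star (real_fun hc) + real_fun hc) = real_fun hc.
 apply: val_inj; apply/funext => s; rewrite scZ scD scS. by apply: complex_eq => /=; field.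
- have h1 := equi_scale 2^-1 (equi_add (equi_star ea) ea). exact: h1.
- by move=> n /=; rewrite starZr starD starK addrC.
Qed.

(* [M^2 - |f|^2] is a square of a real function, so that [d^* a_n^* a_n d] is
 asymptotically at most [M^2 d^* d]. *)
Lemma lifts_nm a f d (M e : R) : 0 <= M -> lifts a f -> ssa_set D d ->
 (forall s, nm (val f s : R[i]^o) <= M) -> 0 < e -> \ev n, nm (val a n ** d) <= M * nm d + e.
move=> M0 ha Dd fM e0.
pose k s : R := Num.sqrt (M ^+ 2 - nm (val f s : R[i]^o) ^+ 2).
have nc' : continuous (fun s => nm (val f s : R[i]^o)). apply/real_cont_near => s r r0.
 have /cont_near/(_ s r r0) := (val_substar f : continuous (val f)). apply: filterS => t; apply: le_lt_trans.
 rewrite ler_norml; apply/andP; split.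
 by have := nm_ler (val f s : R[i]^o) (val f t); rewrite [nm (val f s - _)]nmBC; lra.
 by have := nm_ler (val f t : R[i]^o) (val f s); lra.
have kc : continuous k.
 move=> s; apply: (@continuous_comp _ _ _ (fun s => M ^+ 2 - nm (val f s : R[i]^o) ^+ 2) Num.sqrt).
 apply: cvgB; first exact: cvg_cst. rewrite expr2; under eq_fun do rewrite expr2. by apply: cvgM; exact: nc'.
 exact: sqrt_continuous.
have [b [hb _ sb]] := lifts_real kc.
have u1 : lifts (star a ** a + star b ** b) ((M ^+ 2)%:C *: scalar_cont1 G).
 have := lifts_add (lifts_mul (lifts_star ha) ha) (lifts_mul (lifts_star hb) hb).
 set w := (X in lifts _ X); have -> // : w = (M ^+ 2)%:C *: scalar_cont1 G. apply: val_inj; apply/funext => s.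
 rewrite scD !scM !scS. have kk : k s ^+ 2 = M ^+ 2 - nm (val f s : R[i]^o) ^+ 2.
 by rewrite sqr_sqrtr// subr_ge0 ler_sqr ?nnegrE ?nm_ge0.
 have nf : nm (val f s : R[i]^o) ^+ 2 = Re (val f s) ^+ 2 + Im (val f s) ^+ 2.
 by rewrite nmc_def (sqr_sqrtr (addr_ge0 (sqr_ge0 _) (sqr_ge0 _))).
 rewrite scZ mulr1 -[val (real_fun kc) s]/((k s)%:C). move: kk; rewrite nf; case: (val f s) => p q /= kk.
 by apply: complex_eq => /=; move: kk; rewrite !expr2; lra.
have h1 := nulMl (bdd_cst (star d)) (lifts_scalar u1 Dd).
have [N hN] := nul_ev h1 (exprn_gt0 2 e0).
exists N => n /hN /= h2.
have Md : 0 <= M * nm d by rewrite mulr_ge0 ?nm_ge0.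
suff : nm (val a n ** d) ^+ 2 <= (M * nm d + e) ^+ 2. by rewrite ler_sqr ?nnegrE ?nm_ge0 ?addr_ge0// ltW.
rewrite -nmSS starM.
set v := star (val a n) ** val a n + star (val b n) ** val b n in h2.
have h3 : nm (star d ** star (val a n) ** (val a n ** d)) <= nm (star d ** (v ** d)).
 apply: pos_mono; first by rewrite -starM; exact: pos_star.
 have -> : star d ** (v ** d) - star d ** star (val a n) ** (val a n ** d) =
 star (val b n ** d) ** (val b n ** d) by rewrite starM /v; nc. exact: pos_star.
bnd h3.
have -> : star d ** (v ** d) = star d ** (v ** d - (M ^+ 2)%:C *: d) + (M ^+ 2)%:C *: (star d ** d). by nc.
bnd nmD; rewrite nmZ0 ?sqr_ge0// nmSS.
bnd (lerD h2 (lexx _)).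
rewrite sqrrD exprMn addrC -addrA lerD2l lerDr mulrn_wge0// mulr_ge0//.
exact: ltW.
Qed.

Lemma linf_sum (I : finType) (a : I -> linf A) n : val (\sum_i a i) n = \sum_i val (a i) n.
elim: (index_enum I) => [|i r IH]; first by rewrite !big_nil.
by rewrite !big_cons -IH.
Qed.

(** The extension of [phi] to the tensor product of [C(G)] and [D] is contractive. Replace [f l] by
    the sum of [f l (g k) h_k^2]; what remains is [y_k m_k y_k] summed over [k], where [m_k] is the
    value at [g k], of norm at most [M], and the weights [y_k^2] add up to a unit on [D]. *)
Lemma lifts_sup (L : finType) (a : L -> linf A) (f : L -> @scalar_cont R G) (d : L -> A) (M e : R) :
 (forall l, lifts (a l) (f l)) -> (forall l, ssa_set D (d l)) ->
 (forall s, nm (\sum_l (val (f l) s : R[i]) *: d l) <= M) -> 0 < e -> \ev n, nm (\sum_l val (a l) n ** d l) <= M + e.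
move=> ha Dd hM e0; have M0 : 0 <= M by exact: le_trans (nm_ge0 _) (hM 1%g).
have e4 : 0 < e / 4 by rewrite divr_gt0.
pose K := \sum_l (nm (d l) + 1) + 1.
have K0 : 0 < K by rewrite ltr_wpDl// sumr_ge0// => l _; rewrite addr_ge0 ?nm_ge0.
pose dl := e / 4 / K; have dl0 : 0 < dl by rewrite divr_gt0.
have Wn : nbhs (1%g : G) [set t | forall l s, nm (val (f l) (s * t)%g - val (f l) s : R[i]^o) < dl].
 have h l : nbhs (1%g : G) [set t | forall s, nm (val (f l) (s * t)%g - val (f l) s : R[i]^o) < dl].
 exact: (unif_cont cG (val_substar (f l) : continuous (val (f l))) dl0).
 suff : nbhs (1%g : G) [set t | forall l, l \in enum L ->
 forall s, nm (val (f l) (s * t)%g - val (f l) s : R[i]^o) < dl].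
 by apply: filterS => t ht l; apply: ht; rewrite mem_enum.
 elim: (enum L) => [|l r IH]; first by apply: filterS filterT => t _ l. apply: filterS2 (h l) IH => t h1 h2 l'.
 by rewrite inE => /orP[/eqP ->|/h2].
have [m [g [h [hc h0 h1 hW]]]] := @partition_unity R G cG hG _ Wn.
have [y hy] := choice (fun k => lifts_real (hc k)).
have ly k : lifts (y k) (real_fun (hc k)) by case: (hy k).
have sy k n : star (val (y k) n) = val (y k) n by case: (hy k).
pose yy k : linf A := y k ** y k.
pose hh k := real_fun (hc k) ** real_fun (hc k).
have lyy k : lifts (yy k) (hh k) by apply: lifts_mul.
have hhE k s : val (hh k) s = (h k s ^+ 2)%:C. by rewrite scM -[val (real_fun _) s]/((h k s)%:C) -rmorphM.
pose c l k : R[i] := val (f l) (g k).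
(* [ar l] lifts the remainder [r l], which is uniformly small by the choice of partition, so
   [lifts_nm] controls its contribution. *)
pose ar l : linf A := (-1) *: (\sum_k c l k *: yy k) + a l.
pose r l := (-1) *: (\sum_k c l k *: hh k) + f l.
have lr l : lifts (ar l) (r l). by apply: lifts_lin => //; apply: lifts_sum => k; apply: lifts_scale.
have nr l s : nm (val (r l) s : R[i]^o) <= dl. rewrite scD scZ sc_sum.
 have -> : -1 * \sum_k val (c l k *: hh k) s + val (f l) s = \sum_k (h k s ^+ 2)%:C *: (val (f l) s - c l k : R[i]^o).
 under [RHS]eq_bigr do rewrite scalerBr.
 rewrite sumrB addrC -scaler_suml -rmorph_sum h1 scale1r mulN1r; congr (_ - _). by each k; rewrite scZ hhE mulrC.
 bnd_sum. have -> : dl = \sum_k h k s ^+ 2 * dl by rewrite -mulr_suml h1 mul1r. each k; rewrite nmZ0 ?sqr_ge0//.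
 have [->|hn] := eqVneq (h k s) 0; first by rewrite expr0n !mul0r. apply: ler_wpM2l; first exact: sqr_ge0.
 by have := hW k s hn l (g k); rewrite mulgA mulgV mul1g => /ltW.
have ev1 l : \ev n, nm (val (ar l) n ** d l) <= dl * nm (d l) + dl. by apply: (lifts_nm (ltW dl0) (lr l)).
have [N1 hN1] := choice ev1.
pose mk k := \sum_l c l k *: d l.
have Dm k : ssa_set D (mk k). rewrite /mk; elim: (index_enum L) => [|l r' IH]; first by rewrite big_nil; exact: ssa0.
 by rewrite big_cons; apply: ssaD => //; exact: ssaZ.
have nmk k : nm (mk k) <= M by exact: hM.
have [B hB] := choice (fun k => let: ex_intro2 M h1 h2 := bdd_linf (y k) in ex_intro _ M (conj h1 h2)).
pose B2 := \sum_k B k ^+ 2 + 1.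
have B0 : 0 < B2 by rewrite ltr_wpDl// sumr_ge0// => k _; exact: sqr_ge0.
have t0 : 0 < e / 4 / B2 / 2 by rewrite !divr_gt0.
(* The sum of the [y_k^2] is close to one only on elements of [D]. Compressing every [m_k] by one
   approximate unit [q] of [D] produces weights [y_k q] whose squares add up to nearly [q^2], and
   [nm_weighted] applies. *)
have [cc [pc nc1 hcc]] := @approx_unit R (csubstar D) [seq mksub (S := D) (Dm k) | k <- enum 'I_m] _ t0.
pose q := val cc; have sq : star q = q by have := pos_sa pc => /(congr1 val).
have q1 : nm q <= 1 by exact: nc1.
have Dq : ssa_set D q by exact: val_substar.
have hq k : nm (mk k - q ** mk k ** q) <= e / 4 / B2.
 have [h2 h3] : nm (mk k - q ** mk k) <= e / 4 / B2 / 2 /\ nm (mk k - mk k ** q) <= e / 4 / B2 / 2.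
 have := hcc (mksub (S := D) (Dm k)); apply. by apply/mapP; exists k; rewrite ?mem_enum.
 have -> : mk k - q ** mk k ** q = (mk k - q ** mk k) + q ** (mk k - mk k ** q) by nc.
 bnd nmD; rewrite [leRHS]splitr; apply: lerD => //. by bnd (nmMl _ q1); rewrite mul1r.
have yyE k n : val (yy k) n = val (y k) n ** val (y k) n by [].
have nu1 : nul (fun n => \sum_k val (y k) n ** (val (y k) n ** mk k - mk k ** val (y k) n)).
 by apply: nul_sum => k; apply: nulMl; [exact: bdd_linf|exact: lifts_comm].
have nu2 : nul (fun n => \sum_k val (y k) n ** (q ** q) ** val (y k) n - q ** q).
 have lu : lifts (\sum_k yy k) (scalar_cont1 G).
 have := lifts_sum lyy; set w := (X in lifts _ X); have -> // : w = scalar_cont1 G.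
 apply: val_inj; apply/funext => s; rewrite sc_sum. by under eq_bigr do rewrite hhE; rewrite -rmorph_sum h1.
 have n1 : nul (fun n => \sum_k val (y k) n ** (val (y k) n ** (q ** q) - (q ** q) ** val (y k) n)).
 by apply: nul_sum => k; apply: nulMl; [exact: bdd_linf|apply: lifts_comm => //; exact: ssaM].
 have n2 := lifts_unit lu (ssaM Dq Dq). apply: nul_ext (nulD n2 (nulN n1)) => n.
 rewrite linf_sum amulsl addrAC; congr (_ - _); rewrite -sumrN -big_split /=. by each k; rewrite fctM; nc.
have eM : 0 < e / 4 / (M + 1) by rewrite !divr_gt0// ltr_wpDl.
have [N2 hN2] := nul_ev nu1 e4; have [N3 hN3] := nul_ev nu2 eM.
exists (maxn (\max_l N1 l) (maxn N2 N3)) => n; rewrite !geq_max => /andP[nN1 /andP[nN2 nN3]].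
have -> : \sum_l val (a l) n ** d l = \sum_l val (ar l) n ** d l +
 \sum_k val (y k) n ** (val (y k) n ** mk k - mk k ** val (y k) n) +
 \sum_k val (y k) n ** (mk k - q ** mk k ** q) ** val (y k) n +
 \sum_k (val (y k) n ** q) ** mk k ** star (val (y k) n ** q). rewrite -!addrA -!big_split /=.
 have -> : \sum_k (val (y k) n ** (val (y k) n ** mk k - mk k ** val (y k) n) +
 (val (y k) n ** (mk k - q ** mk k ** q) ** val (y k) n + (val (y k) n ** q) ** mk k ** star (val (y k) n ** q))) =
 \sum_k val (yy k) n ** mk k. by each k; rewrite yyE starM sq sy; nc.
 under [X in _ + X]eq_bigr do rewrite amulsr; rewrite exchange_big /= -big_split /=. each l.
 have arE : val (ar l) n = (-1) *: \sum_k c l k *: val (yy k) n + val (a l) n.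
 change (val (ar l) n) with (-1 *: val (\sum_k c l k *: yy k) n + val (a l) n). by rewrite linf_sum.
 change (val (a l) n ** d l = val (ar l) n ** d l + \sum_k val (yy k) n ** (c l k *: d l)).
 rewrite arE scaleN1r amulDl amulNl amulsl addrAC. under [X in - X + _]eq_bigr do rewrite amulZl.
 by under [X in _ + X + _]eq_bigr do rewrite amulZr; rewrite addNr add0r.
have b1 : nm (\sum_l val (ar l) n ** d l) <= e / 4. bnd_sum. have -> : e / 4 = dl * K by rewrite /dl divfK// gt_eqF.
 via (\sum_l dl * (nm (d l) + 1)). each l; rewrite mulrDr mulr1; apply: hN1. exact: leq_trans (leq_bigmax l) nN1.
 by rewrite -mulr_sumr; apply: ler_wpM2l; [exact: ltW|rewrite lerDl].
have b2 := hN2 n nN2.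
have b3 : nm (\sum_k val (y k) n ** (mk k - q ** mk k ** q) ** val (y k) n) <= e / 4. bnd_sum.
 via (\sum_k B k ^+ 2 * (e / 4 / B2)). each k; have [Bk0 Bk] := hB k. bnd nmM; bnd (ler_wpM2r (nm_ge0 _) (nmM _ _)).
 rewrite mulrAC -expr2; apply: ler_pM; rewrite ?nm_ge0 ?sqr_ge0//. by apply: lerXn2r; rewrite ?nnegrE ?nm_ge0.
 have e0' : 0 <= e / 4 / B2 by rewrite !divr_ge0 ?ltW. rewrite -mulr_suml; via (B2 * (e / 4 / B2)).
 by apply: ler_wpM2r => //; rewrite lerDl. by rewrite mulrC divfK ?gt_eqF.
have b4 : nm (\sum_k (val (y k) n ** q) ** mk k ** star (val (y k) n ** q)) <= M + e / 4. bnd (nm_weighted _ M0 nmk).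
 have -> : \sum_k val (y k) n ** q ** star (val (y k) n ** q) =
 (\sum_k val (y k) n ** (q ** q) ** val (y k) n - q ** q) + q ** q.
 by rewrite subrK; each k; rewrite starM sq sy; nc. have h3 := hN3 n nN3; have h4 : nm (q ** q) <= 1.
 by bnd (nmMl _ q1); rewrite mul1r. via (M * (e / 4 / (M + 1) + 1)).
 by apply: ler_wpM2l => //; apply: le_trans (nmD _ _) (lerD h3 h4).
 rewrite mulrDr mulr1 addrC lerD2l [leLHS]mulrCA ler_piMr ?(ltW e4)//. by rewrite ler_pdivrMr ?ltr_wpDl// mul1r lerDl.
bnd nmD; bnd (lerD (nmD _ _) b4).
bnd (lerD (lerD (nmD _ _) b3) (lexx _)).
by move: b1 b2; move: (nm _) (nm _) => u v; lra.
Qed.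

End Lifts.

(** * Separable invariant subalgebras *)

Lemma dense_seq (T : ptopologicalType) : @second_countable T ->
 exists x : nat -> T, forall U, open U -> U !=set0 -> exists n, U (x n).
move=> [B /countable_injP[i iinj] [Bo Bb]].
pose x n : T := xget point [set g | exists2 U, B U & i U = n /\ U g].
exists x => U Uo [y Uy].
have [V [BV Vy] VU] := Bb y U (open_nbhs_nbhs (conj Uo Uy)).
exists (i V); have [W BW [iW Wx]] : [set g | exists2 U, B U & i U = i V /\ U g] (x (i V)).
 by apply: xgetPex; exists y, V.
have WV : W = V by apply: iinj; rewrite ?mem_set.
by apply: VU; move: Wx; rewrite WV.
Qed.

(* Words in the given generators and operations form a countable type. *)
Lemma countable_closure (T : Type) (z0 : nat -> T) (K : countType) (op : K -> T -> T -> T) :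
 exists Z : set T, [/\ countable Z, forall n, Z (z0 n) & forall k x y, Z x -> Z y -> Z (op k x y)].
pose ev := fix ev (t : GenTree.tree nat) : T := match t with | GenTree.Leaf n => z0 n
 | GenTree.Node n [:: u; v] => if unpickle n is Some k then op k (ev u) (ev v) else z0 0%N | _ => z0 0%N end.
exists (range ev); split.
- exact: card_le_trans (card_image_le _ _) (countableP _).
- by move=> n; exists (GenTree.Leaf n).
move=> k x y [u _ <-] [v _ <-]; exists (GenTree.Node (pickle k) [:: u; v]) => //=.
by rewrite pickleK.
Qed.

Lemma rat_near R (c : R) e : 0 < e -> exists q : rat, `|c - ratr q| < e.
move=> e0; have /rat_in_itvoo[q] : c - e < c + e by lra.
rewrite in_itv /= => /andP[h1 h2]; exists q.
by rewrite ltr_norml; lra.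
Qed.

Lemma gauss_near R (c : R[i]) e : 0 < e -> exists q : rat * rat, nm (c - (ratr q.1 +i* ratr q.2) : R[i]^o) < e.
move=> e0; have e2 : 0 < e / 2 by rewrite divr_gt0.
have [q h] := rat_near (Re c) e2; have [r k] := rat_near (Im c) e2.
exists (q, r); bnd nmc_le; case: c h k => a b /= h k.
by rewrite [e]splitr; apply: ltrD.
Qed.

Section SeparableSubalgebra.
Context {R} {G} {A : cstar R} (alpha : cstarAction G A).

(** The countable set is stable under Gaussian rational multiples and under a dense sequence of the
    group. Its closure is stable under all scalars and the whole group by Lipschitz estimates and
    continuity of the action. *)
Lemma separable_sub (z0 : nat -> A) : @second_countable G ->
 exists D : invSubalg alpha, separable_set (ssa_set D) /\ forall n, ssa_set D (z0 n).
move=> sc; have [x hx] := @dense_seq (pointed_group G) sc.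
pose K : countType := (nat + rat * rat + bool + unit)%type.
pose op (k : K) (a b : A) : A := match k with | inl (inl (inl n)) => alpha (x n) a
 | inl (inl (inr q)) => (ratr q.1 +i* ratr q.2) *: a | inl (inr true) => a + b | inl (inr false) => a ** b
 | inr _ => star a end.
have [Z [cZ Z0 Zop]] := countable_closure z0 op.
have ZA n a (Za : Z a) : Z (alpha (x n) a) := Zop (inl (inl (inl n))) a a Za Za.
have ZQ (q : rat * rat) a (Za : Z a) : Z ((ratr q.1 +i* ratr q.2) *: a) := Zop (inl (inl (inr q))) a a Za Za.
have ZD a b (Za : Z a) (Zb : Z b) : Z (a + b) := Zop (inl (inr true)) a b Za Zb.
have ZM a b (Za : Z a) (Zb : Z b) : Z (a ** b) := Zop (inl (inr false)) a b Za Zb.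
have ZS a (Za : Z a) : Z (star a) := Zop (inr tt) a a Za Za.
pose D : set A := [set a | forall e : R, 0 < e -> exists2 z, Z z & nm (a - z) < e].
have ZD' z : Z z -> D z by move=> Zz e e0; exists z => //; rewrite subrr nm0.
have Dlip (f : A -> A) (M : R) (g : A -> A) a : 0 <= M ->
 (forall e z, 0 < e -> Z z -> exists2 z', Z z' & nm (f z - z') < e) ->
 (forall a b, nm (f a - f b) <= M * nm (a - b)) -> D a -> D (f a).
 move=> M0 fZ fl Da e e0; have e2 : 0 < e / 2 by rewrite divr_gt0. have M1 : 0 < M + 1 by rewrite ltr_wpDl.
 have [z Zz hz] := Da _ (divr_gt0 e2 M1); have [z' Zz' hz'] := fZ _ z e2 Zz.
 exists z' => //; bnd (nm_tri _ (f z) _); rewrite [e]splitr. apply: ler_ltD => //; bnd fl.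
 via ((M + 1) * (e / 2 / (M + 1))). by apply: ler_pM; rewrite ?nm_ge0//; [rewrite lerDl|exact: ltW].
 by rewrite mulrC divfK ?gt_eqF.
have DD a b : D a -> D b -> D (a + b). move=> Da Db e e0; have e2 : 0 < e / 2 by rewrite divr_gt0.
 have [z Zz hz] := Da _ e2; have [w Zw hw] := Db _ e2. exists (z + w); first exact: ZD.
 by rewrite opprD addrACA; bnd nmD; rewrite [e]splitr; exact: ltrD.
have DZ c a : D a -> D (c *: a). move=> Da; apply: (Dlip (fun a => c *: a) (Re `|c|) id) => //.
 - by have := normr_ge0 c; rewrite lecE => /andP[].
 - move=> e z e0 Zz; have n0 : 0 < nm z + 1 by rewrite ltr_wpDl ?nm_ge0.
 have [q hq] := gauss_near c (divr_gt0 e0 n0); exists ((ratr q.1 +i* ratr q.2) *: z); first exact: ZQ.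
 rewrite -scalerBl nmCZ; bnd (_ : _ <= e / (nm z + 1) * nm z). by apply: ler_wpM2r; [exact: nm_ge0|exact: ltW].
 by rewrite mulrAC -mulrA gtr_pMr// ltr_pdivrMr// mul1r ltrDl.
 - by move=> u v; rewrite -scalerBr nmCZ.
have DS a : D a -> D (star a). apply: (Dlip star 1 id) => // [e z e0 Zz|u v]; last by rewrite -starB nmS mul1r.
 by exists (star z); [exact: ZS|rewrite subrr nm0].
have DM a b : D a -> D b -> D (a ** b).
 move=> Da Db; apply: (Dlip (fun u => u ** b) (nm b) id) => //; first exact: nm_ge0.
 move=> e z e0 Zz; apply: (Dlip (fun u => z ** u) (nm z) id) => //; first exact: nm_ge0.
 by move=> d w d0 Zw; exists (z ** w); [exact: ZM|rewrite subrr nm0]. by move=> u v; rewrite -amulBr; exact: nmM.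
 by move=> u v; rewrite -amulBl mulrC; exact: nmM.
have DA g a : D a -> D (alpha g a).
 apply: (Dlip (alpha g) 1 id) => // [e z e0 Zz|u v]; last by rewrite -actB nm_act mul1r.
 have /cont_near/(_ g e e0) := @act_continuous _ _ _ alpha z => hn.
 have : nbhs g [set t | nm (alpha t z - alpha g z) < e] := hn. rewrite nbhsE => -[U [Uo Ug] hU].
 have [n Un] := hx U Uo (ex_intro _ g Ug). by exists (alpha (x n) z); [exact: ZA|rewrite nmBC; exact: hU].
have D0 : D 0 by rewrite -(subrr (z0 0%N)) -scaleN1r; apply: DD; [|apply: DZ]; exact: ZD'.
have Dc : closed D. apply/closed_nmP => a ha e e0; have e2 : 0 < e / 2 by rewrite divr_gt0.
 have [b Db hb] := ha _ e2; have [z Zz hz] := Db _ e2; exists z => //.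
 by bnd (nm_tri _ b _); rewrite [e]splitr; exact: ltrD.
pose D1 := @StarSubalg R A D D0 DD DZ DM DS.
pose D2 := @CStarSubalg R A D1 Dc.
exists (@InvSubalg R G A alpha D2 DA); split; last by move=> n; exact: ZD'.
exists Z; split => // a Da U Ua.
have /nbhs_ballP[e /real_gt0[d d0 ->] hU] := Ua.
have [z Zz hz] := Da _ d0; exists z; split => //; apply: hU.
by rewrite -ball_normE /= normE ltcR.
Qed.

End SeparableSubalgebra.

(** * Uniform estimates over the group *)

Section Uniformity.
Context {R} {G} {A : cstar R} {alpha : cstarAction G A}.
Hypothesis cG : compact [set: G].

(** The index beyond which the bound holds depends on [s]; equicontinuity and compactness make one
    index serve all [s], at the price of [e]. *)
Lemma unif_ev (U : G -> nat -> A) (M e : R) :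
 (forall s d, 0 < d -> nbhs s [set t | forall n, nm (U t n - U s n) <= d]) ->
 (forall s, \ev n, nm (U s n) <= M) -> 0 < e -> \ev n, forall s, nm (U s n) <= M + e.
move=> Ue UM e0; have /compact_near_coveringP nc := cG.
have h := nc nat \oo (fun n s => nm (U s n) <= M + e) _ _.
have [N _ hN] : \forall n \near \oo, [set: G] `<=` (fun s => nm (U s n) <= M + e). apply: h => s _; have [N hN] := UM s.
 exists ([set t | forall n, nm (U t n - U s n) <= e], [set n | (N <= n)%N]). by split; [exact: Ue|exists N].
 move=> [t n] [/= h1 h2]; bnd (nm_ler _ (U s n)). by rewrite addrC; apply: lerD; [exact: hN|exact: h1].
by exists N => n nN s; exact: (hN n nN).
Qed.

Lemma equi_orbit (u : nat -> A) s d : equi (alpha := alpha) u -> 0 < d ->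
 nbhs s [set t | forall n, nm (alpha t (u n) - alpha s (u n)) <= d].
move=> ue d0; have c := @mulg_cont G s^-1%g s; rewrite /continuous_at mulVg in c.
have c2 : nbhs s [set t | forall n, nm (alpha (s^-1 * t)%g (u n) - u n) <= d] := c _ (ue d d0).
apply: filterS c2 => t h n; have := h n; rewrite -(nm_act alpha s) actB -actM mulgA mulgV mul1g.
by [].
Qed.

Lemma seq_ev (T : eqType) (S : seq T) (P : T -> nat -> Prop) : (forall x, x \in S -> \ev n, P x n) ->
 \ev n, forall x, x \in S -> P x n.
elim: S => [|y S IH] h; first by exists 0%N.
have [N hN] := h y (mem_head _ _).
have [|N' hN'] := IH; first by move=> x xS; apply: h; rewrite inE xS orbT.
exists (maxn N N') => n; rewrite geq_max => /andP[n1 n2] x.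
by rewrite inE => /orP[/eqP ->|]; [exact: hN|exact: hN'].
Qed.

End Uniformity.

(** * Sequences representing elements of [C(G) (x) D] *)

Section Fields.
Context {R} {G} {A : cstar R} {alpha : cstarAction G A}.
Hypotheses (cG : compact [set: G]) (hG : hausdorff_space G).
Variable mu : probability (borel_group G) R.
Hypothesis mu_inv : left_invariant mu.
Variables (D : invSubalg alpha) (phi : @scalar_cont R G -> central_quot D).
Hypotheses (sepD : separable_set (ssa_set D)) (phi_hom : star_hom phi) (phi_cont : forall f, central_cont (phi f))
 (phi_unit : forall y, central_cont y -> phi (scalar_cont1 G) ** y = y /\ y ** phi (scalar_cont1 G) = y)
 (phi_act : forall g f, phi (left_translation g f) = central_act g (phi f)).

(* The sequence [u] represents the element [F] of [C(G) (x) D]. *)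
Definition rep (u : nat -> A) (F : G -> A) : Prop := bdd u /\
 exists (L : finType) (a : L -> linf A) (f : L -> @scalar_cont R G) (d : L -> A),
 [/\ forall l, lifts phi (a l) (f l), forall l, ssa_set D (d l), nul (fun n => u n - \sum_l val (a l) n ** d l) &
 forall t, F t = \sum_l (val (f l) t : R[i]) *: d l].

(** Norm estimates for the sequence thus reduce to pointwise estimates for the function [F]; the
    lemmas below compute with such functions. *)
Lemma rep_sup u F (M e : R) : rep u F -> (forall t, nm (F t) <= M) -> 0 < e -> \ev n, nm (u n) <= M + e.
move=> [_ [L [a [f [d [h1 h2 h3 h4]]]]]] FM e0; have e2 : 0 < e / 2 by rewrite divr_gt0.
have [|N hN] := @lifts_sup _ _ _ _ cG hG mu mu_inv D phi sepD phi_hom phi_cont phi_unit L a f d M _ h1 h2 _ e2.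
 by move=> s; rewrite -h4.
have [N' hN'] := nul_ev h3 e2; exists (maxn N N') => n; rewrite geq_max => /andP[n1 n2].
bnd (nm_ler _ (\sum_l val (a l) n ** d l)).
bnd (lerD (hN' n n2) (hN n n1)).
by rewrite [e in leRHS]splitr addrCA.
Qed.

Lemma rep_nul u v F : rep u F -> bdd v -> nul (fun n => v n - u n) -> rep v F.
move=> [_ [L [a [f [d [h1 h2 h3 h4]]]]]] bv vu; split => //.
exists L, a, f, d; split => //.
by apply: nul_ext (nulD vu h3) => n; rewrite addrA subrK.
Qed.

Lemma rep_ext u F H : rep u F -> (forall t, F t = H t) -> rep u H.
move=> [bu [L [a [f [d [h1 h2 h3 h4]]]]]] FH; split => //.
by exists L, a, f, d; split => // t; rewrite -FH.
Qed.

Lemma rep_lift a f d : lifts phi a f -> ssa_set D d -> rep (fun n => val a n ** d) (fun t => (val f t : R[i]) *: d).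
move=> h Dd; split; first by apply: bddM; [exact: bdd_linf|exact: bdd_cst].
exists unit, (fun=> a), (fun=> f), (fun=> d); split => //.
 by apply: nul_ext (@nul0 R A) => n; rewrite big_const card_unit /= addr0 subrr.
by move=> t; rewrite big_const card_unit /= addr0.
Qed.

Lemma rep_lift_l a f d : lifts phi a f -> ssa_set D d -> rep (fun n => d ** val a n) (fun t => (val f t : R[i]) *: d).
move=> h Dd; apply: (rep_nul (rep_lift h Dd)). by apply: bddM; [exact: bdd_cst|exact: bdd_linf].
have h1 : nul (fun n => val a n ** d - d ** val a n) := lifts_comm h Dd.
by apply: nul_ext (nulN h1) => n; rewrite opprB.
Qed.

Lemma rep_add u v F H : rep u F -> rep v H -> rep (fun n => u n + v n) (fun t => F t + H t).
move=> [bu [L [a [f [d [h1 h2 h3 h4]]]]]] [bv [L' [a' [f' [d' [k1 k2 k3 k4]]]]]].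
split; first exact: bddD.
exists (L + L')%type, (fun l => match l with inl i => a i | inr i => a' i end),
 (fun l => match l with inl i => f i | inr i => f' i end),
 (fun l => match l with inl i => d i | inr i => d' i end); split; [by case|by case| |].
 by apply: nul_ext (nulD h3 k3) => n; rewrite big_sumType opprD addrACA.
by move=> t; rewrite big_sumType h4 k4.
Qed.

Lemma rep_opp u F : rep u F -> rep (fun n => - u n) (fun t => - F t).
move=> [[M M0 bu] [L [a [f [d [h1 h2 h3 h4]]]]]]; split; first by exists M => // n; rewrite nmN.
exists L, a, f, (fun l => - d l); split => //.
- by move=> l; rewrite -scaleN1r; exact: ssaZ.
- apply: nul_ext (nulN h3) => n; rewrite opprD; congr (_ + _); congr (- _). by rewrite -sumrN; each l; rewrite amulNr.
- by move=> t; rewrite h4 -sumrN; each l; rewrite scalerN.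
Qed.

Lemma rep_cst d : ssa_set D d -> rep (fun=> d) (fun=> d).
move=> Dd; have [a ha _] := lifts_ex phi_cont (scalar_cont1 G).
apply: rep_ext (_ : rep _ (fun t => (val (scalar_cont1 G) t : R[i]) *: d)) _; last first. by move=> t; rewrite scale1r.
apply: (rep_nul (rep_lift ha Dd)); first exact: bdd_cst.
have h : nul (fun n => val a n ** d - d) := lifts_unit cG hG mu_inv sepD phi_unit ha Dd.
by apply: nul_ext (nulN h) => n; rewrite opprB.
Qed.

Lemma rep_sum (I : finType) (u : I -> nat -> A) (F : I -> G -> A) :
 (forall i, rep (u i) (F i)) -> rep (fun n => \sum_i u i n) (fun t => \sum_i F i t).
move=> h; elim: (index_enum I) => [|i r IH].
 have h0 := rep_cst (ssa0 D); split; first by exists 0 => // n; rewrite big_nil nm0.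
 have [_ [L [a [f [d [h1 h2 h3 h4]]]]]] := h0; exists L, a, f, d; split => //.
 by apply: nul_ext h3 => n; rewrite big_nil. by move=> t; rewrite big_nil.
have := rep_add (h i) IH => -[b [L [a [f [d [h1 h2 h3 h4]]]]]]; split.
 by case: b => M M0 hM; exists M => // n; rewrite big_cons.
exists L, a, f, d; split => //; first by apply: nul_ext h3 => n; rewrite big_cons.
by move=> t; rewrite big_cons.
Qed.

Lemma rep_lift_mul a f u F : lifts phi a f -> rep u F ->
 rep (fun n => val a n ** u n) (fun t => (val f t : R[i]) *: F t).
move=> ha [bu [L [b [h [d [h1 h2 h3 h4]]]]]].
split; first by apply: bddM => //; exact: bdd_linf.
exists L, (fun l => a ** b l), (fun l => f ** h l), d; split => //.
- by move=> l; exact: (lifts_mul phi_hom).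
- have := nulMl (bdd_linf a) h3 => /(@nul_ext _ _ _); apply => n.
 by rewrite amulBr amulsr; congr (_ - _); each l; rewrite amulA.
- move=> t; rewrite h4 scaler_sumr; each l. by rewrite scM scalerA.
Qed.

Lemma rep_cst_mul d u F : ssa_set D d -> rep u F -> rep (fun n => d ** u n) (fun t => d ** F t).
move=> Dd [bu [L [b [h [c [h1 h2 h3 h4]]]]]].
split; first by apply: bddM => //; exact: bdd_cst.
exists L, b, h, (fun l => d ** c l); split => //.
- by move=> l; exact: ssaM.
- have h5 : nul (fun n => \sum_l (val (b l) n ** d - d ** val (b l) n) ** c l).
 apply: nul_sum => l; apply: nulMr; [exact: bdd_cst|exact: lifts_comm].
 apply: nul_ext (nulD (nulMl (bdd_cst d) h3) (nulN h5)) => n.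
 rewrite amulBr -addrA; congr (_ + _); rewrite amulsr -opprD -big_split /=; congr (- _). by each l; nc.
- by move=> t; rewrite h4 amulsr; each l; rewrite amulZr.
Qed.

Lemma rep_mul u v F H : rep u F -> rep v H -> rep (fun n => u n ** v n) (fun t => F t ** H t).
move=> [bu [L [a [f [d [h1 h2 h3 h4]]]]]] hv.
have h : rep (fun n => \sum_l val (a l) n ** (d l ** v n)) (fun t => \sum_l (val (f l) t : R[i]) *: (d l ** H t)).
 by apply: rep_sum => l; apply: rep_lift_mul => //; exact: rep_cst_mul.
apply: rep_ext (_ : rep _ (fun t => \sum_l (val (f l) t : R[i]) *: (d l ** H t))) _; last first.
 by move=> t; rewrite h4 amulsl; each l; rewrite amulZl.
apply: (rep_nul h); first by apply: bddM => //; case: hv.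
have [bv _] := hv; apply: nul_ext (nulMr bv h3) => n; rewrite amulBl amulsl; congr (_ - _).
by each l; rewrite amulA.
Qed.

Lemma rep_act s u F : rep u F -> rep (fun n => alpha s (u n)) (fun t => alpha s (F (s^-1 * t)%g)).
move=> [[M M0 bu] [L [a [f [d [h1 h2 h3 h4]]]]]]; split; first by exists M => // n; rewrite nm_act.
have act_sum (v : L -> A) : alpha s (\sum_l v l) = \sum_l alpha s (v l). exact: (lin_sum (@act_linear _ _ _ alpha s)).
exists L, (fun l => linf_act alpha s (a l)), (fun l => left_translation s (f l)), (fun l => alpha s (d l)); split.
- by move=> l; exact: (lifts_act phi_act).
- by move=> l; exact: inv_act.
- apply: (nul_dom (M := 1)) h3 => n; rewrite mul1r -[leRHS](nm_act alpha s) actB act_sum.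
 have -> // : \sum_l alpha s (val (a l) n ** d l) = \sum_l val (linf_act alpha s (a l)) n ** alpha s (d l).
 by each l; rewrite act_amul.
- by move=> t; rewrite h4 act_sum; each l; rewrite actZ.
Qed.

Section Towers.
Context {m : nat} (g : 'I_m -> G) (h : 'I_m -> G -> R) (hc : forall i, continuous (h i)).
Hypothesis h1 : forall s, \sum_i h i s ^+ 2 = 1.
Variable x : 'I_m -> linf A.
Hypotheses (lx : forall i, lifts phi (x i) (real_fun (@hc i))) (qx : forall i, equi (alpha := alpha) (val (x i)))
 (sx : forall i n, star (val (x i) n) = val (x i) n).

(** It represents an approximation of the function [t |-> alpha t w]. That function is invariant for
    the diagonal action and multiplicative in [w], so the tower is nearly fixed and nearly
    multiplicative. *)
Definition tower (w : A) n := \sum_i val (x i) n ** (alpha (g i) w ** val (x i) n).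
Definition tower_fun (w : A) t := \sum_i (h i t ^+ 2)%:C *: alpha (g i) w.
Definition tower_near (w : A) (d : R) := forall t i, h i t != 0 -> nm (alpha (g i) w - alpha t w) <= d.

Lemma tower_rep w : ssa_set D w -> rep (tower w) (tower_fun w).
move=> Dw; apply: rep_sum => i.
have h2 := rep_lift_mul (lx i) (rep_lift_l (lx i) (inv_act (g i) Dw)).
apply: (rep_ext h2) => t; rewrite scalerA -[val (real_fun _) t]/((h i t)%:C).
by rewrite -rmorphM.
Qed.

Lemma convex_near (v : 'I_m -> A) y d t : (forall i, h i t != 0 -> nm (v i - y) <= d) ->
 nm (\sum_i (h i t ^+ 2)%:C *: v i - y) <= d.
move=> hd; have -> : \sum_i (h i t ^+ 2)%:C *: v i - y = \sum_i (h i t ^+ 2)%:C *: (v i - y).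
 under [RHS]eq_bigr do rewrite scalerBr. by rewrite sumrB -scaler_suml -rmorph_sum h1 scale1r.
bnd_sum; rewrite -[d]mul1r -(h1 t) mulr_suml.
each i; rewrite nmZ0 ?sqr_ge0//.
have [->|hn] := eqVneq (h i t) 0; first by rewrite expr0n !mul0r.
by apply: ler_wpM2l; [exact: sqr_ge0|exact: hd].
Qed.
Lemma tower_fun_near w d t : tower_near w d -> nm (tower_fun w t - alpha t w) <= d.
by move=> hw; apply: convex_near => i; exact: hw. Qed.

Lemma tower_fun_nm w t : nm (tower_fun w t) <= nm w.
rewrite -[tower_fun w t]subr0; apply: convex_near => i _.
by rewrite subr0 nm_act.
Qed.

Lemma tower_equi w : equi (alpha := alpha) (tower w).
rewrite /tower; elim: (index_enum 'I_m) => [|i r IH].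
 move=> e e0; apply: filterS filterT => t _ n; rewrite big_nil act0 subrr nm0; exact: ltW.
have := equi_add (equi_mul (bdd_linf (x i)) (bddM (bdd_cst (alpha (g i) w)) (bdd_linf (x i)))
 (qx i) (equi_mul (bdd_cst _) (bdd_linf (x i)) (@equi_cst _ _ _ alpha _) (qx i))) IH.
move=> h2 e e0; apply: filterS (h2 e e0) => t h3 n; have := h3 n.
by rewrite big_cons.
Qed.

(** For each [s] the estimate compares functions on the group; [unif_ev] then makes it uniform in
    [s], as averaging requires. *)
Lemma tower_act w d e : ssa_set D w -> tower_near w d -> 0 < e ->
 \ev n, forall s, nm (alpha s (tower w n) - tower w n) <= 2 * d + e.
move=> Dw hw e0; have e2 : 0 < e / 2 by rewrite divr_gt0.
have [||N hN] := @unif_ev R G A cG (fun s n => alpha s (tower w n) - tower w n) (2 * d + e / 2) _ _ _ e2.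
- move=> s r r0; apply: filterS (equi_orbit s (tower_equi w) r0) => t h2 n. by rewrite opprB addrA subrK.
- move=> s; have h2 := rep_add (rep_act s (tower_rep Dw)) (rep_opp (tower_rep Dw)). apply: (rep_sup h2 _ e2) => t.
 have -> : alpha s (tower_fun w (s^-1 * t)%g) - tower_fun w t =
 (alpha s (tower_fun w (s^-1 * t)%g) - alpha t w) + (alpha t w - tower_fun w t). by rewrite addrA subrK.
 have k1 := tower_fun_near t hw; have k2 := tower_fun_near (s^-1 * t)%g hw.
 have k3 : nm (alpha s (tower_fun w (s^-1 * t)%g) - alpha t w) <= d.
 by rewrite -(nm_act alpha s^-1%g) actB -!actM mulVg act1. rewrite mulr2n mulrDl mul1r; bnd nmD.
 by apply: lerD => //; rewrite nmBC.
by exists N => n nN s; have := hN n nN s; rewrite -addrA -splitr.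
Qed.

Lemma tower_mul w z u d r e : ssa_set D w -> ssa_set D z -> ssa_set D u ->
 tower_near w d -> tower_near z d -> tower_near u d -> nm (w ** z - u) <= r -> 0 < e -> \ev n,
 nm (tower w n ** tower z n - tower u n) <= d * (nm w + nm z + 1) + r + e.
move=> Dw Dz Du hw hz hu hr e0.
have h2 := rep_add (rep_mul (tower_rep Dw) (tower_rep Dz)) (rep_opp (tower_rep Du)).
apply: (rep_sup h2 _ e0) => t.
have -> : tower_fun w t ** tower_fun z t - tower_fun u t =
 tower_fun w t ** (tower_fun z t - alpha t z) + (tower_fun w t - alpha t w) ** alpha t z
 + (alpha t w ** alpha t z - alpha t u) - (tower_fun u t - alpha t u) by nc.
have k1 := tower_fun_near t hw; have k2 := tower_fun_near t hz; have k3 := tower_fun_near t hu.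
have k4 : nm (tower_fun w t ** (tower_fun z t - alpha t z)) <= nm w * d.
 by bnd nmM; apply: ler_pM; rewrite ?nm_ge0// tower_fun_nm.
have k5 : nm ((tower_fun w t - alpha t w) ** alpha t z) <= d * nm z.
 by bnd nmM; rewrite nm_act; apply: ler_wpM2r => //; exact: nm_ge0.
have k6 : nm (alpha t w ** alpha t z - alpha t u) <= r by rewrite -act_amul -actB nm_act.
bnd nmB; bnd (lerD (nmD _ _) k3).
bnd (lerD (lerD (nmD _ _) k6) (lexx _)).
lra.
Qed.

Lemma tower_fix b e : ssa_set D b -> (forall s, alpha s b = b) -> 0 < e -> \ev n, nm (tower b n - b) <= e.
move=> Db fb e0; have h2 := rep_add (tower_rep Db) (rep_opp (rep_cst Db)).
have [|N hN] := rep_sup (M := 0) h2 _ e0; last by exists N => n /hN; rewrite add0r.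
by move=> t; apply: convex_near => i _; rewrite fb subrr nm0.
Qed.

(** The index must not depend on [w], which may lie outside [D]. Compression by the invariant [k]
    reduces the norm bound to the single tower of [k ** k]. *)
Lemma tower_bnd k e : ssa_set D k -> (forall s, alpha s k = k) -> star k = k -> nm k <= 1 ->
 0 < e -> \ev n, forall w : A, nm (tower (k ** w ** k) n) <= (1 + e) * nm w.
move=> Dk fk sk k1 e0; have e2 : 0 < e / 2 by rewrite divr_gt0.
have fkk s : alpha s (k ** k) = k ** k by rewrite act_amul fk.
have [N hN] := tower_fix (ssaM Dk Dk) fkk e0; exists N => n nN w.
have -> : tower (k ** w ** k) n = \sum_i (val (x i) n ** k) ** alpha (g i) w ** star (val (x i) n ** k).
 by each i; rewrite !act_amul fk starM sk sx; nc.
bnd (nm_weighted _ (nm_ge0 w) _); first by move=> i; rewrite nm_act.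
rewrite mulrC; apply: ler_wpM2r; first exact: nm_ge0.
have -> : \sum_i val (x i) n ** k ** star (val (x i) n ** k) = tower (k ** k) n. by each i; rewrite fkk starM sk sx; nc.
rewrite -[tower _ _](subrK (k ** k)); bnd nmD; rewrite addrC.
apply: lerD; last exact: hN.
by bnd (nmMl _ k1); rewrite mul1r.
Qed.

Lemma tower_lin n : linear (tower^~ n).
move=> c u v; rewrite scaler_sumr -big_split /=; each i.
rewrite act_linear -[sval (x i)]/(val (x i)); nc.
Qed.
Lemma tower_star w n : tower (star w) n = star (tower w n).
by rewrite star_sum; each i; rewrite !starM sx act_star amulA. Qed.

Lemma tower_pos w n : positive w -> positive (tower w n).
move=> pw; apply: pos_sum => i _; rewrite -{1}sx amulA.
by apply: pos_conj; exact: act_positive.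
Qed.

End Towers.

End Fields.

Lemma prod_est R (A : cstar R) (a b p q u v : A) (r K s : R) :
 nm (a - p) <= r -> nm (b - q) <= r -> nm (u - v) <= r -> nm b <= K -> nm p <= K ->
 nm (p ** q - v) <= s -> nm (a ** b - u) <= 2 * K * r + s + r.
move=> h1 h2 h3 h4 h5 h6; have K0 := le_trans (nm_ge0 _) h4.
have -> : a ** b - u = ((a - p) ** b + p ** (b - q)) + (p ** q - v) + (v - u) by nc.
have k1 : nm ((a - p) ** b) <= r * K. by bnd nmM; apply: ler_pM; rewrite ?nm_ge0.
have k2 : nm (p ** (b - q)) <= K * r. by bnd nmM; apply: ler_pM; rewrite ?nm_ge0.
rewrite nmBC in h3; bnd nmD; apply: lerD => //.
bnd nmD; apply: lerD => //; bnd nmD.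
lra.
Qed.

Lemma mult_est R (e p q x : R) : e = 20 * p * q + 20 * q -> x <= q * (p + p + 1) -> 0 <= p * q -> 0 < q ->
 2 * (2 * p) * (3 * q) + (x + 2 * (p * q) + q) + 3 * q <= e.
lra. Qed.
Lemma fix_est R (e p q : R) : e = 20 * p * q + 20 * q -> 0 <= p * q -> 0 < q -> 3 * q + q + 2 * q <= e.
lra. Qed.

(** * Approximately multiplicative maps onto the fixed point algebra *)

Section RokhlinMaps.
Context {R} {G} {A : cstar R} {alpha : cstarAction G A}.
Hypotheses (cG : compact [set: G]) (hG : hausdorff_space G) (sc : @second_countable G).
Variable C : crossedProduct alpha.
Hypothesis rk : rokhlin alpha.
Local Notation B := (csubstar (fixed_alg alpha)).
Local Notation mu := (cp_haar C).
Let mu_inv : left_invariant mu := @cp_haar_inv _ _ _ _ C.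

Lemma act_near_seq (S : seq A) d : 0 < d -> nbhs (1%g : G) [set t | forall y, y \in S -> nm (alpha t y - y) < d].
move=> d0; elim: S => [|y S IH]; first by apply: filterS filterT => t _ y.
apply: filterS2 (act_cont_near alpha y d0) IH => t h1 h2 z.
by rewrite inE => /orP[/eqP ->|/h2].
Qed.

(** The map is [w |-> E (tower (k w k))]. Near invariance of the towers makes averaging a small
    change on [S] and on products of its elements, so it preserves the estimates of the towers. The
    assumption [e <= 1] replaces [1 + e] by [2] in the constants. *)
Lemma rokhlin_maps_small (S : seq A) (e : R) : 0 < e -> e <= 1 -> exists T : A -> B,
 [/\ linear T, {morph T : x / star x}, forall x, positive x -> positive (T x), forall w, nm (T w) <= (1 + e) * nm w &
 (forall w z, w \in S -> z \in S -> nm (T w ** T z - T (w ** z)) <= e) /\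
 forall b : B, val b \in S -> nm (T (val b) - b) <= e].
move=> e0 e1; have [M M0 hM] := seq_bound S.
have M1 : 0 < 20 * (M + 1) by rewrite mulr_gt0// ltr_wpDl.
(* The errors collected in [mult_est] and [fix_est] amount to at most [16 M d + 5 d] and [6 d]. *)
pose d := e / (20 * (M + 1)); have d0 : 0 < d by rewrite divr_gt0.
have dE : e = 20 * M * d + 20 * d by rewrite -mulrDl -[X in _ + X]mulr1 -mulrDr mulrC divfK// gt_eqF.
have [k [pk k1 fk hk]] := inv_approx_unit cG hG alpha mu_inv (S ++ [seq star w | w <- S]) d0.
have sk : star k = k := pos_sa pk.
pose T := S ++ [seq w ** z | w <- S, z <- S].
have ST w : w \in S -> w \in T by move=> wS; rewrite mem_cat wS.
have SST w z : w \in S -> z \in S -> w ** z \in T.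
 by move=> wS zS; rewrite mem_cat; apply/orP; right; apply/allpairsP; exists (w, z).
have [m [g [h [hc h0 h1 hW]]]] := @partition_unity R G cG hG _ (act_near_seq T d0).
have [D [sD hD]] := separable_sub alpha (nth 0 (k :: S)) sc.
have Dk : ssa_set D k := hD 0%N.
have DS w : w \in S -> ssa_set D w. by move=> wS; rewrite -(nth_index 0 wS); exact: hD (index w S).+1.
have DT w : w \in T -> ssa_set D w. rewrite mem_cat => /orP[/DS//|/allpairsP[[u v] [/= uS vS ->]]].
 by apply: ssaM; exact: DS.
have [phi [ph pc pu pa]] := rk sD.
have [x hx] := choice (fun i => lifts_real ph pc (hc i)).
have lx i : lifts phi (x i) (real_fun (@hc i)) by case: (hx i).
have qx i : equi (alpha := alpha) (val (x i)) by case: (hx i).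
have sx i n : star (val (x i) n) = val (x i) n by case: (hx i).
pose c w := k ** w ** k.
have cM w : nm (c w) <= nm w. bnd nmM; rewrite -[leRHS]mulr1; apply: ler_pM; rewrite ?nm_ge0//.
 by bnd (nmMl _ k1); rewrite mul1r.
have cB u v : c (u - v) = c u - c v by rewrite /c; nc.
have ac s w : alpha s (c w) = c (alpha s w) by rewrite !act_amul !fk.
have nT w : w \in T -> tower_near (alpha := alpha) g h (c w) d. move=> wT t i hn; rewrite !ac -cB; bnd cM.
 have := hW i t hn w wT; rewrite -(nm_act alpha (g i)) actB -actM mulgA mulgV mul1g nmBC. exact: ltW.
have Dc w : w \in T -> ssa_set D (c w). by move=> wT; apply: ssaM => //; apply: ssaM => //; exact: DT.
have [N1 hN1] : \ev n, forall w, w \in T ->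
 forall s, nm (alpha s (tower (alpha := alpha) g x (c w) n) - tower (alpha := alpha) g x (c w) n) <= 2 * d + d.
 apply: seq_ev => w wT. exact: (tower_act cG hG mu_inv sD ph pc pu pa h1 lx qx (Dc w wT) (nT w wT) d0).
have kz z : z \in S -> nm (k ** z - z) <= d. by move=> zS; rewrite nmBC; apply: hk; rewrite mem_cat zS.
have zk z : z \in S -> nm (z ** k - z) <= d. move=> zS; rewrite -nmS starB starM sk nmBC; apply: hk.
 by rewrite mem_cat map_f ?orbT.
have cc w z : w \in S -> z \in S -> nm (c w ** c z - c (w ** z)) <= 2 * (M * d).
 move=> wS zS; have -> : c w ** c z - c (w ** z) = c (w ** (k ** (k ** z - z) + (k ** z - z))). by rewrite /c; nc.
 bnd cM; bnd nmM; rewrite mulrCA. apply: ler_pM; rewrite ?nm_ge0//; first exact: hM.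
 bnd nmD; rewrite mulr2n mulrDl mul1r; apply: lerD; last exact: kz. by bnd (nmMl _ k1); rewrite mul1r; exact: kz.
have [N2 hN2] : \ev n, forall w, w \in S -> forall z, z \in S ->
 nm (tower (alpha := alpha) g x (c w) n ** tower (alpha := alpha) g x (c z) n - tower (alpha := alpha) g x (c (w ** z)) n) <=
 d * (nm (c w) + nm (c z) + 1) + 2 * (M * d) + d. apply: seq_ev => w wS; apply: seq_ev => z zS.
 have wzT := SST w z wS zS.
 exact: (tower_mul cG hG mu_inv sD ph pc pu h1 lx (Dc _ (ST _ wS)) (Dc _ (ST _ zS)) (Dc _ wzT)
 (nT _ (ST _ wS)) (nT _ (ST _ zS)) (nT _ wzT) (cc w z wS zS) d0).
have [N3 hN3] := tower_bnd cG hG mu_inv sD ph pc pu g h1 lx sx Dk fk sk k1 e0.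
have [N4 hN4] : \ev n, forall b, b \in S ->
 (forall s, alpha s b = b) -> nm (tower (alpha := alpha) g x (c b) n - c b) <= d.
 apply: seq_ev => b bS; case: (pselect (forall s, alpha s b = b)) => [fb|nf]; last by exists 0%N.
 have fcb s : alpha s (c b) = c b by rewrite ac fb.
 have [N hN] := tower_fix cG hG mu_inv sD ph pc pu g h1 lx (Dc _ (ST _ bS)) fcb d0. by exists N => n nN _; exact: hN.
pose n := maxn (maxn N1 N2) (maxn N3 N4).
have n1 : (N1 <= n)%N by rewrite /n !leq_max leqnn.
have n2 : (N2 <= n)%N by rewrite /n !leq_max leqnn !orbT.
have n3 : (N3 <= n)%N by rewrite /n !leq_max leqnn !orbT.
have n4 : (N4 <= n)%N by rewrite /n !leq_max leqnn !orbT.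
pose Y w := tower (alpha := alpha) g x (c w) n; pose Th w := avgB cG hG C (Y w).
have YB w : nm (Y w) <= (1 + e) * nm w by exact: hN3.
have ThY w : w \in T -> nm (val (Th w) - Y w) <= 3 * d. move=> wT; apply: (avg_bnd cG hG) => s; bnd (hN1 n n1 w wT s).
 by rewrite -[X in _ + X]mul1r -mulrDl natr1.
have ThB w : nm (Th w) <= (1 + e) * nm w by exact: le_trans (avgB_nm _ _ _ _) (YB w).
have K2 w : w \in S -> (1 + e) * nm w <= 2 * M.
 move=> wS; apply: ler_pM; rewrite ?nm_ge0//; [by rewrite addr_ge0// ltW| |exact: hM]. lra.
exists Th; split => //.
- move=> a u v; rewrite /Th /Y; have -> : c (a *: u + v) = a *: c u + c v by rewrite /c; nc.
 by rewrite tower_lin avgB_lin.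
- move=> w; have cS : c (star w) = star (c w) by rewrite /c !starM sk amulA.
 by rewrite /Th /Y cS (tower_star g sx) avgB_star.
- move=> w pw; apply: avgB_pos; apply: (tower_pos g sx). by rewrite /c -{1}sk; exact: pos_conj.
split. move=> w z wS zS. have hb : nm (val (Th z)) <= 2 * M := le_trans (ThB z) (K2 z zS).
 have hp : nm (Y w) <= 2 * M := le_trans (YB w) (K2 w wS).
 have h2 := prod_est (ThY _ (ST _ wS)) (ThY _ (ST _ zS)) (ThY _ (SST w z wS zS)) hb hp (hN2 n n2 w wS z zS). bnd h2.
 have h3 : d * (nm (c w) + nm (c z) + 1) <= d * (M + M + 1). apply: ler_wpM2l; first exact: ltW.
 by rewrite lerD2r; apply: lerD; bnd cM; exact: hM. have h4 : 0 <= M * d by rewrite mulr_ge0// ltW.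
 exact: mult_est dE h3 h4 d0.
move=> b bS; have h2 := ThY _ (ST _ bS); have h3 := hN4 n n4 _ bS (@fixedP _ _ _ _ b).
have h4 : nm (c (val b) - val b) <= 2 * d.
 have -> : c (val b) - val b = k ** (val b ** k - val b) + (k ** val b - val b) by rewrite /c; nc.
 bnd nmD; rewrite mulr2n mulrDl mul1r; apply: lerD; last exact: kz. by bnd (nmMl _ k1); rewrite mul1r; exact: zk.
have -> : nm (Th (val b) - b) = nm (val (Th (val b)) - val b) by [].
have tele (p q r s : A) : p - s = (p - q) + (q - r) + (r - s) by nc.
rewrite (tele _ (Y (val b)) (c (val b))).
bnd nmD; bnd (lerD (nmD _ _) h4).
bnd (lerD (lerD h2 h3) (lexx _)).
have h5 : 0 <= M * d by rewrite mulr_ge0// ltW.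
exact: fix_est dE h5 d0.
Qed.

Lemma rokhlin_maps (S : seq A) (e : R) : 0 < e -> exists T : A -> B,
 [/\ linear T, {morph T : x / star x}, forall x, positive x -> positive (T x), forall w, nm (T w) <= (1 + e) * nm w &
 (forall w z, w \in S -> z \in S -> nm (T w ** T z - T (w ** z)) <= e) /\
 forall b : B, val b \in S -> nm (T (val b) - b) <= e].
move=> e0; have m0 : 0 < Num.min e 1 by rewrite lt_min e0 ltr01.
have m1 : Num.min e 1 <= 1 by rewrite ge_min lexx orbT.
have me : Num.min e 1 <= e by rewrite ge_min lexx.
have [T [h1 h2 h3 h4 [h5 h6]]] := rokhlin_maps_small S m0 m1.
exists T; split => //. by move=> w; bnd (h4 w); apply: ler_wpM2r; rewrite ?nm_ge0// lerD2l.
by split=> [w z wS zS|b bS]; apply: le_trans me; [exact: h5|exact: h6].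
Qed.

End RokhlinMaps.

(** * Fullness of the corner *)

Section GroupContinuity.
Context {G}.

Lemma mulg_cvg (T : Type) (F : set_system T) {FF : Filter F} (f h : T -> G) a b :
 f @ F --> a -> h @ F --> b -> (fun x => (f x * h x)%g) @ F --> (a * b)%g.
move=> fa hb; have c := @mulg_continuous2 G (a, b).
exact: (cvg_comp _ _ (cvg_pair fa hb) c).
Qed.

Lemma unif_cont2 R (V : normedModType R[i]) (F : G -> V) (e : R) : compact [set: G] -> continuous F -> 0 < e ->
 nbhs (1%g : G) [set u | forall t r, nm (F (t * u * r)%g - F (t * r)%g) < e].
move=> cG /cont_near Fc e0; have cGG := compact_setX cG cG.
have /compact_near_coveringP nc := cGG.
have h := nc G (nbhs (1%g : G)) (fun u p => nm (F (p.1 * u * p.2)%g - F (p.1 * p.2)%g) < e) _ _.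
have : \forall u \near nbhs (1%g : G), [set: G] `*` [set: G] `<=`
 (fun p => nm (F (p.1 * u * p.2)%g - F (p.1 * p.2)%g) < e).
 apply: h => -[t r] _; have e2 : 0 < e / 2 by rewrite divr_gt0.
 have q1 : (fun p : (G * G) * G => p.1) @ nbhs ((t, r), 1%g : G) --> (t, r) by exact: cvg_fst.
 have c1 : (fun p : (G * G) * G => p.1.1) @ nbhs ((t, r), 1%g : G) --> t.
 exact: cvg_comp q1 (@cvg_fst G G (nbhs t) (nbhs r) _).
 have c2 : (fun p : (G * G) * G => p.1.2) @ nbhs ((t, r), 1%g : G) --> r.
 exact: cvg_comp q1 (@cvg_snd G G (nbhs t) (nbhs r) _).
 have c3 : (fun p : (G * G) * G => p.2) @ nbhs ((t, r), 1%g : G) --> (1%g : G). exact: cvg_snd.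
 have d1 := @mulg_cvg _ _ (nbhs_filter _) _ _ _ _ (@mulg_cvg _ _ (nbhs_filter _) _ _ _ _ c1 c3) c2; rewrite mulg1 in d1.
 have d2 := @mulg_cvg _ _ (nbhs_filter _) _ _ _ _ c1 c2. have n0 := Fc (t * r)%g _ e2.
 have n1 : nbhs ((t, r), 1%g : G) (fun p : (G * G) * G =>
 nm (F (p.1.1 * p.2 * p.1.2)%g - F (t * r)%g) < e / 2) := d1 _ n0.
 have n2 : nbhs ((t, r), 1%g : G) (fun p : (G * G) * G => nm (F (p.1.1 * p.1.2)%g - F (t * r)%g) < e / 2) := d2 _ n0.
 have : nbhs ((t, r), 1%g : G) (fun p : (G * G) * G => nm (F (p.1.1 * p.2 * p.1.2)%g - F (p.1.1 * p.1.2)%g) < e).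
 apply: filterS2 n1 n2 => p k1 k2. bnd (nm_tri _ (F (t * r)%g) _); rewrite [nm (F (t * r)%g - _)]nmBC.
 by rewrite [e]splitr; exact: ltrD. by [].
by apply: filterS => u hu t r; exact: (hu (t, r)).
Qed.

Lemma nbhs_div (U : set G) : nbhs (1%g : G) U -> exists2 W, nbhs (1%g : G) W & forall w v, W w -> W v -> U (w^-1 * v)%g.
move=> U1; have c1 : (fun p : G * G => p.1^-1%g) @ nbhs (1%g : G, 1%g : G) --> (1^-1%g : G).
 apply: (cvg_comp fst (fun g : G => g^-1%g)); first exact: cvg_fst. exact: invg_continuous.
have c2 : (fun p : G * G => p.2) @ nbhs (1%g : G, 1%g : G) --> (1%g : G) by exact: cvg_snd.
have d := @mulg_cvg _ _ (nbhs_filter _) _ _ _ _ c1 c2; rewrite mulg1 invg1 in d.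
have [[W1 W2] [/= h1 h2] hW] := d _ U1.
exists (W1 `&` W2); first exact: filterI.
by move=> w v [w1 _] [_ v2]; exact: (hW (w, v)).
Qed.

End GroupContinuity.

Section Equicontinuity.
Context {R} {G} {A : cstar R} {alpha : cstarAction G A}.
Implicit Types U V : G -> nat -> A.

Definition equifam U := forall s d, 0 < d -> nbhs s [set t | forall n, nm (U t n - U s n) <= d].

Lemma equifam_add U V : equifam U -> equifam V -> equifam (fun s n => U s n + V s n).
move=> hU hV s d d0; have d2 : 0 < d / 2 by rewrite divr_gt0.
apply: filterS2 (hU s _ d2) (hV s _ d2) => t h1 h2 n.
rewrite opprD addrACA [leRHS]splitr; bnd nmD; exact: lerD.
Qed.

Lemma equifam_sum (I : finType) (U : I -> G -> nat -> A) :
 (forall i, equifam (U i)) -> equifam (fun s n => \sum_i U i s n).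
move=> h; elim: (index_enum I) => [|i r IH] s d d0. by apply: filterS filterT => t _ n; rewrite !big_nil subrr nm0 ltW.
apply: filterS (equifam_add (h i) IH s d0) => t k n; rewrite !big_cons; exact: k.
Qed.
Lemma equifam_cont (F : G -> A) : continuous F -> equifam (fun s _ => F s).
by move=> /cont_near Fc s d d0; apply: filterS (Fc s d d0) => t h n; exact: ltW. Qed.

Lemma equifam_act b u : bdd b -> equi (alpha := alpha) u -> equifam (fun s n => b n ** alpha s (u n)).
move=> [M M0 bM] ue s d d0; have M1 : 0 < M + 1 by rewrite ltr_wpDl.
apply: filterS (equi_orbit s ue (divr_gt0 d0 M1)) => t h n.
rewrite -amulBr; bnd nmM.
via ((M + 1) * (d / (M + 1))). apply: ler_pM; rewrite ?nm_ge0//; bnd (bM n); by lra.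
by rewrite mulrC divfK ?gt_eqF.
Qed.

End Equicontinuity.

Section Fullness.
Context {R} {G} {A : cstar R} {alpha : cstarAction G A}.
Hypotheses (cG : compact [set: G]) (hG : hausdorff_space G) (sc : @second_countable G).
Variable C : crossedProduct alpha.
Hypothesis rk : rokhlin alpha.
Local Notation mu := (cp_haar C).
Let mu_inv : left_invariant mu := @cp_haar_inv _ _ _ _ C.
Local Notation j := (jmap C).

Lemma separable_range (F : G -> A) : continuous F ->
 exists D : invSubalg alpha, separable_set (ssa_set D) /\ forall s, ssa_set D (F s).
move=> Fc; have [x hx] := @dense_seq (pointed_group G) sc.
have [D [sD hD]] := separable_sub alpha (fun n => F (x n)) sc.
exists D; split=> // s; have /closed_nmP := @csa_closed _ _ D; apply => e e0.
have : nbhs s [set t | nm (F t - F s) < e] by move/cont_near : Fc => /(_ s e e0).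
rewrite nbhsE => -[U [Uo Us] hU]; have [n Un] := hx U Uo (ex_intro _ s Us).
by exists (F (x n)); [exact: hD|rewrite nmBC; exact: hU].
Qed.

(** For [c = emb F] take [a = F (g_i g_k^-1) x_i^2] and [b = x_k^2]. The sum of the [a (alpha s b)]
    represents, at [t], the average of [F (g_i g_k^-1)] with weights [h_i(t)^2 h_k(s^-1 t)^2]. On
    their support [g_i] is near [t] and [g_k] near [s^-1 t], so [g_i g_k^-1] is near [s]. *)
Lemma fullness (c : C) (e : R) : 0 < e -> exists (L : finType) (a b : L -> A),
 nm (c - \sum_l j (a l) ** star (j (b l))) <= e.
move=> e0; have e3 : 0 < e / 3 by rewrite divr_gt0.
have [f hf] := cp_approx c e3; pose F := val f; have Fc : continuous F := val_substar f.
have [W W1 hWU] := nbhs_div (unif_cont2 cG Fc e3).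
have [m [g [h [hc h0 h1 hW]]]] := @partition_unity R G cG hG _ W1.
have [D [sD hD]] := separable_range Fc.
have [phi [ph pc pu pa]] := rk sD.
have [x hx] := choice (fun i => lifts_real ph pc (hc i)).
have lx i : lifts phi (x i) (real_fun (@hc i)) by case: (hx i).
have qx i : equi (alpha := alpha) (val (x i)) by case: (hx i).
have sx i n : star (val (x i) n) = val (x i) n by case: (hx i).
pose L : finType := ('I_m * 'I_m)%type.
pose d (l : L) := F (g l.1 * (g l.2)^-1)%g.
pose a (l : L) n := d l ** (val (x l.1) n ** val (x l.1) n).
pose b (l : L) n := val (x l.2) n ** val (x l.2) n.
pose U s n := \sum_l a l n ** alpha s (b l n) + (- F s).
have Ue : equifam U. apply: equifam_add; last by apply: equifam_cont => s; apply: cvgN; exact: Fc.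
 apply: equifam_sum => l; apply: equifam_act. by apply: bddM; [exact: bdd_cst|apply: bddM; exact: bdd_linf].
 exact: equi_mul (bdd_linf _) (bdd_linf _) (qx _) (qx _).
have lxx i := lifts_mul ph (lx i) (lx i).
have UM s : \ev n, nm (U s n) <= e / 3 + e / 3 / 2.
 have r1 l := rep_lift_l (lifts_mul ph (lxx l.1) (lifts_act pa s (lxx l.2))) (hD (g l.1 * (g l.2)^-1)%g).
 have r2 := rep_add (rep_sum cG hG mu_inv sD pc pu r1) (rep_opp (rep_cst cG hG mu_inv sD pc pu (hD s))).
 have e4 : 0 < e / 3 / 2 by rewrite !divr_gt0. have [|N hN] := rep_sup cG hG mu_inv sD ph pc pu (M := e / 3) r2 _ e4.
 move=> t. have -> : \sum_(l : L) (val (real_fun (@hc l.1) ** real_fun (@hc l.1) **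
 left_translation s (real_fun (@hc l.2) ** real_fun (@hc l.2))) t : R[i]) *: d l =
 \sum_i (h i t ^+ 2)%:C *: \sum_k (h k (s^-1 * t)%g ^+ 2)%:C *: d (i, k).
 rewrite -(pair_bigA _ (fun i k => (val (real_fun (@hc i) ** real_fun (@hc i) **
 left_translation s (real_fun (@hc k) ** real_fun (@hc k))) t : R[i]) *: d (i, k))) /=.
 each i; rewrite scaler_sumr; each k. rewrite scalerA; congr (_ *: _); rewrite !expr2 !rmorphM /=. by [].
 apply: (convex_near h1) => i hi; apply: (convex_near h1) => k hk.
 (* With [w = g_i^-1 t] and [v = g_k^-1 s^-1 t], both in [W], one has
    [g_i g_k^-1 = t (w^-1 v) (t^-1 s)]. Two-sided uniform continuity compares this with
    [t (t^-1 s) = s]. *)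
 have := hWU _ _ (hW i t hi) (hW k _ hk) t (t^-1 * s)%g.
 have -> : (t * (((g i)^-1 * t)^-1 * ((g k)^-1 * (s^-1 * t))) * (t^-1 * s))%g = (g i * (g k)^-1)%g.
 by rewrite invgM invgK -!mulgA (mulgA t t^-1%g) mulgV mul1g (mulgA t t^-1%g) mulgV mul1g mulVg mulg1.
 by rewrite mulgA mulgV mul1g => /ltW. exists N => n /hN; congr (nm (_ + _) <= _); each l.
 have vE : val (x l.1 ** x l.1 ** linf_act alpha s (x l.2 ** x l.2)) n =
 (val (x l.1) n ** val (x l.1) n) ** alpha s (val (x l.2) n ** val (x l.2) n) by []. by rewrite /a !amulA.
have [N hN] := unif_ev cG Ue UM (divr_gt0 e3 (ltr0n _ 2)).
have {}hN := hN N (leqnn N).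
exists L, (fun l => a l N), (fun l => b l N).
have bS l : star (b l N) = b l N by rewrite /b starM !sx.
have -> : c - \sum_l j (a l N) ** star (j (b l N)) =
 (c - cp_emb C f) - cp_emb C (\sum_l orb_fun (alpha := alpha) (a l N) (b l N) - f).
 have eL := @cp_linear _ _ _ _ C; under eq_bigr do rewrite jmap_starr bS.
 by rewrite (linB eL) (lin_sum eL) opprB addrA subrK.
bnd nmB.
have -> : e = e / 3 + (e / 3 + e / 3 / 2 + e / 3 / 2) by lra.
apply: lerD; first exact: ltW.
apply: (emb_le cG hG) => s; have := hN s; congr (nm (_ - _) <= _).
elim: (index_enum L) => [|l r IH]; first by rewrite !big_nil.
by rewrite !big_cons IH.
Qed.

End Fullness.

(** * From the algebra to the fixed point algebra *)

Section FixedPointDim.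
Context {R} {G} {A : cstar R} {alpha : cstarAction G A}.
Hypotheses (cG : compact [set: G]) (hG : hausdorff_space G) (sc : @second_countable G).
Variable C : crossedProduct alpha.
Hypothesis rk : rokhlin alpha.
Local Notation B := (csubstar (fixed_alg alpha)).

(** The columns [w a] of data for [A] are carried over by one map from [rokhlin_maps], while the
    coordinate maps are restricted. Near multiplicativity on finitely many elements suffices, since
    [near_data] asks for approximate relations. *)
Lemma dim_fixed dr n : dim_le dr A n -> dim_le dr B n.
move=> hA S e e0; have [t [t0 t1 key]] := near_approx n dr S e0; apply: key.
set tau := t ^+ 2; have tau0 : 0 < tau by rewrite exprn_gt0.
have tau1 : tau <= 1 by rewrite /tau expr_le1// ltW.
have [K K0 SK] := seq_bound S.
have e10 : 0 < tau / 8 by rewrite divr_gt0.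
have [J [r [kap [psi0 [w [[kr rr hb0] wo wr wdr wS]]]]]] := dim_qdata [seq val s | s : B <- S] hA e10.
pose P : R := \sum_(a : J) \sum_(b : J) (K + 1) + \sum_(a : J) 1.
have P1 : 0 <= \sum_(a : J) \sum_(b : J) (K + 1). by apply: sumr_ge0 => a _; apply: sumr_ge0 => b _; rewrite addr_ge0.
have P2 : 0 <= \sum_(a : J) (1 : R) by apply: sumr_ge0.
have P0 : 0 < P + 1 by rewrite ltr_wpDl// addr_ge0.
pose e2 := tau / 8 / (P + 1); have e20 : 0 < e2 by rewrite divr_gt0.
have e2E : (P + 1) * e2 = tau / 8 by rewrite mulrC divfK// gt_eqF.
have e2a : e2 <= tau / 8. by rewrite -e2E -[leLHS]mul1r; apply: ler_wpM2r; [exact: ltW|rewrite lerDr addr_ge0].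
have e2b : (\sum_(a : J) \sum_(b : J) (K + 1)) * e2 <= tau / 8.
 by rewrite -e2E; apply: ler_wpM2r; [exact: ltW|rewrite -addrA lerDl addr_ge0].
have e2c : (\sum_(a : J) 1) * e2 <= tau / 8.
 by rewrite -e2E; apply: ler_wpM2r; [exact: ltW|rewrite addrAC lerDr addr_ge0].
pose S2 := [seq w a | a <- enum J] ++ [seq star (w a) | a <- enum J] ++ [seq val s | s : B <- S].
have [T [Tl Ts Tp Tn [Tm Tb]]] := @rokhlin_maps R G A alpha cG hG sc C rk S2 _ e20.
have wS2 a : w a \in S2 by rewrite mem_cat map_f ?mem_enum.
have sS2 a : star (w a) \in S2.
 by rewrite !mem_cat; apply/orP; right; apply/orP; left; apply/mapP; exists a; rewrite ?mem_enum.
have vS2 s : s \in S -> val s \in S2.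
 by move=> sS; rewrite !mem_cat; apply/orP; right; apply/orP; right; apply/mapP; exists s.
pose psi (s : B) := psi0 (val s).
have hb : bmap r psi. have [vi vn] := val_iso (fixed_alg alpha); have [vl _ _] := vi. split.
 - by move=> a b c x y; exact: (bm_lin hb0).
 - by move=> I X hX; exact: (bm_cp hb0 (gpos_hom vi hX)).
 - by move=> x; exact: (bm_contr hb0).
 - by move=> x a b; exact: (bm_block hb0).
pose rho : hvec B J := fun a => star (T (w a)).
(* Near multiplicativity puts [rho a ** star (rho b)] close to [T (star (w a) ** w b)]; within a
   colour this is [d a] for [a = b] and zero otherwise. *)
pose d a : B := T (star (w a) ** w a).
have rhoS a : rho a = T (star (w a)) by rewrite /rho Ts.
have k1 : 1 + e2 <= 1 + tau / 8 by rewrite lerD2l.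
split; exists B, id, J, r, kap, psi, aid, rho, d; split.
- split; [exact: isohom_id|exact: kr|exact: hb|]. by split; [exact: sa_unit (@aid_l _ _ _)|exact: aid_l|exact: block1].
- split.
 + by move=> a; apply: Tp; exact: pos_star.
 + move=> a; bnd Tn; rewrite nmSS. have h1 : nm (w a) ^+ 2 <= 1 by rewrite expr_le1 ?nm_ge0//; case: (wr a).
 bnd (_ : _ <= 1 + e2); first by rewrite ler_piMr// addr_ge0// ltW. lra.
 + move=> a b rab; rewrite /d; have [-> _] := wr a; have [-> _] := wr b; by rewrite rab.
- move=> i; cbv zeta; rewrite aid_l; set v : hvec B J := aop (sop (cproj kap i)) rho.
 have vE a : v a = if kap a == i then rho a else 0. rewrite /v sopE (bigD1 a)//= ent_cproj eqxx big1 ?addr0 => [|b ba].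
 by case: (kap a == i); rewrite ?scale1r ?scale0r. by rewrite ent_cproj eq_sym (negbTE ba) scale0r.
 have -> : theta v v - sop (cproj kap i) ** dop d = mxo (fun a b =>
 v a ** star (v b) - if (a == b) && (kap a == i) then d a else 0). apply: adjop_eq => x; apply/funext => a.
 rewrite aopDx aopNx aopM hvDE hvNE mxo_theta !mxoE sopE.
 rewrite -sumrB; each b; rewrite dopE ent_cproj amulBl; congr (_ - _).
 case: eqVneq => [<-|_]; last by rewrite scale0r amul0r. by case: (kap a == i); rewrite ?scale1r ?scale0r ?amul0r.
 bnd nm_mxo. via ((\sum_(a : J) \sum_(b : J) (K + 1)) * e2); last first. lra.
 rewrite mulr_suml; each a; rewrite mulr_suml; each b.
 via e2; last by rewrite -[leLHS]mul1r; apply: ler_wpM2r; [exact: ltW|rewrite lerDr].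
 rewrite !vE; case: (eqVneq (kap a) i) => [ka|ka]; last by rewrite amul0r andbF subrr nm0 ltW.
 case: (eqVneq (kap b) i) => [kb|kb]; last first.
 rewrite star0 amulr0; case: (eqVneq a b) => [ab|_]; last by rewrite subrr nm0 ltW. by move: kb; rewrite -ab ka eqxx.
 rewrite rhoS /rho starK; have := Tm _ _ (sS2 a) (wS2 b); case: (eqVneq a b) => [->//|ab].
 by rewrite wo ?ka// (lin0 Tl).
- by move=> X a b; exists (star ((aop X rho : hvec B J) a) ** (aop X rho : hvec B J) b).
rewrite sop1 aidE; split. move=> hdr; rewrite nm_hv hnm_sq hipE. have -> : \sum_a star (rho a) ** rho a =
 \sum_a (T (w a) ** T (star (w a)) - T (w a ** star (w a))) + T (\sum_a w a ** star (w a)).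
 rewrite (lin_sum Tl) sumrB subrK; each a. by rewrite rhoS -Ts starK.
 have h1 : nm (\sum_a (T (w a) ** T (star (w a)) - T (w a ** star (w a)))) <= tau / 8.
 bnd_sum; apply: le_trans e2c; rewrite mulr_suml. by each a; rewrite mul1r; apply: Tm.
 have h2 : nm (T (\sum_a w a ** star (w a))) <= (1 + tau / 8) * (1 + tau / 8).
 bnd Tn; apply: ler_pM; rewrite ?nm_ge0//; last exact: wdr. lra. bnd nmD; bnd (lerD h1 h2).
 by move: tau0 tau1; generalize tau => x; nra.
move=> s sS; rewrite hipE.
pose H := \sum_a \sum_b psi s a b *: (w a ** star (w b)).
have -> : \sum_a star (rho a) ** (aop (sop (mxo (psi s))) rho : hvec B J) a =
 \sum_a \sum_b psi s a b *: (T (w a) ** T (star (w b)) - T (w a ** star (w b))) + T H.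
 rewrite (lin_sum Tl) -big_split; each a; rewrite (lin_sum Tl) -big_split /=.
 rewrite sopE amulsr; each b; rewrite ent_mxo amulZr (linZ Tl) -scalerDr subrK. by rewrite starK Ts.
have h1 : nm (\sum_a \sum_b psi s a b *: (T (w a) ** T (star (w b)) - T (w a ** star (w b)))) <= tau / 8.
 bnd_sum; apply: le_trans e2b; rewrite mulr_suml. each a; bnd_sum; rewrite mulr_suml.
 each b; rewrite nmCZ -/(nm (psi s a b : R[i]^o)); apply: ler_pM; rewrite ?nm_ge0//.
 have h := nm_ent (mxo (psi s)) a b; rewrite ent_mxo in h; bnd h.
 bnd (bm_contr hb s); bnd (SK s sS); by rewrite lerDl. exact: Tm.
have h2 : nm (T H - T (val s)) <= (1 + e2) * (tau / 8).
 rewrite -(linB Tl); bnd Tn; apply: ler_wpM2l; first by rewrite addr_ge0// ltW. by apply: wS; apply/mapP; exists s.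
have h3 := Tb s (vS2 s sS).
rewrite nmBC; set X := (X in nm (X + _ - _)).
have -> : X + T H - s = X + (T H - T (val s)) + (T (val s) - s) by rewrite -!addrA addKr.
bnd nmD; bnd (lerD (nmD _ _) (lexx _)).
bnd (lerD (lerD h1 h2) h3); move: e2a e20 tau0 tau1.
by generalize tau e2 => x y; nra.
Qed.

End FixedPointDim.

(** * Between the fixed point algebra and the crossed product *)

Section CrossedDim.
Context {R} {G} {A : cstar R} {alpha : cstarAction G A}.
Hypotheses (cG : compact [set: G]) (hG : hausdorff_space G).
Variable C : crossedProduct alpha.
Local Notation B := (csubstar (fixed_alg alpha)).
Local Notation j := (jmap C).
Let jnm : forall b, nm (jB C b) = nm b := jB_isometric cG hG C.

(** The fixed point algebra is a corner, so a single [x = jB k], with [k] an approximate unit for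
    [c], is enough; [jmap_corner] brings [x ** a ** star x] back to the corner. *)
Lemma dim_crossed_fixed dr n : dim_le dr C n -> dim_le dr B n.
have iB := jB_iso cG hG jnm; have [[jL jM jS] _] := iB.
apply: (transfer (@isohom_id R C) iB) => c e pc nc1 e0.
have e2 : 0 < e / 2 by rewrite divr_gt0.
have [k [pk k1 hk]] := approx_unit [:: c] e2; have [hc _] := hk c (mem_head _ _).
have sk : star k = k := pos_sa pk.
exists 0%N, (fun=> jB C k); rewrite big_ord_recl big_ord0 addr0 -jS sk -jM; split.
- by rewrite jnm; bnd (nmMl _ k1); rewrite mul1r.
- rewrite -jM -(linB jL) jnm. have -> : c - k ** k ** c = (c - k ** c) + k ** (c - k ** c) by nc.
 bnd nmD; rewrite [e]splitr; apply: lerD => //. by bnd (nmMl _ k1); rewrite mul1r.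
- by move=> i i' q; eexists.
move=> i i' a; have [q hq] := jmap_corner cG hG jnm a (val k) (val k).
by exists q; rewrite hq -jS sk.
Qed.

Hypothesis full : forall (c : C) (e : R), 0 < e -> exists (L : finType) (a b : L -> A),
 nm (c - \sum_l j (a l) ** star (j (b l))) <= e.

(** By fullness [c] is close to a sum of [j (a l) ** star (j (b l))]. With [K] the sum of the
    [j (a l) ** star (j (a l))] and [r] close to [K^(-1/2)], the elements [x i = r j (a i)] give
    [H = r K r], a contraction that nearly fixes every [j (a l)], hence [c]. *)
Lemma dim_fixed_crossed dr n : dim_le dr B n -> dim_le dr C n.
have iB := jB_iso cG hG jnm.
apply: (transfer iB (@isohom_id R C)) => c e pc nc1 e0.
have e3 : 0 < e / 3 by rewrite divr_gt0.
have [L [a [b hab]]] := full c e3.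
pose N := \sum_l nm (j (b l)) + 1; have N0 : 0 < N. by rewrite ltr_wpDl// sumr_ge0// => l _; exact: nm_ge0.
pose d := (e / 3 / N) ^+ 2; have d0 : 0 < d by rewrite exprn_gt0// divr_gt0.
(* [transfer] uses a nonempty index set ['I_m.+1]; the extra index [ord0] carries the zero
   element. *)
pose a' (i : 'I_#|L|.+1) := if unlift ord0 i is Some k then a (enum_val k) else 0.
have aE l : a l = a' (lift ord0 (enum_rank l)) by rewrite /a' liftK enum_rankK.
pose K := \sum_i j (a' i) ** star (j (a' i)).
have pK : positive K by apply: pos_sum => i _; exact: pos_starr.
have [[lL lM lS] ln] := lmul_iso C; have linj := isohom_inj (lmul_iso C).
have nK : np aid (lmul K) by apply/pos_lmul.
have [t [r [_ nr _ [h1 h2] _]]] := inv_sqrt (@aid_l _ _ _) (@aid_r _ _ _) nK d0.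
have sr : star r = r by case: nr.
pose x i : C := aop r (j (a' i)).
have xE i : lmul (x i) = r ** lmul (j (a' i)) by rewrite op_lmul.
pose H := \sum_i x i ** star (x i).
have HE : lmul H = r ** lmul K ** r. rewrite /H /K !(lin_sum lL) amulsr amulsl; each i.
 by rewrite lM lS xE starM sr -lS lM !amulA.
have nH : nm H <= 1 by rewrite -ln HE.
have hx l : nm (j (a l) - H ** j (a l)) <= e / 3 / N. have n0 : 0 <= e / 3 / N by rewrite divr_ge0// ltW.
 rewrite -ler_sqr ?nnegrE ?nm_ge0// -/d -nmSSr -ln. have pP : np aid (lmul (K - j (a l) ** star (j (a l)))).
 apply/pos_lmul; rewrite aE /K (bigD1 (lift ord0 (enum_rank l)))//= addrAC subrr add0r.
 by apply: pos_sum => i _; exact: pos_starr.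
 set s := j (a l) in pP *; pose q : adjop (hself C) := aid - r ** lmul K ** r.
 have sK : star (lmul K) = lmul K by rewrite -lS (pos_sa pK). have sq : star q = q.
 by rewrite starB !starM sr sK amulA (sa_unit (@aid_l _ _ _)).
 have qs : lmul (s - H ** s) = q ** lmul s by rewrite (linB lL) lM HE /q amulBl aid_l.
 have -> : lmul ((s - H ** s) ** star (s - H ** s)) = star q ** lmul (s ** star s) ** q.
 by rewrite lM lS qs starM sq lM lS !amulA. have q1 : nm q <= 1.
 have := np_nm (@aid_l _ _ _) (@aid_r _ _ _) (np_conj (@aid_l _ _ _) (@aid_r _ _ _) r nK).
 by rewrite sr => /(_ 1); rewrite scale1r; apply.
 have pS : np aid (lmul (s ** star s)) by apply/pos_lmul; exact: pos_starr.
 have pQ : np aid (star q ** lmul K ** q - star q ** lmul (s ** star s) ** q).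
 have -> : star q ** lmul K ** q - star q ** lmul (s ** star s) ** q =
 star q ** lmul (K - s ** star s) ** q by rewrite (linB lL); nc.
 exact: (np_conj (@aid_l _ _ _) (@aid_r _ _ _) q pP). bnd (np_mono (@aid_l _ _ _) (@aid_r _ _ _)
 (np_conj (@aid_l _ _ _) (@aid_r _ _ _) q pS) pQ). have qE : q = d%:C *: (r ** r) := h2.
 have -> : star q ** lmul K ** q = d%:C *: (r ** (r ** lmul K ** r) ** (d%:C *: r)). by rewrite sq qE; nc.
 rewrite nmZ0 ?(ltW d0)// -[leRHS]mulr1; apply: ler_wpM2l; first exact: ltW.
 bnd nmM; bnd (ler_wpM2r (nm_ge0 _) (nmMr r h1)).
 rewrite mulr1 nmZ0 ?(ltW d0)// mulrCA -expr2 -(nm_sq sr) -nmZ0 ?(ltW d0)//. by rewrite -qE.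
pose c' := \sum_l j (a l) ** star (j (b l)).
have hc : nm (c' - H ** c') <= e / 3. have -> : c' - H ** c' = \sum_l (j (a l) - H ** j (a l)) ** star (j (b l)).
 rewrite amulsr -sumrB; each l; rewrite amulBl amulA; exact: erefl. bnd_sum; via (\sum_l e / 3 / N * nm (j (b l))).
 each l; bnd nmM; rewrite nmS. by apply: ler_wpM2r; [exact: nm_ge0|exact: hx].
 rewrite -mulr_sumr -[leRHS](divfK (lt0r_neq0 N0)); apply: ler_wpM2l. by rewrite divr_ge0// ltW. by rewrite lerDl.
exists #|L|, x; split => //.
- rewrite -/H; have -> : c - H ** c = (c - c') + (c' - H ** c') + H ** (c' - c) by nc.
 have -> : e = e / 3 + e / 3 + e / 3 by lra. bnd nmD; apply: lerD. by bnd nmD; exact: lerD.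
 by bnd (nmMl _ nH); rewrite mul1r nmBC.
(* The element [star (x i) ** q ** x i'] is the corner of [r q r]. This product belongs to the
   algebra because the left ideal property applies on one side and, through adjoints, on the
   other. *)
- move=> i i' q; pose q1 := star (aop r (star q)); pose q' := aop r q1. have q1E : lmul q ** r = lmul q1.
 by rewrite lS -op_lmul starM lS starK sr. have [p hp] := jmap_corner cG hG jnm q' (a' i) (a' i').
 exists p; rewrite hp; apply: linj. rewrite !lM !lS !xE starM sr /q' -op_lmul -q1E. by rewrite !amulA.
- by move=> i i' y; eexists.
Qed.

End CrossedDim.

Section LeastDim.
Context {R}.

Lemma least_dim_ext (P Q : nat -> Prop) : (forall n, P n <-> Q n) -> least_dim (R := R) P = least_dim Q.
move=> PQ; congr (ereal_inf); apply/seteqP; split=> _ [n hn <-]; by exists n => //; apply/PQ.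
Qed.
Lemma least_dim_le (P Q : nat -> Prop) : (forall n, P n -> Q n) -> (least_dim (R := R) Q <= least_dim P)%E.
by move=> PQ; apply: ereal_inf_le_tmp => _ [n hn <-]; exists n => //; exact: PQ. Qed.

End LeastDim.

Local Open Scope ereal_scope.

Theorem theorem2p9 (R : realType) (A : cstarAlgType R) (G : topGroupType)
    (alpha : cstarAction G A) (AxG : crossedProduct alpha)
    (A_sigma_unital : sigma_unital A)
    (G_compact : compact [set: G]) (G_hausdorff : hausdorff_space G)
    (G_second_countable : @second_countable G)
    (alpha_rokhlin : rokhlin alpha) :
  (nuc_dim (csubstar (fixed_alg alpha)) = nuc_dim AxG /\
   nuc_dim AxG <= nuc_dim A) /\
  (dec_rank (csubstar (fixed_alg alpha)) = dec_rank AxG /\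
   dec_rank AxG <= dec_rank A).
Proof.
pose full := @fullness R G A alpha G_compact G_hausdorff G_second_countable AxG alpha_rokhlin.
have BC dr n : dim_le dr (csubstar (fixed_alg alpha)) n <-> dim_le dr AxG n.
  split; first exact: (dim_fixed_crossed G_compact G_hausdorff full).
  exact: (dim_crossed_fixed G_compact G_hausdorff).
have AB dr n : dim_le dr A n -> dim_le dr AxG n.
  by move=> h; apply/BC; exact: (dim_fixed G_compact G_hausdorff G_second_countable AxG alpha_rokhlin).
split; split.
- by apply: least_dim_ext => n; rewrite !nuc_dim_leE.
- by apply: least_dim_le => n; rewrite !nuc_dim_leE; exact: AB.
- by apply: least_dim_ext => n; rewrite !dec_rank_leE.
- by apply: least_dim_le => n; rewrite !dec_rank_leE; exact: AB.
Qed.
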